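(* For any $d\ge5$ there exists $\widetilde u=\widetilde u(d)>0$ such that for each $0<u<\widetilde u$ there exists $C=C(d,u)<\infty$ such that for all $\kappa>0$, $$\lim_{N\to\infty}N^\kappa\left(1-\mathbb P^{u,N}\left[\,N/C\le\max_{x,y\in\mathcal C^u_{max}}\rho_{u,N}(x,y)\le CN\,\right]\right)=0 .$$
   Context: $\mathbb T_N=(\mathbb Z/N\mathbb Z)^d$ is the discrete torus. Consider simple symmetric nearest neighbor random walk on $\mathbb T_N$ started from a uniformly distributed vertex. $\mathcal I^{u,N}\subseteq\mathbb T_N$ is the set of sites visited by the walk in the first $\lfloor uN^d\rfloor$ steps, and $\mathcal V^{u,N}=\mathbb T_N\setminus\mathcal I^{u,N}$ is the vacant set, viewed as a graph with edges between vertices of $\mathcal V^{u,N}$ at $\ell^1$-distance $1$. $\mathbb P^{u,N}$ is the law of $\mathcal V^{u,N}$. $\rho_{u,N}$ is the graph distance in $\mathcal V^{u,N}$ (equal to $\infty$ between different components). $\mathcal C^u_{max}$ is a connected component of $\mathcal V^{u,N}$ with the largest number of vertices. *)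

(* Defs.v *)
From HB Require Import structures.
From mathcomp Require Import all_boot all_order all_algebra.
From mathcomp Require Import all_classical all_reals all_analysis.
Set Implicit Arguments.
Unset Strict Implicit.
Unset Printing Implicit Defensive.
Import Order.TTheory GRing.Theory Num.Theory.
Import numFieldNormedType.Exports.
Local Open Scope ring_scope.

(* 'Z_0 and 'Z_1 are both Z/2Z; this affects only the terms N = 0, 1 of a
   sequence indexed by N. *)
Definition torus (d N : nat) : finType := 'rV['Z_N]_d.

(* On Z/NZ the distance from a to b is the smaller of the representatives in
   {0, .., N-1} of a - b and b - a. *)
Definition l1dist (d N : nat) (x y : 'rV['Z_N]_d) : nat :=
  (\sum_(i < d) minn ((x 0 i - y 0 i)%R : 'Z_N) ((y 0 i - x 0 i)%R : 'Z_N))%N.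

Definition adj (d N : nat) : rel (torus d N) := fun x y => l1dist x y == 1%N.

Definition step_prob (R : realType) (d N : nat) (x y : torus d N) : R :=
  (adj x y)%:R / #|[pred z | adj x z]|%:R.

(* Probability that the n-step walk started from the uniform distribution is
   (X_0, .., X_n) = (w 0, .., w n). *)
Definition path_prob (R : realType) (d N n : nat)
    (w : {ffun 'I_n.+1 -> torus d N}) : R :=
  #|torus d N|%:R^-1 *
  \prod_(i < n) step_prob R (w (inord i)) (w (inord i.+1)).

Definition visited (d N n : nat) (w : {ffun 'I_n.+1 -> torus d N}) :
    {set torus d N} := finset (fun x => [exists i, w i == x]).

Definition vacant (d N n : nat) (w : {ffun 'I_n.+1 -> torus d N}) :
    {set torus d N} := ~: visited w.

(* truncn is the floor on nonnegative reals. *)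
Definition nsteps (R : realType) (d N : nat) (u : R) : nat :=
  Num.truncn (u * N%:R ^+ d).

(* The law of the vacant set at level u, as a mass function on sets of sites. *)
Definition vacant_law (R : realType) (d N : nat) (u : R) (A : {set torus d N})
    : R :=
  \sum_(w : {ffun 'I_(nsteps d N u).+1 -> torus d N} | vacant w == A)
    path_prob R w.

Definition vacant_prob (R : realType) (d N : nat) (u : R)
    (E : pred {set torus d N}) : R :=
  \sum_(A : {set torus d N} | E A) vacant_law u A.

Definition edge (d N : nat) (A : {set torus d N}) : rel (torus d N) :=
  fun x y => [&& x \in A, y \in A & adj x y].

Definition is_component (d N : nat) (A K : {set torus d N}) : Prop :=
  exists2 x, x \in A & K = finset (connect (edge A) x).

Definition is_largest_component (d N : nat) (A K : {set torus d N}) : Prop :=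
  is_component A K /\
  forall K' : {set torus d N}, is_component A K' -> (#|K'| <= #|K|)%N.

(* The infimum of the empty set is +oo. *)
Definition graph_dist (R : realType) (d N : nat) (A : {set torus d N})
    (x y : torus d N) : \bar R :=
  ereal_inf (fun l : \bar R => exists p : seq (torus d N),
    [/\ path (edge A) x p, last x p = y & l = (size p)%:R%:E]).

Definition max_dist (R : realType) (d N : nat) (A K : {set torus d N})
    : \bar R :=
  \big[Order.max/-oo%E]_(x in K) \big[Order.max/-oo%E]_(y in K)
    graph_dist R A x y.

(* Main.v *)
(* Cover the torus by anchors at spacing L. An anchor p is good when the walk
   leaves a fixed frame (the sites with at least three coordinates divisible by
   a smaller scale l) untouched near p and every vacant site near p that has a
   long vacant path is joined to the frame locally. A pair of consecutive time
   blocks of about L^2 steps (a superblock) fails near p with small conditional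
   probability: since the dimension is at least 5, the walk has, between long
   stretches that never come close to each other, straight cut segments from whose
   sides paths ("arms") lead to the frame. These segments exclude a vacant
   component of large diameter enclosed by the range and missing the frame.

   A supermartingale argument (a Green-function potential summed over a sparse
   set D of anchors, with a killing rate |D|/n over n superblocks) turns this
   into P[all of D bad] <= eps^|D| for all sparse D. A bad *-cluster of coarse
   radius h^k contains a sparse binary tree of 2^k bad anchors, so there are no
   clusters of polynomial size and, along every axis-parallel line, the volume of
   the clusters met is linear, except with probability exp(-N^c). A line between
   two far vacant sites is then rerouted along the outer boundaries of the bad
   clusters; that these boundaries are *-connected in the required sense is a
   mod 2 cohomology argument on the box. The resulting chain of good anchors has
   linear length and its frames join the two sites. *)
Require Import Defs.
From HB Require Import structures.
From mathcomp Require Import all_boot zify.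
Set Implicit Arguments.
Unset Strict Implicit.
Unset Printing Implicit Defensive.

(** * Boxes, cut sets and detours *)

(** The dimension enters through one series. Once a straight segment is given, the walk closes up
    around it with [f] free steps, which can be split before and after the segment in order [f]
    ways, and [f ^ (1 - d / 2)] is summable exactly when [d > 4]. The same exponent bounds the Green
    potential of a sparse set. The obstacle is the past: earlier sites near an anchor can make a
    superblock fail, so its conditional failure probability is small only while that history is
    short. An anchor is therefore charged one unit per touched block and [W] more units for a
    failure with short history. A bad anchor is charged at least [W] in all, and the supermartingale
    controls an exponential moment of the total charge. The scales are powers of one integer [g]:
    [L = g^4], [l = g^3], [M] of order [g^8], [W = g^2]. With [4 d >= 20] every expected number of
    coincidences that is not controlled by the segment length [s] is then of order [1 / g]. Small
    [u] pays for the killing rate, which suppresses returns of the walk around the torus. *)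

Section Potential.
Variables (d : nat) (P : {ffun 'I_d -> nat} -> bool).

Implicit Types (a : {ffun 'I_d -> nat}) (j k : 'I_d).

Definition inc (a : {ffun 'I_d -> nat}) (k : 'I_d) := [ffun i => a i + (i == k)].
Definition dec (a : {ffun 'I_d -> nat}) (k : 'I_d) := [ffun i => a i - (i == k)].

Lemma decK a k : 0 < a k -> inc (dec a k) k = a.
Proof. by move=> a0; apply/ffunP=> i; rewrite !ffunE; have [->|_] := eqVneq i k; rewrite /= ?subn0 ?addn0; lia. Qed.

Lemma incK a k : dec (inc a k) k = a.
Proof. by apply/ffunP=> i; rewrite !ffunE; have [->|_] := eqVneq i k; rewrite /= ?subn0 ?addn0; lia. Qed.

Lemma incC a j k : inc (inc a j) k = inc (inc a k) j.
Proof. by apply/ffunP=> i; rewrite !ffunE; lia. Qed.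

Lemma inc_dec a j k : j != k -> 0 < a j -> dec (inc a k) j = inc (dec a j) k.
Proof.
by move=> jk a0; apply/ffunP=> i; rewrite !ffunE; have [->|ij] := eqVneq i j; rewrite ?(negPf jk); lia.
Qed.

Lemma sum_inc a k : \sum_i inc a k i = (\sum_i a i).+1.
Proof.
under eq_bigr do rewrite ffunE.
by rewrite big_split /= -addn1; congr addn; rewrite (bigD1 k) //= eqxx big1 // => i /negPf->.
Qed.

Variable g : {ffun 'I_d -> nat} -> 'I_d -> bool.
Hypothesis Pdec : forall a k, P (inc a k) -> P a.
Hypothesis closed : forall a j k, j != k -> P (inc (inc a j) k) ->
  g a j (+) g (inc a j) k = g a k (+) g (inc a k) j.

Definition last_nz (a : {ffun 'I_d -> nat}) : option 'I_d :=
  [pick k | (0 < a k) && [forall j : 'I_d, (k < j) ==> (a j == 0)]].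

(** The sum of [g] along the path from 0 that raises the coordinates in increasing order; its last
    step is in the last nonzero coordinate. [n] is fuel, equal to the coordinate sum. *)
Fixpoint potential n (a : {ffun 'I_d -> nat}) : bool :=
  if n is n'.+1 then
    if last_nz a is Some k then potential n' (dec a k) (+) g (dec a k) k else false
  else false.

Lemma last_nz_some a k : 0 < a k -> exists j, last_nz a = Some j.
Proof.
move=> a0; rewrite /last_nz; case: pickP => [j _|none]; first by exists j.
have [j aj jmax] := @arg_maxnP _ k (fun i => 0 < a i) (fun i => i : nat) a0.
have /negbT := none j; rewrite aj /= negb_forall => /existsP[i]; rewrite negb_imply => /andP[ji ai].
by have := jmax i; rewrite lt0n ai => /(_ isT); rewrite /geq /= leqNgt ji.
Qed.

(** If the last nonzero coordinate [j] of [inc a k] differs from [k], closedness on the square at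
    [dec a j] exchanges the steps in [j] and [k], and the induction hypothesis applies to both edges
    leaving [dec a j]. *)
Lemma potential_inc n a k : \sum_i a i = n -> P (inc a k) ->
  potential n.+1 (inc a k) = potential n a (+) g a k.
Proof.
elim: n a k => [|n IHn] a k an Pa; rewrite [LHS]/=.
  have [|j ej] := @last_nz_some (inc a k) k; first by rewrite ffunE eqxx addn1.
  have a0 i : a i = 0 by apply/eqP; move/eqP: an; rewrite sum_nat_eq0 => /forallP/(_ i)/implyP->.
  rewrite ej; move: ej; rewrite /last_nz; case: pickP => // j' /andP[h _] [<-].
  have jk : j' = k by apply/eqP; apply: contraTT h => /negPf h; rewrite ffunE a0 h.
  by rewrite jk incK.
have [|j ej] := @last_nz_some (inc a k) k; first by rewrite ffunE eqxx addn1.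
rewrite ej; move: ej; rewrite {1}/last_nz; case: pickP => // j' /andP[h hj] [ejj]; subst j'.
have [->|jk] := eqVneq j k; first by rewrite incK.
have aj : 0 < a j by move: h; rewrite ffunE (negPf jk) addn0.
rewrite (inc_dec jk aj).
set b := dec a j; have eb : inc b j = a by rewrite decK.
have bn : \sum_i b i = n by move: an; rewrite -eb sum_inc => -[].
have Pbjk : P (inc (inc b j) k) by rewrite eb.
have Pbk : P (inc b k) by apply: (@Pdec _ j); rewrite incC.
have Pbj : P (inc b j) by rewrite eb; apply: Pdec Pa.
have /= -> := IHn b k bn Pbk.
have := IHn b j bn Pbj; rewrite eb /= => ->.
have := closed jk Pbjk; rewrite eb => E.
by rewrite -!addbA -E.
Qed.

Lemma closed_potential : exists f : {ffun 'I_d -> nat} -> bool,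
  forall a k, P (inc a k) -> f (inc a k) = f a (+) g a k.
Proof.
exists (fun a => potential (\sum_i a i) a) => a k Pa.
by rewrite sum_inc potential_inc.
Qed.

End Potential.

(** Corners 1 and 4 of a unit square are opposite; [w] is membership in a set and [x] a label. Equal
    labels on those corners that have a neighbour outside the set make the labelled cut edges cancel
    modulo 2 around the square. *)
Lemma square_parity (w1 w2 w3 w4 x1 x2 x3 x4 : bool) :
  (w1 && (~~ w2 || ~~ w3) ==> w2 && (~~ w1 || ~~ w4) ==> (x1 == x2)) ->
  (w1 && (~~ w2 || ~~ w3) ==> w3 && (~~ w1 || ~~ w4) ==> (x1 == x3)) ->
  (w1 && (~~ w2 || ~~ w3) ==> w4 && (~~ w2 || ~~ w3) ==> (x1 == x4)) ->
  (w2 && (~~ w1 || ~~ w4) ==> w3 && (~~ w1 || ~~ w4) ==> (x2 == x3)) ->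
  (w2 && (~~ w1 || ~~ w4) ==> w4 && (~~ w2 || ~~ w3) ==> (x2 == x4)) ->
  (w3 && (~~ w1 || ~~ w4) ==> w4 && (~~ w2 || ~~ w3) ==> (x3 == x4)) ->
  (if w1 then ~~ w2 && x1 else w2 && x2) (+) (if w2 then ~~ w4 && x2 else w4 && x4) =
  (if w1 then ~~ w3 && x1 else w3 && x3) (+) (if w3 then ~~ w4 && x3 else w4 && x4).
Proof.
by case: w1 w2 w3 w4 x1 x2 x3 x4 => [] [] [] [] [] [] [] [].
Qed.

(** * Inner boundaries of sets in a box *)

Section Box.
Variables (d m : nat).
Definition box : finType := {ffun 'I_d -> 'I_m.+1}.
Implicit Types (a b u v w x y : box) (S U W X : pred box).

Definition nn : rel box := fun a b =>
  [exists k : 'I_d, [forall i, (i != k) ==> (a i == b i)]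
    && (((a k).+1 == b k :> nat) || ((b k).+1 == a k :> nat))].

Definition linf a b : nat := \max_(i < d) maxn (a i - b i) (b i - a i).

Definition star : rel box := fun a b => linf a b <= 1.

Definition gr S : rel box := fun x y => [&& S x, S y & nn x y].

Definition bdry W : pred box := fun u => W u && [exists v, nn u v && ~~ W v].

Lemma nnP a b : reflect (exists k : 'I_d, (forall i, i != k -> a i = b i) /\
   ((a k).+1 = b k :> nat \/ (b k).+1 = a k :> nat)) (nn a b).
Proof.
apply: (iffP existsP) => -[k].
  move=> /andP[/forallP h1 h2]; exists k; split; last by case/orP: h2 => /eqP; [left|right].
  by move=> i ik; apply/eqP; have := h1 i; rewrite ik.
move=> [h1 h2]; exists k; apply/andP; split; last by case: h2 => ->; rewrite eqxx ?orbT.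
by apply/forallP=> i; apply/implyP => /h1->.
Qed.

Lemma nn_sym : symmetric nn.
Proof.
by move=> a b; apply/nnP/nnP => -[k [h1 h2]]; exists k; (split; first by move=> i /h1->); case: h2; auto.
Qed.

Lemma gr_sym S : symmetric (gr S).
Proof. by move=> a b; rewrite /gr nn_sym andbCA. Qed.

Lemma gr_csym S : connect_sym (gr S).
Proof. exact: sym_connect_sym (@gr_sym S). Qed.

Lemma sub_gr S U x y : subpred S U -> connect (gr S) x y -> connect (gr U) x y.
Proof.
move=> SU; apply: connect_sub => a b /and3P[/SU Ua /SU Ub ab].
by apply: connect1; rewrite /gr Ua Ub.
Qed.

Lemma connect_gr_in S x y : S x -> connect (gr S) x y -> S y.
Proof.
move=> Sx /connectP[p]; elim: p x Sx => [|z p IH] x Sx /=; first by move=> _ ->.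
by case/andP=> /and3P[_ Sz _] pz ey; apply: IH pz ey.
Qed.

Lemma linfP a b r : reflect (forall i, a i <= b i + r /\ b i <= a i + r) (linf a b <= r).
Proof.
apply: (iffP (bigmax_leqP _ _ _)) => h i; first by have := h i isT; rewrite geq_max; lia.
by move=> _; have [] := h i; rewrite geq_max; lia.
Qed.

Lemma linf_sym a b : linf a b = linf b a.
Proof. by apply: eq_bigr => i _; rewrite maxnC. Qed.

Lemma linfxx a : linf a a = 0.
Proof. by apply/eqP; rewrite -leqn0; apply/linfP=> i; rewrite addn0. Qed.

Lemma linf_triangle b a c : linf a c <= linf a b + linf b c.
Proof.
apply/linfP => i; have /linfP/(_ i)[] := leqnn (linf a b).
by have /linfP/(_ i)[] := leqnn (linf b c); lia.
Qed.

Lemma linf_coord a b i : a i <= b i + linf a b /\ b i <= a i + linf a b.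
Proof. by apply: (elimT (linfP a b _)). Qed.

Lemma linf_gt a b r : r < linf a b -> exists i, (a i > b i + r) || (b i > a i + r).
Proof.
rewrite ltnNge => /negP h.
have /existsP[i hi] : [exists i, (a i > b i + r) || (b i > a i + r)]; last by exists i.
apply: contra_notT h; rewrite negb_exists => /forallP h; apply/linfP => i.
by have := h i; rewrite negb_or -!leqNgt => /andP.
Qed.

Lemma nn_star a b : nn a b -> star a b.
Proof.
move=> /nnP[k [h1 h2]]; apply/linfP => i.
by have [->|/h1->] := eqVneq i k; lia.
Qed.

Definition setc a (k : 'I_d) (v : 'I_m.+1) : box := [ffun i => if i == k then v else a i].

Lemma setc_id a k : setc a k (a k) = a.
Proof. by apply/ffunP=> i; rewrite ffunE; case: eqP => [->|]. Qed.

Lemma setcc a k (u v : 'I_m.+1) : setc (setc a k u) k v = setc a k v.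
Proof. by apply/ffunP=> i; rewrite !ffunE; case: eqP. Qed.

Lemma connect_setc S a k (v : 'I_m.+1) :
  (forall t : 'I_m.+1, minn (a k) v <= t <= maxn (a k) v -> S (setc a k t)) ->
  connect (gr S) a (setc a k v).
Proof.
move: {2}(maxn (a k - v) (v - a k)) (leqnn (maxn (a k - v) (v - a k))) => n.
elim: n a => [|n IH] a h hS.
  by have -> : v = a k by [apply: ord_inj; lia]; rewrite setc_id connect0.
have [e|ne] := eqVneq (a k : nat) v.
  by have -> : v = a k by [apply: ord_inj]; rewrite setc_id connect0.
pose t0 : nat := if a k < v then (a k).+1 else (a k).-1.
have ht : t0 < m.+1.
  by rewrite /t0; have := ltn_ord v; have := ltn_ord (a k); case: ifP; lia.
pose t := Ordinal ht.
have st : minn (a k) v <= t <= maxn (a k) v by move: ne; rewrite /t /= /t0; move: (nat_of_ord (a k)) (nat_of_ord v) => x y; case: ifP; lia.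
have step : gr S a (setc a k t).
  rewrite /gr (hS t st) -{1}(setc_id a k) hS /=; last by rewrite geq_minl leq_maxl.
  apply/nnP; exists k; split => [i /negPf ik|]; first by rewrite ffunE ik.
  rewrite ffunE eqxx /t /= /t0; move: ne; move: (nat_of_ord (a k)) (nat_of_ord v) => x y.
  by case: ifP; lia.
apply: connect_trans (connect1 step) _.
rewrite -(setcc a k t v); apply: IH => [|t']; rewrite ?ffunE ?eqxx.
  by move: ne h; rewrite /t /= /t0; move: (nat_of_ord (a k)) (nat_of_ord v) => x y; case: ifP; lia.
move=> ht'; rewrite setcc; apply: hS.
move: ne ht'; rewrite /t /= /t0; move: (nat_of_ord (a k)) (nat_of_ord v) (nat_of_ord t') => x y z.
by case: ifP; lia.
Qed.

Lemma nn_connected x y : connect nn x y.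
Proof.
suff h (s : seq 'I_d) : connect nn x [ffun i => if i \in s then y i else x i].
  by have := h (enum 'I_d); congr connect; apply/ffunP=> i; rewrite ffunE mem_enum.
elim: s => [|k s IH]; first by rewrite (_ : [ffun _ => _] = x) //; apply/ffunP=> i; rewrite ffunE.
apply: connect_trans IH _; set a := [ffun _ => _].
have -> : [ffun i => if i \in k :: s then y i else x i] = setc a k (y k).
  by apply/ffunP=> i; rewrite !ffunE in_cons; case: eqP => // ->.
have := @connect_setc predT a k (y k) (fun _ _ => isT).
by apply: connect_sub => u v /and3P[_ _ uv]; apply: connect1.
Qed.

Lemma crossing S W x y : connect (gr S) x y -> ~~ W x -> W y ->
  exists2 u, S u & bdry W u.
Proof.
move=> /connectP[p]; elim: p x => [|z p IH] x /=; first by move=> _ -> /negPf->.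
case/andP=> /and3P[Sx Sz xz] pz ey Wx Wy.
have [Wz|Wz] := boolP (W z); last exact: IH pz ey Wz Wy.
by exists z => //; rewrite /bdry Wz; apply/existsP; exists x; rewrite nn_sym xz.
Qed.

(** Star-connectedness of the boundary is expressed through arbitrary labels [X]. Put on each edge
    leaving [W] the label of its inner endpoint. By [square_parity] this is a cocycle, since
    boundary corners of one square are star-neighbours. It is thus the coboundary of some [f], which
    is constant on [W] and on its complement; hence the label of a cut edge does not depend on the
    edge. *)
Lemma bdry_star_connected W X :
  (forall x y, W x -> W y -> connect (gr W) x y) ->
  (forall x y, ~~ W x -> ~~ W y -> connect (gr (predC W)) x y) ->
  (forall u v, bdry W u -> bdry W v -> star u v -> X u = X v) ->
  forall u v, bdry W u -> bdry W v -> X u = X v.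
Proof.
move=> cW cWc cX.
(* [closed_potential] lives on all natural coordinates; the box is the part where [P] holds. *)
pose emb (a : {ffun 'I_d -> nat}) : box := [ffun i => inord (a i)].
pose raw (x : box) : {ffun 'I_d -> nat} := [ffun i => x i : nat].
have rawK x : emb (raw x) = x by apply/ffunP=> i; rewrite !ffunE inord_val.
pose P (a : {ffun 'I_d -> nat}) := [forall i, a i <= m].
have Pdec (a : {ffun 'I_d -> nat}) k : P (inc a k) -> P a.
  by move=> /forallP h; apply/forallP=> i; have := h i; rewrite ffunE; lia.
have embE (a : {ffun 'I_d -> nat}) i : P a -> emb a i = a i :> nat by move=> /forallP h; rewrite ffunE inordK // ltnS.
pose cut x y := if W x then ~~ W y && X x else W y && X y.
pose g (a : {ffun 'I_d -> nat}) k := cut (emb a) (emb (inc a k)).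
have nn_inc (a : {ffun 'I_d -> nat}) k : P (inc a k) -> nn (emb a) (emb (inc a k)).
  move=> Pa; apply/nnP; exists k; split=> [i /negPf ik|].
    by apply: val_inj => /=; rewrite !embE ?(Pdec _ _ Pa) // ffunE ik addn0.
  by left; rewrite !embE ?(Pdec _ _ Pa) // ffunE eqxx addn1.
have closed (a : {ffun 'I_d -> nat}) j k : j != k -> P (inc (inc a j) k) ->
    g a j (+) g (inc a j) k = g a k (+) g (inc a k) j.
  move=> jk Pjk.
  have Pj := Pdec _ _ Pjk; have Pkj : P (inc (inc a k) j) by rewrite incC.
  have Pk := Pdec _ _ Pkj; have P0 := Pdec _ _ Pj.
  pose sq := [:: a; inc a j; inc a k; inc (inc a j) k].
  have sqP (b : {ffun 'I_d -> nat}) : b \in sq -> P b by rewrite !inE => /or4P[] /eqP->.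
  have sq_range (b : {ffun 'I_d -> nat}) i : b \in sq -> a i <= b i <= a i + 1.
    rewrite !inE; case: (eqVneq i j) => [->|ij].
      by move=> /or4P[] /eqP->; rewrite ?ffunE ?eqxx ?(negPf jk) /=; lia.
    by move=> /or4P[] /eqP->; rewrite ?ffunE ?(negPf ij) /=; lia.
  have sqX (b c : {ffun 'I_d -> nat}) : b \in sq -> c \in sq -> bdry W (emb b) -> bdry W (emb c) -> X (emb b) = X (emb c).
    move=> hb hc Bb Bc; apply: cX => //; apply/linfP=> i.
    have := sq_range _ i hb; have := sq_range _ i hc; rewrite !embE ?sqP //.
    by move: (b i) (c i) (a i) => x y z; clear; lia.
  have nj := nn_inc _ _ Pj; have nk := nn_inc _ _ Pk.
  have njk := nn_inc _ _ Pjk; have nkj := nn_inc _ _ Pkj.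
  have e1 : inc (inc a k) j = inc (inc a j) k by rewrite incC.
  rewrite e1 in nkj *.
  rewrite /g /cut e1.
  have bW x y z : nn x y -> nn x z -> W x && (~~ W y || ~~ W z) -> bdry W x.
    move=> xy xz /andP[Wx h]; rewrite /bdry Wx; apply/existsP.
    by case/orP: h => h; [exists y; rewrite xy|exists z; rewrite xz].
  have nnC x y : nn x y -> nn y x by rewrite nn_sym.
  have b1 := bW _ _ _ nj nk; have b2 := bW _ _ _ (nnC _ _ nj) njk.
  have b3 := bW _ _ _ (nnC _ _ nk) nkj; have b4 := bW _ _ _ (nnC _ _ njk) (nnC _ _ nkj).
  have mem1 : a \in sq by rewrite mem_head.
  have mem2 : inc a j \in sq by rewrite !inE eqxx orbT.
  have mem3 : inc a k \in sq by rewrite !inE eqxx !orbT.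
  have mem4 : inc (inc a j) k \in sq by rewrite !inE eqxx !orbT.
  apply: square_parity.
  - by apply/implyP=> /b1 h1; apply/implyP=> /b2 h2; apply/eqP; exact: sqX.
  - by apply/implyP=> /b1 h1; apply/implyP=> /b3 h2; apply/eqP; exact: sqX.
  - by apply/implyP=> /b1 h1; apply/implyP=> /b4 h2; apply/eqP; exact: sqX.
  - by apply/implyP=> /b2 h1; apply/implyP=> /b3 h2; apply/eqP; exact: sqX.
  - by apply/implyP=> /b2 h1; apply/implyP=> /b4 h2; apply/eqP; exact: sqX.
  - by apply/implyP=> /b3 h1; apply/implyP=> /b4 h2; apply/eqP; exact: sqX.
have [f0 f0P] := closed_potential Pdec closed.
pose f x := f0 (raw x).
have fE x y : nn x y -> f y = f x (+) cut x y.
  have cutC u v : cut u v = cut v u by rewrite /cut; case: (W u); case: (W v).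
  have one u v k : (forall i, i != k -> u i = v i) -> (u k).+1 = v k :> nat -> f v = f u (+) cut u v.
    move=> h1 h2; have e : raw v = inc (raw u) k.
      apply/ffunP=> i; rewrite !ffunE; case: eqP => [->|/eqP ik]; last by rewrite h1 // addn0.
      by rewrite -h2 addn1.
    rewrite /f e f0P; last by rewrite -e; apply/forallP=> i; rewrite ffunE -ltnS.
    by rewrite /g -e !rawK.
  move=> /nnP[k [h1 [h2|h2]]]; first exact: one h1 h2.
  by rewrite cutC (@one y x k) ?addbK // => i /h1->.
have fconst S x y : (forall u v, S u -> S v -> cut u v = false) -> connect (gr S) x y -> f x = f y.
  move=> hS /connectP[p]; elim: p x => [|z p IH] x /=; first by move=> _ ->.
  by case/andP=> /and3P[Sx Sz xz] pz e; rewrite -(IH z) // (fE _ _ xz) hS // addbF.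
have fW x y : W x -> W y -> f x = f y.
  by move=> Wx Wy; apply: (@fconst W); [move=> u v Wu Wv; rewrite /cut Wu Wv|apply: cW].
have fWc x y : ~~ W x -> ~~ W y -> f x = f y.
  move=> Wx Wy; apply: (@fconst (predC W)); last exact: cWc.
  by move=> u v /negPf /= Wu /negPf Wv; rewrite /cut Wu Wv.
have Xcut u : bdry W u -> exists v, [/\ W u, ~~ W v & X u = f u (+) f v].
  case/andP=> Wu /existsP[v /andP[uv Wv]]; exists v; split => //.
  by rewrite (fE _ _ uv) /cut Wu Wv /= addKb.
move=> u v /Xcut[u' [Wu Wu' ->]] /Xcut[v' [Wv Wv' ->]].
by rewrite (fW u v) // (fWc u' v').
Qed.

Lemma connect_component S x y z : connect (gr S) x y -> connect (gr S) x z ->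
  connect (gr (fun v => connect (gr S) x v)) y z.
Proof.
have sub t : connect (gr S) x t -> connect (gr (fun v => connect (gr S) x v)) x t.
  move=> /connectP[p]; elim/last_ind: p t => [|p t' IH] t /=; first by move=> _ ->; exact: connect0.
  rewrite rcons_path last_rcons => /andP[pp tt] ->.
  apply: connect_trans (IH _ pp erefl) _; apply: connect1.
  have cl : connect (gr S) x (last x p) by apply/connectP; exists p.
  by case/and3P: (tt) => _ _ nt; apply/and3P; split=> //; exact: connect_trans cl (connect1 tt).
by move=> xy xz; apply: connect_trans (sub z xz); rewrite gr_csym; apply: sub.
Qed.

Definition comp U w : pred box := fun x => connect (gr (predC U)) w x.

Lemma comp_notin U w x : ~~ U w -> comp U w x -> ~~ U x.
Proof. by move=> Uw; apply: (@connect_gr_in (predC U)). Qed.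

Lemma comp_bdry U w u : ~~ U w -> bdry (comp U w) u ->
  [/\ comp U w u, ~~ U u & exists2 v, nn u v & U v].
Proof.
move=> Uw /andP[cu /existsP[v /andP[uv cv]]].
have Uu := comp_notin Uw cu; split=> //; exists v => //.
apply: contraNT cv => Uv; apply: connect_trans cu _.
by apply: connect1; rewrite /gr /= Uu Uv.
Qed.

(** The complement of the component is connected: a walk of the box from outside the component
    towards [U] cannot enter the component before it meets [U], and [U] is connected. *)
Lemma comp_bdry_star U w X :
  ~~ U w -> (exists u, U u) -> (forall x y, U x -> U y -> connect (gr U) x y) ->
  (forall u v, bdry (comp U w) u -> bdry (comp U w) v -> star u v -> X u = X v) ->
  forall u v, bdry (comp U w) u -> bdry (comp U w) v -> X u = X v.
Proof.
move=> Uw [u0 Uu0] cU; apply: bdry_star_connected => [x y|x y]; first exact: connect_component.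
have UnW : subpred U (predC (comp U w)) by move=> z Uz /=; apply: contraL Uz => /(comp_notin Uw).
have key z : ~~ comp U w z -> connect (gr (predC (comp U w))) z u0.
  have /connectP[p] := nn_connected z u0; elim: p z => [|t p IH] z /=.
    by move=> _ <- _; exact: connect0.
  case/andP=> zt pt e cz; have [Uz|Uz] := boolP (U z); first exact: sub_gr UnW (cU _ _ Uz Uu0).
  have ct : ~~ comp U w t.
    have [Ut|Ut] := boolP (U t); first exact: UnW.
    apply: contra cz => ct; apply: connect_trans ct _; apply: connect1.
    by rewrite /gr /= Ut Uz nn_sym.
  by apply: connect_trans (IH t pt e ct); apply: connect1; rewrite /gr /= cz ct.
move=> cx cy; apply: connect_trans (key x cx) _.
by rewrite gr_csym; apply: key.
Qed.

End Box.

(** * Escaping from bad clusters and walking around them *)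

Section Detour.
Variables (d m : nat).
Hypothesis d_gt1 : 1 < d.
Notation box := (box d m).
Implicit Types (a b u v w x y : box) (S T P U W X Bad : pred box).

Definition sgr S : rel box := fun x y => [&& S x, S y & star x y].

Definition corner : box := [ffun=> ord0].

Definition clusters P Bad : pred box :=
  fun v => [exists q, [&& P q, Bad q & connect (sgr Bad) q v]].

Definition near_clusters P Bad : pred box :=
  fun v => ~~ clusters P Bad v && (P v || [exists a, clusters P Bad a && star a v]).

Variables (P Bad : pred box) (R : nat).
Notation A := (clusters P Bad).
Notation Y := (near_clusters P Bad).
Hypothesis Pconn : forall x y, P x -> P y -> connect (gr P) x y.
Hypothesis small : forall x y, A x -> connect (sgr Bad) x y -> linf x y < R.
Hypothesis deep : forall v i, A v -> 0 < v i.

Lemma clusters_bad v : A v -> Bad v.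
Proof.
case/existsP=> q /and3P[_ Bq /connectP[p]]; elim: p q Bq => [|z p IH] q Bq /=; first by move=> _ ->.
by case/andP=> /and3P[_ Bz _] pz e; apply: IH pz e.
Qed.

Lemma clusters_step u v : A u -> Bad v -> star u v -> A v.
Proof.
move=> Au Bv uv; have Bu := clusters_bad Au; case/existsP: Au => q /and3P[Pq Bq cq].
apply/existsP; exists q; rewrite Pq Bq; apply: connect_trans cq _.
by apply: connect1; rewrite /sgr Bu Bv.
Qed.

Lemma near_clusters_good v : Y v -> ~~ Bad v.
Proof.
case/andP=> nA /orP[Pv|/existsP[a /andP[Aa av]]]; apply: contra nA => Bv.
  by apply/existsP; exists v; rewrite Pv Bv connect0.
exact: clusters_step Aa Bv av.
Qed.

(** Otherwise [S] is enclosed by a boundary contained in the clusters. This boundary is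
    star-connected, so it lies in one bad cluster and has diameter less than [R], while [S] has a
    point [w] at distance at least [R] from it in some coordinate [k]. The hyperplane through [w]
    normal to [k] and a face of the box both miss the boundary, and together they lead from [w] to
    the corner. *)
Lemma escape S x y :
  (forall s t, S s -> S t -> connect (gr S) s t) ->
  S x -> S y -> R.*2 <= linf x y ->
  exists a, [/\ S a, ~~ A a & connect (gr (predC A)) a corner].
Proof.
move=> cS Sx Sy xy.
have nA0 : ~~ A corner.
  have d0 : 0 < d by exact: ltn_trans d_gt1.
  by apply/negP => /(@deep _ (Ordinal d0)); rewrite ffunE.
pose U := fun v => connect (gr (predC A)) corner v.
have UA v : U v -> ~~ A v by exact: (@connect_gr_in _ _ (predC A)).
have [/existsP[a /andP[Sa Ua]]|none] := boolP [exists a, S a && U a].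
  by exists a; rewrite gr_csym (UA a).
have nU s : S s -> ~~ U s by move=> Ss; apply: contra none => Us; apply/existsP; exists s; rewrite Ss.
have SW s : S s -> comp U x s.
  move=> Ss; apply: sub_gr (cS _ _ Sx Ss) => z; exact: nU.
have Ux := nU x Sx; set W := comp U x in SW.
have W0 : ~~ W corner by apply/negP => /(comp_notin Ux); rewrite /U connect0.
have bdA u : bdry W u -> A u.
  move=> /(comp_bdry Ux)[_ Uu [v uv Uv]]; apply: contraNT Uu => Au.
  apply: (connect_trans Uv); apply: connect1.
  by apply/and3P; split; [exact: UA|exact: Au|rewrite nn_sym].
have [c _ bc] : exists2 u, predT u & bdry W u.
  apply: (@crossing d m predT W corner x) => //; last exact: SW.
  have := nn_connected corner x; apply: connect_sub => z t zt.
  by apply: connect1; rewrite /gr /=.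
pose X := fun v => connect (sgr Bad) c v.
have XW u : bdry W u -> X u.
  move=> bu; suff -> : X u = X c by rewrite /X connect0.
  apply: (@comp_bdry_star d m U x X Ux) => //; first by exists corner; rewrite /U connect0.
    by move=> s t; exact: connect_component.
  move=> s t bs bt st; have [As At] := (bdA s bs, bdA t bt).
  have Bs := clusters_bad As; have Bt := clusters_bad At.
  apply/idP/idP => h; apply: connect_trans h (connect1 _); rewrite /sgr Bs Bt //=.
  by rewrite /star linf_sym.
have bdR u : bdry W u -> linf c u < R by move=> /XW; apply: small; exact: bdA.
(* Two points at distance [2 R] are not both within distance less than [R] of [c]. *)
have [w Sw cw] : exists2 w, S w & R <= linf c w.
  have [h|h] := leqP R (linf c x); first by exists x.
  exists y => //; have := linf_triangle c x y; rewrite (linf_sym x c); move: xy h; rewrite -addnn; lia.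
have [k hk] : exists k : 'I_d, R <= maxn (c k - w k) (w k - c k).
  have Rpos : 0 < R by apply: leq_ltn_trans (bdR c bc).
  have [//|] := @linf_gt _ _ c w R.-1; first by rewrite prednK.
  by move=> i hi; exists i; move: hi; rewrite leq_max; lia.
have far_k v : v k = w k -> ~~ bdry W v.
  move=> e; apply/negP => /bdR; have [] := linf_coord c v k; rewrite e.
  by move: hk; rewrite leq_max; lia.
have [j jk] : exists j : 'I_d, j != k.
  have d0 : 0 < d by exact: ltn_trans d_gt1.
  have [e|ne] := eqVneq (Ordinal d0) k; last by exists (Ordinal d0).
  by exists (Ordinal d_gt1); rewrite -e.
have far_j v : v j = ord0 -> ~~ bdry W v.
  by move=> e; apply/negP => /bdA/(deep j); rewrite e.
pose T := predC (bdry W).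
(* First leg: send every coordinate except [k] to 0 without leaving the hyperplane. The second leg
   [c2] moves coordinate [k] where coordinate [j] is already 0. *)
have c1 (s : seq 'I_d) : connect (gr T) w [ffun i => if (i != k) && (i \in s) then ord0 else w i].
  elim: s => [|i s IH].
    by rewrite (_ : [ffun _ => _] = w) //; apply/ffunP=> i; rewrite ffunE andbF.
  apply: connect_trans IH _; set a := [ffun _ => _].
  have [ik|ik] := eqVneq i k.
    rewrite (_ : [ffun _ => _] = a) //; apply/ffunP=> i'; rewrite !ffunE in_cons.
    by rewrite ik; case: eqP.
  have -> : [ffun i' => if (i' != k) && (i' \in i :: s) then ord0 else w i'] = setc a i ord0.
    by apply/ffunP=> i'; rewrite !ffunE in_cons; have [->|_] := eqVneq i' i; rewrite ?ik.
  apply: connect_setc => t _; apply: far_k; rewrite !ffunE eqxx.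
  by rewrite eq_sym (negPf ik).
have c2 : connect (gr T) w corner.
  apply: connect_trans (c1 (enum 'I_d)) _; set a := [ffun _ => _].
  have -> : corner = setc a k ord0.
    by apply/ffunP=> i; rewrite !ffunE mem_enum andbT; case: eqP.
  apply: connect_setc => t _; apply: far_j; rewrite !ffunE mem_enum andbT.
  by rewrite (negPf jk).
have [|u] := @crossing _ _ T W corner w _ W0 (SW w Sw); first by rewrite gr_csym.
by move=> /= /negPf->.
Qed.

(** If [a] does not reach [b] inside [Y], the boundary of the component of [b] off the sites reached
    from [a] has no site of [Y]. On such a boundary, belonging to the clusters propagates to
    star-neighbours, so it is constant. Yet the path inside [P] crosses it at a cluster site, and
    the path avoiding the clusters crosses it elsewhere. *)
Lemma detour a b : P a -> P b -> ~~ A a -> ~~ A b ->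
  connect (gr (predC A)) a b -> connect (gr Y) a b.
Proof.
move=> Pa Pb nAa nAb cab.
have Ya : Y a by rewrite /near_clusters nAa Pa.
pose U := fun v => connect (gr Y) a v; have [//|Ub] := boolP (U b).
have UY v : U v -> Y v by exact: connect_gr_in.
set W := comp U b; have Wa : ~~ W a by apply/negP => /(comp_notin Ub); rewrite /U connect0.
have Wb : W b by exact: connect0.
have bdY u : bdry W u -> ~~ Y u.
  move=> /(comp_bdry Ub)[_ Uu [v uv Uv]]; apply: contra Uu => Yu.
  by apply: (connect_trans Uv); apply: connect1; rewrite /gr Yu (UY v Uv) nn_sym uv.
have AW : forall u v, bdry W u -> bdry W v -> A u = A v.
  apply: comp_bdry_star => //; first by exists a; exact: connect0.
    by move=> s t; exact: connect_component.
  have one s t : bdry W t -> star s t -> A s -> A t.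
    move=> bt st As; have := bdY t bt; rewrite /near_clusters negb_and negbK => /orP[//|].
    by rewrite negb_or => /andP[_ /existsP[]]; exists s; rewrite As.
  move=> s t bs bt st; apply/idP/idP; apply: one => //.
  by rewrite /star linf_sym.
have [u Pu bu] := crossing (Pconn Pa Pb) Wa Wb.
have [v /= Av bv] := crossing cab Wa Wb.
have := bdY u bu; rewrite /near_clusters Pu andbT negbK (AW u v bu bv).
by rewrite (negPf Av).
Qed.

End Detour.

(** After removal of loops the vertices of the path are distinct members of [S]. *)
Lemma short_path (T : finType) (S : pred T) (r : rel T) x y :
  S x -> (forall u v, r u v -> S v) -> connect r x y ->
  exists p, [/\ path r x p, last x p = y & (size p < #|S|)%N].
Proof.
move=> Sx rS /connectP[p pp ->]; case/shortenP: pp => p' pp' up' _.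
exists p'; split=> //; have -> : (size p').+1 = size (x :: p') by [].
rewrite -(card_uniqP up'); apply: subset_leq_card; apply/subsetP => z.
rewrite in_cons => /orP[/eqP->//|]; rewrite unfold_in.
elim: p' x pp' {up' Sx} => [|t p' IH] x //= /andP[xt pt]; rewrite in_cons => /orP[/eqP->|]; last exact: IH pt.
exact: rS xt.
Qed.

Section Lengths.
Variables (d m : nat).
Notation box := (box d m).
Implicit Types (S P Bad : pred box) (x y a : box).

Lemma card_linf_ball a r : #|[pred v : box | linf a v <= r]| <= (2 * r + 1) ^ d.
Proof.
pose f (v : box) : {ffun 'I_d -> 'I_(2 * r).+1} := [ffun i => inord (v i + r - a i)].
have inj : {in [pred v | linf a v <= r] &, injective f}.
  move=> u v; rewrite !inE => /linfP hu /linfP hv /ffunP e; apply/ffunP => i; apply: ord_inj.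
  have := e i; rewrite !ffunE => /(congr1 (@nat_of_ord _)); have [h1 h2] := hu i; have [h3 h4] := hv i.
  by rewrite !inordK; lia.
rewrite -(card_in_image inj); apply: leq_trans (max_card _) _.
by rewrite card_ffun !card_ord addn1.
Qed.

Lemma card_exists (T T' : finType) (Q : pred T') (E : T' -> pred T) :
  #|[pred v | [exists a, Q a && E a v]]| <= \sum_(a | Q a) #|E a|.
Proof.
rewrite -sum1_card; under [leqRHS]eq_bigr do rewrite -sum1_card.
rewrite [leqRHS](exchange_big_dep predT) //=.
apply: (@leq_trans (\sum_(v | [exists a, Q a && E a v]) \sum_(a | Q a && (v \in E a)) 1)).
  apply: leq_sum => v; rewrite inE => /existsP[a /andP[Qa Ea]].
  by rewrite (bigD1 a) //=; apply/andP.
by rewrite [leqRHS](bigID [pred v | [exists a, Q a && E a v]]) /= leq_addr.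
Qed.

Lemma card_near_clusters P Bad :
  #|near_clusters P Bad| <= #|P| + 3 ^ d * #|clusters P Bad|.
Proof.
pose N := [pred v | [exists a, clusters P Bad a && star a v]].
apply: (@leq_trans #|[predU P & N]|).
  by apply: subset_leq_card; apply/subsetP => v /andP[_]; rewrite !inE.
apply: (@leq_trans (#|P| + #|N|)); first by rewrite -cardUI leq_addr.
rewrite leq_add2l; apply: leq_trans (card_exists _ _) _.
rewrite mulnC -[#|_| * _]sum_nat_const; apply: leq_sum => a _.
exact: (card_linf_ball a 1).
Qed.

End Lengths.

Section BoxMoves.
Variables (d m : nat).
Notation box := (box d m).

(** The coordinates in [r] are changed one after another; membership in [S] is asked only along
    these moves, where every other coordinate comes from [v] or from [g]. *)
Lemma connect_move (S : pred box) (r : seq 'I_d) (v g : box) : uniq r ->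
  (forall (v' : box) k (t : 'I_m.+1), k \in r -> (forall i, v' i = v i \/ v' i = g i) ->
     (forall i, i \notin r -> v' i = v i) -> (minn (v k) (g k) <= t <= maxn (v k) (g k))%N ->
     S (setc v' k t)) ->
  connect (gr S) v [ffun i => if i \in r then g i else v i].
Proof.
move=> ur h; suff gen r1 : {subset r1 <= r} -> uniq r1 ->
    connect (gr S) v [ffun i => if i \in r1 then g i else v i].
  exact: gen.
elim: r1 => [_ _|k r1 IH sub /= /andP[kr ur1]].
  by rewrite (_ : finfun _ = v) ?connect0 //; apply/ffunP => i; rewrite ffunE.
have kin : k \in r by apply: sub; rewrite mem_head.
have sub1 : {subset r1 <= r} by move=> i ir; apply: sub; rewrite in_cons ir orbT.
apply: connect_trans (IH sub1 ur1) _; set v1 : box := finfun _.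
have v1k : v1 k = v k by rewrite ffunE (negPf kr).
rewrite (_ : finfun _ = setc v1 k (g k)); last first.
  by apply/ffunP => i; rewrite !ffunE in_cons; case: eqVneq => // ->.
apply: connect_setc => t; rewrite v1k => tb; apply: h => // i; rewrite ffunE.
  by case: ifP; [right|left].
by case: ifP => // ir /negP[]; exact: sub1.
Qed.

End BoxMoves.

(** * Trees of bad boxes *)

Lemma sum_surj_le (I J : finType) (Q : pred I) (A : pred J) (h : J -> I) (F : I -> nat) :
  (forall w, Q w -> exists2 a, A a & h a = w) -> \sum_(w | Q w) F w <= \sum_(a | A a) F (h a).
Proof.
move=> hs; rewrite [leqRHS](partition_big h predT) //= big_mkcond; apply: leq_sum => w _.
case: ifP => // /hs[a Aa ha]; rewrite (bigD1 a) /=; last by rewrite Aa ha eqxx.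
by rewrite ha leq_addr.
Qed.

Section Trees.
Variables (d m l : nat).
Hypothesis l_gt0 : 0 < l.
Notation box := (box d m).
Implicit Types (v w q i j : box) (P S Bad : pred box).

(** Each tree is recorded as the list of its [2^k] leaves: a tree of one depth less at the same
    root, followed by another whose root is at distance exactly [l^k]. *)
Fixpoint trees k i : seq (seq box) :=
  if k is k'.+1 then
    [seq t1 ++ t2 | t1 <- trees k' i, t2 <- flatten [seq trees k' j | j <- enum [pred j | linf i j == l ^ k]]]
  else [:: [:: i]].

Fixpoint reach k : nat := if k is k'.+1 then l ^ k + reach k' else 0.

Definition has_tree Bad k i : bool := has (all Bad) (trees k i).

Lemma reach_mono k n : k <= n -> reach k <= reach n.
Proof. by elim: n => [|n IH]; rewrite leq_eqVlt => /orP[/eqP->//|//] /IH h /=; rewrite (leq_trans h) // leq_addl. Qed.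

Lemma has_treeS Bad k i j : linf i j = l ^ k.+1 -> has_tree Bad k i -> has_tree Bad k j -> has_tree Bad k.+1 i.
Proof.
move=> ij /hasP[t1 t1i a1] /hasP[t2 t2j a2]; apply/hasP; exists (t1 ++ t2); last by rewrite all_cat a1.
apply/allpairsP; exists (t1, t2); split=> //=; apply/flattenP; exists (trees k j) => //.
by apply/mapP; exists j => //; rewrite mem_enum inE ij.
Qed.

Lemma linf_ivt S i x z r : linf i x <= r -> connect (sgr S) x z -> r <= linf i z ->
  exists j, [/\ linf i j = r, connect (sgr S) x j & connect (sgr S) j z].
Proof.
move=> ix /connectP[p pp ->]; elim: p x ix pp => [|y p IH] x ix /=.
  by move=> _ h; exists x; split=> //; apply/eqP; rewrite eqn_leq ix.
case/andP=> xy pp far; have [e|ne] := eqVneq (linf i x) r.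
  by exists x; split=> //; apply/connectP; exists (y :: p) => //=; rewrite xy.
have iy : linf i y <= r.
  apply: leq_trans (linf_triangle x _ _) _; case/and3P: (xy) => _ _; rewrite /star => s1.
  by move: ix ne s1; clear; lia.
have [j [h1 h2 h3]] := IH y iy pp far; exists j; split=> //.
exact: connect_trans (connect1 xy) h2.
Qed.

Lemma sgr_end S x y : S x -> connect (sgr S) x y -> S y.
Proof. by move=> Sx /connectP[p]; elim: p x Sx => [|z p IH] x Sx /=; [move=> _ ->|case/andP=> /and3P[_ Sz _] pz; exact: IH pz]. Qed.

(** As [reach k.+1 = l^k.+1 + reach k], the path passes a point [j] at distance exactly [l^k.+1]
    from [i], and from [j] it still has to travel [reach k]; so both [i] and [j] root a tree of
    depth [k]. *)
Lemma tree_of_path Bad k i z : Bad i -> connect (sgr Bad) i z -> reach k <= linf i z -> has_tree Bad k i.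
Proof.
elim: k i => [|k IH] i Bi cz /= far; first by rewrite /has_tree /= Bi.
have [||j [ij c1 c2]] := @linf_ivt Bad i i z (l ^ k.+1) _ cz; first by rewrite linfxx.
  by apply: leq_trans far; rewrite leq_addr.
apply: (has_treeS ij); first by apply: IH cz _ => //; apply: leq_trans far; rewrite leq_addl.
apply: IH c2 _; first exact: sgr_end Bi c1.
by have := linf_triangle j i z; rewrite ij; move: far; rewrite /=; clear; lia.
Qed.

Definition cluster Bad q : pred box := fun v => Bad q && connect (sgr Bad) q v.

Lemma cluster_reach Bad k q v : ~~ has_tree Bad k q -> cluster Bad q v -> linf q v < reach k.
Proof. by move=> nt /andP[Bq cv]; rewrite ltnNge; apply: contra nt; exact: tree_of_path. Qed.

Lemma cluster_card_reach Bad k q : ~~ has_tree Bad k q -> #|cluster Bad q| <= (2 * reach k + 1) ^ d.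
Proof.
move=> nt; apply: leq_trans (card_linf_ball q (reach k)); apply: subset_leq_card; apply/subsetP => v.
by rewrite !inE => h; apply: ltnW; apply: (cluster_reach nt).
Qed.

Lemma cluster_card Bad K q : ~~ has_tree Bad K q ->
  #|cluster Bad q| <= \sum_(k < K) has_tree Bad k q * (2 * reach k.+1 + 1) ^ d.
Proof.
elim: K => [|K IH] nt.
  rewrite big_ord0 leqn0; apply/eqP/eq_card0 => v; apply/negP => /andP[Bq _].
  by move: nt; rewrite /has_tree /= Bq.
rewrite big_ord_recr /=; case t : (has_tree Bad K q); last by rewrite (leq_trans (IH _)) ?leq_addr ?t.
by rewrite mul1n (leq_trans (cluster_card_reach nt)) // leq_addl.
Qed.

Lemma clusters_sum P Bad : #|clusters P Bad| <= \sum_(q | P q) #|cluster Bad q|.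
Proof.
apply: leq_trans (card_exists P (fun q => cluster Bad q)).
by apply: subset_leq_card; apply/subsetP => v /existsP[q h]; apply/existsP; exists q.
Qed.

End Trees.

Lemma card_subsets (T : finType) : #|{: {set T}}| = 2 ^ #|T|.
Proof. by have := card_powerset [set: T]; rewrite powersetT !cardsT. Qed.

(** * Axis-parallel paths between two sites *)

Section Segments.
Variables (d m : nat).
Notation box := (box d m).
Implicit Types (v w g : box).

(** The union of all paths from [v] to [g] that change one coordinate at a time, in any order. It is
    covered by [2^d * d] axis-parallel lines, so bounds along lines suffice. *)
Definition segs v g : pred box := fun w => [exists k,
  [forall j, (j != k) ==> (w j == v j) || (w j == g j)] && (minn (v k) (g k) <= w k <= maxn (v k) (g k))].

Definition mix v g (S : {set 'I_d}) : box := [ffun j => if j \in S then v j else g j].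

Lemma segsP v g w : segs v g w -> exists S k, w = setc (mix v g S) k (w k) /\ minn (v k) (g k) <= w k <= maxn (v k) (g k).
Proof.
case/existsP => k /andP[/forallP h b]; exists [set j | w j == v j], k; split=> //.
apply/ffunP => j; rewrite !ffunE; case: eqVneq => [->//|jk]; have := h j; rewrite jk inE /=.
by case: eqVneq => //= _ /eqP.
Qed.

Lemma segs_setc v g v' k (t : 'I_m.+1) : (forall i, v' i = v i \/ v' i = g i) ->
  minn (v k) (g k) <= t <= maxn (v k) (g k) -> segs v g (setc v' k t).
Proof.
move=> h b; apply/existsP; exists k; rewrite ffunE eqxx b andbT; apply/forallP => j; apply/implyP => jk.
by rewrite ffunE (negPf jk); case: (h j) => ->; rewrite eqxx ?orbT.
Qed.

Lemma segs_left v g (i0 : 'I_d) : segs v g v.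
Proof. by rewrite -[X in segs v g X](setc_id v i0); apply: segs_setc => [i|]; [left|rewrite geq_minl leq_maxl]. Qed.

Lemma segs_connect v g w : segs v g w -> connect (gr (segs v g)) w g.
Proof.
move=> /existsP[k /andP[/forallP h b]].
have mixed (w' : box) : (forall i, w' i = w i \/ w' i = g i) -> forall i, i != k -> w' i = v i \/ w' i = g i.
  by move=> hw i ik; case: (hw i) => ->; [have := h i; rewrite ik => /orP[]/eqP; auto|right].
have btw (x y : nat) (t : nat) : minn x y <= t -> t <= maxn x y -> forall s, minn t y <= s <= maxn t y -> minn x y <= s <= maxn x y.
  by clear; lia.
have c1 := @connect_move d m (segs v g) [:: k] w g isT; apply: connect_trans (c1 _) _.
  move=> v' k' t; rewrite inE => /eqP-> hv _ tb; apply/existsP; exists k.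
  rewrite ffunE eqxx; case/andP: b => b1 b2; rewrite (btw _ _ _ b1 b2) // andbT.
  apply/forallP => j; apply/implyP => jk; rewrite ffunE (negPf jk).
  by case: (mixed _ hv j jk) => ->; rewrite eqxx ?orbT.
set w1 : box := finfun _.
have w1m i : w1 i = v i \/ w1 i = g i.
  rewrite ffunE inE; case: eqVneq => [->|ik]; first by right.
  by have := h i; rewrite ik => /orP[]/eqP; auto.
have c2 : connect (gr (segs v g)) w1 [ffun i => if i \in enum 'I_d then g i else w1 i].
  apply: connect_move; first exact: enum_uniq.
  move=> v' k' t _ hv _ tb; apply: segs_setc.
    by move=> i; case: (hv i) => ->; auto.
  by move: tb; case: (w1m k') => ->; clear; lia.
by move: c2; rewrite (_ : finfun (fun i => if i \in enum 'I_d then _ else _) = g) //; apply/ffunP => i; rewrite ffunE mem_enum.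
Qed.

Lemma sum_segs v g lo hi (F : box -> nat) :
  (forall i, lo <= v i <= hi) -> (forall i, lo <= g i <= hi) ->
  \sum_(w | segs v g w) F w <= \sum_(S : {set 'I_d}) \sum_(k < d) \sum_(t : 'I_m.+1 | lo <= t <= hi) F (setc (mix v g S) k t).
Proof.
move=> hv hg; pose h (a : {set 'I_d} * ('I_d * 'I_m.+1)) := setc (mix v g a.1) a.2.1 a.2.2.
have step : \sum_(w | segs v g w) F w <= \sum_(a : {set 'I_d} * ('I_d * 'I_m.+1) | lo <= a.2.2 <= hi) F (h a).
  apply: sum_surj_le => w /segsP[S [k [e b]]]; exists (S, (k, w k)) => //=.
  by move: (hv k) (hg k) b => /=; move: (nat_of_ord (v k)) (nat_of_ord (g k)) (nat_of_ord (w k)); clear; lia.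
apply: leq_trans step _; under [leqRHS]eq_bigr => S _ do rewrite (pair_big_dep predT (fun _ (t : 'I_m.+1) => lo <= t <= hi)) /=.
by rewrite (pair_big_dep predT (fun _ (a : 'I_d * 'I_m.+1) => lo <= a.2 <= hi)) /=.
Qed.

Lemma card_segs v g : #|segs v g| <= 2 ^ d * d * m.+1.
Proof.
rewrite -sum1_card; apply: leq_trans (@sum_segs v g 0 m (fun=> 1) _ _) _.
- by move=> i; rewrite leq0n /= -ltnS; exact: ltn_ord.
- by move=> i; rewrite leq0n /= -ltnS; exact: ltn_ord.
apply: (@leq_trans (\sum_(S : {set 'I_d}) \sum_(k < d) m.+1)).
  apply: leq_sum => S _; apply: leq_sum => k _; rewrite sum1_card -[X in _ <= X](card_ord m.+1).
  exact: max_card.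
by rewrite !sum_nat_const card_subsets card_ord mulnA.
Qed.

End Segments.

(** * A short route of good boxes *)

Section Coarse.
Variables (d m l K lo hi : nat) (Bad : pred (box d m)) (X : nat -> nat).
Hypotheses (d_gt1 : 1 < d) (l_gt0 : 0 < l).
Notation box := (box d m).
Notation reach := (reach l).
Notation tree := (has_tree l Bad).
Definition central (v : box) : bool := [forall i, lo <= v i <= hi].
Hypothesis no_tree : forall q, central q -> ~~ tree K q.
Hypothesis few_trees : forall v i k, central v -> k < K ->
  \sum_(t : 'I_m.+1 | lo <= t <= hi) tree k (setc v i t) <= X k.
Hypothesis reach_lo : reach K < lo.
Notation vol r := ((2 * r + 1) ^ d).

(** [P] consists of [S1], [S2] and axis-parallel segments joining them. [escape] gives a point of
    each [Si] joined to the corner off the clusters, and [detour] turns this into a route in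
    [near_clusters]. Clusters met by [S1] or [S2] are bounded crudely by [no_tree]; those met by the
    segments are summed line by line with [few_trees]. *)
Theorem coarse_route (S1 S2 : pred box) (x1 y1 x2 y2 : box) :
  {subset S1 <= central} -> {subset S2 <= central} ->
  (forall u v, S1 u -> S1 v -> connect (gr S1) u v) -> (forall u v, S2 u -> S2 v -> connect (gr S2) u v) ->
  S1 x1 -> S1 y1 -> (2 * reach K + 1).*2 <= linf x1 y1 -> S2 x2 -> S2 y2 -> (2 * reach K + 1).*2 <= linf x2 y2 ->
  exists a b (Y : pred box), [/\ S1 a, S2 b, Y a && Y b, connect (gr Y) a b & (forall v, Y v -> ~~ Bad v) /\
    #|Y| <= (#|S1| + #|S2|) * (1 + 3 ^ d * vol (reach K)) +
      2 ^ d * d * (m.+1 + 3 ^ d * \sum_(k < K) X k * vol (reach k.+1))].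
Proof.
move=> c1 c2 con1 con2 Sx1 Sy1 far1 Sx2 Sy2 far2.
have i0 : 'I_d by exists 0; exact: ltnW d_gt1.
pose P : pred box := fun w => [|| S1 w, S2 w | segs x1 x2 w].
have cx1 i : lo <= x1 i <= hi by have /forallP := c1 _ Sx1; exact.
have cx2 i : lo <= x2 i <= hi by have /forallP := c2 _ Sx2; exact.
have segc w : segs x1 x2 w -> central w.
  case/existsP => k /andP[/forallP h b]; apply/forallP => j.
  have [->|jk] := eqVneq j k; first by move: (cx1 k) (cx2 k) b; clear; lia.
  by have := h j; rewrite jk => /orP[]/eqP->.
have Pc w : P w -> central w by case/or3P; [exact: c1|exact: c2|exact: segc].
have sub1 : subpred S1 P by move=> w h; rewrite /P h.
have sub2 : subpred S2 P by move=> w h; rewrite /P h orbT.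
have sub3 : subpred (segs x1 x2) P by move=> w h; rewrite /P h !orbT.
have to2 w : P w -> connect (gr P) w x2.
  case/or3P => h.
  - apply: connect_trans (sub_gr sub1 (con1 _ _ h Sx1)) _.
    by apply: sub_gr sub3 _; apply: segs_connect; exact: segs_left.
  - exact: sub_gr sub2 (con2 _ _ h Sx2).
  by apply: sub_gr sub3 _; exact: segs_connect.
have Pconn x y : P x -> P y -> connect (gr P) x y.
  by move=> Px Py; apply: connect_trans (to2 _ Px) _; rewrite gr_csym; exact: to2.
have Aq v : clusters P Bad v -> exists2 q, P q & cluster Bad q v.
  by case/existsP => q /and3P[Pq Bq cq]; exists q => //; rewrite /cluster Bq.
have Ar v : clusters P Bad v -> exists2 q, P q & linf q v < reach K /\ cluster Bad q v.
  by move=> /Aq[q Pq cq]; exists q => //; split=> //; apply: (cluster_reach (no_tree (Pc _ Pq))).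
(* Members of one cluster are within [reach K] of a common site of [P]; this is where the radius
   [2 * reach K + 1] comes from. *)
have small x y : clusters P Bad x -> connect (sgr Bad) x y -> linf x y < 2 * reach K + 1.
  move=> /Ar[q Pq [qx /andP[Bq cqx]]] cxy.
  have qy : linf q y < reach K.
    apply: (cluster_reach (no_tree (Pc _ Pq))); rewrite /cluster Bq; exact: connect_trans cqx cxy.
  have := linf_triangle q x y; rewrite [linf x q]linf_sym; move: qx qy; clear; lia.
have deep v i : clusters P Bad v -> 0 < v i.
  move=> /Ar[q Pq [qv _]]; have [h _] := linf_coord q v i; have /forallP/(_ i) := Pc _ Pq.
  by move: h qv reach_lo; clear; lia.
have [a [Sa nAa ca]] := escape d_gt1 small deep con1 Sx1 Sy1 far1.
have [b [Sb nAb cb]] := escape d_gt1 small deep con2 Sx2 Sy2 far2.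
have cab : connect (gr (predC (clusters P Bad))) a b.
  by apply: connect_trans ca _; rewrite gr_csym.
have [Pa Pb] : P a /\ P b by split; [exact: sub1|exact: sub2].
exists a, b, (near_clusters P Bad); split=> //.
- by rewrite /near_clusters nAa nAb Pa Pb.
- exact: detour.
split; first by move=> v; exact: near_clusters_good.
apply: leq_trans (card_near_clusters P Bad) _.
have hP : #|P| <= #|S1| + #|S2| + 2 ^ d * d * m.+1.
  apply: (@leq_trans (#|S1| + #|S2| + #|segs x1 x2|)); last by rewrite leq_add2l card_segs.
  apply: (@leq_trans (#|predU S1 S2| + #|segs x1 x2|)); last first.
    by rewrite leq_add2r -[leqRHS]cardUI leq_addr.
  rewrite -[leqRHS]cardUI; apply: leq_trans (leq_addr _ _); apply: subset_leq_card; apply/subsetP => w.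
  by rewrite /in_mem /= /P orbA.
have hA : #|clusters P Bad| <= (#|S1| + #|S2|) * vol (reach K) + 2 ^ d * d * \sum_(k < K) X k * vol (reach k.+1).
  apply: leq_trans (clusters_sum _ _) _.
  apply: (@leq_trans (\sum_(q | S1 q) #|cluster Bad q| + \sum_(q | S2 q) #|cluster Bad q| + \sum_(q | segs x1 x2 q) #|cluster Bad q|)).
    rewrite (big_mkcond P) (big_mkcond S1) (big_mkcond S2) (big_mkcond (segs x1 x2)) /= -!big_split /=; apply: leq_sum => q _.
    by rewrite /P; case: (S1 q); case: (S2 q); case: (segs x1 x2 q) => //=; clear; lia.
  have hS S : {subset S <= central} -> \sum_(q | S q) #|cluster Bad q| <= #|S| * vol (reach K).
    move=> cS; rewrite -sum_nat_const; apply: leq_sum => q Sq.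
    by apply: cluster_card_reach => //; apply: no_tree; exact: cS.
  rewrite mulnDl; apply: leq_add; first by apply: leq_add; exact: hS.
  apply: (@leq_trans (\sum_(q | segs x1 x2 q) \sum_(k < K) tree k q * vol (reach k.+1))).
    by apply: leq_sum => q sq; apply: cluster_card => //; apply: no_tree; exact: segc.
  apply: leq_trans (@sum_segs d m x1 x2 lo hi (fun q => \sum_(k < K) tree k q * vol (reach k.+1)) cx1 cx2) _.
  apply: (@leq_trans (\sum_(S : {set 'I_d}) \sum_(i < d) \sum_(k < K) X k * vol (reach k.+1))); last first.
    by rewrite !sum_nat_const card_subsets card_ord mulnA.
  apply: leq_sum => S _; apply: leq_sum => i _; rewrite exchange_big /=; apply: leq_sum => k _.
  rewrite -big_distrl /= leq_mul2r; apply/orP; right; apply: few_trees => //.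
  by apply/forallP => j; rewrite ffunE; case: ifP.
apply: leq_trans (leq_add hP (leq_mul (leqnn (3 ^ d)) hA)) _.
by rewrite !mulnDr !mulnDl !mulnA; clear; lia.
Qed.

End Coarse.

From mathcomp Require Import all_order all_algebra reals ring lra zify.
Import Order.TTheory GRing.Theory Num.Theory.
Local Open Scope ring_scope.

(** * Random words and the heat kernel *)

Section WordAverage.
Variables (R : realType) (D : finType).
Implicit Types (n m : nat) (F G : seq D -> R) (w : seq D).

(* The expectation of [F] at a uniformly random word of length [n]. *)
Fixpoint EW n F : R :=
  if n is n'.+1 then #|D|%:R^-1 * \sum_(e : D) EW n' (fun w => F (e :: w)) else F [::].

Lemma eq_EW n F G : (forall w, size w = n -> F w = G w) -> EW n F = EW n G.
Proof.
elim: n F G => [|n IH] F G FG /=; first by rewrite FG.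
by congr *%R; apply: eq_bigr => e _; apply: IH => w sw; rewrite FG //= sw.
Qed.

Lemma ler_EW n F G : (forall w, size w = n -> F w <= G w) -> EW n F <= EW n G.
Proof.
elim: n F G => [|n IH] F G FG /=; first by rewrite FG.
rewrite ler_wpM2l ?invr_ge0 ?ler0n //; apply: ler_sum => e _.
by apply: IH => w sw; rewrite FG //= sw.
Qed.

Lemma EWD n F G : EW n (fun w => F w + G w) = EW n F + EW n G.
Proof.
elim: n F G => [//|n IH] F G /=; rewrite -mulrDr -big_split /=.
by congr *%R; apply: eq_bigr => e _; rewrite IH.
Qed.

Lemma EWZ n c F : EW n (fun w => c * F w) = c * EW n F.
Proof.
elim: n F => [//|n IH] F /=; rewrite mulrCA; congr *%R; rewrite mulr_sumr.
by apply: eq_bigr => e _; rewrite IH.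
Qed.

Lemma EW0 n : EW n (fun=> 0) = 0.
Proof. by have := EWZ n 0 (fun=> 0); under eq_EW do rewrite mul0r; rewrite mul0r. Qed.

Lemma EW_sum (I : Type) (r : seq I) (P : pred I) n (F : I -> seq D -> R) :
  EW n (fun w => \sum_(i <- r | P i) F i w) = \sum_(i <- r | P i) EW n (F i).
Proof.
elim: r => [|i r IH]; first by under eq_EW do rewrite big_nil; rewrite big_nil EW0.
rewrite big_cons -IH; case Pi: (P i).
  by rewrite -EWD; apply: eq_EW => w _; rewrite big_cons Pi.
by apply: eq_EW => w _; rewrite big_cons Pi.
Qed.

Lemma EW_ge0 n F : (forall w, size w = n -> 0 <= F w) -> 0 <= EW n F.
Proof. by move=> F0; rewrite -(EW0 n); apply: ler_EW. Qed.

Lemma EW_cat n m F : EW (n + m) F = EW n (fun u => EW m (fun v => F (u ++ v))).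
Proof.
elim: n F => [//|n IH] F /=; congr *%R.
by apply: eq_bigr => e _; rewrite IH.
Qed.

Hypothesis D_gt0 : (0 < #|D|)%N.

Lemma EW_const n c : EW n (fun=> c) = c.
Proof.
elim: n => [//|n IH] /=; rewrite IH sumr_const -[c *+ _]mulr_natl mulrA mulVf ?mul1r //.
by rewrite pnatr_eq0 -lt0n.
Qed.

Lemma EW_le_const n F c : (forall w, size w = n -> F w <= c) -> EW n F <= c.
Proof. by move=> h; rewrite -[leRHS](EW_const n); apply: ler_EW. Qed.

Lemma EW_drop_last n m F : EW (n + m) (fun w => F (take n w)) = EW n F.
Proof.
rewrite EW_cat; apply: eq_EW => u su; rewrite -[RHS](EW_const m).
by apply: eq_EW => v _; rewrite -su take_size_cat.
Qed.

End WordAverage.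

Section WordAverage2.
Variables (R : realType) (D E : finType).

End WordAverage2.

Lemma ler_sum_inj (R : realType) (I J : finType) (f : I -> J) (F : J -> R) :
  injective f -> (forall j, 0 <= F j) -> \sum_i F (f i) <= \sum_j F j.
Proof.
move=> fI F0; rewrite [leRHS](bigID [in f @: setT]) /=.
rewrite (_ : \sum_i F (f i) = \sum_(j in f @: setT) F j); first by rewrite lerDl sumr_ge0.
by rewrite big_imset /=; [apply: eq_bigl => i; rewrite inE|move=> i j _ _; exact: fI].
Qed.

(** * Heat kernel of the walk on a cycle *)

Section Cycle.
Variables (R : realType) (N : nat).
Hypothesis N_gt2 : (2 < N)%N.
Notation Z := 'Z_N.

Fixpoint q1 n (y : Z) : R :=
  if n is n'.+1 then (q1 n' (y - 1) + q1 n' (y + 1)) / 2 else (y == 0)%:R.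

Lemma q1_ge0 n y : 0 <= q1 n y.
Proof.
elim: n y => [|n IH] y /=; first exact: ler0n.
by have := IH (y - 1); have := IH (y + 1); lra.
Qed.

Lemma sum_shift (f : Z -> R) c : \sum_y f (y + c) = \sum_y f y.
Proof. by rewrite [RHS](reindex_inj (addIr c)). Qed.

Lemma q1_sum n : \sum_y q1 n y = 1.
Proof.
elim: n => [|n IH] /=.
  by rewrite (bigD1 0) //= big1 ?addr0 ?eqxx // => y /negPf->.
by rewrite -mulr_suml big_split /= !sum_shift IH; lra.
Qed.

Lemma q1_convol n m y : q1 (n + m) y = \sum_z q1 n z * q1 m (y - z).
Proof.
elim: n y => [|n IH] y /=.
  rewrite (bigD1 0) //= big1 ?addr0; first by rewrite ?eqxx mul1r subr0.
  by move=> z /negPf->; rewrite mul0r.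
rewrite !IH -big_split /= mulr_suml -!mulr_suml.
under [RHS]eq_bigr do rewrite mulrAC mulrDl.
rewrite -mulr_suml [X in _ = X * _]big_split /=; congr (_ * _); rewrite big_split /=; congr (_ + _).
  rewrite -(sum_shift (fun z => q1 n (z - 1) * q1 m (y - z)) 1).
  by apply: eq_bigr => z _; rewrite addrK opprD addrA addrAC.
rewrite -(sum_shift (fun z => q1 n (z + 1) * q1 m (y - z)) (-1)).
by apply: eq_bigr => z _; rewrite subrK opprB [1 - z]addrC addrA addrAC.
Qed.

Definition energy n := \sum_y q1 n y ^+ 2.

(** Convolution together with [a b <= (a^2 + b^2) / 2]; the sum of squares is invariant under
    [z |-> y - z]. *)
Lemma q1_even_le n y : q1 (n + n) y <= energy n.
Proof.
rewrite q1_convol.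
have -> : energy n = (\sum_z (q1 n z ^+ 2 + q1 n (y - z) ^+ 2)) / 2.
  rewrite big_split /= (_ : \sum_z q1 n (y - z) ^+ 2 = energy n) -?/(energy n); first lra.
  rewrite /energy (reindex_inj (inj_comp (addrI y) oppr_inj)) /=.
  by apply: eq_bigr => z _; rewrite opprD opprK addNKr.
rewrite mulr_suml; apply: ler_sum => z _.
by have := sqr_ge0 (q1 n z - q1 n (y - z)); nra.
Qed.

(** The parallelogram identity. Increments over distance 2 appear because the two neighbours of a
    site are 2 apart. *)
Lemma energy_step n :
  energy n.+1 = energy n - (\sum_y (q1 n (y + 2) - q1 n y) ^+ 2) / 4.
Proof.
have -> : \sum_y (q1 n (y + 2) - q1 n y) ^+ 2 = \sum_y (q1 n (y + 1) - q1 n (y - 1)) ^+ 2.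
  rewrite -[RHS](sum_shift _ 1); apply: eq_bigr => y _.
  by rewrite addrK -addrA (_ : 1 + 1 = 2 :> Z).
have e1 : energy n = \sum_y ((q1 n (y - 1) ^+ 2 + q1 n (y + 1) ^+ 2) / 2).
  by rewrite -mulr_suml big_split /= !(sum_shift (fun y => q1 n y ^+ 2)) -/(energy n); lra.
rewrite {1}/energy e1 mulr_suml -sumrB; apply: eq_bigr => y _ /=; lra.
Qed.

Lemma sqr_sum_le m (f : nat -> R) : (\sum_(i < m) f i) ^+ 2 <= m%:R * \sum_(i < m) f i ^+ 2.
Proof.
elim: m => [|m IH]; first by rewrite !big_ord0; lra.
rewrite !big_ord_recr /= -natr1; set S := \sum_(i < m) f i in IH *; set Q := \sum_(i < m) f i ^+ 2 in IH *.
have Q0 : 0 <= Q by apply: sumr_ge0 => i _; exact: sqr_ge0.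
have [m0|m0] := posnP m.
  by rewrite /S /Q m0 !big_ord0; lra.
have mR : 0 < m%:R :> R by rewrite ltr0n.
set x := f m; have h := sqr_ge0 (S - m%:R * x).
suff : 0 <= m%:R * (Q + m%:R * x ^+ 2 - 2 * S * x) by rewrite pmulr_rge0 //; nra.
by nra.
Qed.

(** A Nash inequality by hand. From a maximum [M] of the kernel move in steps of 2: total mass 1
    forces one of the next [J] values, with [J] of order [1 / M], to be at most [M / 2], and
    Cauchy-Schwarz over this drop bounds the Dirichlet form below by a multiple of [M^3]. The points
    are distinct because [2 * J < N], which follows from [M > 6 / N]. *)
Lemma nash n : energy n <= 6 / N%:R \/
  energy n.+1 <= energy n - energy n ^+ 3 / 48.
Proof.
have N0 : 0 < N%:R :> R by rewrite ltr0n; lia.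
have [y0 ymax] : exists y0, forall y, q1 n y <= q1 n y0.
  by case: (@Order.TotalTheory.arg_maxP _ _ _ (0 : Z) predT (q1 n) isT) => y0 _ h; exists y0 => y; exact: h.
set M := q1 n y0 in ymax.
have eM : energy n <= M.
  rewrite -[leRHS]mulr1 -(q1_sum n) mulr_sumr; apply: ler_sum => y _.
  by rewrite expr2 ler_wpM2r ?q1_ge0.
have e0 : 0 <= energy n by apply: sumr_ge0 => y _; exact: sqr_ge0.
have M1 : M <= 1.
  by rewrite -(q1_sum n) (bigD1 y0) //= lerDl; apply: sumr_ge0 => y _; exact: q1_ge0.
have [M6|M6] := leP M (6 / N%:R); first by left; exact: le_trans M6.
right; have M0 : 0 < M by apply: le_lt_trans M6; apply: divr_ge0; rewrite ?ler0n.
(* [2 < J M <= 3]: enough points to exceed mass 1 if all values were above [M / 2], and few enough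
   for Cauchy-Schwarz. *)
pose J := (Num.truncn (2 / M)).+1.
have J2 : 2 < J%:R * M by have := truncnS_gt (2 / M); rewrite ltr_pdivrMr.
have J3 : J%:R * M <= 3.
  have : J%:R <= 2 / M + 1 by rewrite /J -(natr1 (Num.trunc _)) lerD2r truncn_le divr_ge0 // ltW.
  by rewrite -(ler_pM2r M0) mulrDl mulfVK ?gt_eqF //; lra.
have JN : (2 * J < N)%N.
  rewrite -(ltr_nat R) natrM; move: M6; rewrite ltr_pdivrMr //; nra.
pose f j := q1 n (y0 + (2 * j)%:R).
have [j jJ fj] : exists2 j, (j <= J)%N & f j <= M / 2.
  pose inj : 'I_J -> Z := fun j => y0 + (2 * j.+1)%:R.
  have injI : injective inj.
    move=> i j /addrI /(congr1 val) /=; rewrite !val_Zp_nat; try exact: ltnW.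
    have := ltn_ord i; have := ltn_ord j; move: JN; clear => JN hj hi.
    by rewrite !modn_small; [move=> e; apply: ord_inj; lia|lia|lia].
  have : \sum_(j < J) f j.+1 <= 1.
    by rewrite -(q1_sum n); apply: (ler_sum_inj injI) => z; exact: q1_ge0.
  have [/existsP[j fj] _|none] := boolP [exists j : 'I_J, f j.+1 <= M / 2]; first by exists j.+1.
  have : \sum_(j < J) M / 2 <= \sum_(j < J) f j.+1.
    apply: ler_sum => j _; apply/ltW; rewrite ltNge; apply: contra none => h.
    by apply/existsP; exists j.
  by rewrite sumr_const card_ord -[_ *+ _]mulr_natl; lra.
have tele : (M / 2) ^+ 2 <= j%:R * \sum_(i < j) (f i.+1 - f i) ^+ 2.
  apply: le_trans (sqr_sum_le _ (fun i => f i.+1 - f i)).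
  have := telescope_sumr f (leq0n j); rewrite big_mkord => ->.
  by rewrite /f muln0 addr0 -/M -/(f j); nra.
have sub : \sum_(i < j) (f i.+1 - f i) ^+ 2 <= \sum_y (q1 n (y + 2) - q1 n y) ^+ 2.
  pose inj : 'I_j -> Z := fun i => y0 + (2 * i)%:R.
  have injI : injective inj.
    move=> i k /addrI /(congr1 val) /=; rewrite !val_Zp_nat; try exact: ltnW.
    have := ltn_ord i; have := ltn_ord k; move: JN jJ; clear => JN jJ hj hi.
    by rewrite !modn_small; [move=> e; apply: ord_inj; lia|lia|lia].
  apply: le_trans (ler_sum_inj injI (fun z => sqr_ge0 (q1 n (z + 2) - q1 n z))).
  by apply: ler_sum => i _; rewrite /f mulnS addnC natrD addrA.
rewrite energy_step; set E := (X in _ - X / 4); rewrite -/E in sub; set E' := \sum_(i < j) _ in tele sub.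
have jM : j%:R * M <= 3 by apply: le_trans J3; rewrite ler_wpM2r ?ler_nat // ltW.
have E0 : 0 <= E' by apply: sumr_ge0 => i _; exact: sqr_ge0.
have h1 : M ^+ 3 / 4 <= 3 * E'.
  apply: (@le_trans _ _ (j%:R * M * E')); last by rewrite ler_wpM2r.
  by move: tele; set jj := j%:R; nra.
have h2 : energy n ^+ 3 <= M ^+ 3 by rewrite lerXn2r ?nnegrE // ltW.
by lra.
Qed.

(** A discrete version of [e' <= - e^3 / 48], whose solutions satisfy [n e^2 <= 24]; the constant 48
    leaves room for the discretisation. *)
Lemma energy_bound n : energy n <= 6 / N%:R \/ n.+1%:R * energy n ^+ 2 <= 48.
Proof.
have N0 : 0 < N%:R :> R by rewrite ltr0n; lia.
have e0 k : 0 <= energy k by apply: sumr_ge0 => y _; exact: sqr_ge0.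
have e1 k : energy k.+1 <= energy k.
  rewrite energy_step gerBl divr_ge0 //; apply: sumr_ge0 => y _; exact: sqr_ge0.
have e01 k : energy k <= 1.
  elim: k => [|k IH]; last exact: le_trans IH.
  rewrite /energy (bigD1 0) //= big1 ?addr0 ?eqxx ?expr1n // => y /negPf->.
  by rewrite expr0n.
elim: n => [|n IH]; first by right; have := e01 0%N; have := e0 0%N; nra.
have [h|h] := leP (energy n) (6 / N%:R); first by left; exact: le_trans h.
case: IH => [|IH]; first by rewrite leNgt h.
case: (nash n) => [|step]; first by rewrite leNgt h.
right; move: (e0 n) (e0 n.+1) (e01 n) step IH.
move: (energy n) (energy n.+1) => a b a0 b0 a1 step IH.
have n0 : 0 <= n%:R :> R by exact: ler0n.
have eS k : k.+1%:R = k%:R + 1 :> R by rewrite natr1.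
move: IH; rewrite !eS; move: (n%:R : R) n0 => m m0 IH.
have b2 : b ^+ 2 <= a ^+ 2 * (1 - a ^+ 2 / 48).
  have x0 : 0 <= 1 - a ^+ 2 / 48 by nra.
  have bx : b <= a * (1 - a ^+ 2 / 48) by nra.
  apply: (@le_trans _ _ ((a * (1 - a ^+ 2 / 48)) ^+ 2)); first by rewrite lerXn2r ?nnegrE ?mulr_ge0.
  have x1 : 1 - a ^+ 2 / 48 <= 1 by nra.
  by rewrite exprMn ler_wpM2l ?sqr_ge0 //; move: x0 x1; set x := 1 - _; nra.
have t1 : a ^+ 2 <= 1 by nra.
have t0 : 0 <= a ^+ 2 by exact: sqr_ge0.
move: (a ^+ 2) t0 t1 IH b2 => t t0 t1 IH b2.
apply: (@le_trans _ _ ((m + 1 + 1) * (t * (1 - t / 48)))); first by rewrite ler_wpM2l //; lra.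
have : 0 <= (48 - (m + 1) * t) * (1 - t / 48) by rewrite mulr_ge0; lra.
by nra.
Qed.

(** Both alternatives of [energy_bound] give [energy k <= 7 / sqrt (k + 1)] for [k < N^2]. Odd times
    cost nothing, as a step is an average, and halving the time costs the factor [sqrt 2], with
    [7 sqrt 2 < 10]. *)
Lemma q1_le n y : (n <= N ^ 2)%N -> q1 n y <= 10 / Num.sqrt n.+1%:R.
Proof.
move=> nN; have N0 : 0 < N%:R :> R by rewrite ltr0n; lia.
have even k : (k < N ^ 2)%N -> energy k <= 7 / Num.sqrt k.+1%:R.
  move=> kN; have s0 : 0 < Num.sqrt k.+1%:R :> R by rewrite sqrtr_gt0 ltr0n.
  have s2 : Num.sqrt k.+1%:R ^+ 2 = k.+1%:R :> R by rewrite sqr_sqrtr ?ler0n.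
  rewrite ler_pdivlMr //; case: (energy_bound k) => h.
    have sN : Num.sqrt k.+1%:R <= N%:R :> R.
      by rewrite -(@ler_pXn2r _ 2) ?nnegrE ?ler0n ?sqrtr_ge0 // s2 -natrX ler_nat.
    apply: (@le_trans _ _ (6 / N%:R * N%:R)); last by rewrite divfK ?gt_eqF //; lra.
    by rewrite ler_pM ?sqrtr_ge0 //; apply: sumr_ge0 => z _; exact: sqr_ge0.
  have e0 : 0 <= energy k by apply: sumr_ge0 => z _; exact: sqr_ge0.
  rewrite -s2 in h; move: (Num.sqrt _) s0 h => s s0 h.
  by rewrite -(@ler_pXn2r _ 2) ?nnegrE ?mulr_ge0 // ?ltW // exprMn mulrC; lra.
have step k b : (forall z, q1 k z <= b) -> forall z, q1 k.+1 z <= b.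
  by move=> h z /=; have := h (z - 1); have := h (z + 1); lra.
have q2 : q1 n y <= 7 / Num.sqrt n./2.+1%:R.
  have lt : (n./2 < N ^ 2)%N by have : (0 < N ^ 2)%N; rewrite ?expn_gt0; lia.
  have h z : q1 (n./2 + n./2) z <= 7 / Num.sqrt n./2.+1%:R.
    exact: le_trans (q1_even_le _ _) (even _ lt).
  rewrite -(odd_double_half n) {1}addnC -{1}addnn; case: (odd n); last by rewrite addn0 half_bit_double; exact: h.
  rewrite addn1 half_bit_double; exact: step.
apply: le_trans q2 _.
have s0 : 0 < Num.sqrt n.+1%:R :> R by rewrite sqrtr_gt0 ltr0n.
have s1 : 0 < Num.sqrt n./2.+1%:R :> R by rewrite sqrtr_gt0 ltr0n.
rewrite ler_pdivrMr // mulrAC ler_pdivlMr //.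
rewrite -(@ler_pXn2r _ 2) ?nnegrE ?mulr_ge0 // ?ltW // !exprMn !sqr_sqrtr ?ler0n //.
have h : n.+1%:R <= 2 * n./2.+1%:R :> R by rewrite -natrM ler_nat; lia.
have h0 : 0 < n./2.+1%:R :> R by rewrite ltr0n.
by move: h h0; move: (n.+1%:R : R) (n./2.+1%:R : R) => a b; nra.
Qed.

End Cycle.

(** * Heat kernel on the torus *)

Section Torus.
Variables (R : realType) (d N : nat).
Hypothesis N_gt2 : (2 < N)%N.
Notation T := 'rV['Z_N]_d.
Notation dir := ('I_d * bool)%type.

Definition vec (e : dir) : T := (if e.2 then 1 else -1) *: delta_mx 0 e.1.

Definition wsum (w : seq dir) : T := \sum_(e <- w) vec e.

Lemma wsum_cons e w : wsum (e :: w) = vec e + wsum w.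
Proof. by rewrite /wsum big_cons. Qed.

Lemma wsum_cat u w : wsum (u ++ w) = wsum u + wsum w.
Proof. by rewrite /wsum big_cat. Qed.

Definition heat n (y : T) : R := EW n (fun w => (wsum w == y)%:R).

Lemma heat_ge0 n y : 0 <= heat n y.
Proof. by apply: EW_ge0 => w _; exact: ler0n. Qed.

Lemma heatS n y : heat n.+1 y = #|{: dir}|%:R^-1 * \sum_(e : dir) heat n (y - vec e).
Proof.
congr *%R; apply: eq_bigr => e _; apply: eq_EW => w _.
by rewrite wsum_cons addrC [in RHS]eq_sym subr_eq eq_sym.
Qed.

Lemma dir_gt0 : (0 < d)%N -> (0 < #|{: dir}|)%N.
Proof. by move=> d0; rewrite card_prod card_ord card_bool; lia. Qed.

(** Given the sequence [c] of moved coordinates, the signs are independent, so the coordinates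
    perform independent walks on the cycle. *)
Lemma heat_coord n y : (0 < d)%N ->
  heat n y = EW n (fun c : seq 'I_d => \prod_k q1 R (count_mem k c) (y 0 k)).
Proof.
move=> d0; elim: n y => [|n IH] y.
  rewrite /heat /= /wsum big_nil.
  have [<-|ny] := eqVneq 0 y.
    by rewrite big1 // => k _; rewrite mxE eqxx.
  have [k yk] : exists k, y 0 k != 0.
    apply/existsP; apply: contraNT ny; rewrite negb_exists => /forallP h.
    by apply/eqP/rowP => k; rewrite mxE; apply/esym/eqP; have := h k; rewrite negbK.
  by rewrite (bigD1 k) //= (negPf yk) mul0r.
rewrite heatS /=; have -> : #|{: dir}|%:R = d%:R * 2 :> R.
  by rewrite card_prod card_ord card_bool natrM.
rewrite card_ord invfM -mulrA; congr *%R.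
under eq_bigr do rewrite IH.
rewrite (eq_bigr (fun e => EW n (fun c : seq 'I_d => \prod_k q1 R (count_mem k c) ((y - vec (e.1, e.2)) 0 k)))); last by case.
rewrite -(pair_bigA _ (fun k b => EW n (fun c : seq 'I_d => \prod_k0 q1 R (count_mem k0 c) ((y - vec (k, b)) 0 k0)))) /=.
rewrite mulr_sumr; apply: eq_bigr => k _; rewrite big_bool /= -EWD -EWZ; apply: eq_EW => c _.
rewrite [RHS](bigD1 k) //= (bigD1 k) //= [X in _ + X](bigD1 k) //=.
rewrite eqxx add1n /= !mxE !eqxx /=.
have e b : \prod_(i | i != k) q1 R (count_mem i c) ((y - vec (k, b)) 0 i) =
           \prod_(i | i != k) q1 R ((k == i) + count_mem i c) (y 0 i).
  apply: eq_bigr => i ik; rewrite eq_sym (negPf ik) add0n; congr q1.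
  by rewrite !mxE (negPf ik) andbF mulr0 subr0.
by rewrite !e mulr1 mulN1r opprK; lra.
Qed.

(** Markov's inequality for [2 ^- count], whose mean factorises over the letters. *)
Lemma EW_count_tail k m n : (0 < d)%N ->
  EW n (fun c : seq 'I_d => (count_mem k c <= m)%N%:R) <= 2 ^+ m * (1 - (2 * d)%:R^-1) ^+ n :> R.
Proof.
move=> d0; have gen : EW n (fun c : seq 'I_d => 2 ^- count_mem k c) = (1 - (2 * d)%:R^-1) ^+ n :> R.
  elim: n => [|n IH] /=; first by rewrite invr1.
  rewrite (eq_bigr (fun e => (if e == k then 2^-1 else 1) * (1 - (2 * d)%:R^-1) ^+ n)).
    rewrite -mulr_suml mulrA exprS; congr *%R; rewrite card_ord (bigD1 k) //= eqxx.
    rewrite (eq_bigr (fun=> 1)) => [|i /negPf->//]; rewrite sumr_const cardC1 card_ord.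
    have dR : d%:R != 0 :> R by rewrite pnatr_eq0; lia.
    by rewrite -subn1 mulrnBr // mulr1n natrM; field.
  move=> e _; rewrite -IH -EWZ; apply: eq_EW => c _ /=.
  by case: (e == k); rewrite ?add0n ?mul1r // add1n exprS invfM.
rewrite -gen -EWZ; apply: ler_EW => c _.
have [h|h] := leqP; last by rewrite mulr_ge0 ?invr_ge0 ?exprn_ge0.
by rewrite ler_pdivlMr ?exprn_gt0 // mul1r ler_weXn2l // ler1n.
Qed.

Lemma bernoulli_inv (x : R) k : 0 <= x <= 1 -> (1 - x) ^+ k * (1 + k%:R * x) <= 1.
Proof.
case/andP=> x0 x1; elim: k => [|k IH]; first by rewrite expr0 mul0r addr0 mulr1.
apply: le_trans IH; rewrite exprSr -mulrA ler_wpM2l ?exprn_ge0 ?subr_ge0 // -natr1.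
have k0 : 0 <= k%:R :> R by exact: ler0n.
by nra.
Qed.

Lemma bernoulli (x : R) k : 0 <= x -> 1 + k%:R * x <= (1 + x) ^+ k.
Proof.
move=> x0; elim: k => [|k IH]; first by rewrite mul0r addr0.
rewrite exprS -natr1; have k0 : 0 <= k%:R :> R by exact: ler0n.
apply: (@le_trans _ _ ((1 + x) * (1 + k%:R * x))); first nra.
by rewrite ler_wpM2l // addr_ge0.
Qed.

(** With [x = 1 / (3 d)]: [(m + 1) x <= (1 + x)^m] and [(1 + x)^d <= 3 / 2], so the [d]-th power of
    [(m + 1) x] is at most [(3 / 2)^m]. *)
Lemma poly_le_exp m : (0 < d)%N -> (m.+1%:R : R) ^+ d * (2 / 3) ^+ m <= (3 * d)%:R ^+ d.
Proof.
move=> d0; have dR : 0 < d%:R :> R by rewrite ltr0n.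
pose x : R := (3 * d)%:R^-1; have x0 : 0 < x by rewrite invr_gt0 ltr0n; lia.
have dx : d%:R * x = 1 / 3 by rewrite /x natrM; field; lra.
have x1 : x <= 1 by rewrite invf_le1 ?ltr0n ?ler1n; lia.
have b1 : (1 + x) ^+ d <= 3 / 2.
  have h : (1 + x) ^+ d * (1 - x) ^+ d <= 1.
    by rewrite -exprMn exprn_ile1 //; nra.
  have h2 : 2 / 3 <= (1 - x) ^+ d.
    have [h2 _] : 1 - d%:R * x <= (1 - x) ^+ d /\ True; last by rewrite dx in h2; lra.
    split=> //; elim: (d) => [|k IH]; first by rewrite mul0r subr0.
    rewrite exprS -natr1; have k0 : 0 <= k%:R :> R by exact: ler0n.
    apply: (@le_trans _ _ ((1 - x) * (1 - k%:R * x))); first nra.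
    by rewrite ler_wpM2l // subr_ge0.
  have h3 : 0 <= (1 + x) ^+ d by rewrite exprn_ge0 //; lra.
  by nra.
have b2 : m.+1%:R * x <= (1 + x) ^+ m.
  by apply: le_trans (bernoulli m (ltW x0)); rewrite -natr1 mulrDl mul1r; lra.
have b3 : (m.+1%:R * x) ^+ d <= (3 / 2) ^+ m.
  apply: (@le_trans _ _ (((1 + x) ^+ m) ^+ d)).
    by rewrite lerXn2r ?nnegrE ?mulr_ge0 ?ler0n ?exprn_ge0 //; lra.
  rewrite exprAC lerXn2r ?nnegrE ?exprn_ge0 //; lra.
have -> : (m.+1%:R : R) ^+ d = (m.+1%:R * x) ^+ d * (3 * d)%:R ^+ d.
  by rewrite -exprMn /x mulfVK // pnatr_eq0; lia.
rewrite mulrAC -[leRHS]mul1r ler_wpM2r ?exprn_ge0 ?ler0n //.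
apply: (@le_trans _ _ ((3 / 2) ^+ m * (2 / 3) ^+ m)); first by rewrite ler_wpM2r ?exprn_ge0; lra.
by rewrite -exprMn (_ : 3 / 2 * (2 / 3) = 1) ?expr1n //; lra.
Qed.

(** Factors of [heat_le]: [10 + 3 d] dominates bulk and tail, [1 + d] counts them, [4 d] replaces
    [m] by [n]. *)
Definition hk_const := ((10 + 3 * d) * (1 + d) * (4 * d))%N.

Lemma q1_le1 n y : @q1 R N n y <= 1.
Proof.
elim: n y => [|n IH] y /=; first by case: (_ == _).
by have := IH (y - 1); have := IH (y + 1); lra.
Qed.

Lemma heat_le n y : (0 < d)%N -> (0 < n <= N ^ 2)%N ->
  heat n y <= (hk_const%:R / Num.sqrt n%:R) ^+ d.
Proof.
move=> d0 /andP[n0 nN]; rewrite heat_coord //.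
pose m := (n %/ (4 * d))%N.
have d4 : (0 < 4 * d)%N by lia.
have mn : (4 * d * m <= n < 4 * d * m.+1)%N.
  by rewrite /m mulnC leq_divM /= mulnC -ltn_divLR.
pose s := Num.sqrt m.+1%:R : R; have s0 : 0 < s by rewrite sqrtr_gt0 ltr0n.
have s2 : s ^+ 2 = m.+1%:R by rewrite sqr_sqrtr ?ler0n.
have s1 : 1 <= s by rewrite -(@ler_pXn2r _ 2) ?nnegrE ?expr1n ?s2 ?ler1n // ltW.
have prod_le c : size c = n -> \prod_k q1 R (count_mem k c) (y 0 k) <=
    (10 / s) ^+ d + \sum_k (count_mem k c <= m)%N%:R.
  move=> sc; have [/existsP[k ck]|none] := boolP [exists k : 'I_d, (count_mem k c <= m)%N].
    apply: (@le_trans _ _ 1).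
      by apply: prodr_ile1 => i _; rewrite q1_ge0 q1_le1.
    rewrite (bigD1 k) //= ck addrCA lerDl addr_ge0 //; first by rewrite exprn_ge0 ?divr_ge0 ?ltW.
    by apply: sumr_ge0 => i _; rewrite ler0n.
  apply: (@le_trans _ _ ((10 / s) ^+ d)); last by rewrite lerDl; apply: sumr_ge0 => i _; rewrite ler0n.
  rewrite -[X in _ ^+ X]card_ord -prodr_const; apply: ler_prod => k _; rewrite q1_ge0 /=.
  have ck : (m < count_mem k c)%N.
    by rewrite ltnNge; apply: contra none => h; apply/existsP; exists k.
  apply: le_trans (q1_le _ _ _ _) _ => //; first by apply: leq_trans nN; rewrite -sc count_size.
  by rewrite ler_pM2l // lef_pV2 ?posrE ?sqrtr_gt0 ?ltr0n // ler_sqrt ?ltr0n // ler_nat ltnS ltnW.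
apply: le_trans (ler_EW prod_le) _.
rewrite EWD EW_const ?card_ord // EW_sum.
have tail : \sum_k EW n (fun c : seq 'I_d => (count_mem k c <= m)%N%:R) <= d%:R * (2 / 3) ^+ m :> R.
  rewrite -[d in d%:R]card_ord mulr_natl -sumr_const; apply: ler_sum => k _.
  apply: le_trans (EW_count_tail _ _ _ d0) _; rewrite -{1}[m]muln1.
  pose x : R := (2 * d)%:R^-1; have x0 : 0 < x by rewrite invr_gt0 ltr0n; lia.
  have x1 : x <= 1 by rewrite invf_le1 ?ltr0n ?ler1n; lia.
  have h : (1 - x) ^+ (4 * d) <= 1 / 3.
    have := @bernoulli_inv x (4 * d); rewrite x1 ltW // => /(_ isT).
    have -> : (4 * d)%:R * x = 2 by rewrite /x !natrM; field; rewrite pnatr_eq0; lia.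
    have : 0 <= (1 - x) ^+ (4 * d) by rewrite exprn_ge0 // subr_ge0.
    by lra.
  have h2 : (1 - x) ^+ n <= (1 / 3) ^+ m.
    apply: (@le_trans _ _ ((1 - x) ^+ (4 * d * m))).
      by rewrite ler_wiXn2l ?subr_ge0 // ?gerBl ?ltW //; case/andP: mn.
    by rewrite exprM lerXn2r ?nnegrE ?exprn_ge0 ?subr_ge0 //; lra.
  rewrite muln1; apply: (@le_trans _ _ (2 ^+ m * (1 / 3) ^+ m)); first by rewrite ler_wpM2l ?exprn_ge0.
  by rewrite -exprMn mulrA mulr1.
have pe : (2 / 3) ^+ m <= ((3 * d)%:R / s) ^+ d :> R.
  rewrite [leRHS]expr_div_n ler_pdivlMr ?exprn_gt0 // mulrC; apply: le_trans (poly_le_exp m d0).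
  rewrite ler_wpM2r ?exprn_ge0 //; first lra.
  have ss : s <= m.+1%:R by rewrite -s2; nra.
  by rewrite lerXn2r // nnegrE ?ler0n // ltW.
have sn : Num.sqrt n%:R <= (4 * d)%:R * s :> R.
  rewrite -(@ler_pXn2r _ 2) ?nnegrE ?sqrtr_ge0 ?mulr_ge0 ?ler0n ?ltW // sqr_sqrtr ?ler0n // exprMn s2.
  rewrite -natrX -natrM ltr_nat; case/andP: mn => _; nia.
have sn0 : 0 < Num.sqrt n%:R :> R by rewrite sqrtr_gt0 ltr0n.
have [s0' sn0'] := (ltW s0, ltW sn0).
have step : ((10 + 3 * d)%:R * (1 + d)%:R / s) ^+ d <= (hk_const%:R / Num.sqrt n%:R) ^+ d :> R.
  rewrite lerXn2r ?nnegrE ?divr_ge0 ?mulr_ge0 ?ler0n //.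
  rewrite ler_pdivrMr // mulrAC ler_pdivlMr // /hk_const natrM -natrM -mulrA.
  by rewrite ler_wpM2l ?ler0n // mulrC.
apply: le_trans step; apply: (@le_trans _ _ ((10 / s) ^+ d + d%:R * ((3 * d)%:R / s) ^+ d)).
  by rewrite lerD2l; apply: le_trans tail _; rewrite ler_wpM2l ?ler0n.
have a0 : 0 <= (10 + 3 * d)%:R / s :> R by rewrite divr_ge0 ?ler0n.
apply: (@le_trans _ _ (((10 + 3 * d)%:R / s) ^+ d * (1 + d)%:R)).
  have l1 : (10 / s) ^+ d <= ((10 + 3 * d)%:R / s) ^+ d.
    by rewrite lerXn2r ?nnegrE ?divr_ge0 ?ler0n // ler_wpM2r ?invr_ge0 // ler_nat leq_addr.
  have l2 : ((3 * d)%:R / s) ^+ d <= ((10 + 3 * d)%:R / s) ^+ d :> R.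
    by rewrite lerXn2r ?nnegrE ?divr_ge0 ?ler0n // ler_wpM2r ?invr_ge0 // ler_nat leq_addl.
  set X := leRHS in l1 l2 *; have h : 0 <= d%:R :> R by exact: ler0n.
  by move: l1 l2 h; rewrite (natrD _ 1 d) /X; move: (_ ^+ d) (_ ^+ d) (_ ^+ d) => a b c; nra.
rewrite [in leRHS]mulrAC [leRHS]exprMn ler_wpM2l ?exprn_ge0 //.
by rewrite -natrX ler_nat -{1}[(1 + d)%N]expn1 leq_pexp2l //.
Qed.

Lemma heat_sup_le n k b : (0 < d)%N -> (forall y, heat n y <= b) -> forall y, heat (n + k) y <= b.
Proof.
move=> d0 h; elim: k => [|k IH] y; first by rewrite addn0.
rewrite addnS heatS mulrC ler_pdivrMr ?ltr0n ?dir_gt0 // mulr_natr -sumr_const.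
by apply: ler_sum => e _; exact: IH.
Qed.

Lemma heat_le_large n y : (0 < d)%N -> (N ^ 2 <= n)%N -> heat n y <= (hk_const%:R / N%:R) ^+ d.
Proof.
move=> d0 /subnKC <-; apply: heat_sup_le => // z.
have := @heat_le (N ^ 2) z d0; rewrite leqnn andbT expn_gt0 (ltn_trans _ N_gt2) // => /(_ isT).
by rewrite natrX sqrtr_sqr ger0_norm ?ler0n.
Qed.

End Torus.

(* [lia] on the numerical hypotheses only. *)
Ltac alia := repeat (match goal with H : ?P |- _ => lazymatch P with
  | is_true (leq _ _) => fail
  | is_true (leq _ _ && leq _ _) => fail
  | @eq nat _ _ => fail
  | _ => clear H end end); lia.

(** * Distances on the cycle and on the torus *)

Section CycleNorm.
Variable N : nat.
Hypothesis N_gt2 : (2 < N)%N.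
Notation Z := 'Z_N.

Definition cyc (a : Z) : nat := minn a (- a)%R.
Arguments cyc a%_R.

Let N_gt1 : (1 < N)%N. Proof. exact: ltnW. Qed.

Lemma val_natZ n : (n < N)%N -> (n%:R : Z) = n :> nat.
Proof. by move=> h; rewrite val_Zp_nat // modn_small. Qed.

Lemma val_ltZ (a : Z) : (a < N)%N.
Proof. by have := ltn_ord a; rewrite [X in (_ < X)%N]Zp_cast. Qed.

Lemma val_oppZ (a : Z) : (0 < a)%N -> (- a)%R = (N - a)%N :> nat.
Proof.
move=> a0; have aN := val_ltZ a.
have e : ((a : nat) + (N - a))%N = N by rewrite subnKC // ltnW.
have : a + (N - a)%:R = 0 :> Z by rewrite -{1}(natr_Zp a) -natrD e char_Zp.
move/eqP; rewrite addrC addr_eq0 => /eqP <-.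
by rewrite val_natZ // -subn_gt0 subKn // ltnW.
Qed.

Lemma cycN a : cyc (- a) = cyc a.
Proof. by rewrite /cyc opprK minnC. Qed.

Lemma cyc0 : cyc 0 = 0%N. Proof. by rewrite /cyc min0n. Qed.

Lemma cyc_nat n : (cyc n%:R <= n)%N.
Proof. by rewrite geq_min val_Zp_nat // leq_mod. Qed.

Lemma cyc_eq n : (2 * n <= N)%N -> cyc n%:R = n.
Proof.
move=> h; have [->|n0] := posnP n; first exact: cyc0.
have nN : (n < N)%N by lia.
by rewrite /cyc val_oppZ ?val_natZ //; lia.
Qed.

Lemma cycP a : a = (cyc a)%:R \/ a = - (cyc a)%:R.
Proof.
rewrite /cyc; case: leqP => h; [left|right]; first by rewrite natr_Zp.
by rewrite natr_Zp opprK.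
Qed.

Lemma cycB_nat i j : (cyc (i%:R - j%:R) <= i + j)%N.
Proof.
have [h|h] := leqP j i; first by rewrite -natrB //; apply: leq_trans (cyc_nat _) _; lia.
rewrite -cycN opprB -natrB; last exact: ltnW.
by apply: leq_trans (cyc_nat _) _; lia.
Qed.

Lemma cycD a b : (cyc (a + b) <= cyc a + cyc b)%N.
Proof.
case: (cycP a) => {1}->; case: (cycP b) => {1}->.
- by rewrite -natrD cyc_nat.
- exact: cycB_nat.
- by rewrite addrC addnC cycB_nat.
- by rewrite -opprD cycN -natrD cyc_nat.
Qed.

Lemma cyc_eq0 a : (cyc a == 0%N) = (a == 0).
Proof.
apply/eqP/eqP => [h|->]; last exact: cyc0.
by case: (cycP a); rewrite h ?oppr0.
Qed.

Lemma cyc_toward (a : Z) : (0 < cyc a)%N ->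
  (cyc (a - 1) <= (cyc a).-1)%N \/ (cyc (a + 1) <= (cyc a).-1)%N.
Proof.
move=> a0; case: (cycP a) => e; [left|right]; rewrite {1}e.
  by rewrite -(prednK a0) -natr1 addrK cyc_nat.
by rewrite -(prednK a0) -natr1 opprD subrK cycN cyc_nat.
Qed.

Lemma cyc1 : (cyc 1 <= 1)%N. Proof. exact: (cyc_nat 1). Qed.

End CycleNorm.
Arguments cyc {N} a%_R.

Section TorusNorm.
Variables (d N : nat).
Hypothesis N_gt2 : (2 < N)%N.
Notation T := 'rV['Z_N]_d.
Notation dir := ('I_d * bool)%type.
Implicit Types (u v x y : T).

Definition nrm v : nat := \max_(i < d) cyc (v 0%R i).
Arguments nrm v%_R.

Lemma nrmP v r : reflect (forall i, cyc (v 0%R i) <= r)%N (nrm v <= r)%N.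
Proof. by apply: (iffP (bigmax_leqP _ _ _)) => h i; [apply: h|move=> _; apply: h]. Qed.

Lemma cyc_nrm v i : (cyc (v 0%R i) <= nrm v)%N.
Proof. exact: (elimT (nrmP v _)). Qed.

Lemma nrmN v : nrm (- v) = nrm v.
Proof. by apply: eq_bigr => i _; rewrite mxE cycN. Qed.

Lemma nrmB u v : nrm (u - v) = nrm (v - u).
Proof. by rewrite -nrmN opprB. Qed.

Lemma nrmD u v : (nrm (u + v) <= nrm u + nrm v)%N.
Proof. by apply/nrmP => i; rewrite mxE; apply: leq_trans (cycD N_gt2 _ _) _; rewrite leq_add ?cyc_nrm. Qed.

Lemma nrm0 : nrm 0 = 0%N.
Proof. by apply/eqP; rewrite -leqn0; apply/nrmP => i; rewrite mxE cyc0. Qed.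

Lemma nrm_triangle x y z : (nrm (x - z) <= nrm (x - y) + nrm (y - z))%N.
Proof. by rewrite -(subrKA y) ; exact: nrmD. Qed.

Lemma nrm_vec (e : dir) : (nrm (vec N e) <= 1)%N.
Proof.
apply/nrmP => i; rewrite /vec; case: e => k [] /=; rewrite !mxE eqxx /=;
by case: (i == k); rewrite ?mulr1 ?mulr0 ?cyc0 ?cycN ?cyc1.
Qed.

Lemma nrm_wsum w : (nrm (wsum N w : T) <= size w)%N.
Proof.
elim: w => [|e w IH]; first by rewrite /wsum big_nil nrm0.
by rewrite wsum_cons; apply: leq_trans (nrmD _ _) _; rewrite /= -add1n leq_add ?nrm_vec.
Qed.

Lemma card_ball (c : T) r : (#|[pred y : T | (nrm (y - c) <= r)%N]| <= (2 * r + 1) ^ d)%N.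
Proof.
pose f (g : {ffun 'I_d -> 'I_(2 * r).+1}) : T := \row_i (c 0 i + (g i)%:R - r%:R).
apply: (@leq_trans #|codom f|).
  apply: subset_leq_card; apply/subsetP => y; rewrite inE; pose z : T := y - c.
  rewrite -/z => /nrmP h; have e i : y 0 i = c 0 i + z 0 i by rewrite /z !mxE [RHS]addrC subrK.
  pose g i : nat := if z 0 i == (cyc (z 0 i))%:R then (r + cyc (z 0%R i))%N else (r - cyc (z 0%R i))%N.
  apply/codomP; exists [ffun i => inord (g i)].
  apply/rowP => i; rewrite mxE ffunE inordK; last by have := h i; rewrite /g; case: ifP; lia.
  rewrite /g; case: eqP => [h1|h1].
    by rewrite natrD -addrA [r%:R + _]addrC addrK -h1 -e.
  case: (cycP (z 0 i)) => // h2.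
  by rewrite natrB ?h // addrA addrAC addrK -h2 -e.
apply: leq_trans (leq_image_card f predT) _.
by rewrite card_ffun !card_ord addn1.
Qed.

Variable R : realType.

Definition pos x (w : seq dir) t : T := x + wsum N (take t w).

Lemma pos0 x w : pos x w 0 = x.
Proof. by rewrite /pos take0 /wsum big_nil addr0. Qed.

Lemma pos_catl x (u v : seq dir) t : (t <= size u)%N -> pos x (u ++ v) t = pos x u t.
Proof. by move=> h; rewrite /pos takel_cat. Qed.

Lemma pos_catr x (u v : seq dir) t : pos x (u ++ v) (size u + t) = pos (pos x u (size u)) v t.
Proof. by rewrite /pos take_size take_cat ltnNge leq_addr /= addKn wsum_cat addrA. Qed.

Lemma pos_size x w : pos x w (size w) = x + wsum N w.
Proof. by rewrite /pos take_size. Qed.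

Lemma heat_in (S : pred T) n b : (forall y, heat R n y <= b) ->
  EW n (fun w => (wsum N w \in S)%:R) <= #|S|%:R * b.
Proof.
move=> h; rewrite (eq_EW (G := fun w => \sum_(y in S) (wsum N w == y)%:R)).
  by rewrite EW_sum mulr_natl -sumr_const; apply: ler_sum => y _; exact: h.
move=> w _; case Sw: (_ \in S); last first.
  by rewrite big1 // => y Sy; case: eqP => // e; rewrite -e Sw in Sy.
by rewrite (bigD1 (wsum N w)) //= eqxx big1 ?addr0 // => y /andP[_]; rewrite eq_sym => /negPf->.
Qed.

(** * Exit probabilities from an exponential supermartingale *)

Section Exit.
Variable b : R.
Hypothesis b_gt1 : 1 < b.
(** [psi] is twice a hyperbolic cosine: on the integers it is an eigenfunction of the walk with
    eigenvalue [h]. Being even and increasing, it survives the folding by [cyc]. *)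
Let h := (b + b^-1) / 2.
Let psi (i : nat) := b ^+ i + b ^- i.

Let b0 : 0 < b. Proof. exact: lt_trans b_gt1. Qed.

Let bV : b * b^-1 = 1. Proof. by rewrite mulfV // gt_eqF. Qed.

Lemma h_ge1 : 1 <= h.
Proof. have c0 : 0 <= b^-1 by rewrite invr_ge0 ltW.
have e : (b - 1) ^+ 2 * b^-1 = b - 2 + b^-1 by field; rewrite gt_eqF.
have := mulr_ge0 (sqr_ge0 (b - 1)) c0; rewrite e /h; lra. Qed.

Lemma psi_mono i j : (i <= j)%N -> psi i <= psi j.
Proof.
elim: j => [|j IH]; first by rewrite leqn0 => /eqP->.
rewrite leq_eqVlt => /orP[/eqP->//|/IH]; move/le_trans; apply.
rewrite /psi !exprS invfM.
have p1 : 1 <= b ^+ j by apply: exprn_ege1; exact: ltW.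
have p0 : 0 < b ^+ j by apply: exprn_gt0.
have pV : b ^+ j * b ^- j = 1 by rewrite mulfV // gt_eqF.
move: p1 p0 pV bV; move: (b ^+ j) (b ^- j) (b^-1) => p q c p1 p0 pq bc.
have q0 : 0 < q by nra.
have c0 : 0 < c by have := b0; nra.
have q1 : q <= p by nra.
have c1 : c < 1 by have := b_gt1; nra.
have : (b - 1) * p - (1 - c) * q >= 0; last by nra.
have e : 1 - c = (b - 1) * c by nra.
have := b_gt1 => b1; rewrite e -mulrA -mulrBr mulr_ge0; nra.
Qed.

(** Away from 0 one neighbour is at least one closer to 0 and the other at most one farther, so
    monotonicity of [psi] also covers the antipode. At 0 both neighbours have norm at most 1 and
    [psi 0 = 2]. *)
Lemma psi_step (a : 'Z_N) : psi (cyc (a - 1)) + psi (cyc (a + 1)) <= 2 * h * psi (cyc a).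
Proof.
have up (s : 'Z_N) : (cyc s <= 1)%N -> (cyc (a + s)%R <= (cyc a).+1)%N.
  by move=> s1; apply: leq_trans (cycD N_gt2 _ _) _; lia.
have u1 := up 1 (cyc1 N_gt2); have u2 := up (-1); rewrite cycN cyc1 // in u2.
have hE : 2 * h = b + b^-1 by rewrite /h; lra.
have [a0|a0] := posnP (cyc a).
  apply: (le_trans (lerD (psi_mono (u2 isT)) (psi_mono u1))); rewrite a0 hE /psi !expr1 !expr0 invr1; lra.
have e : psi (cyc a).-1 + psi (cyc a).+1 = 2 * h * psi (cyc a).
  rewrite hE /psi; case: (cyc a) a0 => // k _ /=; rewrite !exprS !invfM.
  move: (b ^+ k) (b ^- k) bV; move: (b^-1) => c p q bc.
  have -> : (b + c) * (b * p + c * q) = b * (b * p) + (b * c) * p + (b * c) * q + c * (c * q) by ring.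
  by rewrite bc; ring.
rewrite -e; case: (cyc_toward N_gt2 a0) => h1.
  by apply: lerD; exact: psi_mono.
by rewrite addrC; apply: lerD; [exact: psi_mono|apply: psi_mono; apply: u2].
Qed.

(** Induction on the first letter. Once the level is reached the right side is at least 1; before
    that, a step in coordinate [k] costs [h] by [psi_step], and any other step leaves [psi] fixed,
    which is allowed since [h >= 1]. *)
Lemma exit_coord (k : 'I_d) (v : T) n r :
  EW n (fun w => [exists t : 'I_n.+1, (r <= cyc (pos v w t 0%R k))%N]%:R) <=
  h ^+ n * (psi (cyc (v 0 k)) / psi r).
Proof.
have psi_gt0 i : 0 < psi i by rewrite /psi addr_gt0 ?invr_gt0 ?exprn_gt0.
have h1 n' : 1 <= h ^+ n' by apply: exprn_ege1; exact: h_ge1.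
have d0 : (0 < #|{: dir}|)%N by rewrite card_prod card_ord card_bool muln_gt0 andbT; case: (d) k => // -[].
have triv n' v' : (r <= cyc (v' 0%R k))%N ->
    EW n' (fun w => [exists t : 'I_n'.+1, (r <= cyc (pos v' w t 0%R k))%N]%:R) <=
    h ^+ n' * (psi (cyc (v' 0 k)) / psi r).
  move=> rv; apply: (@le_trans _ _ 1); first by apply: EW_le_const => // w _; rewrite lern1 leq_b1.
  rewrite -[leLHS]mulr1 ler_pM // ler_pdivlMr ?psi_gt0 // mul1r.
  exact: psi_mono.
elim: n v => [|n IH] v.
  have [rv|rv] := leqP r (cyc (v 0 k)); first exact: triv.
  rewrite /=; case: existsP => [[t]|_]; first by rewrite /pos /= /wsum big_nil addr0 leqNgt rv.
  by rewrite mulr_ge0 ?divr_ge0 // ltW // ?exprn_gt0 ?psi_gt0.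
have [rv|rv] := leqP r (cyc (v 0 k)); first exact: triv.
rewrite /= mulrC ler_pdivrMr ?ltr0n //.
have step e : EW n (fun w => [exists t : 'I_n.+2, (r <= cyc (pos v (e :: w) t 0%R k))%N]%:R) <=
    h ^+ n * (psi (cyc ((v + vec N e) 0 k)) / psi r).
  apply: le_trans (IH (v + vec N e)); apply: ler_EW => w _; rewrite ler_nat.
  case: existsP => // -[t ht]; suff -> : [exists t : 'I_n.+1, (r <= cyc (pos (v + vec N e) w t 0%R k))%N] by [].
  case: t ht => -[|t] lt /= ht; first by move: ht; rewrite pos0 leqNgt rv.
  apply/existsP; exists (Ordinal (lt : (t < n.+1)%N)) => /=.
  by move: ht; rewrite /pos /= wsum_cons addrA.
apply: le_trans (ler_sum _ (fun e _ => step e)) _.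
rewrite -mulr_sumr -mulr_suml exprS; apply: (@le_trans _ _ (h ^+ n * (h * psi (cyc (v 0 k)) * #|{: dir}|%:R / psi r))); last first.
  by rewrite le_eqVlt; apply/orP; left; apply/eqP; ring.
rewrite ler_wpM2l ?(le_trans ler01 (h1 n)) // ler_wpM2r ?invr_ge0 ?(ltW (psi_gt0 _)) //.
rewrite (eq_bigr (fun e => psi (cyc ((v + vec N (e.1, e.2)) 0 k)))); last by case.
rewrite -(pair_bigA _ (fun j s => psi (cyc ((v + vec N (j, s)) 0 k)))) /=.
have -> : h * psi (cyc (v 0 k)) * #|{: dir}|%:R = \sum_(j < d) (2 * h * psi (cyc (v 0 k))).
  by rewrite sumr_const card_ord -[RHS]mulr_natr card_prod card_ord card_bool natrM; ring.
apply: ler_sum => j _; rewrite big_bool /= !mxE eqxx /=.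
have [jk|_] := eqVneq k j; first by rewrite mulr1n mulr1 mulr1 addrC; exact: psi_step.
rewrite !mulr0 !addr0; have := h_ge1; have := psi_gt0 (cyc (v 0 k)); nra.
Qed.

Lemma exit_prob n r : (0 < r)%N ->
  EW n (fun w => [exists t : 'I_n.+1, (r <= nrm (pos 0 w t))%N]%:R) <=
  d%:R * (2 * h ^+ n / b ^+ r).
Proof.
move=> r0.
rewrite -[d in d%:R]card_ord mulr_natl -sumr_const.
apply: (@le_trans _ _ (\sum_k EW n (fun w => [exists t : 'I_n.+1, (r <= cyc (pos 0 w t 0%R k))%N]%:R))).
  rewrite -EW_sum; apply: ler_EW => w _.
  case: existsP => [[t ht]|_]; last by apply: sumr_ge0 => k _; rewrite ler0n.
  have [k hk] : exists k, (r <= cyc (pos 0 w t 0%R k))%N.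
    apply/existsP; apply: contraTT ht; rewrite negb_exists -ltnNge => /forallP h'.
    rewrite -(prednK r0) ltnS; apply/nrmP => i; have := h' i; rewrite -ltnNge; lia.
  rewrite (bigD1 k) //=; have -> : [exists t : 'I_n.+1, (r <= cyc (pos 0 w t 0%R k))%N].
    by apply/existsP; exists t.
  by rewrite lerDl; apply: sumr_ge0 => i _; rewrite ler0n.
apply: ler_sum => k _; apply: le_trans (exit_coord _ _ _ _) _.
rewrite mxE cyc0 {1}/psi expr0 invr1 [2 * _]mulrC -mulrA.
have hn : 0 <= h ^+ n by rewrite exprn_ge0 // (le_trans ler01 h_ge1).
rewrite ler_wpM2l // (_ : 1 + 1 = 2) // ler_wpM2l ?ler0n // lef_pV2 ?posrE ?exprn_gt0 //; last first.
  by rewrite /psi addr_gt0 ?invr_gt0 ?exprn_gt0.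
by rewrite /psi lerDl invr_ge0 ltW ?exprn_gt0.
Qed.

End Exit.
End TorusNorm.
Arguments nrm {d N} v%_R.
Arguments wsum {d} N w.
Arguments pos {d N} x%_R w t.

(** * Failure of a superblock *)

Lemma zmod_move3 (V : zmodType) (x a b v w : V) : x + (a + b) + v + w = x + a + v + w + b.
Proof. by rewrite addrA (addrAC _ b v) (addrAC _ b w). Qed.

Lemma zmod_move2 (V : zmodType) (x a b w : V) : x + (a + b) + w = x + a + w + b.
Proof. by rewrite addrA (addrAC _ b w). Qed.

(** * The frame, and arms leading to it *)

Section Frame.
Variables (d' N l s : nat).
Notation d := d'.+1.
Hypothesis N_gt2 : (2 < N)%N.
Hypothesis l_gt0 : (0 < l)%N.
Notation T := 'rV['Z_N]_d.
Notation dir := ('I_d * bool)%type.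
Implicit Types (x y v : T) (c : 'I_d) (sg : bool).

Let N_gt1 : (1 < N)%N. Proof. exact: ltnW. Qed.

Definition grid (a : 'Z_N) : bool := (l %| a)%N.

Definition frame x : bool := (2 < #|[pred i | grid (x 0%R i)]|)%N.

Definition unit_vec c : T := locked (vec N (c, true)).

Lemma unit_vecE c i : unit_vec c 0 i = (i == c)%:R.
Proof. by rewrite /unit_vec -lock /vec /= !mxE eqxx mul1r. Qed.

Lemma vecE c sg : vec N (c, sg) = (if sg then 1 else -1) *: unit_vec c.
Proof. by rewrite /unit_vec -lock /vec /= scale1r. Qed.

Definition short_offset v : bool :=
  (nrm v <= s + l)%N && (#|[pred i | v 0%R i != 0%R]| <= 3)%N.

(** Searching [l] values suffices even if [l] does not divide [N]: the representative 0 is a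
    multiple of [l], so wrapping around only shortens the last gap. *)
Definition next_grid (m : nat) sg (a : 'Z_N) : nat :=
  m + find (fun h => grid (a + (if sg then (m + h)%:R else - (m + h)%:R))) (iota 0 l).

(** Direction 0 is reserved for the straight segments, so the last two legs of an arm use directions
    other than 0 and [c]. *)
Definition other2 c : 'I_d := inord (if c == 1%N :> nat then 2 else 1).
Definition other3 c : 'I_d := inord (if (c == 1%N :> nat) || (c == 2%N :> nat) then 3 else 2).

(* The [j]-th site of a path from [x] that leaves in direction [c] for at least
   [s] steps, never moves in coordinate 0 (when [c != 0]), and makes three
   coordinates multiples of [l]. *)
Definition arm x c sg (j : nat) : T :=
  let h1 := next_grid s sg (x 0 c) in
  let h2 := next_grid 0 true (x 0 (other2 c)) in
  let h3 := next_grid 0 true (x 0 (other3 c)) in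
  locked (x + (if sg then 1 else -1) *: ((minn j h1)%:R *: unit_vec c)
    + (minn (j - h1) h2)%:R *: unit_vec (other2 c)
    + (minn (j - h1 - h2) h3)%:R *: unit_vec (other3 c)).

Definition arm_len x c sg : nat :=
  next_grid s sg (x 0 c) + next_grid 0 true (x 0 (other2 c)) + next_grid 0 true (x 0 (other3 c)).

Lemma next_gridP m sg a : [/\ (m <= next_grid m sg a)%N, (next_grid m sg a < m + l)%N &
  grid (a + (if sg then (next_grid m sg a)%:R else - (next_grid m sg a)%:R))].
Proof.
pose p h := grid (a + (if sg then (m + h)%:R else - (m + h)%:R)).
have hp : has p (iota 0 l).
  pose b : 'Z_N := a + (if sg then m%:R else - m%:R).
  have bE h : a + (if sg then (m + h)%:R else - (m + h)%:R) = b + (if sg then h%:R else - h%:R).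
    by rewrite /b; case: (sg); rewrite natrD ?opprD addrA.
  apply/hasP; case: sg @p @b bE => p b bE.
    pose r := (b %% l)%N; have rl : (r < l)%N by rewrite ltn_mod.
    have [r0|r0] := posnP r.
      by exists 0%N; [rewrite mem_iota|rewrite /p bE addr0 /grid /dvdn -/r r0].
    have [w|w] := ltnP (b + (l - r)) N.
      exists (l - r)%N; first by rewrite mem_iota; lia.
      rewrite /p bE /grid -[b in b + _]natr_Zp -natrD val_natZ //.
      rewrite [X in (l %| X + _)%N](divn_eq b l) -/r -addnA subnKC; last exact: ltnW.
      by rewrite dvdn_addr ?dvdn_mull.
    have bN := val_ltZ N_gt2 b.
    exists (N - b)%N; first by rewrite mem_iota; lia.
    rewrite /p bE natrB; last exact: ltnW.
    by rewrite char_Zp // sub0r natr_Zp subrr /grid dvdn0.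
  exists (b %% l)%N; first by rewrite mem_iota ltn_mod.
  rewrite /p bE -[b in b - _]natr_Zp -natrB ?leq_mod // /grid val_natZ //; last first.
    by apply: leq_ltn_trans (leq_subr _ _) (val_ltZ N_gt2 b).
  by rewrite [X in (l %| X - _)%N](divn_eq b l) addnK dvdn_mull.
have := hp; rewrite has_find size_iota => hl; split; first exact: leq_addr.
  by rewrite ltn_add2l.
by have := nth_find 0%N hp; rewrite nth_iota // add0n.
Qed.

Lemma other_neq c : (3 < d)%N -> [/\ other2 c != c, other3 c != c, other2 c != other3 c,
   other2 c != ord0 & other3 c != ord0].
Proof.
move=> d3; have i1 : (1 < d)%N by lia. have i2 : (2 < d)%N by lia.
have e i : (i < d)%N -> (inord i : 'I_d) = i :> nat by move=> h; rewrite inordK.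
rewrite -!val_eqE /= /other2 /other3; case: c => c hc /=.
have [c1|c1] := eqVneq c 1%N; first by rewrite /= !e //; split; lia.
by have [c2|c2] := eqVneq c 2%N; rewrite /= !e //; split; lia.
Qed.

Lemma arm_first x c sg : (0 < s)%N -> arm x c sg 1 = x + vec N (c, sg).
Proof.
move=> s0; have [h _ _] := next_gridP s sg (x 0 c).
rewrite /arm -lock vecE; set h1 := next_grid s sg _ in h *.
have [-> ->] : (minn 1 h1 = 1 /\ 1 - h1 = 0)%N by lia.
by rewrite !sub0n !min0n !scale0r !addr0 scale1r.
Qed.

Section Arm.
Hypothesis d3 : (3 < d)%N.

Lemma arm_step x c sg j : (j < arm_len x c sg)%N ->
  exists e : dir, arm x c sg j.+1 = arm x c sg j + vec N e.
Proof.
rewrite /arm_len /arm -!lock => jl.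
set h1 := next_grid s sg _ in jl *; set h2 := next_grid 0 true _ in jl *; set h3 := next_grid 0 true _ in jl *.
have [j1|j1] := ltnP j h1.
  exists (c, sg); rewrite vecE.
  have [e1 [e2 e3]] : (minn j.+1 h1 = j.+1 /\ minn j h1 = j /\ j.+1 - h1 = j - h1)%N by lia.
  rewrite e1 e3 -natr1 scalerDl scale1r scalerDr.
  exact: zmod_move3.
have [j2|j2] := ltnP j (h1 + h2).
  exists (other2 c, true); rewrite vecE scale1r.
  have [-> [-> ->]] : (minn j.+1 h1 = h1 /\ minn (j.+1 - h1) h2 = (minn (j - h1) h2).+1 /\ j.+1 - h1 - h2 = j - h1 - h2)%N by lia.
  rewrite -natr1 scalerDl scale1r.
  exact: zmod_move2.
exists (other3 c, true); rewrite vecE scale1r.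
have [-> [-> ->]] : (minn j.+1 h1 = h1 /\ minn (j.+1 - h1) h2 = minn (j - h1) h2 /\ minn (j.+1 - h1 - h2) h3 = (minn (j - h1 - h2) h3).+1)%N by lia.
by rewrite -natr1 scalerDl scale1r; exact: addrA.
Qed.

Lemma arm_coord x c sg j i : arm x c sg j 0 i =
  if i == c then x 0 i + (if sg then 1 else -1) * (minn j (next_grid s sg (x 0 c)))%:R
  else if i == other2 c then x 0 i + (minn (j - next_grid s sg (x 0 c)) (next_grid 0 true (x 0 (other2 c))))%:R
  else if i == other3 c then x 0 i + (minn (j - next_grid s sg (x 0 c) - next_grid 0 true (x 0 (other2 c))) (next_grid 0 true (x 0 (other3 c))))%:R
  else x 0 i.
Proof.
have [n2 n3 n23 _ _] := other_neq c d3.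
rewrite /arm -lock; move: (next_grid s sg _) (next_grid 0 _ _) (next_grid 0 _ _) => h1 h2 h3.
rewrite !mxE !unit_vecE; have [->|ic] := eqVneq i c.
  by rewrite eq_sym (negPf n2) eq_sym (negPf n3) !mulr0 !addr0 mulr1.
rewrite !mulr0 addr0; have [->|i2] := eqVneq i (other2 c).
  by rewrite (negPf n23) mulr1 mulr0 addr0.
by rewrite mulr0 addr0; have [->|i3] := eqVneq i (other3 c); rewrite ?mulr1 ?mulr0 ?addr0.
Qed.

Lemma arm_frame x c sg : frame (arm x c sg (arm_len x c sg)).
Proof.
have [n2 n3 n23 _ _] := other_neq c d3.
have [_ _ g1] := next_gridP s sg (x 0 c).
have [_ _ g2] := next_gridP 0 true (x 0 (other2 c)).
have [_ _ g3] := next_gridP 0 true (x 0 (other3 c)).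
apply: (@leq_trans #|[set c; other2 c; other3 c]|).
  by rewrite -setUA !cardsU1 cards1 !inE negb_or (eq_sym c) n2 (eq_sym c) n3 n23.
apply: subset_leq_card; apply/subsetP => i; rewrite !inE -orbA arm_coord.
set h1 := next_grid s sg _ in g1 *; set h2 := next_grid 0 true _ in g2 *; set h3 := next_grid 0 true _ in g3 *.
have -> : minn (arm_len x c sg) h1 = h1 by rewrite /arm_len -/h1 -/h2 -/h3; lia.
have -> : minn (arm_len x c sg - h1) h2 = h2 by rewrite /arm_len -/h1 -/h2 -/h3; lia.
have -> : minn (arm_len x c sg - h1 - h2) h3 = h3 by rewrite /arm_len -/h1 -/h2 -/h3; lia.
have [->|ic] := eqVneq i c; first by move: g1; case: (sg); rewrite ?mul1r ?mulN1r.
have [->|i2] := eqVneq i (other2 c); first by [].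
by move=> /= /eqP i3; rewrite i3 eqxx.
Qed.

Lemma arm_offset x c sg j : short_offset (arm x c sg j - x).
Proof.
have [_ h1 _] := next_gridP s sg (x 0 c).
have [_ h2 _] := next_gridP 0 true (x 0 (other2 c)).
have [_ h3 _] := next_gridP 0 true (x 0 (other3 c)).
apply/andP; split.
  apply/nrmP => i; rewrite !mxE arm_coord.
  have [->|ic] := eqVneq i c.
    rewrite addrC addKr; case: (sg) h1 => h1; rewrite ?mul1r ?mulN1r ?cycN; apply: leq_trans (cyc_nat N_gt2 _) _; exact: leq_trans (geq_minr _ _) (ltnW h1).
  have [->|i2] := eqVneq i (other2 c); first by rewrite addrC addKr; apply: leq_trans (cyc_nat N_gt2 _) _; apply: leq_trans (geq_minr _ _) _; move: h2; clear; lia.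
  have [->|i3] := eqVneq i (other3 c); first by rewrite addrC addKr; apply: leq_trans (cyc_nat N_gt2 _) _; apply: leq_trans (geq_minr _ _) _; move: h3; clear; lia.
  by rewrite subrr cyc0.
apply: (@leq_trans #|[set c; other2 c; other3 c]|); last first.
  by rewrite -setUA !cardsU1 cards1; case: (_ \notin _); case: (_ \notin _).
apply: subset_leq_card; apply/subsetP => i; rewrite !inE !mxE arm_coord.
case: (eqVneq i c) => //= ic; case: (eqVneq i (other2 c)) => //= i2; case: (eqVneq i (other3 c)) => //= i3.
by rewrite subrr eqxx.
Qed.

Definition l1norm v : nat := \sum_(i < d) cyc (v 0%R i).

Lemma l1normD u v : (l1norm (u + v) <= l1norm u + l1norm v)%N.
Proof.
by rewrite /l1norm -big_split /=; apply: leq_sum => i _; rewrite mxE cycD.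
Qed.

Lemma l1norm_vec (e : dir) : (l1norm (vec N e) <= 1)%N.
Proof.
rewrite /l1norm (bigD1 e.1) //= big1 ?addn0 => [|i ie].
  exact: leq_trans (cyc_nrm _ _) (nrm_vec N_gt2 e).
by case: e ie => c sg /= ic; rewrite vecE !mxE unit_vecE (negPf ic) mulr0 cyc0.
Qed.

Lemma l1norm_wsum w : (l1norm (wsum N w) <= size w)%N.
Proof.
elim: w => [|e w IH]; first by rewrite /wsum big_nil /l1norm big1 // => i _; rewrite mxE cyc0.
by rewrite wsum_cons; apply: leq_trans (l1normD _ _) _; rewrite /= -[X in (_ <= X)%N]add1n leq_add ?l1norm_vec.
Qed.

(** An arm in direction [c != 0] never moves in coordinate 0, which contributes [s]; its three legs
    are monotone in distinct coordinates, without wrapping as [2 (s + l) <= N], and contribute [j].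
    Since a step changes the l1 norm by at most 1, the walk needs [s + j] steps between an end of
    the segment and site [j] of the arm. *)
Lemma arm_l1 x c sg j (a : 'Z_N) : c != ord0 -> (2 * (s + l) <= N)%N -> (j <= arm_len x c sg)%N ->
  cyc a = s -> (s + j <= l1norm (arm x c sg j - (x + a *: unit_vec ord0)))%N.
Proof.
move=> c0 sN + sa; have [n2 n3 n23 n20 n30] := other_neq c d3.
have [_ h1 _] := next_gridP s sg (x 0 c).
have [_ h2 _] := next_gridP 0 true (x 0 (other2 c)).
have [_ h3 _] := next_gridP 0 true (x 0 (other3 c)).
rewrite /arm_len => jl; rewrite /l1norm.
have sum4 (f : 'I_d -> nat) : (f ord0 + f c + f (other2 c) + f (other3 c) <= \sum_i f i)%N.
  pose r := [:: ord0; c; other2 c; other3 c].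
  have ur : uniq r.
    by rewrite /r /= !inE !negb_or eq_sym c0 eq_sym n20 eq_sym n30 eq_sym n2 eq_sym n3 n23.
  apply: (@leq_trans (\sum_(i <- r) f i)); first by rewrite !big_cons big_nil addn0 !addnA.
  by rewrite big_uniq // [leqRHS](bigID [in r]) /= leq_addr.
apply: leq_trans (sum4 _).
have E i : (arm x c sg j - (x + a *: unit_vec ord0)) 0 i = arm x c sg j 0 i - x 0 i - a * (i == ord0)%:R.
  by rewrite !mxE unit_vecE opprD addrA.
rewrite !E !arm_coord !eqxx (negPf n2) (negPf n3) (negPf n20) (negPf n30) (negPf c0) ?[_ == other3 c]eq_sym.
rewrite (eq_sym ord0 c) (negPf c0) (eq_sym ord0 (other2 c)) (negPf n20) (negPf n30) (eq_sym (other3 c) (other2 c)) (negPf n23).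
move: h1 h2 h3 jl.
set a1 := next_grid s sg _; set a2 := next_grid 0 true _; set a3 := next_grid 0 true _ => h1 h2 h3 jl.
have ee (z w : 'Z_N) : z + w - z = w by rewrite addrC addKr.
rewrite !ee !mulr1 !mulr0 !subr0 subrr sub0r cycN sa.
have -> : cyc ((if sg then 1 else -1) * (minn j a1)%:R : 'Z_N) = minn j a1.
  by case: (sg); rewrite ?mul1r ?mulN1r ?cycN cyc_eq //; lia.
by rewrite !cyc_eq //; lia.
Qed.

End Arm.

Lemma card_le_sum (I J : finType) (P : pred J) (Q : I -> pred J) (k m : nat) :
  (forall j, P j -> exists i, Q i j) -> (forall i, #|Q i| <= m)%N -> (#|I| <= k)%N ->
  (#|P| <= k * m)%N.
Proof.
move=> PQ Qm Ik; apply: (@leq_trans (\sum_(i : I) #|Q i|)%N).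
  rewrite -sum1_card; under [leqRHS]eq_bigr do rewrite -sum1_card.
  rewrite (exchange_big_dep predT) //= [leqRHS](bigID P) /=.
  apply: leq_trans (leq_addr _ _); apply: leq_sum => j Pj.
  by have [i Qij] := PQ j Pj; rewrite (bigD1 i).
apply: (@leq_trans (\sum_(i : I) m)%N); first exact: leq_sum.
by rewrite sum_nat_const leq_mul2r Ik orbT.
Qed.

Lemma card_prod_coord (F : 'I_d -> pred 'Z_N) :
  (#|[pred x : T | [forall i, F i (x 0%R i)]]| <= \prod_i #|F i|)%N.
Proof.
rewrite (_ : \prod_i #|F i| = #|family F|)%N; last by rewrite card_family foldrE big_image.
pose f x : {ffun 'I_d -> 'Z_N} := [ffun i => x 0 i].
have fI : injective f by move=> x y /ffunP e; apply/rowP => i; have := e i; rewrite !ffunE.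
rewrite -(card_image fI); apply: subset_leq_card; apply/subsetP => y /imageP[x].
rewrite inE => /forallP h ->; apply/familyP => i; rewrite ffunE; exact: h.
Qed.

Lemma card_cyc_ball (a : 'Z_N) r : (#|[pred b : 'Z_N | (cyc (b - a) <= r)%N]| <= 2 * r + 1)%N.
Proof.
pose f (j : 'I_(2 * r).+1) : 'Z_N := a - r%:R + j%:R.
apply: (@leq_trans #|codom f|); last by apply: leq_trans (leq_image_card f predT) _; rewrite card_ord addn1.
apply: subset_leq_card; apply/subsetP => b; rewrite inE => h.
have e : b = a + (b - a) by rewrite addrC subrK.
apply/codomP; case: (cycP (b - a)) => e2.
  have lt : (r + cyc (b - a)%R < (2 * r).+1)%N by lia.
  by exists (Ordinal lt); rewrite /f /= natrD addrA subrK -e2.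
have lt : (r - cyc (b - a)%R < (2 * r).+1)%N by lia.
by exists (Ordinal lt); rewrite /f /= natrB // addrA subrK -e2.
Qed.

(** The leading 2 accounts for intervals that wrap around: on either side of the wrap multiples of
    [l] are [l] apart, so the side and the quotient by [l] determine the point. *)
Lemma card_grid (a : 'Z_N) r : (2 * r < N)%N ->
  (#|[pred b : 'Z_N | grid b && (cyc (b - a) <= r)%N]| <= 2 * (2 * r %/ l + 1))%N.
Proof.
move=> rN; pose A : 'Z_N := a - r%:R.
pose j (b : 'Z_N) : nat := (b - A)%R.
have jr b : (cyc (b - a) <= r)%N -> (j b <= 2 * r)%N.
  move=> h; rewrite /j /A opprB addrA addrAC.
  have e2 := cycP (b - a).
  case: e2 => ->; first by rewrite -natrD val_natZ; lia.
  by rewrite addrC -natrB // val_natZ; lia.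
have bE (b : 'Z_N) : (b : nat) = ((A + j b) %% N)%N.
  have e : b = A + (b - A) by rewrite addrC subrK.
  by rewrite {1}e -{1}(natr_Zp A) -{1}(natr_Zp (b - A)) -natrD val_Zp_nat.
pose f (b : 'Z_N) : bool * 'I_(2 * r %/ l).+1 := ((N <= A + j b)%N, inord (j b %/ l)).
rewrite (_ : (2 * _)%N = #|{: bool * 'I_(2 * r %/ l).+1}|); last by rewrite card_prod card_bool card_ord addn1.
have inj : {in [pred b : 'Z_N | grid b && (cyc (b - a) <= r)%N] &, injective f}.
  move=> b b'; rewrite !inE => /andP[gb /jr hb] /andP[gb' /jr hb'] [e1 e2].
  have e3 : (j b %/ l = j b' %/ l)%N.
    move/(congr1 (@nat_of_ord _)): e2; rewrite !inordK // ltnS leq_div2r //.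
  have jlt z : (j z < N)%N by exact: val_ltZ.
  have key (z : 'Z_N) : (z : nat) = (A + j z - (N <= A + j z) * N)%N.
    rewrite {1}(bE z); case: leqP => h; last by rewrite mul0n subn0 modn_small.
    rewrite mul1n -{1}(subnK h) modnDr modn_small //.
    by have := val_ltZ N_gt2 A; have := jlt z; lia.
  move: gb gb'; rewrite /grid => gb gb'; apply: val_inj => /=.
  have d1 := divn_eq (j b) l; have d2 := divn_eq (j b') l; rewrite -e3 in d2.
  have m1 := ltn_pmod (j b) l_gt0; have m2 := ltn_pmod (j b') l_gt0.
  have close : (b < b' + l)%N /\ (b' < b + l)%N.
    move: (key b) (key b') e1 d1 d2 m1 m2 => k1 k2 e1; rewrite {}k1 {}k2.
    move: e1; move: (N <= A + j b)%N (N <= A + j b')%N => w w' <-.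
    move: (j b) (j b') (nat_of_ord A) (_ %/ _)%N (_ %% _)%N (_ %% _)%N => x y z q r1 r2.
    by clear; case: w; lia.
  case/dvdnP: gb => u eu; case/dvdnP: gb' => v ev; rewrite eu ev in close *.
  move: close; rewrite -!mulSnr !ltn_pmul2r // => -[c1 c2].
  by congr (_ * _)%N; move: c1 c2; clear; lia.
rewrite -(card_in_image inj); exact: max_card.
Qed.

Lemma prod_if_mem (S : {set 'I_d}) (a b : nat) :
  (\prod_(i < d) (if i \in S then a else b) = a ^ #|S| * b ^ (d - #|S|))%N.
Proof.
rewrite (bigID [in S]) /=; congr (_ * _)%N.
  by rewrite -prod_nat_const; apply: eq_bigr => i ->.
have -> : (d - #|S| = #|[predC S]|)%N by rewrite -[d in (d - _)%N]card_ord -(cardC [in S]) addKn.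
by rewrite -prod_nat_const; apply: eq_big => i; rewrite ?inE // => /negPf->.
Qed.

(** Choose which three coordinates are multiples of [l]. The gain of order [l^-3] over the full ball
    is what beats the [L^2] steps of a superblock, as [l^3 = g^9] and [L^2 = g^8]. *)
Lemma card_frame y r : (2 < d)%N -> (2 * r < N)%N ->
  (#|[pred x : T | frame x && (nrm (x - y)%R <= r)%N]| <=
    2 ^ d * ((2 * (2 * r %/ l + 1)) ^ 3 * (2 * r + 1) ^ (d - 3)))%N.
Proof.
move=> d2 rN; pose F (S : {set 'I_d}) (i : 'I_d) : pred 'Z_N :=
  if i \in S then [pred b | grid b && (cyc (b - y 0%R i) <= r)%N] else [pred b | (cyc (b - y 0%R i) <= r)%N].
pose Q (S : {set 'I_d}) : pred T := if #|S| == 3%N then [pred x : T | [forall i, F S i (x 0%R i)]] else pred0.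
apply: (@card_le_sum _ _ _ Q).
- move=> x /andP[fx /nrmP bx].
  pose P := [pred i | grid (x 0 i)]; exists [set i in take 3 (enum P)].
  have sP : size (take 3 (enum P)) = 3%N.
    by rewrite size_takel // -cardE; exact: fx.
  have uP : uniq (take 3 (enum P)) by rewrite take_uniq ?enum_uniq.
  rewrite /Q cardsE (card_uniqP uP) sP eqxx; apply/forallP => i; rewrite /F inE.
  have bi := bx i; rewrite !mxE in bi.
  case: ifP => //= /mem_take; rewrite mem_enum inE => ->.
  exact: bi.
- move=> S; rewrite /Q; case: eqP => [S3|_]; last by rewrite card0.
  apply: leq_trans (card_prod_coord _) _; rewrite -S3 -prod_if_mem; apply: leq_prod => i _.
  by rewrite /F; case: ifP => _; [exact: card_grid|exact: card_cyc_ball].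
- by have := card_powerset [set: 'I_d]; rewrite cardsT card_ord powersetT cardsT => ->.
Qed.

Lemma card_short_offset : (#|short_offset| <= 2 ^ d * (2 * (s + l) + 1) ^ 3)%N.
Proof.
pose F (S : {set 'I_d}) (i : 'I_d) : pred 'Z_N :=
  if i \in S then [pred b | (cyc (b - 0)%R <= s + l)%N] else pred1 0.
pose Q (S : {set 'I_d}) : pred T := if (#|S| <= 3)%N then [pred x : T | [forall i, F S i (x 0%R i)]] else pred0.
apply: (@card_le_sum _ _ _ Q).
- move=> v /andP[/nrmP bv sv]; exists [set i | v 0 i != 0].
  rewrite /Q cardsE sv; apply/forallP => i; rewrite /F inE.
  by case: ifP => [_|/negbT]; rewrite ?negbK //= subr0; exact: bv.
- move=> S; rewrite /Q; case: ifP => [S3|_]; last by rewrite card0.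
  apply: leq_trans (card_prod_coord _) _.
  apply: (@leq_trans (\prod_(i < d) (if i \in S then 2 * (s + l) + 1 else 1))%N).
    apply: leq_prod => i _; rewrite /F; case: ifP => _; first exact: card_cyc_ball.
    by rewrite card1.
  by rewrite prod_if_mem exp1n muln1 leq_pexp2l // addn1.
- by have := card_powerset [set: 'I_d]; rewrite cardsT card_ord powersetT cardsT => ->.
Qed.

End Frame.

Section Steps.
Variables (d' N : nat).
Notation d := d'.+1.
Notation T := 'rV['Z_N]_d.
Hypothesis N_gt2 : (2 < N)%N.

Lemma cyc_vec (e : 'I_d * bool) i : cyc ((vec N e : T) 0 i) = (i == e.1) :> nat.
Proof.
case: e => k a; rewrite vecE !mxE unit_vecE /=.
have c1 : cyc (1 : 'Z_N) = 1%N by apply: (cyc_eq N_gt2 (n := 1)); move: N_gt2; clear; lia.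
case: eqVneq => _; last by rewrite mulr0 cyc0.
by rewrite mulr1; case: a; rewrite ?cycN.
Qed.

Lemma vec_inj : injective (vec N : 'I_d * bool -> T).
Proof.
move=> [k a] [k' a'] e; have kk : k = k'.
  by apply/eqP; have := cyc_vec (k', a') k; rewrite -e cyc_vec //= eqxx; case: eqP.
subst k'; congr pair; move/rowP/(_ k): e; rewrite !vecE !mxE !unit_vecE eqxx !mulr1.
have n1 : (1 : 'Z_N) != -1.
  rewrite -addr_eq0 -[1 + 1]/(2%:R); apply/eqP => h.
  by have := val_natZ N_gt2 (n := 2) N_gt2; rewrite h.
by case: a; case: a' => // /eqP; rewrite ?(negPf n1) // eq_sym (negPf n1).
Qed.

End Steps.

Lemma zmod_move4 (V : zmodType) (p u v z : V) : p + v + z + u - p = v + u + z.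
Proof. by rewrite addrC -!addrA addKr [z + u]addrC. Qed.

Lemma has_mem (I : eqType) (p : pred I) (r : seq I) x : x \in r -> p x -> has p r.
Proof. by move=> xr px; apply/hasP; exists x. Qed.

Lemma sum2_ge (R : realType) (I J : finType) (B : pred J) (F : I -> J -> R) :
  (forall i j, 0 <= F i j) -> forall i j, j \in B -> F i j <= \sum_i \sum_(j in B) F i j.
Proof.
move=> F0 i j jB; rewrite (bigD1 i) // (bigD1 j) //= -addrA lerDl.
by apply: addr_ge0; do ?[apply: sumr_ge0 => ? _] => //; exact: F0.
Qed.

Lemma leq_implb (a b : bool) : (a -> b) -> (a <= b)%N.
Proof. by case: a => // ->. Qed.

(** * Union bounds and prescribed runs in random words *)

Section WordEvents.
Variables (R : realType) (D : finType).
Hypothesis D_gt0 : (0 < #|D|)%N.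
Implicit Types (w : seq D).

Lemma EW_has_sum (I : Type) (r : seq I) n (P : I -> seq D -> bool) :
  EW n (fun w => (has (P^~ w) r)%:R) <= \sum_(i <- r) EW n (fun w => (P i w)%:R) :> R.
Proof.
rewrite -EW_sum; apply: ler_EW => w _; elim: r => [|i r IH]; first by rewrite big_nil.
rewrite big_cons /=; apply: le_trans (lerD (lexx _) IH).
by case: (P i w) => /=; rewrite ?add0r // lerDl ler0n.
Qed.

Lemma EW_has (I : eqType) (r : seq I) n (P : I -> seq D -> bool) (B : R) :
  (forall i, i \in r -> EW n (fun w => (P i w)%:R) <= B) ->
  EW n (fun w => (has (P^~ w) r)%:R) <= (size r)%:R * B.
Proof.
move=> h; apply: le_trans (EW_has_sum _ _ _) _; rewrite big_seq.
apply: le_trans (ler_sum _ h) _; rewrite -big_seq big_const_seq count_predT.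
by rewrite -Monoid.iteropE /= mulr_natl.
Qed.

Lemma EW_or n (P Q : seq D -> bool) (a b : R) :
  EW n (fun w => (P w)%:R) <= a -> EW n (fun w => (Q w)%:R) <= b ->
  EW n (fun w => (P w || Q w)%:R) <= a + b.
Proof.
move=> ha hb; apply: le_trans (lerD ha hb); rewrite -EWD; apply: ler_EW => w _.
by case: (P w) => /=; rewrite ?add0r // lerDl ler0n.
Qed.

Lemma EW_imp n (P Q : seq D -> bool) (b : R) : (forall w, size w = n -> P w -> Q w) ->
  EW n (fun w => (Q w)%:R) <= b -> EW n (fun w => (P w)%:R) <= b.
Proof.
move=> PQ; apply: le_trans; apply: ler_EW => w sw; rewrite ler_nat.
by move: (PQ w sw); case: (P w) => // ->.
Qed.

Lemma EW_false n (P : seq D -> bool) (b : R) : 0 <= b -> (forall w, size w = n -> ~~ P w) ->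
  EW n (fun w => (P w)%:R) <= b.
Proof.
move=> b0 h; apply: le_trans b0; rewrite -(EW0 R D n); apply: ler_EW => w sw.
by rewrite (negPf (h w sw)).
Qed.

Lemma EW_nseq n e : EW n (fun w => (w == nseq n e)%:R) = #|D|%:R^-1 ^+ n :> R.
Proof.
elim: n => [|n IH] /=; first by rewrite expr0.
rewrite (bigD1 e) //= big1 ?addr0 => [|j je].
  by under eq_EW do rewrite eqseq_cons eqxx /=; rewrite IH exprS.
by under eq_EW do rewrite eqseq_cons (negPf je) /=; rewrite EW0.
Qed.

(** The letters of the run are independent of those before and after it, so prescribing the run
    costs [#|D|^-m] whatever is asked of the rest. *)
Lemma EW_window n0 a m b n1 (e : D) (P : seq D -> seq D -> seq D -> bool) (B : R) :
  EW n0 (fun u => EW a (fun v => EW b (fun z => (P u v z)%:R))) <= B ->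
  EW (n0 + (a + (m + (b + n1))))
    (fun w => ((take m (drop (n0 + a) w) == nseq m e) &&
      P (take n0 w) (take a (drop n0 w)) (take b (drop (n0 + a + m) w)))%:R) <=
  #|D|%:R^-1 ^+ m * B.
Proof.
have h0 : 0 <= #|D|%:R^-1 ^+ m :> R by rewrite exprn_ge0 ?invr_ge0 ?ler0n.
move=> h; apply: le_trans (ler_wpM2l h0 h); rewrite EW_cat -EWZ; apply: ler_EW => u su.
rewrite EW_cat -EWZ; apply: ler_EW => v sv.
rewrite EW_cat -[X in X * _](EW_nseq m e) mulrC -EWZ; apply: ler_EW => x sx.
rewrite EW_cat mulrC -EWZ; apply: ler_EW => z sz.
rewrite -[leRHS](EW_const D_gt0 n1); apply: ler_EW => r sr.
have -> : take n0 (u ++ v ++ x ++ z ++ r) = u by rewrite -su take_size_cat.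
have -> : drop n0 (u ++ v ++ x ++ z ++ r) = v ++ x ++ z ++ r by rewrite -su drop_size_cat.
have -> : drop (n0 + a) (u ++ v ++ x ++ z ++ r) = x ++ z ++ r.
  by rewrite addnC -drop_drop -su drop_size_cat // -sv drop_size_cat.
have -> : drop (n0 + a + m) (u ++ v ++ x ++ z ++ r) = z ++ r.
  by rewrite addnC -drop_drop addnC -drop_drop -su drop_size_cat // -sv drop_size_cat // -sx drop_size_cat.
rewrite -sv take_size_cat // -sx take_size_cat // -sz take_size_cat //.
by case: (_ == _) => /=; rewrite ?mul1r ?mul0r.
Qed.

End WordEvents.

Section Density.
Variables (R : realType) (d' N : nat).
Notation d := d'.+1.
Hypothesis N_gt2 : (2 < N)%N.
Notation T := 'rV['Z_N]_d.
Notation dir := ('I_d * bool)%type.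
Implicit Types (x y v : T).

Definition density n : R := ((hk_const d)%:R / Num.sqrt n%:R) ^+ d.

Lemma density_ge0 n : 0 <= density n.
Proof. by rewrite exprn_ge0 // divr_ge0 ?ler0n ?sqrtr_ge0. Qed.

Lemma heat_density n m y : (0 < n <= N ^ 2)%N -> (n <= m)%N -> heat R m y <= density n.
Proof.
move=> nN nm; rewrite -(subnKC nm); apply: heat_sup_le => // z.
exact: heat_le.
Qed.

Lemma card_shift (S : pred T) (f : T -> T) : injective f -> (#|[pred z | S (f z)]| <= #|S|)%N.
Proof.
move=> fI; rewrite -(card_image fI); apply: subset_leq_card; apply/subsetP => y /imageP[x].
by rewrite inE => h ->.
Qed.

Lemma EW_wsum n (S : pred T) y b : (forall z : T, heat R n z <= b) ->
  EW n (fun w => (S (y + wsum N w))%:R) <= #|S|%:R * b.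
Proof.
move=> h; apply: le_trans (heat_in [pred z | S (y + z)] h) _.
have b0 : 0 <= b by apply: le_trans (h 0); exact: heat_ge0.
by rewrite ler_wpM2r // ler_nat; apply: card_shift; exact: addrI.
Qed.

Lemma EW_pos n t y (S : pred T) b : (t <= n)%N -> (forall z : T, heat R t z <= b) ->
  EW n (fun w => (S (pos y w t))%:R) <= #|S|%:R * b.
Proof.
move=> tn h; rewrite -(subnKC tn) (EW_drop_last _ _ _ (fun w => (S (y + wsum N w))%:R)); last exact: dir_gt0.
exact: EW_wsum.
Qed.

Lemma EW2_wsum (a b : nat) (S : pred T) B : (forall z : T, heat R (a + b) z <= B) ->
  EW a (fun r => EW b (fun z => (S (wsum N r + wsum N z))%:R)) <= #|S|%:R * B.
Proof.
move=> h; have := EW_wsum S 0 h; rewrite EW_cat; apply: le_trans.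
apply: ler_EW => v _; apply: ler_EW => z _; by rewrite add0r wsum_cat.
Qed.

End Density.

(** * The ways in which a superblock can fail *)

Section SuperblockEvents.
Variables (d' N l s M k L : nat).
Notation d := d'.+1.
Notation T := 'rV['Z_N]_d.
Implicit Types (Y : nat -> T) (x z : T) (H : seq T).

Definition straight Y t : bool :=
  all (fun i => Y (t - s + i.+1)%N == Y (t - s + i)%N + unit_vec N ord0) (iota 0 (2 * s)).

(* The candidate times of the half of the superblock starting at time [m]. *)
Definition cands m : seq nat := [seq (m + (2 * a + 1) * s)%N | a <- iota 0 k].

Definition on_arm x z : bool :=
  [exists q : 'I_d * bool, (q.1 != ord0) &&
    has (fun j => z == arm l s x q.1 q.2 j) (iota 1 (arm_len l s x q.1 q.2))].

Lemma cands_bound m t : (2 * s * k <= M)%N ->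
  t \in cands m -> (m + s <= t)%N /\ (t + s <= m + M)%N.
Proof. by move=> skM /mapP[a]; rewrite mem_iota add0n => /= h ->; nia. Qed.

Notation late := (index_iota M (2 * M).+1).
Notation after t := (index_iota t.+1 (2 * M).+1).

Definition slow Y := all (fun t => (nrm (Y t - Y 0%N) < L)%N) (index_iota 0 (2 * M).+1).
Definition hits_frame Y := has (fun t => frame l (Y t)) late.
Definition crooked Y := all (fun t => ~~ straight Y t) (cands M).
(** Candidates of both halves are tested: a segment found in one superblock lies in the first half
    of the next, where it must still separate. For [arm_hit_before] the second half suffices, since
    the sites before a segment belong to the superblock that finds it or to its history. *)
Definition cut_broken Y := has (fun t => straight Y t &&
  has (fun a => has (fun b => (nrm (Y a - Y b) <= 1)%N) (after t)) (iota 0 t)) (cands 0 ++ cands M).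
Definition arm_hit_after Y := has (fun t => straight Y t &&
  has (fun a => on_arm (Y t) (Y a)) (after t)) (cands 0 ++ cands M).
Definition arm_hit_before Y := has (fun t => straight Y t &&
  has (fun a => on_arm (Y t) (Y a)) (iota 0 t)) (cands M).
(** Only late times are tested against the history: after [M] steps the position has density of
    order [L^-d], whatever the start. *)
Definition near_past Y H := has (fun t => has (fun h => (nrm (Y t - h) <= 1)%N) H) late.
Definition past_arm_hit Y H := has (fun t => has (fun h => short_offset l s (Y t - h)) H) late.
Definition arm_near_past Y H := has (fun t => has (fun h => short_offset l s (h - Y t)) H) (cands M).

(* [H] lists the earlier sites of the walk, [Hc] those visited at candidate times. *)
Definition fails Y H Hc := [|| ~~ slow Y, hits_frame Y, crooked Y, cut_broken Y, arm_hit_after Y,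
  arm_hit_before Y, near_past Y H, past_arm_hit Y Hc | arm_near_past Y H].

Record sound Y H Hc : Prop := Sound {
  sound_slow : slow Y;
  sound_frame : ~~ hits_frame Y;
  sound_straight : exists2 t, t \in cands M & straight Y t;
  sound_cut : ~~ cut_broken Y;
  sound_after : ~~ arm_hit_after Y;
  sound_before : ~~ arm_hit_before Y;
  sound_past : ~~ near_past Y H;
  sound_past_arm : ~~ past_arm_hit Y Hc;
  sound_arm_past : ~~ arm_near_past Y H }.

Lemma not_fails Y H Hc : ~~ fails Y H Hc -> sound Y H Hc.
Proof.
rewrite /fails; case: (boolP (slow Y)) => //= s1; case: (boolP (hits_frame Y)) => //= s2.
case: (boolP (crooked Y)) => //= /allPn[t tc /negbNE st]; case: (boolP (cut_broken Y)) => //= s4.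
case: (boolP (arm_hit_after Y)) => //= s5; case: (boolP (arm_hit_before Y)) => //= s6.
case: (boolP (near_past Y H)) => //= s7; case: (boolP (past_arm_hit Y Hc)) => //= s8 s9.
by split=> //; exists t.
Qed.

End SuperblockEvents.

(** * Probability of each failure of a slow superblock *)

Section SuperblockProbability.
Variables (R : realType) (d' N l s M k L : nat).
Notation d := d'.+1.
Notation T := 'rV['Z_N]_d.
Notation dir := ('I_d * bool)%type.
Hypotheses (N_gt2 : (2 < N)%N) (l_gt0 : (0 < l)%N) (s_gt0 : (0 < s)%N) (d_gt3 : (3 < d)%N).
Hypotheses (skM : (2 * s * k <= M)%N) (MN : (2 * M <= N ^ 2)%N) (M_gt1 : (1 < M)%N).
Hypotheses (slN : (4 * (s + l) <= N)%N).
Variable y : T.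
Notation Y := (pos y).
Notation e0 := (@unit_vec d' N ord0).
Notation fwd := ((ord0, true) : dir).
Notation q := ((#|{: dir}|%:R : R)^-1 ^+ (2 * s)).
Notation density := (density R d').
Notation EM := (@EW R dir (2 * M)).

Let dir0 : (0 < #|{: dir}|)%N. Proof. exact: dir_gt0. Qed.

Lemma vec_fwd : vec N fwd = e0.
Proof. by rewrite vecE scale1r. Qed.

Lemma wsum_nseq n : wsum N (nseq n fwd) = n%:R *: e0.
Proof.
elim: n => [|n IH]; first by rewrite scale0r /wsum big_nil.
by rewrite /= wsum_cons IH vec_fwd -natr1 scalerDl scale1r addrC.
Qed.

Lemma posE w i j : (i <= j)%N -> Y w j = Y w i + wsum N (take (j - i) (drop i w)).
Proof. by move=> ij; rewrite /pos -addrA -wsum_cat -takeD subnKC. Qed.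

Lemma posS w i : (i < size w)%N -> Y w i.+1 = Y w i + vec N (nth fwd w i).
Proof.
by move=> h; rewrite /pos (take_nth fwd h) -cats1 wsum_cat /= wsum_cons /wsum big_nil addr0 addrA.
Qed.

Lemma straight_word w t : (s <= t)%N -> (t + s <= size w)%N -> straight s (Y w) t ->
  take (2 * s) (drop (t - s) w) = nseq (2 * s) fwd.
Proof.
move=> st ts /allP h; apply: (@eq_from_nth _ fwd).
  by rewrite size_nseq size_takel // size_drop; lia.
move=> i; rewrite size_takel; last by rewrite size_drop; lia.
move=> hi; rewrite nth_take // nth_nseq hi nth_drop.
have := h i; rewrite mem_iota add0n hi => /(_ isT) /eqP.
rewrite addnS posS; last lia.
by move/addrI; rewrite -vec_fwd => /(vec_inj N_gt2).
Qed.

Lemma straight_pos w t i j : (s <= t)%N -> (t + s <= size w)%N -> straight s (Y w) t ->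
  (t - s <= i <= j)%N -> (j <= t + s)%N -> Y w j = Y w i + (j - i)%:R *: e0.
Proof.
move=> st ts sw ij jt; rewrite (posE w (i := i) (j := j)); last lia.
congr (_ + _); rewrite -wsum_nseq; congr wsum.
have := congr1 (fun u => take (j - i) (drop (i - (t - s)) u)) (straight_word st ts sw).
rewrite drop_nseq take_nseq; last lia.
move=> <-; rewrite [drop i w](_ : _ = drop (i - (t - s)) (drop (t - s) w)); last by rewrite drop_drop subnK //; lia.
by rewrite !take_drop take_takel //; lia.
Qed.

Lemma cands2_bound t : t \in cands s k 0 ++ cands s k M -> (s <= t)%N /\ (t + s <= 2 * M)%N.
Proof. by rewrite mem_cat => /orP[] /(cands_bound skM); lia. Qed.

Lemma EW_late (S : pred T) t : (M <= t <= 2 * M)%N ->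
  EM (fun w => (S (Y w t))%:R) <= #|S|%:R * density M.
Proof.
case/andP=> Mt tM; apply: EW_pos => // z; apply: heat_density => //; lia.
Qed.

Lemma EW_window_at t a b (P : seq dir -> seq dir -> seq dir -> bool) (B : R) :
  (s <= t)%N -> (a <= t - s)%N -> (t + s + b <= 2 * M)%N ->
  EW (t - s - a) (fun u => EW a (fun v => EW b (fun z => (P u v z)%:R))) <= B ->
  EM (fun w => ((take (2 * s) (drop (t - s) w) == nseq (2 * s) fwd) &&
    P (take (t - s - a) w) (take a (drop (t - s - a) w)) (take b (drop (t + s) w)))%:R) <= q * B.
Proof.
move=> st ta tb hB.
have e : (2 * M = (t - s - a) + (a + (2 * s + (b + (2 * M - (t + s + b))))))%N by lia.
have [e1 e2] : (t - s - a + a = t - s /\ t - s + 2 * s = t + s)%N by lia.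
rewrite e; have := EW_window dir0 (2 * s) (2 * M - (t + s + b)) fwd hB.
by rewrite e1 e2.
Qed.

Notation sumfd := (\sum_(s <= f < (2 * M).+1) f%:R * density f).

Lemma frame_prob : EM (fun w => (hits_frame l M (Y w) && slow M L (Y w))%:R) <=
  M.+1%:R * (#|[pred x : T | frame l x && (nrm (x - y)%R <= L)%N]|%:R * density M).
Proof.
apply: (@le_trans _ _ (EM (fun w => (has (fun t => frame l (Y w t) && (nrm (Y w t - y)%R <= L)%N)
   (index_iota M (2 * M).+1))%:R))).
  apply: ler_EW => w _; rewrite ler_nat /hits_frame /slow pos0.
  case: hasP; rewrite ?andFb // => -[t tl ft]; case: allP => // sl.
  have -> //: has (fun t => frame l (Y w t) && (nrm (Y w t - y)%R <= L)%N) (index_iota M (2 * M).+1).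
  apply/hasP; exists t => //; rewrite ft ltnW //; apply: sl.
  by move: tl; rewrite !mem_index_iota; lia.
have -> : M.+1 = size (index_iota M (2 * M).+1) by rewrite size_iota; lia.
apply: EW_has => t; rewrite mem_index_iota => tM.
apply: (@EW_late (fun x => frame l x && (nrm (x - y)%R <= L)%N)); lia.
Qed.

(** Between the two times the walk makes [f = a' + b'] free steps and a piece [wd] of the straight
    window. Closing up forces [wd <= 1 + f], hence [f >= s]. For fixed [f] at most [4 f] cases
    remain, each of probability at most [3^d density f] besides the factor [q] of the window. *)
Lemma cut_prob t : (s <= t)%N -> (t + s <= 2 * M)%N ->
  EM (fun w => (straight s (Y w) t && has (fun a => has (fun b => (nrm (Y w a - Y w b)%R <= 1)%N)
     (index_iota t.+1 (2 * M).+1)) (iota 0 t))%:R) <= q * ((4 * 3 ^ d)%:R * sumfd).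
Proof.
move=> st ts.
(* Pairs of the number of free steps before the window and the length of window used. The three
   lists are: both times outside the window, the later time inside, the earlier time inside. Both
   inside is impossible, since a straight piece does not close up. *)
pose code f : seq (nat * nat) := [seq (a, 2 * s)%N | a <- iota 0 f.+1] ++
  [seq (f, s + i)%N | i <- iota 0 s] ++ [seq (0, s + i)%N | i <- iota 0 s].
pose G f (c : nat * nat) w := [&& (c.1 <= t - s)%N, (t + s + (f - c.1) <= 2 * M)%N, (c.1 <= f)%N &
  (take (2 * s) (drop (t - s) w) == nseq (2 * s) fwd) &&
  (nrm (wsum N (take c.1 (drop (t - s - c.1) w)) + wsum N (take (f - c.1) (drop (t + s) w)) + c.2%:R *: e0)%R <= 1)%N].
apply: (@EW_imp _ _ _ _ (fun w => has (fun f => has (fun c => G f c w) (code f)) (index_iota s (2 * M).+1))).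
  move=> w sw /andP[stw /hasP[a]]; rewrite mem_iota add0n /= => at_ /hasP[b]; rewrite mem_index_iota => tb near.
  pose a' := (t - s - a)%N; pose b' := (b - t - s)%N.
  pose wd := (minn s (t - a) + minn s (b - t))%N.
  have ew := straight_word st (_ : (t + s <= size w)%N) stw; rewrite sw in ew; have {ew} := ew ts => ew.
  have disp : Y w b - Y w a = wsum N (take a' (drop (t - s - a') w)) + wsum N (take b' (drop (t + s) w)) + wd%:R *: e0.
    have sp := @straight_pos w t _ _ st; rewrite sw in sp; have {}sp i j := sp i j ts stw.
    have eb : Y w b = Y w (minn b (t + s)) + wsum N (take b' (drop (t + s) w)).
      have [h|h] := leqP b (t + s); first by rewrite (_ : b' = 0%N) ?take0 ?[wsum N [::]]big_nil ?addr0 // /b'; lia.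
      rewrite (posE w (i := t + s) (j := b)); last exact: ltnW.
      by congr (_ + wsum N (take _ _)); rewrite /b'; lia.
    have ea : Y w (maxn a (t - s)) = Y w a + wsum N (take a' (drop (t - s - a') w)).
      have [h|h] := leqP (t - s) a; first by rewrite (_ : a' = 0%N) ?take0 ?[wsum N [::]]big_nil ?addr0 // /a'; lia.
      rewrite (posE w (i := a) (j := (t - s)%N)); last exact: ltnW.
      by congr (_ + wsum N (take _ (drop _ _))); rewrite /a'; lia.
    rewrite eb (sp (maxn a (t - s)) (minn b (t + s))); [|lia|lia].
    rewrite ea (_ : (minn b (t + s) - maxn a (t - s))%N = wd); last by rewrite /wd; lia.
    move: (Y w a) (wsum N _) (wsum N _) (wd%:R *: e0) => p u v z.
    exact: zmod_move4.
  have near' : (nrm (wsum N (take a' (drop (t - s - a') w)) + wsum N (take b' (drop (t + s) w)) + wd%:R *: e0)%R <= 1)%N.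
    by rewrite -disp nrmB.
  have cl : (wd <= 1 + (a' + b'))%N.
    set u := wsum N _ in near'; set v := wsum N _ in near'.
    have nu : (nrm u <= a')%N by apply: leq_trans (nrm_wsum _ _) _ => //; rewrite size_take_min geq_minl.
    have nv : (nrm v <= b')%N by apply: leq_trans (nrm_wsum _ _) _ => //; rewrite size_take_min geq_minl.
    have := nrmD N_gt2 (u + v + wd%:R *: e0) (- (u + v)); rewrite addrAC subrr add0r nrmN.
    have := nrmD N_gt2 u v; have := cyc_nrm (wd%:R *: e0 : T) ord0.
    rewrite mxE unit_vecE eqxx mulr1 cyc_eq //; last by rewrite /wd; lia.
    by move: near' nu nv; clear; lia.
  have fs : (s <= a' + b')%N.
    by move: cl; rewrite /a' /b' /wd; have := s_gt0; have := at_; have := tb; clear; lia.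
  have fM : (a' + b')%N \in index_iota s (2 * M).+1 by rewrite mem_index_iota fs /= /a' /b'; lia.
  have hG : G (a' + b')%N (a', wd) w.
    by rewrite /G /= addKn ew eqxx near' !andbT leq_addr; rewrite /a' /b'; lia.
  suff hc : (a', wd) \in code (a' + b')%N.
    by apply: (has_mem fM); apply: (has_mem hc).
  rewrite !mem_cat.
  have [h1|h1] := leqP s (t - a); have [h2|h2] := leqP s (b - t).
  - apply/orP; left; apply/mapP; exists a'; first by rewrite mem_iota /=; lia.
    by congr pair; rewrite /wd; lia.
  - apply/orP; right; apply/orP; left; apply/mapP; exists (b - t)%N; first by rewrite mem_iota /=; lia.
    by congr pair; rewrite /wd /a' /b'; lia.
  - apply/orP; right; apply/orP; right; apply/mapP; exists (t - a)%N; first by rewrite mem_iota /=; lia.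
    by congr pair; rewrite /wd /a' /b'; lia.
  - by move: fs cl; rewrite /a' /b' /wd; have := at_; have := tb; clear -h1 h2; lia.
apply: le_trans (@EW_has_sum R dir _ (index_iota s (2 * M).+1) (2 * M) (fun f w => has (fun c => G f c w) (code f))) _.
rewrite mulrA mulr_sumr [leLHS]big_nat_cond [leRHS]big_nat_cond; apply: ler_sum => f; rewrite andbT => /andP[sf fM].
have q0 : 0 <= q by rewrite exprn_ge0 ?invr_ge0 ?ler0n.
have df := density_ge0 R d' f.
apply: (@le_trans _ _ ((size (code f))%:R * (q * ((3 ^ d)%:R * density f)))).
  apply: EW_has => -[a wd] _; rewrite /G /=.
  have [ta|_] := leqP a (t - s); last by apply: EW_false; rewrite ?mulr_ge0 // ler0n.
  have [tb|_] := leqP (t + s + (f - a)) (2 * M); last by apply: EW_false; rewrite ?mulr_ge0 // ler0n.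
  have [af|_] := leqP a f; last by apply: EW_false; rewrite ?mulr_ge0 // ler0n.
  apply: (@EW_window_at t a (f - a) (fun _ v z => (nrm (wsum N v + wsum N z + wd%:R *: e0)%R <= 1)%N)) => //.
  apply: EW_le_const => // u _.
  have hd (z : T) : heat R (a + (f - a)) z <= density f.
    by rewrite subnKC //; apply: heat_density => //; lia.
  apply: le_trans (EW2_wsum (fun z => (nrm (z + wd%:R *: e0)%R <= 1)%N) hd) _.
  rewrite ler_wpM2r // ler_nat.
  apply: leq_trans (card_ball N_gt2 (- (wd%:R *: e0)) 1).
  by apply: subset_leq_card; apply/subsetP => z; rewrite !inE opprK.
have sz : (size (code f) <= 4 * f)%N by rewrite !size_cat !size_map !size_iota; lia.
have -> : q * (4 * 3 ^ d)%:R * (f%:R * density f) = (4 * f)%:R * (q * ((3 ^ d)%:R * density f)) by rewrite !natrM; ring.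
by rewrite ler_wpM2r ?ler_nat // mulr_ge0 // mulr_ge0 ?ler0n.
Qed.

Lemma card_values (I : finType) (F : I -> T) : (#|[pred z | [exists i, z == F i]]| <= #|I|)%N.
Proof.
apply: (@leq_trans #|codom F|); last exact: leq_image_card.
by apply: subset_leq_card; apply/subsetP => z; rewrite inE => /existsP[i /eqP->]; exact: codom_f.
Qed.

Lemma l1norm_pos w i j : (l1norm (Y w i - Y w j) <= (i - j) + (j - i))%N.
Proof.
have h i' j' : (i' <= j')%N -> (l1norm (Y w j' - Y w i') <= j' - i')%N.
  move=> ij; rewrite (posE w ij) [X in l1norm X]addrC addKr.
  by apply: leq_trans (l1norm_wsum N_gt2 _) _; rewrite size_take_min geq_minl.
have [ij|ij] := leqP j i; first by apply: leq_trans (h _ _ ij) _; rewrite leq_addr.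
have -> : l1norm (Y w i - Y w j) = l1norm (Y w j - Y w i).
  by apply: eq_bigr => u _; rewrite -cycN; congr cyc; rewrite !mxE opprB.
by apply: leq_trans (h _ _ (ltnW ij)) _; rewrite leq_addl.
Qed.

(** By [arm_l1], hitting site [j] of an arm takes at least [s + j] steps after the window. So a hit
    after [f] steps needs [f >= s], and only the indices [j <= f] in the [2 d] directions are
    targets. *)
Lemma arm_after_prob t : (s <= t)%N -> (t + s <= 2 * M)%N ->
  EM (fun w => (straight s (Y w) t && has (fun a => on_arm l s (Y w t) (Y w a))
     (index_iota t.+1 (2 * M).+1))%:R) <= q * ((8 * d)%:R * sumfd).
Proof.
move=> st ts.
pose pt u : T := y + wsum N u + s%:R *: e0.
pose P f u (_ z : seq dir) := [exists c : dir * 'I_f.+1,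
  wsum N z == arm l s (pt u) c.1.1 c.1.2 c.2 - (pt u + s%:R *: e0)].
apply: (@EW_imp _ _ _ _ (fun w => has (fun f => (t + s + f <= 2 * M)%N &&
   ((take (2 * s) (drop (t - s) w) == nseq (2 * s) fwd) &&
    P f (take (t - s - 0) w) (take 0 (drop (t - s - 0) w)) (take f (drop (t + s) w)))) (index_iota s (2 * M).+1))).
  move=> w sw /andP[stw /hasP[a]]; rewrite mem_index_iota => /andP[ta aM] /existsP[c /andP[c0 /hasP[j]]].
  rewrite mem_iota add1n ltnS => /andP[j0 jl] /eqP ya.
  have tw : (t + s <= size w)%N by rewrite sw.
  have ets : Y w (t + s) = Y w t + s%:R *: e0.
    by rewrite (straight_pos st tw stw (i := t)) ?addKn // ?leq_subr ?leq_addr.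
  have := @arm_l1 _ _ l s N_gt2 l_gt0 d_gt3 (Y w t) c.1 c.2 j (s%:R) c0.
  rewrite -ets -ya => /(_ _ jl) h.
  have {}h : (s + j <= (a - (t + s)) + ((t + s) - a))%N.
    by apply: leq_trans (l1norm_pos _ _ _); apply: h; rewrite ?cyc_eq //; lia.
  have fM : (a - (t + s))%N \in index_iota s (2 * M).+1 by rewrite mem_index_iota; lia.
  apply: (has_mem fM).
  have tsa : (t + s <= a)%N by lia.
  rewrite subnKC // -ltnS aM (straight_word st tw stw) eqxx /=.
  have jf : (j < (a - (t + s)).+1)%N by lia.
  apply/existsP; exists (c, Ordinal jf) => /=.
  have -> : pt (take (t - s - 0) w) = Y w t.
    by rewrite (straight_pos st tw stw (i := (t - s)%N) (j := t)) ?subKn ?leq_addr ?leqnn ?leq_subr // subn0.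
  by rewrite -ya -ets (posE w tsa) [X in _ == X]addrC addKr.
apply: le_trans (@EW_has_sum R dir _ (index_iota s (2 * M).+1) (2 * M) _) _.
rewrite mulrA mulr_sumr [leLHS]big_nat_cond [leRHS]big_nat_cond; apply: ler_sum => f; rewrite andbT => /andP[sf fM].
have q0 : 0 <= q by rewrite exprn_ge0 ?invr_ge0 ?ler0n.
have df := density_ge0 R d' f.
have [tb|_] := leqP (t + s + f) (2 * M); last by apply: EW_false; rewrite ?mulr_ge0 // ler0n.
rewrite -mulrA.
apply: (@EW_window_at t 0 f (P f)) => //.
apply: EW_le_const => // u _ /=.
have hd (z : T) : heat R f z <= density f by apply: heat_density => //; lia.
apply: (@le_trans _ _ (#|[pred z : T | [exists c : dir * 'I_f.+1,
   z == arm l s (pt u) c.1.1 c.1.2 c.2 - (pt u + s%:R *: e0)]]|%:R * density f)).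
  by have := EW_wsum [pred z : T | [exists c : dir * 'I_f.+1, z == arm l s (pt u) c.1.1 c.1.2 c.2 - (pt u + s%:R *: e0)]] 0 hd; under eq_EW do rewrite add0r.
rewrite mulrA ler_wpM2r // -natrM ler_nat; apply: leq_trans (card_values _) _.
by rewrite !card_prod !card_ord card_bool; nia.
Qed.

Lemma shift_prob a t (S : pred T) : (a + M./2 <= t)%N -> (t <= 2 * M)%N ->
  EM (fun w => (S (Y w t - Y w a))%:R) <= #|S|%:R * density M./2.
Proof.
move=> at_ tM; have aM : (a <= 2 * M)%N by lia.
rewrite -[in leLHS](subnKC aM) EW_cat; apply: EW_le_const => // u su.
have hd (z : T) : heat R (t - a) z <= density M./2 by apply: heat_density => //; lia.
have ta : (t - a <= 2 * M - a)%N by lia.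
apply: le_trans (EW_pos 0 S ta hd); apply: ler_EW => v _.
have le : (a <= t)%N by lia.
by rewrite (posE (u ++ v) le) addrC addKr -su drop_size_cat // /pos add0r.
Qed.

(** The arm hangs on the later position [Y t], so one sums over its value [x], confined to a ball by
    slowness. If at most [M / 2] steps separate the hit from the window, the walk before the hit
    still has density [density M./2], which compensates the number of values of [x]. For an earlier
    hit it is enough that the displacement is a short offset. *)
Lemma arm_before_prob t : (M + s <= t)%N -> (t + s <= 2 * M)%N ->
  EM (fun w => ((straight s (Y w) t && has (fun a => on_arm l s (Y w t) (Y w a)) (iota 0 t)) &&
      slow M L (Y w))%:R) <=
  q * ((8 * d)%:R * (#|[pred x : T | (nrm (x - y)%R <= L)%N]|%:R * density M./2 * sumfd)) +
  (2 * M)%:R * (#|short_offset l s : pred T|%:R * density M./2).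
Proof.
move=> Mt ts; have st : (s <= t)%N by lia.
pose B : pred T := [pred x : T | (nrm (x - y)%R <= L)%N].
pose P f u v (_ : seq dir) := [exists c : dir * 'I_f.+1, [exists x in B,
  (y + wsum N u == arm l s x c.1.1 c.1.2 c.2) && (wsum N v == x - s%:R *: e0 - arm l s x c.1.1 c.1.2 c.2)]].
apply: (@EW_imp _ _ _ _ (fun w => has (fun f => (f <= M./2)%N &&
   ((take (2 * s) (drop (t - s) w) == nseq (2 * s) fwd) &&
    P f (take (t - s - f) w) (take f (drop (t - s - f) w)) (take 0 (drop (t + s) w)))) (index_iota s (2 * M).+1)
   || has (fun a => (a + M./2 <= t)%N && short_offset l s (- (Y w t - Y w a))) (iota 0 t))).
  move=> w sw /andP[/andP[stw /hasP[a + /existsP[c /andP[c0 /hasP[j jl ya]]]]] sl]; rewrite mem_iota add0n => at_; move: jl ya.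
  rewrite mem_iota add1n ltnS => /andP[j0 jl] /eqP ya.
  have tw : (t + s <= size w)%N by rewrite sw.
  have ets : Y w t = Y w (t - s)%N + s%:R *: e0.
    by rewrite (straight_pos st tw stw (i := (t - s)%N) (j := t)) ?subKn ?leq_addr ?leqnn ?leq_subr.
  have := @arm_l1 _ _ l s N_gt2 l_gt0 d_gt3 (Y w t) c.1 c.2 j (- s%:R) c0.
  have -> : Y w t + - s%:R *: e0 = Y w (t - s)%N by rewrite ets scaleNr addrK.
  rewrite -ya => /(_ _ jl) h.
  have {}h : (s + j <= (a - (t - s)) + ((t - s) - a))%N.
    by apply: leq_trans (l1norm_pos _ _ _); apply: h; rewrite ?cycN ?cyc_eq //; lia.
  have [fM|fM] := leqP (t - s - a) M./2; apply/orP; [left|right]; last first.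
    apply/hasP; exists a; first by rewrite mem_iota.
    rewrite opprB ya arm_offset // andbT; lia.
  have fM' : (t - s - a)%N \in index_iota s (2 * M).+1 by rewrite mem_index_iota; lia.
  apply: (has_mem fM').
  rewrite fM (straight_word st tw stw) eqxx !andTb.
  have jf : (j < (t - s - a).+1)%N by lia.
  apply/existsP; exists (c, Ordinal jf); apply/existsP; exists (Y w t).
  have ea : (t - s - (t - s - a))%N = a by lia.
  rewrite ea /= -ya /B /= inE.
  have := allP sl t; rewrite mem_index_iota pos0 => /(_ _)/ltnW -> /=; last by lia.
  rewrite eqxx /= ets addrK (posE w (i := a) (j := (t - s)%N)); last by lia.
  by rewrite [X in _ == X]addrC addKr.
apply: EW_or; last first.
  have aM : (t <= 2 * M)%N by lia.
  apply: (@le_trans _ _ (t%:R * (#|short_offset l s : pred T|%:R * density M./2))); last first.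
    by rewrite ler_wpM2r ?ler_nat // mulr_ge0 ?density_ge0.
  rewrite -[t in leRHS](size_iota 0); apply: EW_has => a _.
  have [h|_] := leqP (a + M./2) t; last by apply: EW_false => //; rewrite mulr_ge0 ?density_ge0.
  apply: le_trans (shift_prob (fun z => short_offset l s (- z)) h aM) _.
  by rewrite ler_wpM2r ?density_ge0 // ler_nat; apply: card_shift; exact: oppr_inj.
apply: le_trans (@EW_has_sum R dir _ (index_iota s (2 * M).+1) (2 * M) _) _.
rewrite !mulr_sumr [leLHS]big_nat_cond [leRHS]big_nat_cond; apply: ler_sum => f; rewrite andbT => /andP[sf fM].
have q0 : 0 <= q by rewrite exprn_ge0 ?invr_ge0 ?ler0n.
have df := density_ge0 R d' f; have dM := density_ge0 R d' M./2.
have [fM2|_] := leqP f M./2; last by apply: EW_false; rewrite ?mulr_ge0.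
apply: (@EW_window_at t f 0 (P f)) => //; [lia|lia|].
have hd (z : T) : heat R f z <= density f by apply: heat_density => //; lia.
have hM (z : T) : heat R (t - s - f) z <= density M./2 by apply: heat_density => //; lia.
pose F (c : dir * 'I_f.+1) (x : T) (u v : seq dir) : R :=
  (wsum N u == arm l s x c.1.1 c.1.2 c.2 - y)%:R * (wsum N v == x - s%:R *: e0 - arm l s x c.1.1 c.1.2 c.2)%:R.
apply: (@le_trans _ _ (EW (t - s - f) (fun u => EW f (fun v => \sum_(c : dir * 'I_f.+1) \sum_(x in B) F c x u v)))).
  apply: ler_EW => u _; apply: ler_EW => v _ /=.
  have F0 c x : 0 <= F c x u v by rewrite mulr_ge0.
  have [/existsP[c /existsP[x /and3P[xB e1 e2]]]|_] := boolP (P f u v [::]); last by do 2 apply: sumr_ge0 => ? _.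
  have {}e1 : wsum N u == arm l s x c.1.1 c.1.2 c.2 - y by rewrite -(eqP e1) addrC addKr.
  apply: le_trans (sum2_ge F0 c xB); by rewrite /F e1 e2 mulr1.
under eq_EW => u _ do rewrite EW_sum.
rewrite EW_sum; apply: (@le_trans _ _ (\sum_(c : dir * 'I_f.+1) \sum_(x in B) (density M./2 * density f))); last first.
  rewrite !sumr_const -[X in X <= _]mulr_natl -[X in _ * X]mulr_natl !card_prod !card_ord card_bool.
  have -> : (8 * d)%:R * (#|B|%:R * density M./2 * (f%:R * density f)) =
      (8 * d * f)%:R * (#|B|%:R * (density M./2 * density f)) by rewrite [in RHS]natrM; ring.
  by rewrite ler_wpM2r ?mulr_ge0 // ler_nat; move: s_gt0 sf; clear; nia.
apply: ler_sum => c _; under eq_EW => u _ do rewrite EW_sum; rewrite EW_sum; apply: ler_sum => x _.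
rewrite /F; under eq_EW => u _ do rewrite EWZ mulrC; rewrite EWZ mulrC.
by apply: ler_pM; rewrite ?heat_ge0 //; [exact: hM|exact: hd].
Qed.

Lemma near_past_prob H :
  EM (fun w => (near_past M (Y w) H)%:R) <= M.+1%:R * ((size H)%:R * ((3 ^ d)%:R * density M)).
Proof.
rewrite (_ : M.+1 = size (index_iota M (2 * M).+1)); last by rewrite size_iota; lia.
apply: EW_has => t; rewrite mem_index_iota => tM; apply: EW_has => h _.
apply: le_trans (EW_late (fun z => (nrm (z - h)%R <= 1)%N) tM) _.
rewrite ler_wpM2r ?density_ge0 // ler_nat.
exact: (card_ball N_gt2 h 1).
Qed.

Lemma card_short_shift (h : T) : (#|[pred z : T | short_offset l s (z - h)]| <= #|short_offset l s : pred T|)%N.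
Proof. by apply: (card_shift (short_offset l s)); exact: addIr. Qed.

Lemma past_arm_prob H :
  EM (fun w => (past_arm_hit l s M (Y w) H)%:R) <=
  M.+1%:R * ((size H)%:R * (#|short_offset l s : pred T|%:R * density M)).
Proof.
rewrite (_ : M.+1 = size (index_iota M (2 * M).+1)); last by rewrite size_iota; lia.
apply: EW_has => t; rewrite mem_index_iota => tM; apply: EW_has => h _.
apply: le_trans (EW_late (fun z => short_offset l s (z - h)) tM) _.
by rewrite ler_wpM2r ?density_ge0 // ler_nat; exact: card_short_shift.
Qed.

Lemma arm_near_prob H :
  EM (fun w => (arm_near_past l s M k (Y w) H)%:R) <=
  k%:R * ((size H)%:R * (#|short_offset l s : pred T|%:R * density M)).
Proof.
have -> : k%:R = (size (cands s k M))%:R :> R by rewrite size_map size_iota.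
apply: EW_has => t /(cands_bound skM)[Mt tM]; apply: EW_has => h _.
have tM' : (M <= t <= 2 * M)%N by lia.
apply: le_trans (EW_late (fun z => short_offset l s (h - z)) tM') _.
rewrite ler_wpM2r ?density_ge0 // ler_nat.
by apply: (card_shift (short_offset l s)) => u v /addrI /oppr_inj.
Qed.

Lemma EW_no_window n m j r : (j * m <= n)%N ->
  EW (r + n) (fun w => (all (fun a => take m (drop (r + a * m) w) != nseq m fwd) (iota 0 j))%:R) =
  (1 - (#|{: dir}|%:R : R)^-1 ^+ m) ^+ j.
Proof.
move=> jn; rewrite EW_cat -[RHS](EW_const dir0 r); apply: eq_EW => u su.
transitivity (EW n (fun w => (all (fun a => take m (drop (a * m) w) != nseq m fwd) (iota 0 j))%:R) : R).
  apply: eq_EW => w _; congr (nat_of_bool _)%:R; apply: eq_all => a.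
  by rewrite addnC -drop_drop -su drop_size_cat.
elim: j n jn {u su} => [|j IH] n jn; first by rewrite expr0; exact: EW_const.
have e : n = (m + (n - m))%N by rewrite subnKC //; move: jn; rewrite mulSn; lia.
rewrite e EW_cat exprS.
pose X (u : seq dir) : R := (u != nseq m fwd)%:R.
transitivity (EW m X * (1 - (#|{: dir}|%:R : R)^-1 ^+ m) ^+ j).
  rewrite mulrC -EWZ; apply: eq_EW => u su; rewrite /= -(IH (n - m)%N); last by move: jn; rewrite mulSn; lia.
  rewrite mulrC /X -EWZ; apply: eq_EW => v _.
  rewrite mul0n drop0 -su take_size_cat //; rewrite -mulnb natrM; congr (_ * _).
  rewrite (_ : iota 1 j = map (addn 1) (iota 0 j)) ?all_map; last by rewrite -iotaDl.
  congr (nat_of_bool _)%:R; apply: eq_all => a /=.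
  by rewrite mulSn addnC -drop_drop drop_size_cat.
congr (_ * _); rewrite -(EW_nseq R m fwd).
apply/eqP; rewrite eq_sym subr_eq eq_sym -EWD; apply/eqP; rewrite -[RHS](EW_const dir0 m); apply: eq_EW => u _.
by rewrite /X; case: (_ == _); rewrite ?addr0 ?add0r.
Qed.

Lemma crooked_prob : EM (fun w => (crooked s M k (Y w))%:R) <= (1 - q) ^+ k.
Proof.
have km : (k * (2 * s) <= M)%N by move: skM; rewrite mulnC.
rewrite -(EW_no_window M km) (_ : (2 * M = M + M)%N); last by rewrite mul2n addnn.
apply: ler_EW => w sw; rewrite ler_nat.
apply: leq_implb => /allP h; apply/allP => a; rewrite mem_iota add0n => ak.
have tc : (M + (2 * a + 1) * s)%N \in cands s k M by apply/mapP; exists a; rewrite ?mem_iota.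
have [Mt tM] := cands_bound skM tc; have := h _ tc.
apply: contra => /eqP e; apply/allP => i; rewrite mem_iota add0n => /= hi.
have -> : (M + (2 * a + 1) * s - s = M + a * (2 * s))%N by nia.
rewrite addnS posS; last by rewrite sw; nia.
apply/eqP; congr (_ + _); rewrite -vec_fwd; congr (vec N _).
have := congr1 (fun u => nth fwd u i) e; rewrite nth_take // nth_drop nth_nseq hi.
by move->.
Qed.

(** Leaving the ball of radius [L] is excluded here: its probability is controlled by [A] rather
    than by the scale [g], and it is paid for separately through [escapes]. *)
Lemma fails_prob H Hc :
  EM (fun w => (fails l s M k L (Y w) H Hc && slow M L (Y w))%:R) <=
    M.+1%:R * (#|[pred x : T | frame l x && (nrm (x - y)%R <= L)%N]|%:R * density M)
  + (1 - q) ^+ k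
  + (2 * k)%:R * (q * ((4 * 3 ^ d)%:R * sumfd))
  + (2 * k)%:R * (q * ((8 * d)%:R * sumfd))
  + k%:R * (q * ((8 * d)%:R * (#|[pred x : T | (nrm (x - y)%R <= L)%N]|%:R * density M./2 * sumfd)) +
      (2 * M)%:R * (#|short_offset l s : pred T|%:R * density M./2))
  + M.+1%:R * ((size H)%:R * ((3 ^ d)%:R * density M))
  + M.+1%:R * ((size Hc)%:R * (#|short_offset l s : pred T|%:R * density M))
  + k%:R * ((size H)%:R * (#|short_offset l s : pred T|%:R * density M)).
Proof.
have sz : (2 * k)%:R = (size (cands s k 0 ++ cands s k M))%:R :> R.
  by rewrite size_cat !size_map !size_iota addnn -mul2n.
apply: (@EW_imp _ _ _ _ (fun w => hits_frame l M (Y w) && slow M L (Y w) || crooked s M k (Y w) ||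
  cut_broken s M k (Y w) || arm_hit_after l s M k (Y w) ||
  arm_hit_before l s M k (Y w) && slow M L (Y w) || near_past M (Y w) H || past_arm_hit l s M (Y w) Hc ||
  arm_near_past l s M k (Y w) H)).
  move=> w _ /andP[] /[swap] sl; rewrite /fails sl /= !andbT -!orbA.
  by [].
apply: EW_or; last exact: arm_near_prob.
apply: EW_or; last exact: past_arm_prob.
apply: EW_or; last exact: near_past_prob.
apply: EW_or; last first.
  have -> : k%:R = (size (cands s k M))%:R :> R by rewrite size_map size_iota.
  apply: (@EW_imp _ _ _ _ (fun w => has (fun t => (straight s (Y w) t &&
     has (fun a => on_arm l s (Y w t) (Y w a)) (iota 0 t)) && slow M L (Y w)) (cands s k M))).
    by move=> w _ /andP[/hasP[t tc h] sl]; apply: (has_mem tc); rewrite h.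
  by apply: EW_has => t /(cands_bound skM)[Mt tM]; apply: arm_before_prob; lia.
apply: EW_or; last first.
  by rewrite sz; apply: EW_has => t /cands2_bound[Mt tM]; apply: arm_after_prob; lia.
apply: EW_or; last first.
  by rewrite sz; apply: EW_has => t /cands2_bound[Mt tM]; apply: cut_prob; lia.
apply: EW_or; last exact: crooked_prob.
exact: frame_prob.
Qed.

End SuperblockProbability.

(** * Choosing the scales of a superblock *)

Section Estimates.
Variables (R : realType) (d' : nat).
Notation d := d'.+1.
Hypothesis d_gt4 : (4 < d)%N.
Notation density := (density R d').
Notation c0 := ((hk_const d)%:R : R).

Lemma inv_sqrt_telescope f : (1 < f)%N ->
  (f%:R * Num.sqrt f%:R)^-1 <= 2 * ((Num.sqrt f.-1%:R)^-1 - (Num.sqrt f%:R)^-1) :> R.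
Proof.
move=> f1; set b := Num.sqrt f%:R; set a := Num.sqrt f.-1%:R.
have a0 : 0 < a by rewrite sqrtr_gt0 ltr0n; lia.
have b0 : 0 < b by rewrite sqrtr_gt0 ltr0n; lia.
have a2 : a ^+ 2 = f.-1%:R by rewrite sqr_sqrtr ?ler0n.
have b2 : b ^+ 2 = f%:R by rewrite sqr_sqrtr ?ler0n.
have ab : b ^+ 2 = a ^+ 2 + 1 by rewrite a2 b2 natr1 prednK //; lia.
have ale : a <= b by rewrite -(@ler_pXn2r _ 2) ?nnegrE ?sqrtr_ge0 // ab lerDl.
rewrite -b2; have -> : 2 * (a^-1 - b^-1) = 2 * (b - a) / (a * b) by field; lra.
rewrite ler_pdivlMr ?mulr_gt0 // mulrC ler_pdivrMr ?mulr_gt0 ?exprn_gt0 //.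
have e : (b - a) * (b + a) = 1 by rewrite -subr_sqr ab addrAC subrr add0r.
have h : a * b * 1 <= 2 * (b - a) * (b ^+ 2 * b); last by rewrite mulr1 in h.
rewrite -{1}e; have -> : a * b * ((b - a) * (b + a)) = (b - a) * (a * b * (b + a)) by ring.
have -> : 2 * (b - a) * (b ^+ 2 * b) = (b - a) * (2 * (b ^+ 2 * b)) by ring.
apply: ler_wpM2l; first by rewrite subr_ge0.
have -> : 2 * (b ^+ 2 * b) = b * b * (b + b) by ring.
have bb := ltW b0; have aa := ltW a0.
by apply: ler_pM; rewrite ?mulr_ge0 ?addr_ge0 ?ler_wpM2r ?lerD2l.
Qed.

(** This is the place of [d >= 5]: [f^(1 - d/2) <= f^(-3/2)]. *)
Lemma density_mul f : (0 < f)%N -> f%:R * density f <= c0 ^+ d * (f%:R * Num.sqrt f%:R)^-1.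
Proof.
move=> f0; set b := Num.sqrt f%:R : R; have b2 : b ^+ 2 = f%:R by rewrite sqr_sqrtr ?ler0n.
have b1 : 1 <= b by rewrite -(@ler_pXn2r _ 2) ?nnegrE ?sqrtr_ge0 ?expr1n ?b2 ?ler1n //.
have b0 : 0 < b by lra.
rewrite /density -/b expr_div_n mulrCA ler_wpM2l ?exprn_ge0 ?ler0n //.
rewrite ler_pdivrMr ?exprn_gt0 // -b2 mulrC ler_pdivlMr ?mulr_gt0 ?exprn_gt0 //.
by rewrite -!exprSr -exprD ler_weXn2l //; lia.
Qed.

Lemma sum_density s n : (1 < s)%N ->
  \sum_(s <= f < n) f%:R * density f <= c0 ^+ d * (2 / Num.sqrt s.-1%:R).
Proof.
move=> s1; apply: (@le_trans _ _ (\sum_(s <= f < n) c0 ^+ d * (2 * ((Num.sqrt f.-1%:R)^-1 - (Num.sqrt f%:R)^-1)))).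
  rewrite [leLHS]big_nat_cond [leRHS]big_nat_cond; apply: ler_sum => f; rewrite andbT => /andP[sf _].
  apply: le_trans (density_mul _) _; first lia.
  by rewrite ler_wpM2l ?exprn_ge0 ?ler0n // inv_sqrt_telescope //; lia.
rewrite -!mulr_sumr ler_wpM2l ?exprn_ge0 ?ler0n // ler_wpM2l //.
have [sn|sn] := leqP s n; last by rewrite big_geq ?invr_ge0 ?sqrtr_ge0 // ltnW.
have -> : \sum_(s <= f < n) ((Num.sqrt f.-1%:R)^-1 - (Num.sqrt f%:R)^-1) =
    (Num.sqrt s.-1%:R)^-1 - (Num.sqrt n.-1%:R)^-1 :> R.
  elim: n sn => [|n IH]; first by rewrite leqn0 => /eqP->; rewrite big_geq // subrr.
  rewrite leq_eqVlt => /orP[/eqP<-|sn]; first by rewrite big_geq // subrr.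
  by rewrite big_nat_recr //= IH // addrA subrK.
by rewrite gerBl invr_ge0 sqrtr_ge0.
Qed.

Lemma density_large A L n : (0 < A)%N -> (0 < L)%N -> (L ^ 2 <= 16 * A ^ 2 * n)%N ->
  density n <= (4 * A%:R * c0) ^+ d / L%:R ^+ d.
Proof.
move=> A0 L0 h; have n0 : (0 < n)%N by case: n h => //; rewrite muln0 leqn0 expn_eq0; lia.
rewrite /density -expr_div_n lerXn2r ?nnegrE ?divr_ge0 ?mulr_ge0 ?ler0n ?sqrtr_ge0 //.
rewrite ler_pdivrMr ?sqrtr_gt0 ?ltr0n //.
have -> : 4 * A%:R * c0 / L%:R * Num.sqrt n%:R = c0 * (4 * A%:R * Num.sqrt n%:R / L%:R) by ring.
rewrite ler_peMr ?ler0n // ler_pdivlMr ?ltr0n // mul1r.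
rewrite -(@ler_pXn2r _ 2) ?nnegrE ?mulr_ge0 ?ler0n ?sqrtr_ge0 // !exprMn sqr_sqrtr ?ler0n //.
by rewrite -!natrX -!natrM ler_nat; apply: leq_trans h _; lia.
Qed.

Lemma combine_bounds (e K' v a1 a2 a3 kk p r a6 a7 a8 b c1 c5 c6 c7 c8 : R) :
  a1 <= c1 * K' / v -> a2 + a3 + kk * p <= b -> kk * r <= c5 * K' / v ->
  a6 <= c6 * K' / v -> a7 <= c7 * K' / v -> a8 <= c8 * K' / v ->
  a1 + e + a2 + a3 + kk * (p + r) + a6 + a7 + a8 <= e + b + (c1 + c5 + c6 + c7 + c8) * K' / v.
Proof. by rewrite !mulrDl mulrDr; lra. Qed.

Section Choice.
Variables (A k s g : nat).
Hypotheses (A0 : (0 < A)%N) (k0 : (0 < k)%N) (s0 : (1 < s)%N) (g_large : (s + 8 * A ^ 2 * (s * k) <= g)%N).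
Notation L := (g ^ 4)%N.
Notation l := (g ^ 3)%N.
Notation M := (L ^ 2 %/ (2 * A ^ 2))%N.
Notation K := ((4 * A%:R * c0) ^+ d).

Lemma scales : [/\ (0 < g)%N, (2 * s * k <= M)%N, (s <= l)%N, (L ^ 2 <= 16 * A ^ 2 * M./2)%N &
  [/\ (1 < M)%N, (2 * M <= L ^ 2)%N, (M.+1 <= L ^ 2)%N & (s + l <= L)%N]].
Proof.
have g2 : (1 < g)%N by lia.
have gl : (g <= l)%N by rewrite -[X in (X <= _)%N]expn1 leq_pexp2l //; lia.
have gL : (g <= L ^ 2)%N by rewrite -expnM -[X in (X <= _)%N]expn1 leq_pexp2l //; lia.
have A2 : (0 < 2 * A ^ 2)%N by rewrite muln_gt0 expn_gt0 A0.
have h := divn_eq (L ^ 2) (2 * A ^ 2); have h2 := ltn_pmod (L ^ 2) A2.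
have sk : (0 < s * k)%N by rewrite muln_gt0 k0 andbT; lia.
have M1 : (4 * (s * k) <= M)%N.
  by rewrite leq_divRL //; apply: leq_trans gL; apply: leq_trans g_large; nia.
have l2 : (2 * l <= L)%N by rewrite [L]expnS leq_mul2r g2 orbT.
move: h h2; set M' := M in M1 *; set r := (_ %% _)%N => h h2.
split; [lia|lia|lia| |split; [lia| |nia|lia]]; rewrite h.
  by have := odd_double_half M'; case: (odd M'); rewrite -muln2; nia.
by rewrite mulnC -[X in (X <= _)%N]addn0 leq_add // leq_mul2l; apply/orP; right; nia.
Qed.

Lemma ratio_le (a b c : R) (i j : nat) : 0 <= c -> (i + 1 <= j)%N -> a <= c * g%:R ^+ i ->
  b <= K / g%:R ^+ j -> 0 <= b -> 0 <= a -> a * b <= c * K / g%:R.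
Proof.
have [gp _ _ _ _] := scales; have g1 : 1 <= g%:R :> R by rewrite ler1n.
have g0 : 0 < g%:R :> R by lra.
move=> c0' ij ha hb b0 a0; apply: le_trans (ler_pM a0 b0 ha hb) _.
rewrite mulrACA mulrA -mulrA ler_wpM2l ?mulr_ge0 ?exprn_ge0 ?mulr_ge0 ?ler0n //.
rewrite ler_pdivrMr ?exprn_gt0 // mulrC ler_pdivlMr // -exprSr ler_weXn2l //; lia.
Qed.

Variables (N : nat) (y : 'rV['Z_N]_d) (H Hc : seq 'rV['Z_N]_d).
Hypotheses (N_gt2 : (2 < N)%N) (LN : (8 * L <= N)%N).
Hypotheses (sizeH : (size H <= g ^ 10)%N) (sizeHc : (size Hc <= 2 * k * g ^ 2)%N).
Notation dir := ('I_d * bool)%type.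
Notation q := ((#|{: dir}|%:R : R)^-1 ^+ (2 * s)).

Let DgA : L%:R ^+ d = g%:R ^+ (4 * d) :> R. Proof. by rewrite natrX -exprM. Qed.

Let densM : density M <= K / g%:R ^+ (4 * d).
Proof.
have [gp _ _ LM [M1 _ _ _]] := scales; rewrite -DgA; apply: density_large => //.
  by rewrite expn_gt0 gp.
by apply: leq_trans LM _; rewrite leq_mul2l; apply/orP; right; lia.
Qed.

Let densH : density M./2 <= K / g%:R ^+ (4 * d).
Proof.
have [gp _ _ LM _] := scales; rewrite -DgA; apply: density_large => //.
by rewrite expn_gt0 gp.
Qed.

Let short_card : (#|short_offset l s : pred 'rV['Z_N]_d| <= 2 ^ d * 125 * g ^ 9)%N.
Proof.
have [gp _ sl _ _] := scales; have l0 : (0 < l)%N by rewrite expn_gt0 gp.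
apply: leq_trans (card_short_offset d' s N_gt2 l0) _.
have -> : (2 ^ d * 125 * g ^ 9 = 2 ^ d * (5 * l) ^ 3)%N by rewrite expnMn -expnM mulnA.
rewrite leq_mul2l leq_exp2r //; apply/orP; right; move: sl l0; move: (g ^ 3)%N; clear; lia.
Qed.

(** Powers of [g]: the frame term has order [g^(8 + 3 + 4 (d - 3) - 4 d) = g^-1]. Short offsets
    number [g^9], the histories at most [g^10] and [2 k g^2], the times [g^8], so the history terms
    carry at most [g^19] against a density [g^(-4 d) <= g^-20]. The term with [sqrt s] is free of
    [g]. *)
Lemma fails_bound : EW (2 * M) (fun w => (fails l s M k L (pos y w) H Hc && slow M L (pos y w))%:R) <=
  (1 - q) ^+ k + (k%:R * q) * (c0 ^+ d * (8 * 3 ^+ d + 16 * d%:R + 8 * d%:R * 3 ^+ d * K) * (2 / Num.sqrt s.-1%:R))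
  + (2 ^+ d * 216 * 3 ^+ d + k%:R * (2 ^+ d * 125) + 3 ^+ d + 2 * k%:R * (2 ^+ d * 125) + k%:R * (2 ^+ d * 125)) * K / g%:R.
Proof.
have [gp skM sl LM [M1 ML ML1 slL]] := scales.
have l0 : (0 < l)%N by rewrite expn_gt0 gp.
have L8 : (L ^ 2 = g ^ 8)%N by rewrite -expnM.
have gR0 : 0 < g%:R :> R by rewrite ltr0n.
have K0 : 0 <= K by rewrite exprn_ge0 ?mulr_ge0 ?ler0n.
have [DM0 DH0] := (density_ge0 R d' M, density_ge0 R d' M./2).
have MN : (2 * M <= N ^ 2)%N by apply: leq_trans ML _; rewrite leq_exp2r //; move: LN; move: (g ^ 4)%N; clear; lia.
have slN : (4 * (s + l) <= N)%N by move: slL LN; move: (g ^ 4)%N (g ^ 3)%N; clear; lia.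
have s_gt0 : (0 < s)%N by exact: ltnW.
have d3 : (3 < d)%N by move: d_gt4; clear; lia.
have := @fails_prob R d' N l s M k L N_gt2 l0 s_gt0 d3 skM MN M1 slN y H Hc; move/le_trans; apply.
have sd := sum_density (2 * M).+1 s0; set S := \sum_(_ <= f < _) _ in sd *.
set B := c0 ^+ d * (2 / Num.sqrt s.-1%:R) in sd.
have S0 : 0 <= S by apply: sumr_ge0 => f _; rewrite mulr_ge0 ?density_ge0.
have q0 : 0 <= q by rewrite exprn_ge0 ?invr_ge0 ?ler0n.
have d20 : (20 <= 4 * d)%N by move: d_gt4; clear; lia.
have t1 : M.+1%:R * (#|[pred x : 'rV['Z_N]_d | frame l x && (nrm (x - y)%R <= L)%N]|%:R * density M) <=
    (2 ^+ d * 216 * 3 ^+ d) * K / g%:R.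
  have LN2 : (2 * L < N)%N by move: LN N_gt2; move: (g ^ 4)%N; clear; lia.
  have d41 : (4 * d - 1 + 1 <= 4 * d)%N by clear; lia.
  have cR : 0 <= (2 ^ d * 216 * 3 ^ d)%:R :> R by rewrite ler0n.
  have aR : M.+1%:R * #|[pred x : 'rV['Z_N]_d | frame l x && (nrm (x - y)%R <= L)%N]|%:R <= (2 ^ d * 216 * 3 ^ d)%:R * g%:R ^+ (4 * d - 1) :> R.
    rewrite -natrX -!natrM ler_nat.
    apply: leq_trans (leq_mul ML1 (card_frame N_gt2 l0 y (ltnW d3) LN2)) _.
  have -> : (2 * L %/ l = 2 * g)%N by rewrite [L]expnS mulnA mulnK.
  apply: (@leq_trans (g ^ 8 * (2 ^ d * ((6 * g) ^ 3 * (3 * L) ^ (d - 3))))%N).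
    rewrite L8 !leq_mul2l; apply/orP; right; apply/orP; right.
    have d3' : (0 < d - 3)%N by move: d_gt4; clear; lia.
    have L0 : (0 < L)%N by rewrite expn_gt0 gp.
    by apply: leq_mul; rewrite leq_exp2r //; [move: gp|move: L0; move: (g ^ 4)%N]; clear; lia.
  have -> : (4 * d - 1 = 8 + (3 + 4 * (d - 3)))%N by move: d_gt4; clear; lia.
  have e1 : ((3 * L) ^ (d - 3) = 3 ^ (d - 3) * g ^ (4 * (d - 3)))%N by rewrite expnMn -(expnM g 4).
    have e2 : ((6 * g) ^ 3 = 216 * g ^ 3)%N by rewrite (expnMn 6 g).
    have e3 : (g ^ (8 + (3 + 4 * (d - 3))) = g ^ 8 * (g ^ 3 * g ^ (4 * (d - 3))))%N by rewrite (expnD g 8) (expnD g 3).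
    rewrite e1 e2 e3; move: (g ^ (4 * (d - 3)))%N => w.
  apply: (@leq_trans (2 ^ d * 216 * 3 ^ (d - 3) * (g ^ 8 * (g ^ 3 * w)))%N).
    move: (2 ^ d)%N (3 ^ (d - 3))%N (g ^ 8)%N (g ^ 3)%N => u1 u2 u3 u4.
    by rewrite leq_eqVlt; apply/orP; left; apply/eqP; clear; lia.
  by rewrite leq_mul2r leq_mul2l leq_pexp2l ?leq_subr ?orbT.
  have := ratio_le cR d41 aR densM DM0 (mulr_ge0 (ler0n _ _) (ler0n _ _)).
  by rewrite [(2 ^ d * 216 * 3 ^ d)%:R]natrM [(2 ^ d * 216)%:R]natrM !natrX mulrA.
have t5 : #|[pred x : 'rV['Z_N]_d | (nrm (x - y)%R <= L)%N]|%:R * density M./2 <= 3 ^+ d * K.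
  apply: (@le_trans _ _ ((3 ^+ d * g%:R ^+ (4 * d)) * (K / g%:R ^+ (4 * d)))); last first.
    by rewrite mulrACA mulrA -mulrA mulfV ?mulr1 // expf_neq0 // gt_eqF.
  apply: ler_pM => //; rewrite -!natrX -natrM ler_nat; apply: leq_trans (card_ball N_gt2 y L) _.
  have -> : (3 ^ d * g ^ (4 * d) = (3 * L) ^ d)%N by rewrite expnMn -expnM.
  have L0 : (0 < L)%N by rewrite expn_gt0 gp.
  by rewrite leq_exp2r //; move: L0; move: (g ^ 4)%N; clear; lia.
have tb (a c : nat) (i : nat) : (a <= c * g ^ i)%N -> (i <= 19)%N -> (a%:R * density M <= c%:R * K / g%:R) /\
    (a%:R * density M./2 <= c%:R * K / g%:R).
  move=> ha hi; have ha' : a%:R <= c%:R * g%:R ^+ i :> R by rewrite -natrX -natrM ler_nat.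
  have i4 : (i + 1 <= 4 * d)%N by move: hi d20; clear; lia.
  by split; apply: (ratio_le (ler0n _ _) i4 ha' _ _ (ler0n _ _)).
have t5b : k%:R * ((2 * M)%:R * (#|short_offset l s : pred 'rV['Z_N]_d|%:R * density M./2)) <=
    k%:R * (2 ^+ d * 125) * K / g%:R.
  have h : (k * (2 * M) * #|short_offset l s : pred 'rV['Z_N]_d| <= k * (2 ^ d * 125) * g ^ 17)%N.
    have -> : (k * (2 ^ d * 125) * g ^ 17 = k * g ^ 8 * (2 ^ d * 125 * g ^ 9))%N.
      rewrite (expnD g 8 9); move: (2 ^ d)%N (g ^ 8)%N (g ^ 9)%N => u1 u2 u3; clear; lia.
    by rewrite leq_mul // leq_mul2l -L8 ML orbT.
  have [_ {}h] := tb _ _ 17%N h isT; move: h.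
  by rewrite (natrM _ (k * (2 * M))) (natrM _ k (2 * M)) (natrM _ k (2 ^ d * 125)) (natrM _ (2 ^ d) 125) (natrX _ 2) !mulrA.
have t6 : M.+1%:R * ((size H)%:R * ((3 ^ d)%:R * density M)) <= 3 ^+ d * K / g%:R.
  have h : (M.+1 * size H * 3 ^ d <= 3 ^ d * g ^ 18)%N.
    have -> : (3 ^ d * g ^ 18 = g ^ 8 * g ^ 10 * 3 ^ d)%N by rewrite -expnD mulnC.
    by rewrite leq_mul2r leq_mul ?orbT // -L8.
  have [{}h _] := tb _ _ 18%N h isT; move: h.
  by rewrite (natrM _ (M.+1 * size H)) (natrM _ M.+1) !(natrX _ 3) !mulrA.
have t7 : M.+1%:R * ((size Hc)%:R * (#|short_offset l s : pred 'rV['Z_N]_d|%:R * density M)) <=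
    2 * k%:R * (2 ^+ d * 125) * K / g%:R.
  have h : (M.+1 * size Hc * #|short_offset l s : pred 'rV['Z_N]_d| <= 2 * k * (2 ^ d * 125) * g ^ 19)%N.
    have -> : (2 * k * (2 ^ d * 125) * g ^ 19 = g ^ 8 * (2 * k * g ^ 2) * (2 ^ d * 125 * g ^ 9))%N.
      rewrite (expnD g 8 11) (expnD g 2 9); move: (2 ^ d)%N (g ^ 8)%N (g ^ 9)%N (g ^ 2)%N => u1 u2 u3 u4; clear; lia.
    by rewrite leq_mul // leq_mul // -L8.
  have [{}h _] := tb _ _ 19%N h isT; move: h.
  by rewrite (natrM _ (M.+1 * size Hc)) (natrM _ M.+1) (natrM _ (2 * k)) (natrM _ 2 k) (natrM _ (2 ^ d) 125) (natrX _ 2) !mulrA.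
have t8 : k%:R * ((size H)%:R * (#|short_offset l s : pred 'rV['Z_N]_d|%:R * density M)) <=
    k%:R * (2 ^+ d * 125) * K / g%:R.
  have h : (k * size H * #|short_offset l s : pred 'rV['Z_N]_d| <= k * (2 ^ d * 125) * g ^ 19)%N.
    have -> : (k * (2 ^ d * 125) * g ^ 19 = k * g ^ 10 * (2 ^ d * 125 * g ^ 9))%N.
      rewrite (expnD g 10 9); move: (2 ^ d)%N (g ^ 10)%N (g ^ 9)%N => u1 u2 u3; clear; lia.
    by rewrite leq_mul // leq_mul2l sizeH orbT.
  have [{}h _] := tb _ _ 19%N h isT; move: h.
  by rewrite (natrM _ (k * size H)) (natrM _ k (size H)) (natrM _ k (2 ^ d * 125)) (natrM _ (2 ^ d) 125) (natrX _ 2) !mulrA.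
have t34 : (2 * k)%:R * (q * ((4 * 3 ^ d)%:R * S)) + (2 * k)%:R * (q * ((8 * d)%:R * S)) +
    k%:R * (q * ((8 * d)%:R * (#|[pred x : 'rV['Z_N]_d | (nrm (x - y)%R <= L)%N]|%:R * density M./2 * S))) <=
    k%:R * q * (c0 ^+ d * (8 * 3 ^+ d + 16 * d%:R + 8 * d%:R * 3 ^+ d * K) * (2 / Num.sqrt s.-1%:R)).
  apply: (@le_trans _ _ (k%:R * q * ((8 * 3 ^+ d + 16 * d%:R + 8 * d%:R * (3 ^+ d * K)) * S))).
    have h : #|[pred x : 'rV['Z_N]_d | (nrm (x - y)%R <= L)%N]|%:R * density M./2 * S <= 3 ^+ d * K * S by rewrite ler_wpM2r.
    set X := _ * S in h *; have -> : k%:R * q * ((8 * 3 ^+ d + 16 * d%:R + 8 * d%:R * (3 ^+ d * K)) * S) =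
      (2 * k)%:R * (q * ((4 * 3 ^ d)%:R * S)) + (2 * k)%:R * (q * ((8 * d)%:R * S)) + k%:R * (q * ((8 * d)%:R * (3 ^+ d * K * S))).
      by rewrite !natrM natrX; ring.
    by rewrite lerD2l !ler_wpM2l ?ler0n.
  rewrite -[8 * d%:R * 3 ^+ d * K]mulrA; set C := _ + 8 * d%:R * _.
  have -> : k%:R * q * (c0 ^+ d * C * (2 / Num.sqrt s.-1%:R)) = k%:R * q * (C * B) by rewrite /B; ring.
  rewrite ler_wpM2l ?mulr_ge0 ?ler0n // ler_wpM2l //.
  by do ?[exact: ler0n|exact: K0|apply: addr_ge0|apply: mulr_ge0|apply: exprn_ge0].
exact: (combine_bounds _ t1 t34 t5b t6 t7 t8).
Qed.

End Choice.

Lemma nat_above (x : R) : exists n : nat, (0 < n)%N /\ x <= n%:R.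
Proof.
exists (Num.truncn `|x|).+1; split=> //; apply: le_trans (ler_norm x) _.
exact: ltW (truncnS_gt _).
Qed.

Notation dir := ('I_d * bool)%type.

(** Order of the choices: [kap = k q] makes [(1 - q)^k] small; then [s] large makes the return terms
    small, although [k] depends on [s], because they contain only the product [k q]; finally [g] is
    taken large. *)
Lemma fails_small (delta : R) (A : nat) : 0 < delta -> (0 < A)%N ->
  exists k s G : nat, [/\ (0 < k)%N, (1 < s)%N & forall g : nat, (G <= g)%N ->
    (s + 8 * A ^ 2 * (s * k) <= g)%N /\
    forall N (y : 'rV['Z_N]_d) (H Hc : seq 'rV['Z_N]_d), (2 < N)%N -> (8 * g ^ 4 <= N)%N ->
    (size H <= g ^ 10)%N -> (size Hc <= 2 * k * g ^ 2)%N ->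
    forall M, M = ((g ^ 4) ^ 2 %/ (2 * A ^ 2))%N ->
    EW (2 * M) (fun w => (fails (g ^ 3) s M k (g ^ 4) (pos y w) H Hc && slow M (g ^ 4) (pos y w))%:R) <= delta].
Proof.
move=> dl0 A0; have [kap [kap0 hkap]] := nat_above (3 / delta).
pose K : R := (4 * A%:R * c0) ^+ d.
have K0 : 0 <= K by rewrite exprn_ge0 ?mulr_ge0 ?ler0n.
pose CA : R := c0 ^+ d * (8 * 3 ^+ d + 16 * d%:R + 8 * d%:R * 3 ^+ d * K).
have CA0 : 0 <= CA by do ?[exact: ler0n|exact: K0|apply: addr_ge0|apply: mulr_ge0|apply: exprn_ge0].
have [s1 [_ hs1]] := nat_above ((6 * kap%:R * CA / delta) ^+ 2).
pose s := s1.+2; pose Q := (#|{: dir}| ^ (2 * s))%N; pose k := (kap * Q)%N.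
have dir0 : (0 < #|{: dir}|)%N by exact: dir_gt0.
have Q0 : (0 < Q)%N by rewrite expn_gt0 dir0.
have k0 : (0 < k)%N by rewrite muln_gt0 kap0.
pose CB : R := (2 ^+ d * 216 * 3 ^+ d + k%:R * (2 ^+ d * 125) + 3 ^+ d + 2 * k%:R * (2 ^+ d * 125) + k%:R * (2 ^+ d * 125)) * K.
have [G1 [_ hG1]] := nat_above (3 * CB / delta).
exists k, s, (G1 + (s + 8 * A ^ 2 * (s * k)))%N; split=> // g hg.
have gl : (s + 8 * A ^ 2 * (s * k) <= g)%N by apply: leq_trans hg; exact: leq_addl.
split=> [|N y H Hc N2 gN sH sHc]; first exact: gl.
move=> M ->; apply: le_trans (@fails_bound A k s g A0 k0 isT gl N y H Hc N2 gN sH sHc) _.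
rewrite -/CA -/CB.
set q := _ ^+ (2 * s); have qE : q = Q%:R^-1 by rewrite /q exprVn natrX.
have kq : k%:R * q = kap%:R by rewrite qE natrM mulfK // pnatr_eq0 -lt0n.
have q01 : 0 <= q <= 1 by rewrite qE invr_ge0 ler0n /= invf_le1 ?ltr0n // ler1n.
have b1 : (1 - q) ^+ k <= delta / 3.
  have := bernoulli_inv k q01; rewrite kq => h.
  have kapR : 0 < 1 + kap%:R :> R by rewrite ltr_pwDl ?ler0n.
  rewrite -ler_pdivlMr // div1r in h; apply: le_trans h _.
  rewrite invf_ple ?posrE ?divr_gt0 // invf_div; apply: le_trans hkap _; lra.
have b2 : k%:R * q * (CA * (2 / Num.sqrt s.-1%:R)) <= delta / 3.
  rewrite kq; have s10 : 0 < Num.sqrt s.-1%:R :> R by rewrite sqrtr_gt0 ltr0n.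
  have h : 6 * kap%:R * CA / delta <= Num.sqrt s.-1%:R.
    have x0 : 0 <= 6 * kap%:R * CA / delta by do ?[exact: ler0n|exact: CA0|exact: ltW|apply: mulr_ge0|rewrite invr_ge0].
    rewrite -(@ler_pXn2r _ 2) ?nnegrE ?sqrtr_ge0 // sqr_sqrtr ?ler0n //.
    by apply: le_trans hs1 _; rewrite ler_nat /s.
  have aux (v c kp : R) : 0 < v -> 6 * kp * c / delta <= v -> kp * (c * (2 / v)) <= delta / 3.
    by move=> v0; rewrite ler_pdivrMr // => h'; rewrite !mulrA ler_pdivrMr //; lra.
  exact: aux.
have b3 : CB / g%:R <= delta / 3.
  have g0 : (0 < g)%N by alia.
  have h : 3 * CB / delta <= g%:R by apply: le_trans hG1 _; rewrite ler_nat; alia.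
  rewrite ler_pdivrMr // in h; rewrite ler_pdivrMr ?ltr0n //; lra.
by lra.
Qed.

End Estimates.

(** * Good boxes *)

Section Embedding.
Variables (d' N : nat).
Notation d := d'.+1.
Hypothesis N_gt2 : (2 < N)%N.
Notation T := 'rV['Z_N]_d.
Notation dir := ('I_d * bool)%type.
Implicit Types (x y z : T).

Section Emb.
Variables (c : T) (r : nat).
Hypothesis rN : (4 * r < N)%N.
Notation box := (box d (2 * r)).
Implicit Types (u v w : box).

(* The cube of radius [r] around [c], as a box in the lattice. *)
Definition emb v : T := \row_i (c 0 i + ((v i)%:R - r%:R)).

Lemma embB u v i : (emb u - emb v) 0 i = (u i)%:R - (v i)%:R.
Proof. by rewrite !mxE opprD addrACA subrr add0r opprB addrA subrK. Qed.

Lemma cyc_embB u v i : cyc ((emb u - emb v) 0 i) = ((u i - v i) + (v i - u i))%N.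
Proof.
rewrite embB; have [iu iv] := (ltn_ord (u i), ltn_ord (v i)).
have [h|h] := leqP (v i) (u i).
  by rewrite -natrB // cyc_eq //; lia.
rewrite -cycN opprB -natrB; last exact: ltnW.
by rewrite cyc_eq //; lia.
Qed.

Lemma nrm_embB u v : nrm (emb u - emb v) = linf u v.
Proof.
apply: eq_bigr => i _; rewrite cyc_embB; move: (nat_of_ord _) (nat_of_ord _); clear; lia.
Qed.

Lemma emb_ball v : (nrm (emb v - c) <= r)%N.
Proof.
apply/nrmP => i; rewrite !mxE addrAC subrr add0r; have iv := ltn_ord (v i).
have [h|h] := leqP r (v i).
  by rewrite -natrB //; apply: leq_trans (cyc_nat N_gt2 _) _; move: iv h; move: (nat_of_ord _); clear; lia.
rewrite -cycN opprB -natrB; last exact: ltnW.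
by apply: leq_trans (cyc_nat N_gt2 _) _; exact: leq_subr.
Qed.

Lemma emb_surj z : (nrm (z - c) <= r)%N -> exists v, emb v = z.
Proof.
move=> /nrmP h.
have hi i : exists k : 'I_(2 * r).+1, c 0 i + (k%:R - r%:R) = z 0 i.
  have := h i; rewrite !mxE => hz; have e : z 0 i = c 0 i + (z 0 i - c 0 i) by rewrite addrC subrK.
  rewrite e; case: (cycP (z 0 i - c 0 i)) => ->; move: hz; move: (cyc _) => a ha.
    have lt : (r + a < (2 * r).+1)%N by move: ha; clear; lia.
    by exists (Ordinal lt); rewrite /= natrD addrAC subrr add0r.
  have lt : (r - a < (2 * r).+1)%N by move: ha; clear; lia.
  by exists (Ordinal lt); rewrite /= natrB // addrAC subrr add0r.
have [f fE] := fin_all_exists hi; exists (finfun f); apply/rowP => i.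
by rewrite mxE ffunE.
Qed.

Lemma emb_center : emb [ffun=> inord r] = c.
Proof. by apply/rowP => i; rewrite !mxE ffunE inordK ?subrr ?addr0 // mul2n -addnn ltnS leq_addr. Qed.

Lemma emb_coord v q i : (nrm (emb v - c) <= q)%N -> (v i <= r + q)%N.
Proof.
rewrite -[in X in nrm X]emb_center nrm_embB => /linfP/(_ i)[h _]; move: h.
by rewrite ffunE inordK // mul2n -addnn ltnS leq_addr.
Qed.

Lemma nn_emb u v : nn u v -> exists e : dir, emb v = emb u + vec N e.
Proof.
case/nnP => k [h1 h2].
have eqr (a b : 'I_(2 * r).+1) : a.+1 = b :> nat -> (b%:R : 'Z_N) = a%:R + 1 by move=> <-; rewrite natr1.
case: h2 => [/eqr h2|/eqr h2].
  exists (k, true); rewrite vecE scale1r; apply/rowP => i; rewrite !mxE unit_vecE.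
  have [->|ik] := eqVneq i k; last by rewrite addr0 h1.
  by rewrite h2 !addrA [_ + 1 - _]addrAC.
exists (k, false); rewrite vecE scaleN1r; apply/rowP => i; rewrite !mxE unit_vecE.
have [->|ik] := eqVneq i k; last by rewrite subr0 h1.
by rewrite h2 !addrA [X in _ = X - 1]addrAC addrK.
Qed.

Lemma emb_nn u v (e : dir) : emb v = emb u + vec N e -> nn u v.
Proof.
case: e => k a; rewrite vecE => E; have D i : cyc ((emb v - emb u) 0 i) = (i == k).
  rewrite E addrAC subrr add0r !mxE unit_vecE.
  have -> : cyc ((if a then 1 else -1) * (i == k)%:R : 'Z_N) = cyc ((i == k)%:R : 'Z_N).
    by case: (a); rewrite ?mul1r ?mulN1r ?cycN.
  by rewrite cyc_eq //; case: (_ == _) => //; lia.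
apply/nnP; exists k; split=> [i ik|]; last by have := D k; rewrite cyc_embB eqxx; lia.
by apply: ord_inj; have := D i; rewrite cyc_embB (negPf ik); lia.
Qed.

End Emb.

Definition lstep x y : bool := [exists e : dir, y == x + vec N e].

Definition lgr (S : pred T) : rel T := fun x y => [&& S x, S y & lstep x y].

Lemma lstep_sym : symmetric lstep.
Proof.
have h x y : lstep x y -> lstep y x.
  case/existsP => -[k a] /eqP->; apply/existsP; exists (k, ~~ a).
  by apply/eqP; rewrite -addrA !vecE -scalerDl; case: (a); rewrite /= ?subrr ?addNr ?scale0r ?addr0.
by move=> x y; apply/idP/idP; exact: h.
Qed.

Lemma lgr_sym S : symmetric (lgr S).
Proof. by move=> x y; rewrite /lgr lstep_sym andbCA. Qed.

Lemma lgr_csym S : connect_sym (lgr S).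
Proof. exact: sym_connect_sym (@lgr_sym S). Qed.

Lemma lstep_nrm x y : lstep x y -> (nrm (y - x) <= 1)%N.
Proof. by case/existsP => e /eqP->; rewrite addrAC subrr add0r nrm_vec. Qed.

Lemma connect_emb c r (S : pred (box d (2 * r))) (P : pred T) u v :
  (4 * r < N)%N -> (forall w, S w -> P (emb c w)) -> connect (gr S) u v ->
  connect (lgr P) (emb c u) (emb c v).
Proof.
move=> rN SP /connectP[p]; elim: p u => [|w p IH] u /=; first by move=> _ ->.
case/andP=> /and3P[Su Sw uw] pw e; apply: connect_trans (IH w pw e); apply: connect1.
rewrite /lgr !SP //=; have [f ->] := nn_emb c uw.
by apply/existsP; exists f.
Qed.

(** The path is followed until it first reaches distance [q]; up to then it stays in the cube, where
    torus steps are box steps. *)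
Lemma lift_far c r (P : pred T) a z q : (4 * r < N)%N -> (nrm (emb c a - c) + q <= r)%N ->
  connect (lgr P) (@emb c r a) z -> (q <= nrm (z - emb c a))%N -> P (emb c a) ->
  exists b, [/\ connect (gr (fun w => P (emb c w))) a b, (q <= nrm (emb c b - emb c a))%N &
    (nrm (emb c b - emb c a) <= q)%N].
Proof.
move=> rN aq /connectP[p pz ->] {z} far Pa.
suff gen u : connect (gr (fun w => P (emb c w))) a u -> (nrm (emb c u - emb c a) <= q)%N ->
    path (lgr P) (emb c u) p -> (q <= nrm (last (emb c u) p - emb c a))%N ->
    exists b, [/\ connect (gr (fun w => P (emb c w))) a b, (q <= nrm (emb c b - emb c a))%N &
      (nrm (emb c b - emb c a) <= q)%N].
  by apply: (gen a) => //; rewrite ?connect0 // subrr nrm0.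
elim: p u {pz far} => [|z p IH] u au uq /=; first by move=> _ h; exists u.
case/andP=> /and3P[Pu Pz uz] pz far.
have [h|h] := leqP q (nrm (emb c u - emb c a)); first by exists u.
have zq : (nrm (z - emb c a) <= q)%N.
  apply: leq_trans (nrm_triangle N_gt2 z (emb c u) _) _.
  by apply: leq_trans (leq_add (lstep_nrm uz) (leqnn _)) _; rewrite add1n.
have [w ew] : exists w, @emb c r w = z.
  apply: emb_surj => //; apply: leq_trans (nrm_triangle N_gt2 z (emb c a) _) _.
  by apply: leq_trans (leq_add zq (leqnn _)) _; rewrite addnC.
subst z; apply: (IH w) => //; apply: connect_trans au _; apply: connect1.
rewrite /gr Pu Pz /=; case/existsP: uz => e /eqP; exact: emb_nn.
Qed.

Section FrameConnected.
Variables (l : nat) (c : T) (r : nat).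
Hypotheses (l_gt0 : (0 < l)%N) (d_gt3 : (3 < d)%N) (rN : (4 * r < N)%N) (lr : (l <= r)%N).
Notation box := (box d (2 * r)).
Notation e := (@emb c r).

(* Move coordinate [i] of [v] up to the next multiple of [l]. *)
Definition up (v : box) i : 'I_(2 * r).+1 := inord (v i + next_grid l 0 true (e v 0%R i)).

Lemma upP (v : box) i : (v i + l <= 2 * r)%N ->
  [/\ (v i <= up v i)%N, (up v i <= v i + l)%N & grid l (c 0 i + ((up v i)%:R - r%:R))].
Proof.
move=> h; have [_ b g] := next_gridP N_gt2 l_gt0 0 true (e v 0 i).
rewrite /up inordK; last by move: h b; move: (nat_of_ord _); clear; lia.
split; [exact: leq_addr|by move: b; clear; lia|].
by rewrite natrD addrAC addrA; move: g; rewrite mxE.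
Qed.

Lemma frameE (v : box) : frame l (e v) = (2 < #|[pred i | grid l (c 0%R i + ((v i)%:R - r%:R))%R]|)%N.
Proof. by rewrite /frame; congr (_ < _)%N; apply: eq_card => i; rewrite !inE mxE. Qed.

Lemma grid_vertex : exists g : box, forall i, grid l (c 0 i + ((g i)%:R - r%:R)).
Proof.
pose v : box := [ffun=> ord0]; exists (finfun (up v)) => i; rewrite ffunE.
by have [] := @upP v i; rewrite // ffunE /=; move: lr; clear; lia.
Qed.

(** First move the coordinates that are not multiples of [l], while the three or more that are stay
    fixed. After that all coordinates are multiples, and moving one at a time leaves [d - 1 >= 3] of
    them. *)
Lemma frame_connect (v g : box) : (forall i, grid l (c 0 i + ((g i)%:R - r%:R))) -> frame l (e v) ->
  connect (gr (fun w => frame l (e w))) v g.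
Proof.
move=> gg fv; pose G := [pred i | grid l (c 0 i + ((v i)%:R - r%:R))].
have fG : (2 < #|G|)%N by rewrite frameE in fv.
have S1 := @connect_move _ _ (fun w => frame l (e w)) (enum [predC G]) v g (enum_uniq _).
apply: connect_trans (S1 _) _ => {S1}.
  move=> v' k t; rewrite mem_enum => kG _ v'v _; rewrite frameE; apply: leq_trans fG _.
  apply: subset_leq_card; apply/subsetP => i iG; rewrite !inE ffunE.
  have [ik|ik] := eqVneq i k; first by rewrite -ik inE iG in kG.
  by rewrite v'v // mem_enum inE iG.
set v1 : box := finfun _.
have v1g i : grid l (c 0 i + ((v1 i)%:R - r%:R)).
  by rewrite ffunE mem_enum inE; case: ifP => // /negbFE.
have S2 := @connect_move _ _ (fun w => frame l (e w)) (enum 'I_d) v1 g (enum_uniq _).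
rewrite [g in connect _ _ g](_ : g = [ffun i => if i \in enum 'I_d then g i else v1 i]); last first.
  by apply/ffunP => i; rewrite ffunE mem_enum.
apply: S2 => v' k t _ hv' _ _; rewrite frameE.
apply: (@leq_trans #|predC1 k|); first by rewrite cardC1 card_ord.
apply: subset_leq_card; apply/subsetP => i; rewrite !inE ffunE => /negPf->.
by case: (hv' i) => ->.
Qed.

Lemma frame_up (v : box) (r3 : seq 'I_d) : uniq r3 -> size r3 = 3%N ->
  (forall i, (v i + l <= 2 * r)%N) -> frame l (e [ffun i => if i \in r3 then up v i else v i]).
Proof.
move=> u3 s3 hv; rewrite frameE; apply: (@leq_trans #|r3|); first by rewrite (card_uniqP u3) s3.
apply: subset_leq_card; apply/subsetP => i ir; rewrite !inE ffunE ir.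
by have [] := upP (hv i).
Qed.

End FrameConnected.

End Embedding.

(** * The walk seen from an anchor *)

Section PathEvents.
Variables (d' N s M k L : nat).
Notation d := d'.+1.
Notation T := 'rV['Z_N]_d.
Implicit Types (X : nat -> T) (p x y z : T).

Definition near p x : bool := (nrm (x - p) <= 41 * L)%N.

(* Block [j] is the time interval [j M, (j+1) M]; it is the second half of the
   superblock starting at [(j-1) M]. *)
Definition touches X p j : bool := has (fun t => near p (X t)) (index_iota (j * M) (j * M + M).+1).

Definition past X p n : seq T := [seq X t | t <- iota 0 n & near p (X t)].

Definition past_cands X p n : seq T :=
  [seq X t | t <- iota 0 n & (t %% M \in cands s k 0)%N && near p (X t)].

Definition superblock X j : nat -> T := fun t => X (j.-1 * M + t)%N.

(** Observation starts at time [M], so that every observed block is the second half of a superblock.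
    The uniform start makes this shift harmless, see [walk_shift]. *)
Definition unvisited X Tl x : bool := ~~ has (fun t => X t == x) (index_iota M (M + Tl).+1).

End PathEvents.

(** * Good anchors join far-reaching vacant sites to the frame *)

Section Local.
Variables (d' N l s M k L nb Tl : nat).
Notation d := d'.+1.
Notation T := 'rV['Z_N]_d.
Hypotheses (N_gt2 : (2 < N)%N) (l_gt0 : (0 < l)%N) (s_gt0 : (0 < s)%N) (d_gt3 : (3 < d)%N).
Hypotheses (skM : (2 * s * k <= M)%N) (slL : (s + l <= L)%N) (LN : (4 * (40 * L) < N)%N).
Variables (X : nat -> T) (p : T).
Hypothesis total : (M + Tl < nb.+1 * M)%N.
Notation touches := (touches M L X p).
Notation fail j := (fails l s M k L (superblock M X j) (past L X p (j.-1 * M)) (past_cands s M k L X p (j.-1 * M))).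
Hypothesis ok : forall j, (0 < j <= nb)%N -> touches j -> ~~ fail j.
Notation vac := (unvisited M X Tl).
Notation e0 := (unit_vec N ord0).

Let M_gt0 : (0 < M)%N. Proof. by move: total; case: (M) => //; rewrite muln0. Qed.

Lemma visitedP x : reflect (exists2 t, (M <= t <= M + Tl)%N & X t = x) (~~ vac x).
Proof.
rewrite negbK; apply: (iffP hasP) => [[t]|[t tM <-]].
  by rewrite mem_index_iota ltnS => tM /eqP <-; exists t.
by exists t => //; rewrite mem_index_iota ltnS.
Qed.

Lemma block_of t : (M <= t <= M + Tl)%N ->
  exists j, [/\ (0 < j <= nb)%N, (j * M <= t)%N & (t < j * M + M)%N].
Proof.
move=> /andP[Mt tT]; exists (t %/ M)%N; have := divn_eq t M; have := ltn_pmod t M_gt0.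
rewrite divn_gt0 // Mt /= => h e; have : (t %/ M < nb.+1)%N by rewrite ltn_divLR //; apply: leq_ltn_trans total.
by rewrite ltnS => ->; split=> //; move: h e; move: (t %/ M * M)%N; clear; lia.
Qed.

Lemma touchesI j t : (j * M <= t <= j * M + M)%N -> near L p (X t) -> touches j.
Proof. by move=> tj h; apply/hasP; exists t; rewrite // mem_index_iota ltnS. Qed.

Lemma near40 x : (nrm (x - p) <= 40 * L)%N -> near L p x.
Proof. by rewrite /near => h; apply: leq_trans h _; rewrite leq_mul2r orbT. Qed.

Lemma frame_unvisited x : frame l x -> (nrm (x - p) <= 40 * L)%N -> vac x.
Proof.
move=> fx xp; case: (boolP (vac x)) => // /visitedP[t /block_of[j [jb jt tj]] tx].
have tt : (j * M <= t <= j * M + M)%N by lia.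
have tn : near L p (X t) by rewrite tx near40.
have [_ /hasPn h _ _ _ _ _ _ _] := not_fails (ok jb (touchesI tt tn)); 
have tm : (t - j.-1 * M)%N \in index_iota M (2 * M).+1.
  by rewrite mem_index_iota; case: (j) jb jt tj => //= i _; lia.
have := h _ tm; rewrite /superblock subnKC ?tx ?fx //.
by case: (j) jb jt => //= i _; rewrite mulSn; clear; lia.
Qed.

(** The cut segments: near [p] they separate earlier from later sites ([wire_cut]), and their arms
    are vacant ([wire_arm]). *)
Definition wire j t : bool :=
  [&& (0 < j <= nb)%N, touches j, t \in cands s k (j * M) & straight s X t].

Lemma cand_shift m a t : t \in cands s k m -> (t + a)%N \in cands s k (m + a).
Proof. by case/mapP => i ik ->; apply/mapP; exists i => //; rewrite addnAC. Qed.

Lemma straight_shift a t : (s <= t)%N -> straight s (fun u => X (a + u)%N) t = straight s X (a + t).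
Proof. by move=> st; apply: eq_all => i; rewrite -!addnBA // !addnA. Qed.

Lemma wire_bound j t : wire j t -> (j * M + s <= t)%N /\ (t + s <= j * M + M)%N.
Proof. by case/and4P=> _ _ tc _; exact: cands_bound tc. Qed.

Lemma wire_exists j : (0 < j <= nb)%N -> touches j -> exists t, wire j t.
Proof.
move=> jb tj; have [_ _ [t tc st] _ _ _ _ _ _] := not_fails (ok jb tj); have [t1 t2] := cands_bound skM tc.
rewrite straight_shift in st; last lia.
exists (j.-1 * M + t)%N; rewrite /wire jb tj st andbT /= addnC.
by case: (j) jb tc => //= i _ tc; rewrite mulSn; exact: cand_shift.
Qed.

(** Superblocks overlap by one block, so the superblock [j'] is [j] or [j + 1], and the wire is a
    candidate of its second or first half respectively. *)
Lemma wire_in_superblock j t j' : wire j t -> (j'.-1 * M <= t)%N -> (t < j' * M + M)%N -> (0 < j')%N ->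
  [/\ straight s (superblock M X j') (t - j'.-1 * M),
      (t - j'.-1 * M)%N \in cands s k 0 ++ cands s k M & (j' = j -> (t - j'.-1 * M)%N \in cands s k M)].
Proof.
move=> w jt tj j0; have [t1 t2] := wire_bound w; case/and4P: (w) => jb tcj tc st.
case: j' j0 jt tj => // i _ /= jt tj.
have cases : j = i \/ j = i.+1.
  have h1 : (i < j.+1)%N by rewrite -(ltn_pmul2r M_gt0); move: jt t2 s_gt0; rewrite mulSn; clear; lia.
  have h2 : (j < i.+2)%N by rewrite -(ltn_pmul2r M_gt0); move: tj t1 s_gt0; rewrite !mulSn; clear; lia.
  by move: h1 h2; clear; lia.
have sb : (s <= t - i * M)%N by case: cases => e; rewrite e in t1; nia.
have tci : t \in cands s k (i * M) -> (t - i * M)%N \in cands s k 0.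
  by case/mapP => a ak ->; apply/mapP; exists a => //; rewrite addnAC addnC add0n addnK.
have tci1 : t \in cands s k (i.+1 * M) -> (t - i * M)%N \in cands s k M.
  by case/mapP => a ak ->; apply/mapP; exists a => //; rewrite mulSn -!addnA addnCA addKn.
split; first by rewrite straight_shift ?subnKC.
  by rewrite mem_cat; case: cases => e; rewrite e in tc; [rewrite tci|rewrite tci1 ?orbT].
by move=> e; apply: tci1; rewrite e.
Qed.

Lemma mem_past j t : (t < j)%N -> near L p (X t) -> X t \in past L X p j.
Proof. by move=> tj nt; apply: map_f; rewrite mem_filter nt mem_iota. Qed.

(** The superblock of the later time [b] decides: there [a] either belongs to the history, excluded
    by [near_past], or the wire is one of its candidates, and [cut_broken] applies. *)
Lemma wire_cut j t a b : wire j t -> (M <= a < t)%N -> (t < b <= M + Tl)%N ->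
  near L p (X a) -> near L p (X b) -> (1 < nrm (X a - X b))%N.
Proof.
move=> w /andP[Ma at_] /andP[tb bT] na nb_; rewrite ltnNge; apply/negP => ab.
have [|j' [jb jt tj]] := @block_of b; first alia.
have tt : (j' * M <= b <= j' * M + M)%N by alia.
have [_ _ _ /hasPn cut _ _ /hasPn np _ _] := not_fails (ok jb (touchesI tt nb_)).
have jM : (j'.-1 * M + M = j' * M)%N by case: (j') jb => //= i _; rewrite mulSn addnC.
have [h|h] := ltnP a (j'.-1 * M).
  have := np (b - j'.-1 * M)%N; rewrite mem_index_iota => /(_ _)/negP[]; first alia.
  apply: (has_mem (mem_past h na)); rewrite /superblock subnKC; last alia.
  by rewrite nrmB.
have [|||st tc _] := @wire_in_superblock j t j' w; [alia|alia|alia|].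
have := cut _ tc; rewrite st andTb => /hasPn/(_ (a - j'.-1 * M)%N).
rewrite mem_iota => /(_ _)/negP[]; first alia.
have bm : (b - j'.-1 * M)%N \in index_iota (t - j'.-1 * M).+1 (2 * M).+1.
  by rewrite mem_index_iota; alia.
apply: (has_mem bm); rewrite /superblock !subnKC //; alia.
Qed.

(** A visit after the wire is excluded in the superblock of the visit, by [arm_hit_after], or by
    [past_arm_hit] if the wire is already history. A visit before it is excluded in the superblock
    of the wire, by [arm_hit_before] or [arm_near_past]. A visit at time [t] itself contradicts
    [arm_l1]. *)
Lemma wire_arm j t c sg i : wire j t -> (M <= t <= M + Tl)%N -> (nrm (X t - p) <= 39 * L)%N ->
  c != ord0 -> (0 < i <= arm_len l s (X t) c sg)%N ->
  vac (arm l s (X t) c sg i) /\ (nrm (arm l s (X t) c sg i - p) <= 40 * L)%N.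
Proof.
move=> w tT tp c0 /andP[i0 il].
have off := @arm_offset _ _ l s N_gt2 l_gt0 d_gt3 (X t) c sg i.
have zp : (nrm (arm l s (X t) c sg i - p) <= 40 * L)%N.
  apply: leq_trans (nrm_triangle N_gt2 _ (X t) _) _.
  by case/andP: off => h _; move: h tp slL; clear; lia.
split=> //; case: (boolP (vac _)) => // /visitedP[b bT bz].
have zn : near L p (X b) by rewrite bz near40.
have tn : near L p (X t) by apply: near40; apply: leq_trans tp _; rewrite leq_mul2r orbT.
have /and4P[jb' tcj tc st] := w; have [t1 t2] := wire_bound w.
have arm_on : on_arm l s (X t) (X b).
  apply/existsP; exists (c, sg); rewrite c0 /=.
  have im : i \in iota 1 (arm_len l s (X t) c sg) by rewrite mem_iota; alia.
  by apply: (has_mem im); rewrite bz.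
have [tb|bt|tb] := ltngtP t b.
- have [j' [jb jt tj]] := block_of bT.
  have tt : (j' * M <= b <= j' * M + M)%N by alia.
  have [_ _ _ _ /hasPn after _ _ /hasPn pa _] := not_fails (ok jb (touchesI tt zn)).
  have jM : (j'.-1 * M + M = j' * M)%N by case: (j') jb => //= u _; rewrite mulSn addnC.
  have [h|h] := ltnP t (j'.-1 * M).
    have := pa (b - j'.-1 * M)%N; rewrite mem_index_iota => /(_ _)/negP[]; first alia.
    have tin : X t \in past_cands s M k L X p (j'.-1 * M).
      apply: map_f; rewrite mem_filter tn mem_iota add0n leq0n h !andbT.
      case/mapP: tc => a ak et; rewrite et modnMDl modn_small; last by move: t2; rewrite et; move: s_gt0; clear; lia.
      by apply/mapP; exists a.
    by apply: (has_mem tin); rewrite /superblock subnKC ?bz //; alia.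
  have [|||st' tc' _] := @wire_in_superblock j t j' w; [alia|alia|alia|].
  have := after _ tc'; rewrite st' andTb => /negP[].
  have bm : (b - j'.-1 * M)%N \in index_iota (t - j'.-1 * M).+1 (2 * M).+1.
    by rewrite mem_index_iota; alia.
  by apply: (has_mem bm); rewrite /superblock !subnKC //; alia.
- have [_ _ _ _ _ /hasPn before _ _ /hasPn an] := not_fails (ok jb' tcj).
  have jM : (j.-1 * M + M = j * M)%N by case: (j) jb' => //= u _; rewrite mulSn addnC.
  have [|||st' _ /(_ erefl) tc'] := @wire_in_superblock j t j w; [alia|alia|alia|].
  have [h|h] := ltnP b (j.-1 * M).
    have := an _ tc' => /negP[]; apply: (has_mem (mem_past h zn)).
    by rewrite /superblock subnKC ?bz //; alia.
  have := before _ tc'; rewrite st' andTb => /negP[].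
  have bm : (b - j.-1 * M)%N \in iota 0 (t - j.-1 * M) by rewrite mem_iota; alia.
  by apply: (has_mem bm); rewrite /superblock !subnKC //; alia.
- have := @arm_l1 _ _ l s N_gt2 l_gt0 d_gt3 (X t) c sg i s%:R c0.
  rewrite -bz -tb opprD addrA subrr add0r => /(_ _ il) h.
  have : (s + i <= s)%N; last alia.
  have sN : (2 * (s + l) <= N)%N by move: slL LN; clear; lia.
  apply: leq_trans (h sN _) _; first by apply: cyc_eq => //; move: sN; clear; lia.
  rewrite -scaleNr /l1norm (bigD1 ord0) //= big1 => [|u u0].
    by rewrite addn0 !mxE unit_vecE eqxx mulr1 cycN cyc_nat.
  by rewrite !mxE unit_vecE (negPf u0) mulr0 cyc0.
Qed.

Lemma slow_block j a b : (0 < j <= nb)%N -> touches j -> (j.-1 * M <= a <= j * M + M)%N ->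
  b = (j.-1 * M)%N -> (nrm (X a - X b) < L)%N.
Proof.
move=> jb tj aj ->; have [/allP/(_ (a - j.-1 * M)%N) h _ _ _ _ _ _ _ _] := not_fails (ok jb tj).
have jM : (j.-1 * M + M = j * M)%N by case: (j) jb => //= u _; rewrite mulSn addnC.
move: h; rewrite mem_index_iota /superblock addn0 subnKC; last lia.
by apply; lia.
Qed.

Lemma arm_connect (g : box d (2 * (40 * L))) j t c sg i w :
  (forall i, grid l (p 0 i + ((g i)%:R - (40 * L)%:R))) ->
  wire j t -> (M <= t <= M + Tl)%N -> (nrm (X t - p) <= 39 * L)%N ->
  c != ord0 -> (0 < i <= arm_len l s (X t) c sg)%N -> emb p w = arm l s (X t) c sg i ->
  connect (gr (fun w => vac (emb p w))) w g.
Proof.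
move=> gg wr tT tp c0; have [n en] : exists n, n = (arm_len l s (X t) c sg - i)%N by exists (arm_len l s (X t) c sg - i)%N.
elim: n i w en => [|n IH] i w en ib ew.
  have {}en : i = arm_len l s (X t) c sg by alia.
  have fw : frame l (emb p w) by rewrite ew en; exact: arm_frame.
  move: (frame_connect d_gt3 gg fw); apply: sub_gr => v fv.
  by apply: frame_unvisited => //; exact: emb_ball.
have il : (i < arm_len l s (X t) c sg)%N by alia.
have [e1 ee] := arm_step N_gt2 l_gt0 d_gt3 il.
have [va _] := wire_arm wr tT tp c0 ib.
have ib' : (0 < i.+1 <= arm_len l s (X t) c sg)%N by rewrite /= il.
have [va' ball'] := wire_arm wr tT tp c0 ib'.
have [w' ew'] := emb_surj ball'.
apply: connect_trans (IH i.+1 w' _ ib' ew'); last by alia.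
apply: connect1; rewrite /gr ew va ew' va' /=; apply: (@emb_nn d' N N_gt2 p (40 * L) LN w w' e1).
by rewrite ew ew' ee.
Qed.

(** The superblock of [j0] is slow, so the next block starts near [p], is therefore touched and
    contains a wire, unless observation ends first. [lower_wire] is the same towards the past. *)
Lemma upper_wire j0 t0 : (0 < j0 <= nb)%N -> touches j0 -> (j0 * M <= t0 < j0 * M + M)%N ->
  (nrm (X t0 - p) <= 3 * L)%N -> (t0 <= M + Tl)%N -> (0 < L)%N ->
  exists hi, [/\ (t0 < hi)%N,
    (M + Tl < hi)%N \/ exists j, [&& wire j hi, (M < hi < M + Tl)%N & (nrm (X hi - p) <= 39 * L)%N] &
    forall t, (j0 * M <= t < hi)%N -> (t <= M + Tl)%N -> (nrm (X t - X (j0 * M)%N) <= 2 * L)%N].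
Proof.
move=> jb tj jt t0p tT L0.
have jM : (j0.-1 * M + M = j0 * M)%N by case: (j0) jb => //= u _; rewrite mulSn addnC.
have in0 t : (j0 * M <= t <= j0 * M + M)%N -> (nrm (X t - X (j0 * M)%N) <= 2 * L)%N.
  move=> tb; have h1 : (nrm (X t - X (j0.-1 * M)%N) < L)%N by apply: (slow_block jb tj) => //; alia.
  have h2 : (nrm (X (j0 * M)%N - X (j0.-1 * M)%N) < L)%N by apply: (slow_block jb tj) => //; alia.
  have := nrm_triangle N_gt2 (X t) (X (j0.-1 * M)%N) (X (j0 * M)%N); rewrite [X in (_ <= _ + X)%N -> _]nrmB.
  by move: h1 h2; clear; lia.
have [jn|jn] := ltnP j0 nb; last first.
  exists (M + Tl).+1; split; [by []|by left|] => t tb tT'; apply: in0.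
  have : (nb.+1 * M <= j0 * M + M)%N by rewrite mulSn addnC leq_add2r leq_mul2r jn orbT.
  by move: total tb tT'; clear; lia.
have j1 : (0 < j0.+1 <= nb)%N by [].
have t0M : (nrm (X t0 - X (j0 * M)%N) <= 2 * L)%N by apply: in0; alia.
have base : (nrm (X (j0 * M)%N - p) <= 5 * L)%N.
  have := nrm_triangle N_gt2 (X (j0 * M)%N) (X t0) p; rewrite [nrm (X (j0 * M)%N - X t0)]nrmB.
  by move: t0M t0p; clear; lia.
have tj1 : touches j0.+1.
  apply: (@touchesI _ (j0.+1 * M)); first by rewrite leqnn leq_addr.
  have := in0 (j0.+1 * M)%N; rewrite mulSn addnC => /(_ _) h; rewrite /near.
  have {}h : (nrm (X (M + j0 * M)%N - X (j0 * M)%N) <= 2 * L)%N by rewrite addnC; apply: h; rewrite leqnn leq_addr.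
  have := nrm_triangle N_gt2 (X (M + j0 * M)%N) (X (j0 * M)%N) p; rewrite addnC; rewrite addnC in h.
  by move: h base; clear; lia.
have [w wr] := wire_exists j1 tj1; have [w1 w2] := wire_bound wr.
have in1 t : (j0 * M <= t <= j0 * M + M + M)%N -> (nrm (X t - X (j0 * M)%N) < L)%N.
  move=> tb; apply: (slow_block j1 tj1) => //=; rewrite mulSn; move: tb; clear; lia.
rewrite mulSn in w1 w2.
have [wT|wT] := ltnP w (M + Tl).
  exists w; split; first alia.
    right; exists j0.+1; rewrite wr wT andbT /=.
    have := in1 w; have := nrm_triangle N_gt2 (X w) (X (j0 * M)%N) p.
    have Mw : (M < w)%N by alia.
    rewrite Mw /= => h1 h2; apply: leq_trans h1 _; have {}h2 : (nrm (X w - X (j0 * M)%N) < L)%N by apply: h2; alia.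
    by move: h2 base; clear; lia.
  move=> t tb _; have h : (nrm (X t - X (j0 * M)%N) < L)%N by apply: in1; alia.
  by move: h; clear; lia.
exists (M + Tl).+1; split; [by []|by left|] => t tb tT'.
have h : (nrm (X t - X (j0 * M)%N) < L)%N by apply: in1; alia.
by move: h; clear; lia.
Qed.

Lemma lower_wire j0 t0 : (0 < j0 <= nb)%N -> touches j0 -> (j0 * M <= t0 < j0 * M + M)%N ->
  (nrm (X t0 - p) <= 3 * L)%N -> (t0 <= M + Tl)%N -> (0 < L)%N ->
  exists lo, [/\ (lo < t0)%N,
    (lo < M)%N \/ exists j, [&& wire j lo, (M < lo < M + Tl)%N & (nrm (X lo - p) <= 39 * L)%N] &
    forall t, (lo < t < j0 * M)%N -> (M <= t)%N -> (nrm (X t - X (j0 * M)%N) <= 2 * L)%N].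
Proof.
move=> jb tj jt t0p tT L0.
have jM : (j0.-1 * M + M = j0 * M)%N by case: (j0) jb => //= u _; rewrite mulSn addnC.
have in0 t : (j0.-1 * M <= t <= j0 * M + M)%N -> (nrm (X t - X (j0 * M)%N) <= 2 * L)%N.
  move=> tb; have h1 : (nrm (X t - X (j0.-1 * M)%N) < L)%N by apply: (slow_block jb tj) => //; alia.
  have h2 : (nrm (X (j0 * M)%N - X (j0.-1 * M)%N) < L)%N by apply: (slow_block jb tj) => //; alia.
  have := nrm_triangle N_gt2 (X t) (X (j0.-1 * M)%N) (X (j0 * M)%N); rewrite [X in (_ <= _ + X)%N -> _]nrmB.
  by move: h1 h2; clear; lia.
have t0M : (nrm (X t0 - X (j0 * M)%N) <= 2 * L)%N by apply: in0; alia.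
have base : (nrm (X (j0 * M)%N - p) <= 5 * L)%N.
  have := nrm_triangle N_gt2 (X (j0 * M)%N) (X t0) p; rewrite [nrm (X (j0 * M)%N - X t0)]nrmB.
  by move: t0M t0p; clear; lia.
have [j1|j1] := ltnP 1 j0; last first.
  have e : (j0 * M = M)%N by rewrite (_ : j0 = 1%N) ?mul1n //; alia.
  exists M.-1; rewrite e in jt *; split; first by move: M_gt0 jt; clear; lia.
    by left; rewrite prednK.
  by move=> t tb Mt; exfalso; move: tb Mt; clear; lia.
have j1b : (0 < j0.-1 <= nb)%N by alia.
have tj1 : touches j0.-1.
  apply: (@touchesI _ (j0 * M)); first by rewrite -jM leqnn leq_addr.
  by rewrite /near; move: base; clear; lia.
have [w wr] := wire_exists j1b tj1; have [w1 w2] := wire_bound wr.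
have Mw : (M <= j0.-1 * M)%N by rewrite -[X in (X <= _)%N]mul1n leq_mul2r; apply/orP; right; alia.
exists w; split; first alia.
  right; exists j0.-1; rewrite wr /=; apply/andP; split; first by alia.
  have h1 := nrm_triangle N_gt2 (X w) (X (j0 * M)%N) p.
  have h2 : (nrm (X w - X (j0 * M)%N) <= 2 * L)%N by apply: in0; alia.
  by move: h1 h2 base; clear; lia.
by move=> t tb Mt; apply: in0; alia.
Qed.

(** Suppose not, and let [W] be the component of [a] off [U], the vacant component of the frame
    together with the wire centres. Its boundary is star-connected and consists of visited sites off
    the wires. Star-neighbours are not separated in time by a wire, so the boundary is visited
    between two wires only and stays within [2 L] of one point [c]. But [W] contains a site [b] at
    distance [10 L] from [a], and a hyperplane through [b] leads to the frame without meeting that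
    boundary. *)
Lemma frame_near x z : (nrm (x - p) <= 2 * L)%N -> vac x -> connect (lgr vac) x z ->
  (10 * L <= nrm (z - x))%N ->
  exists2 f, frame l f & connect (lgr (fun y => vac y && (nrm (y - p)%R <= 40 * L)%N)) x f.
Proof.
move=> xp vx xz far; have L0 : (0 < L)%N by move: slL s_gt0; clear; lia.
have xb : (nrm (x - p) <= 40 * L)%N by apply: leq_trans xp _; rewrite leq_mul2r orbT.
have lL : (l <= 40 * L)%N by move: slL; clear; lia.
have [a ea] := emb_surj xb; subst x.
have aq : (nrm (emb p a - p) + 10 * L <= 40 * L)%N.
  by apply: leq_trans (leq_add xp (leqnn _)) _; rewrite -mulnDl leq_mul2r orbT.
have [b [cab farb nearb]] := @lift_far d' N N_gt2 p (40 * L) vac a z (10 * L) LN aq xz far vx.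
have [g gg] := grid_vertex N_gt2 p l_gt0 lL.
pose V (w : box d (2 * (40 * L))) := vac (emb p w).
have fg : frame l (emb p g).
  rewrite frameE; apply: (@leq_trans #|'I_d|); first by rewrite card_ord; exact: ltnW.
  by apply: subset_leq_card; apply/subsetP => i _; rewrite inE.
have Vf w : frame l (emb p w) -> V w by move=> fw; apply: frame_unvisited => //; exact: emb_ball.
have conn_f w : frame l (emb p w) -> connect (gr V) g w.
  move=> fw; rewrite gr_csym; move: (frame_connect d_gt3 gg fw); apply: sub_gr => v.
  exact: Vf.
have [cag|nag] := boolP (connect (gr V) a g).
  exists (emb p g) => //; apply: (connect_emb LN _ cag) => w Vw.
  by apply/andP; split; [exact: Vw|exact: emb_ball].
exfalso.
pose wired (w : box d (2 * (40 * L))) := has (fun j => has (fun t => [&& wire j t, (nrm (X t - p) <= 39 * L)%N & X t == emb p w])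
  (index_iota M.+1 (M + Tl))) (iota 0 nb.+1).
have wiredP w : wired w -> exists j t, [/\ wire j t, (M < t < M + Tl)%N, (nrm (X t - p) <= 39 * L)%N & X t = emb p w].
  case/hasP => j _ /hasP[t]; rewrite mem_index_iota => tM /and3P[h1 h2 /eqP h3].
  by exists j, t.
have wiredI j t w : wire j t -> (M < t < M + Tl)%N -> (nrm (X t - p) <= 39 * L)%N -> X t = emb p w -> wired w.
  move=> wr tM tp tw; have /and4P[jb _ _ _] := wr.
  have jm : j \in iota 0 nb.+1 by rewrite mem_iota; alia.
  have tm : t \in index_iota M.+1 (M + Tl) by rewrite mem_index_iota.
  by apply: (has_mem jm); apply: (has_mem tm); rewrite wr tp tw eqxx.
have trace_nv t w : (M <= t <= M + Tl)%N -> X t = emb p w -> ~~ V w.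
  by move=> tM tw; apply/visitedP; exists t.
(* Wire centres may be added: they are joined to the frame through the first sites of their arms, so
   [U] stays connected, and they can no longer lie on the boundary of [W]. *)
pose U w := connect (gr V) g w || wired w.
have Vg : V g by exact: Vf.
have UV w : connect (gr V) g w -> V w by move=> h; exact: connect_gr_in Vg h.
have c1 : (inord 1 : 'I_d) != ord0 by rewrite -val_eqE /= inordK //; move: d_gt3; clear; lia.
have len1 t c sg : (0 < 1 <= arm_len l s (X t) c sg)%N.
  rewrite /arm_len; have [h _ _] := next_gridP N_gt2 l_gt0 s sg (X t 0 c).
  by move: h s_gt0; clear; lia.
have nbr j t (w v : box d (2 * (40 * L))) c sg : wire j t -> (M < t < M + Tl)%N -> (nrm (X t - p) <= 39 * L)%N ->
    c != ord0 -> X t = emb p w -> emb p v = X t + vec N (c, sg) -> connect (gr V) g v.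
  move=> wr tM tp c0 tw ev; rewrite gr_csym.
  apply: (arm_connect (c := c) (sg := sg) (i := 1) gg wr _ tp c0 (len1 _ _ _)); first alia.
  by rewrite ev arm_first.
have Uconn w : U w -> connect (gr U) g w.
  case/orP=> [h|wr].
    have h' := @connect_component _ _ V g g w (connect0 _ _) h.
    by apply: sub_gr h' => u hu; rewrite /U hu.
  have [j [t [wrj tM tp tw]]] := wiredP _ wr.
  have tM' : (M <= t <= M + Tl)%N by alia.
  have [_ ball1] := @wire_arm j t (inord 1) true 1 wrj tM' tp c1 (len1 _ _ _).
  have [v ev] := emb_surj ball1; rewrite arm_first // in ev.
  have gv := nbr j t w v (inord 1) true wrj tM tp c1 tw ev.
  have h' := @connect_component _ _ V g g v (connect0 _ _) gv.
  have Uv : U v by rewrite /U gv.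
  have {}h' : connect (gr U) g v by apply: sub_gr h' => u hu; rewrite /U hu.
  apply: connect_trans h' _; rewrite gr_csym; apply: connect1.
  have wv := @emb_nn d' N N_gt2 p (40 * L) LN w v (inord 1, true).
  by rewrite /gr Uv {1}/U wr orbT wv // -tw.
have Ua : ~~ U a.
  rewrite /U negb_or gr_csym nag /=; apply/negP => /wiredP[j [t [_ tM _ tw]]].
  by have := @trace_nv t a _ tw; rewrite /V vx => /(_ _)/negP[] //; alia.
(* A neighbour of a wire centre is the first site of an arm, joined to the frame, or the site
   visited just before or just after the centre. *)
have bd u : bdry (comp U a) u -> ~~ V u.
  move=> /(comp_bdry Ua)[_ nUu [v uv Uv]]; apply/negP => Vu.
  case/orP: Uv => [gv|/wiredP[j [t [wr tM tp tv]]]].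
    move: nUu; rewrite /U negb_or => /andP[/negP nU _]; apply: nU; apply: (connect_trans gv); apply: connect1.
    by rewrite /gr nn_sym uv Vu (UV _ gv).
  rewrite nn_sym in uv; have [[c sg] eu] := nn_emb p uv; rewrite -tv in eu.
  have [c0|c0] := eqVneq c ord0; last first.
    by move: nUu; rewrite /U (nbr j t v u c sg wr tM tp c0 tv eu).
  have /and4P[_ _ _ /allP st] := wr; have [w1 w2] := wire_bound wr.
  rewrite {}c0 vecE in eu; case: sg eu => /= eu.
    have := st s; rewrite mem_iota subnK; last alia.
    rewrite addnS subnK; last alia.
    move=> /(_ _)/eqP e; have : ~~ V u; last by rewrite Vu.
    apply: (@trace_nv t.+1); first alia.
    by rewrite e ?eu ?scale1r //; move: s_gt0; clear; lia.
  have := st s.-1; rewrite mem_iota prednK // subnK; last alia.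
  move=> /(_ _)/eqP e; have : ~~ V u; last by rewrite Vu.
  apply: (@trace_nv (t - s + s.-1)%N); first alia.
  rewrite eu e; last by move: s_gt0; clear; lia.
  by rewrite scaleN1r addrK.
have ap : (nrm (emb p a - p) <= 2 * L)%N by [].
have room i : (a i + l <= 2 * (40 * L))%N.
  by have := emb_coord N_gt2 LN i ap; move: slL; clear; lia.
pose r3 : seq 'I_d := [seq inord i | i <- iota 0 3].
have ur3 : uniq r3.
  rewrite map_inj_in_uniq ?iota_uniq // => i j; rewrite !mem_iota !add0n => /andP[_ i3] /andP[_ j3] e.
  by rewrite -(@inordK d' i) ?e ?inordK //; move: d_gt3 i3 j3; clear; lia.
pose a1 : box d (2 * (40 * L)) := [ffun i => if i \in r3 then up l p a i else a i].
have fa1 : frame l (emb p a1) by apply: (frame_up N_gt2 p l_gt0) => //; rewrite ?size_map ?size_iota.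
have ca1 : connect (gr (fun v => linf a v <= l)%N) a a1.
  have := @connect_move d (2 * (40 * L)) (fun v => linf a v <= l)%N r3 a [ffun i => up l p a i] ur3.
  rewrite (_ : finfun _ = a1); last by apply/ffunP => i; rewrite !ffunE.
  apply=> v k1 t _ hv _; rewrite ffunE => ht; apply/linfP => i; rewrite ffunE.
  have [u1 u2 _] := upP N_gt2 p l_gt0 (room i).
  have [ik|ik] := eqVneq i k1; first by subst k1; move: ht u1 u2; clear; lia.
  by case: (hv i) => ->; rewrite ?ffunE; move: u1 u2; clear; lia.
rewrite gr_csym in ca1.
have Wa : comp U a a by exact: connect0.
have nW1 : ~~ comp U a a1.
  apply/negP => /(comp_notin Ua); rewrite /U conn_f //.
(* [a1] is a frame site within [l] of [a], so some boundary site is this close to [a]. *)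
have [u0 u0a bu0] := crossing ca1 nW1 Wa.
have [t0 t0T tu0] := elimT (visitedP _) (bd _ bu0).
have [j0 [jb0 jt0 tj0]] := block_of t0T.
have nt0 : near L p (X t0) by rewrite tu0 near40 // emb_ball.
have tt0 : (j0 * M <= t0 <= j0 * M + M)%N by alia.
have tch0 := touchesI tt0 nt0.
have d0 : (nrm (X t0 - emb p a) <= l)%N by rewrite tu0 nrm_embB // linf_sym.
have d0p : (nrm (X t0 - p) <= 3 * L)%N.
  by have := nrm_triangle N_gt2 (X t0) (emb p a) p; move: d0 ap slL; clear; lia.
have tj0' : (j0 * M <= t0 < j0 * M + M)%N by rewrite jt0.
have [hi [hi0 hiw hic]] := upper_wire jb0 tch0 tj0' d0p (elimTF andP t0T).2 L0.
have [lo [lo0 low loc]] := lower_wire jb0 tch0 tj0' d0p (elimTF andP t0T).2 L0.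
(* The label used with [comp_bdry_star]: sites visited between the wires [lo] and [hi]. *)
pose Xp (v : box d (2 * (40 * L))) := has (fun t => [&& (lo < t)%N, (t < hi)%N & X t == emb p v]) (index_iota M (M + Tl).+1).
have star_closed u v : bdry (comp U a) u -> bdry (comp U a) v -> star u v -> Xp u -> Xp v.
  move=> bu bv uv /hasP[t]; rewrite mem_index_iota ltnS => tT /and3P[lt ht /eqP tu].
  have [t' tT' tv] := elimT (visitedP _) (bd _ bv).
  have nu : near L p (X t) by rewrite tu near40 // emb_ball.
  have nv : near L p (X t') by rewrite tv near40 // emb_ball.
  have duv : (nrm (X t - X t') <= 1)%N by rewrite tu tv nrm_embB.
  have notw j : ~~ [&& wire j t', (M < t' < M + Tl)%N & (nrm (X t' - p) <= 39 * L)%N].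
    apply/negP => /and3P[h1 h2 h3]; have [_ /negP nU _] := comp_bdry Ua bv; apply: nU.
    by rewrite /U (wiredI j t' v h1 h2 h3 tv) orbT.
  have tm' : t' \in index_iota M (M + Tl).+1 by rewrite mem_index_iota ltnS.
  apply: (has_mem tm'); rewrite tv eqxx andbT.
  have [h1|h1] := ltnP lo t'; have [h2|h2] := ltnP t' hi => //; exfalso.
  - case: hiw => [hT|[j /and3P[wr hM hp]]]; first by move: h2 tT' hT; clear; lia.
    move: h2; rewrite leq_eqVlt => /orP[/eqP e|h2].
      by have := notw j; rewrite -e wr hM hp.
    have := wire_cut wr (_ : (M <= t < hi)%N) (_ : (hi < t' <= M + Tl)%N) nu nv.
    by move=> h; move: duv; apply/negP; rewrite -ltnNge; apply: h; alia.
  - case: low => [hT|[j /and3P[wr hM hp]]]; first by move: h1 tT' hT; clear; lia.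
    move: h1; rewrite leq_eqVlt => /orP[/eqP e|h1].
      by have := notw j; rewrite e wr hM hp.
    have := wire_cut wr (_ : (M <= t' < lo)%N) (_ : (lo < t <= M + Tl)%N) nv nu.
    by move=> h; move: duv; apply/negP; rewrite -ltnNge nrmB; apply: h; alia.
  - by move: hi0 lo0 h1 h2; clear; lia.
have allX u : bdry (comp U a) u -> Xp u.
  move=> bu; have <- : Xp u0 = Xp u.
    apply: (@comp_bdry_star d (2 * (40 * L)) U a Xp Ua) => //.
    - by exists g; rewrite /U connect0.
    - by move=> v w Uv Uw; apply: connect_trans (Uconn w Uw); rewrite gr_csym; exact: Uconn.
    move=> v w bv bw vw; apply/idP/idP; apply: star_closed => //.
    by rewrite /star linf_sym.
  have tm : t0 \in index_iota M (M + Tl).+1 by rewrite mem_index_iota ltnS.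
  by apply: (has_mem tm); rewrite lo0 hi0 tu0 eqxx.
pose c := X (j0 * M)%N.
have bdc u : bdry (comp U a) u -> (nrm (emb p u - c) <= 2 * L)%N.
  move/allX => /hasP[t]; rewrite mem_index_iota ltnS => tT /and3P[lt ht /eqP <-].
  by have [h|h] := ltnP t (j0 * M); [apply: loc; alia|apply: hic; alia].
have Wb : comp U a b.
  have h' := @connect_component _ _ V a a b (connect0 _ _) cab.
  move: h'; apply: sub_gr => w aw; rewrite /U /= negb_or; apply/andP; split.
    apply: contra nag => gw; apply: connect_trans aw _; by rewrite gr_csym.
  apply/negP => /wiredP[j [t [_ tM _ tw]]].
  have := @trace_nv t w _ tw; rewrite (connect_gr_in vx aw) => /(_ _)/negP[] //; alia.
have bfar : (2 * L < nrm (emb p b - c))%N.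
  have t1 := nrm_triangle N_gt2 (emb p b) c (emb p a).
  have t2 := nrm_triangle N_gt2 c (X t0) (emb p a).
  have t3 : (nrm (c - X t0) <= 2 * L)%N by rewrite nrmB; apply: hic; [alia|case/andP: t0T].
  by move: farb t1 t2 t3 d0 slL s_gt0; clear; lia.
(* In coordinate [kk] the site [b] is beyond the whole boundary; three other coordinates are then
   moved to multiples of [l]. *)
have [kk hkk] : exists kk, (2 * L < cyc ((emb p b - c)%R 0%R kk))%N.
  apply/existsP; apply: contraTT bfar; rewrite negb_exists -leqNgt => /forallP h.
  by apply/nrmP => i; rewrite leqNgt.
pose r4 := take 3 (enum (predC1 kk)).
have ur4 : uniq r4 by rewrite take_uniq ?enum_uniq.
have sr4 : size r4 = 3%N.
  by rewrite size_takel // -cardE cardC1 card_ord; move: d_gt3; clear; lia.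
have kr4 i : i \in r4 -> i != kk by move/mem_take; rewrite mem_enum.
have bp : (nrm (emb p b - p) <= 12 * L)%N.
  by have := nrm_triangle N_gt2 (emb p b) (emb p a) p; move: nearb ap; clear; lia.
have room2 i : (b i + l <= 2 * (40 * L))%N.
  by have := emb_coord N_gt2 LN i bp; move: slL; clear; lia.
pose b1 : box d (2 * (40 * L)) := [ffun i => if i \in r4 then up l p b i else b i].
have fb1 : frame l (emb p b1) by apply: (frame_up N_gt2 p l_gt0).
have cb1 : connect (gr (fun v => v kk == b kk)) b b1.
  have := @connect_move d (2 * (40 * L)) (fun v => v kk == b kk) r4 b [ffun i => up l p b i] ur4.
  rewrite (_ : finfun _ = b1); last by apply/ffunP => i; rewrite !ffunE.
  apply=> v k1 t kin _ hv _; rewrite ffunE [kk == _]eq_sym (negPf (kr4 _ kin)) hv //.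
  by apply/negP => /kr4; rewrite eqxx.
rewrite gr_csym in cb1.
have nW2 : ~~ comp U a b1 by apply/negP => /(comp_notin Ua); rewrite /U conn_f.
have [u /eqP ukk bu] := crossing cb1 nW2 Wb.
have := leq_trans (cyc_nrm _ kk) (bdc u bu).
by rewrite leqNgt; move: hkk; rewrite !mxE ukk => ->.
Qed.

End Local.

From mathcomp Require Import boolp.

(** * Joint rarity of bad boxes *)

Ltac nneg := repeat first [assumption | exact: ler0n | exact: ler01 | exact: sqrtr_ge0
  | exact: density_ge0 | apply: addr_ge0 | apply: mulr_ge0 | apply: exprn_ge0 | rewrite invr_ge0
  | by apply: ltW].

Lemma exp_le2 (R : realType) (y : R) n : 0 <= y -> n%:R * y <= 1 / 2 -> (1 + y) ^+ n <= 2.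
Proof.
move=> y0 ny; have [->|n0] := posnP n; first by rewrite expr0; lra.
have n1 : 1 <= n%:R :> R by rewrite ler1n.
have y1 : y <= 1 / 2 by nra.
have h : 1 - n%:R * y <= (1 - y) ^+ n.
  elim: (n) => [|k IH]; first by rewrite mul0r subr0.
  rewrite exprS -natr1; have k0 : 0 <= k%:R :> R by exact: ler0n.
  apply: (@le_trans _ _ ((1 - y) * (1 - k%:R * y))); first nra.
  by rewrite ler_wpM2l // subr_ge0; lra.
have p0 : 0 <= (1 + y) ^+ n by rewrite exprn_ge0 //; lra.
have p1 : (1 + y) ^+ n * (1 - y) ^+ n <= 1 by rewrite -exprMn exprn_ile1 //; nra.
nra.
Qed.

Lemma small_ratio (R : realType) (v u c : R) :
  v <= u -> u <= 1 / 4 -> 0 <= c -> c * u = 1 / 2 -> c * (v / (1 - v)) <= 1.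
Proof.
move=> vu u4 c0 cu; have h := ler_wpM2l c0 vu.
by rewrite mulrA ler_pdivrMr; lra.
Qed.

Lemma geometric_le (R : realType) (x : R) m n : 0 <= x < 1 ->
  \sum_(m <= i < n) x ^+ i <= x ^+ m / (1 - x).
Proof.
case/andP=> x0 x1; have x1' : 0 < 1 - x by lra.
have [mn|mn] := leqP m n; last by rewrite big_geq ?divr_ge0 ?exprn_ge0 // ?(ltW x1') // ltnW.
suff -> : \sum_(m <= i < n) x ^+ i = (x ^+ m - x ^+ n) / (1 - x).
  by rewrite ler_wpM2r ?gerBl ?exprn_ge0 // invr_ge0 ltW.
elim: n mn => [|n IH]; first by rewrite leqn0 => /eqP->; rewrite big_geq // subrr mul0r.
rewrite leq_eqVlt => /orP[/eqP<-|mn]; first by rewrite big_geq // subrr mul0r.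
by rewrite big_nat_recr //= IH // exprSr; field; rewrite gt_eqF.
Qed.

(** * Green potential of a sparse set of anchors *)

Section Potential.
Variables (R : realType) (d' N A L M : nat).
Notation d := d'.+1.
Notation T := 'rV['Z_N]_d.
Notation dir := ('I_d * bool)%type.
Hypotheses (N_gt2 : (2 < N)%N) (d_gt4 : (4 < d)%N) (A_gt0 : (0 < A)%N) (L_gt0 : (0 < L)%N).
Hypotheses (AL : (A %| L)%N) (MA : (2 * M * A ^ 2 <= L ^ 2)%N) (LM : (L ^ 2 <= 16 * A ^ 2 * M)%N).
Hypothesis A_large : (8 * d)%:R <= 2 ^+ A :> R.
Implicit Types (y z p : T).

Let dir0 : (0 < #|{: dir}|)%N. Proof. exact: dir_gt0. Qed.

(** [exit_prob] with [b = 1 + A / L]: then [b^L >= 2^A], and [2 M A^2 <= L^2] keeps the growth over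
    one superblock below 2. *)
Lemma exit_le l j : (0 < j)%N ->
  EW (l * (2 * M)) (fun w : seq dir => [exists t : 'I_(l * (2 * M)).+1, (j * L <= nrm (pos (0 : T) w t))%N]%:R) <=
  (2 * d)%:R * 2 ^+ l / 2 ^+ (A * j) :> R.
Proof.
move=> j0; pose x : R := A%:R / L%:R.
have LR : 0 < L%:R :> R by rewrite ltr0n.
have AR : 0 < A%:R :> R by rewrite ltr0n.
have x0 : 0 < x by rewrite divr_gt0.
have b1 : 1 < 1 + x by lra.
have jL : (0 < j * L)%N by rewrite muln_gt0 j0.
apply: le_trans (exit_prob d'.+1 N_gt2 b1 (l * (2 * M)) jL) _.
have bL : 2 ^+ A <= (1 + x) ^+ L.
  case/dvdnP: AL => q eq; rewrite {1}eq exprM lerXn2r ?nnegrE ?exprn_ge0 //; first lra.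
  apply: le_trans (bernoulli q (ltW x0)); rewrite /x eq natrM.
  have q0 : 0 < q%:R :> R by rewrite ltr0n; case: (q) eq L_gt0 => // ->; rewrite mul0n.
  have -> : q%:R * (A%:R / (q%:R * A%:R)) = 1 :> R by field; rewrite !gt_eqF.
  lra.
have hM : ((1 + x + (1 + x)^-1) / 2) ^+ (2 * M) <= 2.
  have h0 : 0 <= (1 + x + (1 + x)^-1) / 2 by rewrite divr_ge0 ?addr_ge0 ?invr_ge0; lra.
  have h1 : (1 + x + (1 + x)^-1) / 2 <= 1 + x ^+ 2 / 2.
    have -> : (1 + x + (1 + x)^-1) / 2 = 1 + x ^+ 2 / 2 / (1 + x) by field; lra.
    by rewrite lerD2l ler_pdivrMr ?ler_peMr //; [nra|lra|lra].
  apply: (@le_trans _ _ ((1 + x ^+ 2 / 2) ^+ (2 * M))).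
    by rewrite lerXn2r // nnegrE; nra.
  apply: exp_le2; first nra.
  have : (2 * M)%:R * x ^+ 2 <= 1; last by lra.
  rewrite /x expr_div_n mulrA ler_pdivrMr ?exprn_gt0 // mul1r -!natrX -natrM ler_nat.
  exact: MA.
rewrite natrM [2 * d%:R]mulrC -!mulrA ler_wpM2l ?ler0n // ler_wpM2l //.
have hn0 : 0 <= ((1 + x + (1 + x)^-1) / 2) ^+ (l * (2 * M)).
  by rewrite exprn_ge0 // divr_ge0 ?addr_ge0 ?invr_ge0; lra.
apply: ler_pM => //; first by rewrite invr_ge0 exprn_ge0; lra.
  rewrite mulnC exprM lerXn2r ?nnegrE //.
  by rewrite exprn_ge0 // divr_ge0 ?addr_ge0 ?invr_ge0; lra.
rewrite lef_pV2 ?posrE ?exprn_gt0 //; [|lra].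
rewrite exprM mulnC exprM lerXn2r ?nnegrE ?exprn_ge0 //; lra.
Qed.

Definition level z : nat := (nrm z %/ L)%N.

Lemma level_le z m : (nrm z <= m * L)%N -> (level z <= m)%N.
Proof. by move=> h; rewrite /level -(mulnK m L_gt0) leq_div2r. Qed.

Lemma nrm_level z : (nrm z <= (level z).+1 * L)%N.
Proof. by apply: ltnW; rewrite -ltn_divLR. Qed.

(** [2 ^- level] serves as an upper profile, up to a constant, for the chance that one superblock
    touches an anchor at 0; [kap l] is this profile seen [l] superblocks ahead. *)
Definition kap l z : R := EW (l * (2 * M)) (fun w : seq dir => 2 ^- level (z + wsum N w)).

(** Gaining [j] levels multiplies the profile by [2^j] and has probability at most
    [2 d 2^l / 2^(A j)]; the sum over [j] converges since [2^A >= 8 d]. *)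
Lemma kap_far l z : kap l z <= 2 ^+ (l + 2) / 2 ^+ level z.
Proof.
pose n := (l * (2 * M))%N.
pose E j (w : seq dir) := [exists t : 'I_n.+1, (j * L <= nrm (pos (0 : T) w t))%N].
apply: (@le_trans _ _ (EW n (fun w : seq dir => 2 / 2 ^+ level z * (1 + \sum_(1 <= j < n.+1) 2 ^+ j * (E j w)%:R)))).
  apply: ler_EW => w sw; set S := wsum N w.
  have h1 : (level z <= (level (z + S)).+1 + level S)%N.
    rewrite /level -ltnS ltn_divLR //.
    have t1 : (nrm z <= nrm (z + S) + nrm S)%N.
      by rewrite -{1}[z](addrK S); apply: leq_trans (nrmD N_gt2 _ _) _; rewrite nrmN.
    have t2 : (nrm (z + S) < (level (z + S)).+1 * L)%N by rewrite -ltn_divLR.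
    have t3 : (nrm S < (level S).+1 * L)%N by rewrite -ltn_divLR.
    change (nrm z < ((level (z + S)).+1 + level S).+1 * L)%N.
    move: t1 t2 t3; move: (level (z + S)) (level S) (nrm (z + S)) (nrm S) (nrm z) => a b c e f.
    by rewrite addSn !mulSn mulnDl; clear; lia.
  have h2 : 2 ^+ level S <= 1 + \sum_(1 <= j < n.+1) 2 ^+ j * (E j w)%:R :> R.
    have terms j : 0 <= 2 ^+ j * (E j w)%:R :> R by rewrite mulr_ge0 ?exprn_ge0.
    have [->|S0] := posnP (level S).
      by rewrite expr0 lerDl sumr_ge0.
    have Sn : (level S <= n)%N.
      by apply: leq_trans (leq_div _ _) _; have := nrm_wsum N_gt2 w; rewrite sw.
    rewrite (bigD1_seq (level S)) /= ?mem_index_iota ?S0 ?ltnS ?iota_uniq //.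
    have -> : E (level S) w.
      apply/existsP; exists ord_max; rewrite /= -[n in pos _ _ n]sw pos_size add0r.
      exact: leq_divM.
    by rewrite mulr1 addrCA lerDl addr_ge0 // sumr_ge0.
  apply: (@le_trans _ _ (2 / 2 ^+ level z * 2 ^+ level S)); last by rewrite ler_wpM2l ?divr_ge0 ?exprn_ge0.
  rewrite mulrAC ler_pdivlMr ?exprn_gt0 // mulrC ler_pdivrMr ?exprn_gt0 //.
  by rewrite -exprS -exprD ler_weXn2l ?ler1n // addSnnS addnC.
rewrite EWZ EWD EW_const // EW_sum.
have b j : (1 <= j)%N -> EW n (fun w => 2 ^+ j * (E j w)%:R) <= 2 ^+ l * ((2 * d)%:R * (2 / 2 ^+ A) ^+ j) :> R.
  move=> j0; rewrite EWZ; apply: le_trans (ler_wpM2l (exprn_ge0 _ _) (exit_le l j0)) _; first by [].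
  by rewrite expr_div_n exprM le_eqVlt; apply/orP; left; apply/eqP; ring.
have A8 : (8 * d)%:R <= 2 ^+ A :> R := A_large.
have dR : 1 <= d%:R :> R by rewrite ler1n.
have p0 : 0 < 2 ^+ A :> R by rewrite exprn_gt0.
rewrite natrM in A8.
have x14 : 2 / 2 ^+ A <= 1 / (4 * d%:R) :> R.
  by rewrite ler_pdivrMr // mulrAC ler_pdivlMr; lra.
have x0 : 0 <= 2 / 2 ^+ A :> R by rewrite divr_ge0 // ltW.
have x1 : 1 / (4 * d%:R) <= 1 / 4 :> R by rewrite !div1r lef_pV2 ?posrE; lra.
have sm : \sum_(1 <= j < n.+1) EW n (fun w => 2 ^+ j * (E j w)%:R) <= 2 ^+ l :> R.
  apply: (@le_trans _ _ (\sum_(1 <= j < n.+1) 2 ^+ l * ((2 * d)%:R * (2 / 2 ^+ A) ^+ j))).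
    by rewrite [leLHS]big_nat_cond [leRHS]big_nat_cond; apply: ler_sum => j /andP[/andP[j1 _] _]; exact: b.
  rewrite -!mulr_sumr -[leRHS]mulr1 ler_wpM2l ?exprn_ge0 //.
  have h := geometric_le 1 n.+1 (x := 2 / 2 ^+ A : R); rewrite expr1 in h.
  apply: (@le_trans _ _ ((2 * d)%:R * (2 / 2 ^+ A / (1 - 2 / 2 ^+ A)))).
    rewrite ler_wpM2l ?ler0n //; apply: h; rewrite x0 /=; apply: le_lt_trans (le_trans x14 x1) _; lra.
  apply: (small_ratio x14 x1); first exact: ler0n.
  by rewrite natrM; field; lra.
have l1 : 1 <= 2 ^+ l :> R by rewrite exprn_ege1 // ler1n.
apply: (@le_trans _ _ (2 / 2 ^+ level z * (2 * 2 ^+ l))).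
  by rewrite ler_wpM2l ?divr_ge0 ?exprn_ge0 //; lra.
by rewrite le_eqVlt exprD; apply/orP; left; apply/eqP; rewrite expr2; ring.
Qed.

Lemma poly_two_thirds m : (m.+1%:R : R) ^+ d / 2 ^+ m <= (3 * d)%:R ^+ d * (3 / 4) ^+ m.
Proof.
have h := @poly_le_exp R d N N_gt2 m isT.
have -> : (2 ^+ m)^-1 = (2 / 3) ^+ m * (3 / 4) ^+ m :> R.
  by rewrite -exprMn -exprVn; congr (_ ^+ _); field.
by rewrite mulrA ler_wpM2r // exprn_ge0 // divr_ge0.
Qed.

Definition ball_const : R := 4 * (3 * (3 * d)%:R) ^+ d.

Lemma level_sum : \sum_(z : T) 2 ^- level z <= ball_const * L%:R ^+ d :> R.
Proof.
have lvN z : (level z < N)%N.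
  apply: leq_ltn_trans (leq_div _ _) _; apply: leq_ltn_trans (_ : N.-1 < N)%N; last by rewrite prednK //; exact: ltnW (ltnW _).
  apply/nrmP => i; apply: leq_trans (geq_minl _ _) _; rewrite -ltnS prednK; last exact: ltnW (ltnW _).
  exact: val_ltZ.
rewrite (partition_big (fun z => Ordinal (lvN z)) predT) //=.
apply: (@le_trans _ _ (\sum_(m < N) (3 * (3 * d)%:R) ^+ d * L%:R ^+ d * (3 / 4) ^+ m)).
  apply: ler_sum => m _.
  apply: (@le_trans _ _ (\sum_(z : T | (nrm (z - 0)%R <= m.+1 * L)%N) 2 ^- m)).
    rewrite [leRHS](bigID (fun z => Ordinal (lvN z) == m)) /=.
    apply: (@le_trans _ _ (\sum_(z : T | (nrm (z - 0)%R <= m.+1 * L)%N && (Ordinal (lvN z) == m)) 2 ^- m)).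
      rewrite le_eqVlt; apply/orP; left; apply/eqP; apply: eq_big => [z|z /eqP <-] //.
      apply/idP/andP => [/eqP h|[]//]; split; last by rewrite h.
      by rewrite subr0 -h /= nrm_level.
    by rewrite lerDl sumr_ge0 // => z _; rewrite invr_ge0 exprn_ge0.
  rewrite sumr_const -[leLHS]mulr_natl.
  have cb := card_ball N_gt2 (0 : T) (m.+1 * L).
  have cb2 : (#|[pred z : T | (nrm (z - 0)%R <= m.+1 * L)%N]| <= (3 * (m.+1 * L)) ^ d)%N.
    by apply: leq_trans cb _; rewrite leq_exp2r //; have : (0 < m.+1 * L)%N by [rewrite muln_gt0]; lia.
  apply: (@le_trans _ _ (((3 * (m.+1 * L)) ^ d)%:R / 2 ^+ m)).
    by rewrite ler_wpM2r ?invr_ge0 ?exprn_ge0 // ler_nat.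
  have := poly_two_thirds m; set u := (3 / 4) ^+ m; rewrite natrX !natrM !exprMn => h.
  have -> : 3 ^+ d * (m.+1%:R ^+ d * L%:R ^+ d) / 2 ^+ m = 3 ^+ d * L%:R ^+ d * (m.+1%:R ^+ d / 2 ^+ m) :> R by ring.
  have -> : 3 ^+ d * (3 ^+ d * d%:R ^+ d) * L%:R ^+ d * u = 3 ^+ d * L%:R ^+ d * (3 ^+ d * d%:R ^+ d * u) :> R by ring.
  by rewrite ler_wpM2l // mulr_ge0 ?exprn_ge0.
rewrite -mulr_sumr /ball_const -[4 * _ * _]mulrA [4 * _]mulrC ler_wpM2l ?mulr_ge0 ?exprn_ge0 ?mulr_ge0 ?ler0n //.
rewrite -(big_mkord predT (fun m => (3 / 4) ^+ m)).
apply: le_trans (geometric_le 0 N _) _; first by apply/andP; split; lra.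
by rewrite expr0 ler_pdivrMr; lra.
Qed.

Lemma kap_near l z h : (forall u : T, heat R (l * (2 * M)) u <= h) -> kap l z <= ball_const * L%:R ^+ d * h.
Proof.
move=> hh; have h0 : 0 <= h by apply: le_trans (hh 0); exact: heat_ge0.
apply: (@le_trans _ _ (\sum_(u : T) 2 ^- level u * h)); last first.
  by rewrite -mulr_suml ler_wpM2r // level_sum.
rewrite /kap (eq_EW (G := fun w : seq dir => \sum_(u : T) 2 ^- level u * (wsum N w == u - z)%:R)) => [|w _].
  rewrite EW_sum; apply: ler_sum => u _; rewrite EWZ ler_wpM2l ?invr_ge0 ?exprn_ge0 //.
  exact: hh.
rewrite (bigD1 (z + wsum N w)) //= addrAC subrr add0r eqxx mulr1 big1 ?addr0 // => u uz.
by case: eqP => [e|_]; rewrite ?mulr0 //; move: uz; rewrite e addrC subrK eqxx.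
Qed.

Section Sparse.
Variable D : {set T}.
(** 100 exceeds the 42 levels within which a slow superblock can touch anchors; such a superblock
    thus touches at most one anchor of [D]. *)
Definition sparse := forall y (r : nat), (100 * #|[pred p in D | (nrm (y - p)%R <= r * L)%N]| <= 100 + r)%N.
Hypothesis D_sparse : sparse.

Lemma sparse_sum y q : \sum_(p in D | (q <= level (y - p))%N) 2 ^- level (y - p) <= 12 * (3 / 4) ^+ q :> R.
Proof.
have lvN z : (level z < N)%N.
  apply: leq_ltn_trans (leq_div _ _) _; apply: leq_ltn_trans (_ : N.-1 < N)%N; last by rewrite prednK //; exact: ltnW (ltnW _).
  apply/nrmP => i; apply: leq_trans (geq_minl _ _) _; rewrite -ltnS prednK; last exact: ltnW (ltnW _).
  exact: val_ltZ.
have [Nq|qN] := leqP N q.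
  rewrite big_pred0 ?mulr_ge0 ?exprn_ge0 ?divr_ge0 // => p.
  by rewrite [(q <= _)%N]leqNgt (leq_trans (lvN _) Nq) andbF.
rewrite (partition_big (fun p => Ordinal (lvN (y - p))) (fun m : 'I_N => (q <= m)%N)) /=; last by move=> p /andP[].
apply: (@le_trans _ _ (\sum_(m < N | (q <= m)%N) 3 * (3 / 4) ^+ m)).
  apply: ler_sum => m qm.
  apply: (@le_trans _ _ (\sum_(p in [pred p in D | (nrm (y - p)%R <= m.+1 * L)%N]) 2 ^- m)).
    rewrite [leRHS](bigID (fun p => (q <= level (y - p))%N && (Ordinal (lvN (y - p)) == m))) /=.
    apply: (@le_trans _ _ (\sum_(p in [pred p in D | (nrm (y - p)%R <= m.+1 * L)%N] | (q <= level (y - p)%R)%N && (Ordinal (lvN (y - p)) == m)) 2 ^- m)).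
      rewrite le_eqVlt; apply/orP; left; apply/eqP; apply: eq_big => [p|p /andP[_ /eqP <-]] //.
      rewrite !inE -!andbA; case: (p \in D) => //=; apply/idP/idP => [/andP[h1 /eqP h2]|/and3P[_ -> ->] //].
      by rewrite h1 h2 eqxx -h2 /= nrm_level.
    by rewrite lerDl sumr_ge0 // => p _; rewrite invr_ge0 exprn_ge0.
  rewrite sumr_const -[leLHS]mulr_natl.
  have c2 : (#|[pred p in D | (nrm (y - p)%R <= m.+1 * L)%N]| <= m + 2)%N by have := D_sparse y m.+1; lia.
  apply: (@le_trans _ _ ((m + 2)%:R / 2 ^+ m)); first by rewrite ler_wpM2r ?invr_ge0 ?exprn_ge0 // ler_nat.
  have b1 : (m + 2)%:R <= 3 * (3 / 2) ^+ m :> R.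
    have b2 : 1 + m%:R * (1 / 2) <= (1 + 1 / 2) ^+ m :> R by apply: bernoulli; lra.
    have -> : 3 / 2 = 1 + 1 / 2 :> R by lra.
    have m0 : 0 <= m%:R :> R by exact: ler0n.
    by rewrite natrD; lra.
  have -> : 3 / 4 = 3 / 2 * 2^-1 :> R by lra.
  by rewrite exprMn mulrA exprVn ler_wpM2r ?invr_ge0 ?exprn_ge0.
have -> : \sum_(m < N | (q <= m)%N) 3 * (3 / 4) ^+ m = \sum_(q <= m < N) 3 * (3 / 4) ^+ m :> R.
  by rewrite (big_nat_widenl _ 0) // big_mkord.
rewrite -mulr_sumr.
have -> : 12 * (3 / 4) ^+ q = 3 * ((3 / 4) ^+ q / (1 - 3 / 4)) :> R by rewrite (_ : 1 - 3 / 4 = 4^-1 :> R) ?invrK; lra.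
by rewrite ler_wpM2l // geometric_le //; apply/andP; split; lra.
Qed.

Variables (gam : R) (n : nat).
Hypotheses (gam01 : 0 <= gam < 1).

Definition pot_const : R := 156 + 12 * ball_const * (4 * A%:R * (hk_const d)%:R) ^+ d.

(** Levels from [4 l] on are too far to matter, as [2^l (3/4)^(4 l) = (81/128)^l]. Below them
    sparseness leaves at most [2 l] anchors, each seen with density of order [l^(-5/2)], so the sum
    is of order [l^(-3/2)]. *)
Lemma kap_sum l y : (0 < l)%N -> (l * (2 * M) <= N ^ 2)%N ->
  \sum_(p in D) kap l (y - p) <=
  48 * (81 / 128) ^+ l + 2 * ball_const * (4 * A%:R * (hk_const d)%:R) ^+ d * (l%:R * Num.sqrt l%:R)^-1.
Proof.
move=> l0 lN; rewrite (bigID (fun p => (4 * l <= level (y - p)%R)%N)) /=; apply: lerD.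
  apply: (@le_trans _ _ (\sum_(p in D | (4 * l <= level (y - p)%R)%N) 2 ^+ (l + 2) * 2 ^- level (y - p))).
    by apply: ler_sum => p _; exact: kap_far.
  rewrite -mulr_sumr; apply: le_trans (ler_wpM2l _ (sparse_sum y (4 * l))) _; first exact: exprn_ge0.
  have -> : (81 / 128) ^+ l = 2 ^+ l * (3 / 4) ^+ (4 * l) :> R.
    by rewrite exprM -exprMn; congr (_ ^+ _); rewrite !exprS expr0; lra.
  by rewrite exprD expr2 le_eqVlt; apply/orP; left; apply/eqP; ring.
have M0 : (0 < M)%N by case: (M) LM => //; rewrite muln0 leqn0 expn_eq0 andbT; case: (L) L_gt0.
have bc0 : 0 <= ball_const by do ?[exact: ler0n|apply: mulr_ge0|apply: exprn_ge0].
have LR : 0 < L%:R ^+ d :> R by rewrite exprn_gt0 // ltr0n.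
pose K : R := (4 * A%:R * (hk_const d)%:R) ^+ d.
have K0 : 0 <= K by do ?[exact: ler0n|apply: mulr_ge0|apply: exprn_ge0].
have sl1 : 1 <= Num.sqrt l%:R :> R by rewrite -(@ler_pXn2r _ 2) ?nnegrE ?sqrtr_ge0 // expr1n sqr_sqrtr ?ler0n // ler1n.
have sl0 : 0 < Num.sqrt l%:R :> R by lra.
have dens : density R d' (l * (2 * M)) <= K / L%:R ^+ d * (l%:R ^+ 2 * Num.sqrt l%:R)^-1.
  have h2 : density R d' (2 * M) <= K / L%:R ^+ d.
    apply: density_large => //; apply: leq_trans LM _; rewrite leq_mul2l; apply/orP; right; clear; lia.
  have -> : density R d' (l * (2 * M)) = density R d' (2 * M) * (Num.sqrt l%:R ^+ d)^-1.
    rewrite /density natrM sqrtrM ?ler0n // -exprVn -exprMn; congr (_ ^+ _).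
    by rewrite invfM mulrA mulrAC.
  apply: ler_pM => //; first exact: density_ge0.
    by rewrite invr_ge0 exprn_ge0 // sqrtr_ge0.
  rewrite lef_pV2 ?posrE ?exprn_gt0 ?mulr_gt0 ?exprn_gt0 ?ltr0n //.
  rewrite -[in l%:R ^+ 2](sqr_sqrtr (ler0n R l)) -exprM -exprSr ler_weXn2l //.
apply: (@le_trans _ _ (\sum_(p in [pred p in D | (nrm (y - p)%R <= 4 * l * L)%N]) (ball_const * L%:R ^+ d * density R d' (l * (2 * M))))).
  rewrite [leLHS]big_mkcond [leRHS]big_mkcond; apply: ler_sum => p _; rewrite !inE.
  case: (p \in D) => //=; have t0 : 0 <= ball_const * L%:R ^+ d * density R d' (l * (2 * M)).
    by nneg.
  case: leqP => /= [_|h]; first by case: ifP.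
  rewrite ifT; first by apply: kap_near => u; apply: heat_density => //; rewrite muln_gt0 l0 muln_gt0 M0.
  by apply: leq_trans (nrm_level _) _; rewrite leq_mul2r h orbT.
rewrite sumr_const -[leLHS]mulr_natl.
have c2 : (#|[pred p in D | (nrm (y - p)%R <= 4 * l * L)%N]| <= 2 * l)%N.
  rewrite -(leq_pmul2l (isT : (0 < 100)%N)); apply: leq_trans (D_sparse y (4 * l)) _; move: l0; clear; lia.
apply: (@le_trans _ _ ((2 * l)%:R * (ball_const * K * (l%:R ^+ 2 * Num.sqrt l%:R)^-1))).
  apply: ler_pM; [exact: ler0n|by nneg|by rewrite ler_nat|].
  apply: (@le_trans _ _ (ball_const * L%:R ^+ d * (K / L%:R ^+ d * (l%:R ^+ 2 * Num.sqrt l%:R)^-1))).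
    by rewrite ler_wpM2l //; nneg.
  by rewrite le_eqVlt; apply/orP; left; apply/eqP; field; rewrite !gt_eqF ?exprn_gt0 ?ltr0n.
rewrite -/K natrM le_eqVlt; apply/orP; left; apply/eqP; field.
by rewrite !gt_eqF ?ltr0n.
Qed.

(* The far range [N^2 <= 2 M l] is controlled by the killing factor [gam]. *)
Lemma potential_le y : #|D|%:R * (ball_const * L%:R ^+ d * ((hk_const d)%:R / N%:R) ^+ d) <= 1 - gam ->
  \sum_(l < n) gam ^+ l * \sum_(p in D) kap l (y - p) <= pot_const + 1.
Proof.
case/andP: gam01 => g0 g1 hD.
have bc0 : 0 <= ball_const by do ?[exact: ler0n|apply: mulr_ge0|apply: exprn_ge0].
set F := #|D|%:R * _ in hD; set K := (4 * A%:R * (hk_const d)%:R) ^+ d : R.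
have K0 : 0 <= K by do ?[exact: ler0n|apply: mulr_ge0|apply: exprn_ge0].
have F0 : 0 <= F by do ?[exact: ler0n|apply: mulr_ge0|apply: exprn_ge0|rewrite invr_ge0].
pose G l : R := if l == 0%N then 12 else 48 * (81 / 128) ^+ l + 2 * ball_const * K * (l%:R * Num.sqrt l%:R)^-1.
have G0 l : 0 <= G l.
  rewrite /G; case: eqP => // _; have h : 0 <= (l%:R * Num.sqrt l%:R)^-1 :> R by rewrite invr_ge0 mulr_ge0 ?sqrtr_ge0.
  by nneg.
have bd l : \sum_(p in D) kap l (y - p) <= G l + F.
  have [->|l0] := posnP l.
    rewrite /G eqxx; apply: (@le_trans _ _ 12); last by rewrite lerDl.
    have := sparse_sum y 0; rewrite expr0 mulr1; apply: le_trans.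
    rewrite [X in _ <= X](eq_bigl (fun p => p \in D)) => [|p]; last by rewrite leq0n andbT.
    by apply: ler_sum => p _; rewrite /kap /= /wsum big_nil addr0.
  have [lN|lN] := leqP (l * (2 * M)) (N ^ 2).
    apply: le_trans (kap_sum y l0 lN) _; rewrite /G -[l == 0%N]negbK -lt0n l0 /= -/K.
    by rewrite lerDl.
  apply: (@le_trans _ _ F); last by rewrite lerDr.
  rewrite /F mulr_natl -sumr_const; apply: ler_sum => p _.
  by apply: kap_near => u; apply: heat_le_large => //; exact: ltnW.
have geo l : gam ^+ l <= 1 by rewrite exprn_ile1 // ltW.
apply: (@le_trans _ _ (\sum_(l < n) (G l + gam ^+ l * F))).
  apply: ler_sum => l _; apply: le_trans (ler_wpM2l (exprn_ge0 _ g0) (bd l)) _.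
  rewrite mulrDr lerD2r; have := geo l; have := G0 l; have := exprn_ge0 l g0; nra.
rewrite big_split /=; apply: lerD; last first.
  rewrite -mulr_suml -(big_mkord predT (fun l => gam ^+ l)).
  have := geometric_le 0 n (x := gam); rewrite g0 g1 expr0 => /(_ isT) h.
  apply: le_trans (ler_wpM2r F0 h) _; rewrite mulrAC mul1r ler_pdivrMr ?mul1r //; lra.
rewrite -(big_mkord predT G).
apply: (@le_trans _ _ (12 + \sum_(1 <= l < n.+1) G l)).
  case: (n) => [|n']; first by rewrite !big_geq // addr0.
  rewrite big_ltn // {1}/G eqxx lerD2l [leRHS]big_nat_recr //= lerDl; exact: G0.
have -> : \sum_(1 <= l < n.+1) G l = \sum_(1 <= l < n.+1) 48 * (81 / 128) ^+ l +
    \sum_(1 <= l < n.+1) 2 * ball_const * K * (l%:R * Num.sqrt l%:R)^-1.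
  rewrite -big_split /= [LHS]big_nat_cond [RHS]big_nat_cond; apply: eq_bigr => l /andP[/andP[l0 _] _].
  by rewrite /G -[l == 0%N]negbK -lt0n l0.
rewrite -!mulr_sumr.
have s1 : \sum_(1 <= l < n.+1) (81 / 128) ^+ l <= 2 :> R.
  apply: le_trans (geometric_le 1 _ _) _; first by apply/andP; split; lra.
  by rewrite expr1 ler_pdivrMr; lra.
have s2 : \sum_(1 <= l < n.+1) (l%:R * Num.sqrt l%:R)^-1 <= 3 :> R.
  case: (n) => [|n']; first by rewrite big_geq.
  rewrite big_ltn // sqrtr1 mulr1 invr1 (_ : 3 = 1 + 2 :> R) ?lerD2l; last by lra.
  apply: (@le_trans _ _ (\sum_(2 <= l < n'.+2) 2 * ((Num.sqrt l.-1%:R)^-1 - (Num.sqrt l%:R)^-1))).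
    rewrite [leLHS]big_nat_cond [leRHS]big_nat_cond; apply: ler_sum => l /andP[/andP[l0 _] _].
    exact: inv_sqrt_telescope.
  rewrite -mulr_sumr -[leRHS]mulr1 ler_wpM2l //.
  have -> : \sum_(2 <= l < n'.+2) ((Num.sqrt l.-1%:R)^-1 - (Num.sqrt l%:R)^-1) = 1 - (Num.sqrt n'.+1%:R)^-1 :> R.
    elim: n' => [|n' IH]; first by rewrite big_geq // sqrtr1 invr1 subrr.
    by rewrite big_nat_recr //= IH addrA subrK.
  by rewrite gerBl invr_ge0 sqrtr_ge0.
have c0 : 0 <= 2 * ball_const * K by nneg.
have := ler_wpM2l c0 s2; rewrite /pot_const -/K; set S2 := \sum_(1 <= l < n.+1) (_ * _)^-1.
have : 0 <= ball_const * K by rewrite mulr_ge0.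
rewrite -![_ * ball_const * K]mulrA; move: (ball_const * K) S2 s1 => u v; set S1 := \sum_(1 <= l < n.+1) _; nra.
Qed.

End Sparse.

End Potential.

(** * Dependence on finite pieces of the path, and the weight of an anchor *)

Section Congruence.
Variables (d' N l s M k L : nat).
Notation d := d'.+1.
Notation T := 'rV['Z_N]_d.
Hypothesis skM : (2 * s * k <= M)%N.
Implicit Types (Y X : nat -> T) (H Hc : seq T).

Lemma straight_eq Y Y' t : (s <= t)%N -> (t + s <= 2 * M)%N -> (forall u, (u <= 2 * M)%N -> Y u = Y' u) ->
  straight s Y t = straight s Y' t.
Proof.
move=> st tM e; apply: eq_in_all => i; rewrite mem_iota => ib.
by rewrite !e //; move: ib st tM; clear; lia.
Qed.

Lemma fails_eq Y Y' H Hc : (forall t, (t <= 2 * M)%N -> Y t = Y' t) ->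
  fails l s M k L Y H Hc = fails l s M k L Y' H Hc.
Proof.
move=> e.
have late t : t \in index_iota M (2 * M).+1 -> Y t = Y' t by rewrite mem_index_iota => /andP[_ h]; exact: e.
have aft t u : u \in index_iota t.+1 (2 * M).+1 -> Y u = Y' u by rewrite mem_index_iota => /andP[_ h]; exact: e.
have bef t u : (t <= 2 * M)%N -> u \in iota 0 t -> Y u = Y' u.
  by move=> tM; rewrite mem_iota => /andP[_ h]; apply: e; move: h tM; clear; lia.
have c1 t : t \in cands s k M -> [/\ (s <= t)%N, (t + s <= 2 * M)%N & (t <= 2 * M)%N].
  by move=> /(cands_bound skM)[h1 h2]; move: h1 h2; clear; split; lia.
have c2 t : t \in cands s k 0 ++ cands s k M -> [/\ (s <= t)%N, (t + s <= 2 * M)%N & (t <= 2 * M)%N].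
  by rewrite mem_cat => /orP[] /(cands_bound skM)[h1 h2]; move: h1 h2; clear; split; lia.
have e1 : slow M L Y = slow M L Y'.
  apply: eq_in_all => t; rewrite mem_index_iota => /andP[_ h]; by rewrite !e.
have e2 : hits_frame l M Y = hits_frame l M Y' by apply: eq_in_has => t tl; rewrite late.
have e3 : crooked s M k Y = crooked s M k Y'.
  by apply: eq_in_all => t /c1[h1 h2 _]; rewrite (straight_eq h1 h2 e).
have e4 : cut_broken s M k Y = cut_broken s M k Y'.
  apply: eq_in_has => t /c2[h1 h2 h3]; rewrite (straight_eq h1 h2 e); apply: (congr1 (andb _)).
  by apply: eq_in_has => a /(bef _ _ h3) ->; apply: eq_in_has => b /aft ->.
have e5 : arm_hit_after l s M k Y = arm_hit_after l s M k Y'.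
  apply: eq_in_has => t /c2[h1 h2 h3]; rewrite (straight_eq h1 h2 e); apply: (congr1 (andb _)).
  by apply: eq_in_has => a /aft ->; rewrite e.
have e6 : arm_hit_before l s M k Y = arm_hit_before l s M k Y'.
  apply: eq_in_has => t /c1[h1 h2 h3]; rewrite (straight_eq h1 h2 e); apply: (congr1 (andb _)).
  by apply: eq_in_has => a /(bef _ _ h3) ->; rewrite e.
have e7 : near_past M Y H = near_past M Y' H by apply: eq_in_has => t tl; rewrite late.
have e8 : past_arm_hit l s M Y Hc = past_arm_hit l s M Y' Hc by apply: eq_in_has => t tl; rewrite late.
have e9 : arm_near_past l s M k Y H = arm_near_past l s M k Y' H by apply: eq_in_has => t /c1[_ _ h]; rewrite e.
by rewrite /fails e1 e2 e3 e4 e5 e6 e7 e8 e9.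
Qed.

Variables (W cH cC : nat).

(* A failure costs [W] touches: either it occurs, or the number of touches stays
   below [W] and the history of the walk near [p] stays within the caps [cH], [cC]. *)
Definition weight X p j : nat :=
  touches M L X p j * (1 + W * [&& fails l s M k L (superblock M X j) (past L X p (j.-1 * M))
      (past_cands s M k L X p (j.-1 * M)), (size (past L X p (j.-1 * M)) <= cH)%N &
      (size (past_cands s M k L X p (j.-1 * M)) <= cC)%N]).

Lemma past_eq X X' p n : (forall t, (t < n)%N -> X t = X' t) -> past L X p n = past L X' p n.
Proof.
move=> e; rewrite /past (eq_in_filter (a2 := fun t => near L p (X' t))) => [|t].
  apply/eq_in_map => t; rewrite mem_filter mem_iota => /andP[_ /andP[_ h]]; exact: e.
by rewrite mem_iota => /andP[_ h]; rewrite e.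
Qed.

Lemma past_cands_eq X X' p n : (forall t, (t < n)%N -> X t = X' t) ->
  past_cands s M k L X p n = past_cands s M k L X' p n.
Proof.
move=> e; rewrite /past_cands (eq_in_filter (a2 := fun t => (t %% M \in cands s k 0)%N && near L p (X' t))) => [|t].
  apply/eq_in_map => t; rewrite mem_filter mem_iota => /andP[_ /andP[_ h]]; exact: e.
by rewrite mem_iota => /andP[_ h]; rewrite e.
Qed.

Lemma weight_eq X X' p j : (0 < j)%N -> (forall t, (t <= j * M + M)%N -> X t = X' t) ->
  weight X p j = weight X' p j.
Proof.
move=> j0 e; have jM : (j.-1 * M + M = j * M)%N by case: (j) j0 => //= u _; rewrite mulSn addnC.
rewrite /weight; congr (nat_of_bool _ * (1 + W * nat_of_bool _))%N.
  by apply: eq_in_has => t; rewrite mem_index_iota => /andP[_ h]; rewrite e.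
have lt t : (t < j.-1 * M)%N -> X t = X' t by move=> h; apply: e; move: h jM; clear; lia.
rewrite (past_eq p lt) (past_cands_eq p lt) (@fails_eq _ (superblock M X' j)) // => t tM.
by apply: e; move: tM jM; clear; lia.
Qed.

Lemma count_blocks (P : pred nat) (Q : pred nat) q m :
  (forall j, (count (fun t => P t && Q t) (iota (j * M) M) <= has Q (iota (j * M) M) * m)%N) ->
  (count (fun t => P t && Q t) (iota 0 (q * M)) <= m * \sum_(j < q) has Q (iota (j * M) M))%N.
Proof.
move=> h; elim: q => [|q IH]; first by rewrite mul0n.
rewrite mulSn addnC iotaD count_cat add0n big_ord_recr /= mulnDr leq_add //.
by rewrite [X in (_ <= X)%N]mulnC; exact: h.
Qed.

Lemma touches_iota X p j : (has (fun t => near L p (X t)) (iota (j * M) M) <= touches M L X p j)%N.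
Proof.
apply: leq_implb => /hasP[t]; rewrite mem_iota => /andP[h1 h2] nt.
apply/hasP; exists t => //; rewrite mem_index_iota h1; move: h2; clear; lia.
Qed.

Lemma size_past X p q : (size (past L X p (q * M)) <= M * \sum_(j < q) touches M L X p j)%N.
Proof.
rewrite size_map size_filter.
rewrite (eq_count (a2 := fun t => predT t && near L p (X t))) //.
apply: leq_trans (count_blocks (m := M) q _) _.
  move=> j; case: hasP => [_|no]; first by rewrite mul1n; apply: leq_trans (count_size _ _) _; rewrite size_iota.
  by rewrite leqn0 -[_ == _]negbK -lt0n -has_count; apply/hasP => -[t tj /andP[_ nt]]; apply: no; exists t.
by rewrite leq_mul2l leq_sum ?orbT // => j _; exact: touches_iota.
Qed.

Lemma size_past_cands X p q : (0 < M)%N ->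
  (size (past_cands s M k L X p (q * M)) <= k * \sum_(j < q) touches M L X p j)%N.
Proof.
move=> M0; rewrite size_map size_filter.
apply: leq_trans (count_blocks (m := k) q _) _.
  move=> j; case: hasP => [_|no]; last first.
    by rewrite leqn0 -[_ == _]negbK -lt0n -has_count; apply/hasP => -[t tj /andP[_ nt]]; apply: no; exists t.
  have sc := @sub_count _ (fun t => ((t %% M)%N \in cands s k 0) && near L p (X t)) (fun t => (t %% M)%N \in cands s k 0).
  rewrite mul1n; apply: leq_trans (sc _ _) _; first by move=> t /andP[].
  rewrite (_ : iota (j * M) M = [seq (j * M + i)%N | i <- iota 0 M]); last by rewrite -iotaDl addn0.
  rewrite count_map (eq_in_count (a2 := [in cands s k 0])) => [|i]; last first.
    by rewrite mem_iota add0n => /andP[_ iM] /=; rewrite modnMDl modn_small.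
  rewrite -size_filter; apply: (@leq_trans (size (cands s k 0))); last by rewrite size_map size_iota.
  apply: uniq_leq_size; first by rewrite filter_uniq ?iota_uniq.
  by move=> i; rewrite mem_filter => /andP[].
by rewrite leq_mul2l leq_sum ?orbT // => j _; exact: touches_iota.
Qed.

(** If the total were below [W], fewer than [W] of the blocks from 1 on would be touched, so the
    history before the failing block would respect the caps, and that failure alone would cost [W].
    Block 0 belongs to the history without being weighed, hence the weak inequality in [tq]. *)
Lemma bad_weight X p nb : (0 < M)%N -> (M * W <= cH)%N -> (k * W <= cC)%N -> (0 < W)%N ->
  ~ (forall j, (0 < j <= nb)%N -> touches M L X p j ->
      ~~ fails l s M k L (superblock M X j) (past L X p (j.-1 * M)) (past_cands s M k L X p (j.-1 * M))) ->
  (W <= \sum_(j < nb) weight X p j.+1)%N.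
Proof.
move=> M0 hH hC W0 bad; rewrite leqNgt; apply/negP => small; apply: bad => j /andP[j0 jn] tj.
apply/negP => fj.
have tw : (\sum_(i < nb) touches M L X p i.+1 < W)%N.
  by apply: leq_ltn_trans small; apply: leq_sum => i _; rewrite /weight leq_pmulr // add1n.
have tq : (\sum_(i < j.-1) touches M L X p i <= W)%N.
  case: j j0 jn {tj fj} => // -[|j] _ jn; first by rewrite big_ord0.
  rewrite big_ord_recl; apply: (@leq_trans (1 + \sum_(i < j) touches M L X p i.+1)).
    by apply: leq_add; [exact: leq_b1|exact: leq_sum].
  rewrite add1n; apply: leq_ltn_trans tw.
  rewrite -(big_mkord predT (fun i => nat_of_bool (touches M L X p i.+1))).
  rewrite -(big_mkord predT (fun i => nat_of_bool (touches M L X p i.+1))).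
  rewrite [X in (_ <= X)%N](@big_cat_nat _ _ _ j) //=; first exact: leq_addr.
  by move: jn; clear; lia.
have s1 : (size (past L X p (j.-1 * M)) <= cH)%N.
  by apply: leq_trans (size_past X p _) _; apply: leq_trans hH; rewrite leq_mul2l tq orbT.
have s2 : (size (past_cands s M k L X p (j.-1 * M)) <= cC)%N.
  by apply: leq_trans (size_past_cands X p _ M0) _; apply: leq_trans hC; rewrite leq_mul2l tq orbT.
have jn' : (j.-1 < nb)%N by rewrite prednK.
move: small; rewrite (bigD1 (Ordinal jn')) //= {1}/weight prednK // tj fj s1 s2 /= mul1n muln1.
by clear; lia.
Qed.

End Congruence.

(** [(v - 1) u <= 2 (v - 1)]: it separates the penalty factor from the potential. *)
Lemma mul_le_add (R : realType) (u v : R) : 1 <= u -> u <= 2 -> 1 <= v -> v * u <= u + 2 * (v - 1).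
Proof. by move=> *; nra. Qed.

Lemma half_le_compl (R : realType) (x : R) : x <= 1 / 2 -> 1 / 2 <= 1 - x.
Proof. by move=> *; lra. Qed.

Lemma absorb_two (R : realType) (x y e : R) : 2 ^+ 47 * x * y <= e -> 2 * (2 ^+ 46 * x * y) <= e.
Proof. by rewrite (exprS _ 46) !mulrA. Qed.

(** * The supermartingale over superblocks *)

Section OneSuperblock.
Variables (R : realType) (d' N A L M l s k : nat).
Notation d := d'.+1.
Notation T := 'rV['Z_N]_d.
Notation dir := ('I_d * bool)%type.
Hypotheses (N_gt2 : (2 < N)%N) (d_gt4 : (4 < d)%N) (A_gt0 : (0 < A)%N) (L_gt0 : (0 < L)%N).
Hypotheses (AL : (A %| L)%N) (MA : (2 * M * A ^ 2 <= L ^ 2)%N) (LM : (L ^ 2 <= 16 * A ^ 2 * M)%N).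
Hypothesis A_large : (8 * d)%:R <= 2 ^+ A :> R.
Variables (W cH cC : nat) (B b1 delta eps : R) (D : {set T}).
Hypotheses (B_ge1 : 1 <= B) (Bb1 : B ^+ (1 + W) <= b1) (eps_gt0 : 0 < eps) (delta_ge0 : 0 <= delta).
Hypothesis slow_ok : (B - 1) + b1 * delta <= eps / 2 ^+ 43.
Hypotheses (A_b1 : 4 * b1 <= 2 ^+ A) (fast_ok : 2 ^+ 47 * d%:R * b1 ^+ 2 <= eps * 2 ^+ A).
Hypothesis D_sparse : sparse L D.
Hypothesis rare : forall (y : T) H Hc, (size H <= cH)%N -> (size Hc <= cC)%N ->
  EW (2 * M) (fun w : seq dir => (fails l s M k L (pos y w) H Hc && slow M L (pos y w))%:R) <= delta.

Let dir0 : (0 < #|{: dir}|)%N. Proof. exact: dir_gt0. Qed.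

Notation level := (level L).
Notation EM := (@EW R dir (2 * M)).

Section Fixed.
Variables (y : T) (H Hc : T -> seq T).

Definition meets p (w : seq dir) : bool := has (fun t => near L p (pos y w t)) (index_iota M (2 * M).+1).
Definition breaks p (w : seq dir) : bool :=
  [&& fails l s M k L (pos y w) (H p) (Hc p), (size (H p) <= cH)%N & (size (Hc p) <= cC)%N].
Definition penalty (w : seq dir) : nat := (\sum_(p in D) meets p w * (1 + W * breaks p w))%N.

Definition escapes j (w : seq dir) : bool :=
  [exists t : 'I_(1 * (2 * M)).+1, (j * L <= nrm (pos (0 : T) w t))%N].

Lemma b1_ge1 : 1 <= b1.
Proof. by apply: le_trans Bb1; rewrite exprn_ege1. Qed.

Lemma posB w t : pos y w t - y = pos 0 w t.
Proof. by rewrite /pos add0r addrC addKr. Qed.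

Lemma penalty_le (S : {set T}) w m : (forall p, p \in D -> meets p w -> p \in S) ->
  (#|[pred p in D | p \in S]| <= m)%N -> B ^+ penalty w <= b1 ^+ m.
Proof.
move=> hS hm; apply: (@le_trans _ _ (B ^+ (m * (1 + W)))).
  rewrite ler_weXn2l //; apply: (@leq_trans (\sum_(p in [pred p in D | p \in S]) (1 + W))); last first.
    by rewrite sum_nat_const leq_mul2r hm orbT.
  rewrite /penalty [leqLHS]big_mkcond [leqRHS]big_mkcond; apply: leq_sum => p _; rewrite !inE.
  case pD : (p \in D) => //=; case mp : (meets p w) => //=.
  by rewrite (hS p) // mul1n leq_add2l; case: (breaks p w); rewrite ?muln1 ?muln0.
rewrite mulnC exprM lerXn2r ?nnegrE ?exprn_ge0 //; first exact: le_trans ler01 B_ge1.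
exact: le_trans ler01 b1_ge1.
Qed.

(** Let [m] be the number of levels travelled. If [m = 0] the walk is slow and at most one anchor is
    charged, with a factor [B], or at most [b1] if it breaks. Otherwise sparseness leaves at most
    [1 + m] touched anchors, and the factor is at most [b1^(1 + m)]. *)
Lemma penalty_pointwise w : size w = (2 * M)%N ->
  B ^+ penalty w <= 1 + (\sum_(p in D | (level (y - p)%R <= 42)%N) ((B - 1) + b1 * (breaks p w && slow M L (pos y w))%:R)
   + \sum_(1 <= m < (2 * M).+1) \sum_(p in D | (level (y - p)%R <= 42 + m)%N) b1 ^+ (1 + m) * (escapes m w)%:R).
Proof.
move=> sw; have B0 : 0 <= B by exact: le_trans ler01 B_ge1.
have b1g := b1_ge1; have b10 : 0 <= b1 by exact: le_trans ler01 b1_ge1.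
pose S1 := \sum_(p in D | (level (y - p)%R <= 42)%N) ((B - 1) + b1 * (breaks p w && slow M L (pos y w))%:R).
pose S2 := \sum_(1 <= m < (2 * M).+1) \sum_(p in D | (level (y - p)%R <= 42 + m)%N) b1 ^+ (1 + m) * (escapes m w)%:R.
have S10 : 0 <= S1 by apply: sumr_ge0 => p _; rewrite addr_ge0 ?mulr_ge0 ?ler0n ?subr_ge0.
have S20 : 0 <= S2.
  by apply: sumr_ge0 => m _; apply: sumr_ge0 => p _; rewrite mulr_ge0 ?exprn_ge0 ?ler0n.
rewrite -/S1 -/S2.
pose mx := \max_(t < (2 * M).+1) nrm (pos (0 : T) w t).
have mxP (t : nat) : (t <= 2 * M)%N -> (nrm (pos y w t - y) <= mx)%N.
  move=> tM; have tM' : (t < (2 * M).+1)%N by rewrite ltnS.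
  by rewrite posB; exact: (@leq_bigmax _ (fun t : 'I_(2 * M).+1 => nrm (pos (0 : T) w t)) (Ordinal tM')).
pose m := (mx %/ L)%N.
have mxm : (mx < m.+1 * L)%N by rewrite -ltn_divLR.
(* 41 levels from the radius in [near], and [m + 1] from the distance travelled. *)
pose S : {set T} := [set p | (nrm (y - p)%R <= (42 + m) * L)%N].
have hS p : p \in D -> meets p w -> p \in S.
  move=> _ /hasP[t]; rewrite mem_index_iota => /andP[_ tM] np; rewrite inE.
  have h := nrm_triangle N_gt2 y (pos y w t) p.
  have h2 := mxP t tM; rewrite nrmB in h2.
  apply: leq_trans h _; apply: leq_trans (leq_add (leq_trans h2 (ltnW mxm)) np) _.
  by rewrite -mulnDl leq_mul2r; apply/orP; right; clear; lia.
have cardS : (100 * #|[pred p in D | p \in S]| <= 142 + m)%N.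
  rewrite (eq_card (B := [pred p in D | (nrm (y - p)%R <= (42 + m) * L)%N])); first exact: (D_sparse y (42 + m)).
  by move=> p; rewrite !inE.
have [m0|m0] := posnP m.
  have slw : slow M L (pos y w).
    apply/allP => t; rewrite mem_index_iota pos0 => /andP[_ tM].
    by apply: leq_ltn_trans (mxP t tM) _; move: mxm; rewrite m0 mul1n.
  apply: (@le_trans _ _ (1 + S1)); last by rewrite addrA lerDl.
  have [|none] := boolP [exists p in D, meets p w]; last first.
    rewrite /penalty big1 ?expr0 ?lerDl // => p pD.
    by move: none; rewrite negb_exists => /forallP/(_ p); rewrite pD /= => /negPf->.
  case/existsP => p /andP[pD mp].
  have pen : (penalty w <= 1 + W * breaks p w)%N.
    rewrite /penalty (bigD1 p) //= mp mul1n big1 ?addn0 // => p' /andP[p'D pp'].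
    case mp' : (meets p' w) => //; exfalso.
    have c2 : (2 <= #|[pred p in D | p \in S]|)%N.
      apply: (@leq_trans #|[set p; p']|); first by rewrite cards2 eq_sym pp'.
      apply: subset_leq_card; apply/subsetP => u; rewrite !inE => /orP[] /eqP->.
        by rewrite pD; have := hS p pD mp; rewrite inE.
      by rewrite p'D; have := hS p' p'D mp'; rewrite inE.
    by move: cardS c2; rewrite m0; clear; lia.
  apply: (@le_trans _ _ (1 + ((B - 1) + b1 * (breaks p w && slow M L (pos y w))%:R))).
    apply: le_trans (ler_weXn2l B_ge1 pen) _; rewrite slw andbT.
    case: (breaks p w); last by rewrite muln0 addn0 expr1 mulr0 addr0 addrC subrK.
    by rewrite muln1 mulr1; apply: le_trans Bb1 _; rewrite addrA lerDr addrC subrK.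
  rewrite lerD2l /S1 (bigD1 p) /=; last first.
    by rewrite pD level_le //; have := hS p pD mp; rewrite inE m0 addn0.
  by rewrite lerDl sumr_ge0 // => p' _; rewrite addr_ge0 ?mulr_ge0 ?ler0n ?subr_ge0.
apply: (@le_trans _ _ (1 + S2)); last by rewrite lerD2l lerDr.
have [|none] := boolP [exists p in D, meets p w]; last first.
  rewrite /penalty big1 ?expr0 ?lerDl // => p pD.
  by move: none; rewrite negb_exists => /forallP/(_ p); rewrite pD /= => /negPf->.
case/existsP => p /andP[pD mp].
have mM : (m <= 2 * M)%N.
  apply: leq_trans (leq_div _ _) _; apply/bigmax_leqP => t _.
  rewrite /pos add0r; apply: leq_trans (nrm_wsum N_gt2 _) _; rewrite size_take_min; apply: leq_trans (geq_minl _ _) _.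
  by rewrite -ltnS.
have em : escapes m w.
  have [t mt] : {t : 'I_(2 * M).+1 | mx = nrm (pos (0 : T) w t)} by apply: (@bigop.eq_bigmax _ (fun t : 'I_(2 * M).+1 => nrm (pos (0 : T) w t))); rewrite card_ord.
  have lt : (t < (1 * (2 * M)).+1)%N by rewrite mul1n.
  by apply/existsP; exists (Ordinal lt); rewrite /= -mt leq_divM.
have c1 : (#|[pred p in D | p \in S]| <= 1 + m)%N by move: cardS m0; clear; lia.
apply: le_trans (penalty_le hS c1) _; apply: (@le_trans _ _ S2); last by rewrite lerDr.
rewrite /S2 (bigD1_seq m) /= ?mem_index_iota ?iota_uniq //; last by rewrite m0 ltnS.
rewrite (bigD1 p) /=; last first.
  by rewrite pD level_le //; have := hS p pD mp; rewrite inE.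
rewrite em mulr1 -addrA lerDl addr_ge0 // ?sumr_ge0 // => [p' _|m' _].
  by rewrite ?mulr_ge0 ?exprn_ge0 ?ler0n.
by apply: sumr_ge0 => p' _; rewrite mulr_ge0 ?exprn_ge0 ?ler0n.
Qed.

Definition hit_rate : R := eps * \sum_(p in D) 2 ^- level (y - p).

(** Half of [hit_rate] pays for slow superblocks, through [slow_ok]. The other half pays for
    escapes: [2^-(A m)] beats [b1^(1 + m)] and the factor [2^m] lost in the level, by [A_b1] and
    [fast_ok]. *)
Lemma penalty_mean : EM (fun w => B ^+ penalty w) <= 1 + hit_rate.
Proof.
have b10 : 0 <= b1 by exact: le_trans ler01 b1_ge1.
apply: le_trans (ler_EW penalty_pointwise) _.
rewrite EWD EW_const // lerD2l EWD !EW_sum.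
pose near42 := \sum_(p in D | (level (y - p)%R <= 42)%N) eps / 2 * 2 ^- level (y - p).
pose half := \sum_(p in D) eps / 2 * 2 ^- level (y - p).
have e0 : 0 <= eps by exact: ltW.
have -> : hit_rate = half + half.
  rewrite /half /hit_rate mulr_sumr -big_split /=; apply: eq_bigr => p _.
  by rewrite -mulrDl -splitr.
apply: lerD.
  apply: (@le_trans _ _ near42); last first.
    rewrite /near42 /half big_mkcondr /=; apply: ler_sum => p _; case: ifP => // _.
    by rewrite mulr_ge0 ?divr_ge0 ?invr_ge0 ?exprn_ge0.
  apply: ler_sum => p /andP[_ lv]; rewrite EWD EW_const // EWZ.
  apply: (@le_trans _ _ (B - 1 + b1 * delta)).
    rewrite lerD2l ler_wpM2l //.
    have [sH|sH] := boolP ((size (H p) <= cH)%N && (size (Hc p) <= cC)%N); last first.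
      by apply: EW_false => // w _; rewrite /breaks (negPf sH) andbF.
    case/andP: sH => sH sHc; apply: EW_imp (rare y sH sHc) => w _ /andP[/and3P[-> _ _] ->] //.
  apply: le_trans slow_ok _; rewrite -mulrA ler_wpM2l // -invfM -exprS.
  by rewrite lef_pV2 ?posrE ?exprn_gt0 // ler_weXn2l // ler1n.
under eq_bigr => m _ do rewrite EW_sum.
rewrite [leLHS](eq_bigr (fun m => \sum_(p in D) if (level (y - p)%R <= 42 + m)%N then
   b1 ^+ (1 + m) * EM (fun w => (escapes m w)%:R) else 0)) => [|m _]; last first.
  rewrite big_mkcondr /=; apply: eq_bigr => p _; case: ifP => // _; exact: EWZ.
rewrite exchange_big /=; apply: ler_sum => p _.
pose x := 2 * (b1 / 2 ^+ A).
have A0 : 0 < 2 ^+ A :> R by rewrite exprn_gt0.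
have x0 : 0 <= x by rewrite mulr_ge0 ?divr_ge0 // ltW.
have x2 : x <= 1 / 2.
  have -> : 1 / 2 = 2 ^+ A / 2 / 2 ^+ A :> R by field; rewrite gt_eqF.
  rewrite /x mulrA ler_wpM2r ?invr_ge0 ?(ltW A0) // ler_pdivlMr //.
  by rewrite (_ : 2 * b1 * 2 = 4 * b1) //; ring.
pose c := (4 * d)%:R * b1 * (2 ^+ 42 * 2 ^- level (y - p)).
have c0 : 0 <= c by rewrite /c; nneg.
apply: (@le_trans _ _ (\sum_(1 <= m < (2 * M).+1) c * x ^+ m)).
  rewrite [leLHS]big_nat_cond [leRHS]big_nat_cond; apply: ler_sum => m; rewrite andbT => /andP[m0 _].
  case: leqP => lv; last by rewrite mulr_ge0 ?exprn_ge0.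
  have := @exit_le R d' N A L M N_gt2 A_gt0 L_gt0 AL MA 1 m m0.
  rewrite mul1n expr1 => ex; have {}ex : EM (fun w => (escapes m w)%:R) <= (2 * d)%:R * 2 / 2 ^+ (A * m).
    by rewrite /escapes mul1n.
  apply: le_trans (ler_wpM2l _ ex) _; first by rewrite exprn_ge0.
  have lv2 : 1 <= 2 ^+ m * (2 ^+ 42 * 2 ^- level (y - p)) :> R.
    by rewrite mulrA ler_pdivlMr ?exprn_gt0 // mul1r -exprD ler_weXn2l ?ler1n // addnC.
  have -> : c * x ^+ m = (4 * d)%:R * b1 * (b1 / 2 ^+ A) ^+ m * (2 ^+ m * (2 ^+ 42 * 2 ^- level (y - p))).
    by rewrite /c /x exprMn; ring.
  have -> : b1 ^+ (1 + m) * ((2 * d)%:R * 2 / 2 ^+ (A * m)) = (4 * d)%:R * b1 * (b1 / 2 ^+ A) ^+ m.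
    rewrite exprS expr_div_n exprM (_ : (4 * d)%:R = (2 * d)%:R * 2); last by rewrite -natrM; congr (_%:R); clear; lia.
    by ring.
  by rewrite ler_peMr //; rewrite !mulr_ge0 ?exprn_ge0 ?divr_ge0 ?ler0n // ltW.
rewrite -mulr_sumr.
have g1 : \sum_(1 <= m < (2 * M).+1) x ^+ m <= 2 * x.
  have := geometric_le 1 (2 * M).+1 (x := x); rewrite x0 /= expr1 => /(_ (le_lt_trans x2 _)) h.
  have x1 : 1 / 2 < 1 :> R by rewrite ltr_pdivrMr // mul1r ltr1n.
  apply: le_trans (h x1) _; rewrite ler_pdivrMr ?subr_gt0 ?(le_lt_trans x2) //.
  rewrite mulrC mulrA ler_peMl // -ler_pdivrMr //.
  exact: half_le_compl.
apply: le_trans (ler_wpM2l c0 g1) _; rewrite /c /x.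
have -> : (4 * d)%:R * b1 * (2 ^+ 42 * 2 ^- level (y - p)) * (2 * (2 * (b1 / 2 ^+ A))) =
    (2 ^+ 46 * d%:R * b1 ^+ 2) / 2 ^+ A * 2 ^- level (y - p).
  rewrite natrM (exprD 2 42 4) !expr2 (_ : 2 ^+ 4 = 2 * (2 * (2 * 2))); last by rewrite !exprS expr0 mulr1.
  rewrite (_ : 4%:R = 2 * 2); last by rewrite -natrM.
  by ring.
rewrite ler_wpM2r ?invr_ge0 ?exprn_ge0 // ler_pdivrMr // -(@ler_pM2l _ 2) // [leRHS]mulrA [2 * (eps / 2)]mulrC divfK ?pnatr_eq0 //.
exact: absorb_two.
Qed.

End Fixed.

Variables (gam : R).
Hypothesis gam01 : 0 < gam < 1.
Hypothesis potential_ok : 2 * eps * (pot_const R d' A + 1) <= 1.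
Hypothesis killing : #|D|%:R * (ball_const R d' * L%:R ^+ d * ((hk_const d)%:R / N%:R) ^+ d) <= 1 - gam.

Definition potsum i y : R := \sum_(p in D) kap R L M i (y - p).

(** One plus a multiple of the discounted future contacts over [m] superblocks; [potential_ok] keeps
    it between 1 and 2. *)
Definition Phi m y : R := 1 + 2 * eps * \sum_(i < m) gam ^+ i * potsum i y.

Lemma kap_ge0 i (z : T) : 0 <= kap R L M i z.
Proof. by apply: EW_ge0 => w _; rewrite invr_ge0 exprn_ge0. Qed.

Lemma potsum_ge0 i y : 0 <= potsum i y.
Proof. by apply: sumr_ge0 => p _; exact: kap_ge0. Qed.

Lemma Phi_ge1 m y : 1 <= Phi m y.
Proof.
case/andP: gam01 => g0 _; rewrite lerDl mulr_ge0 ?mulr_ge0 ?(ltW eps_gt0) //.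
by apply: sumr_ge0 => i _; rewrite mulr_ge0 ?potsum_ge0 // exprn_ge0 // ltW.
Qed.

Lemma Phi_le2 m y : Phi m y <= 2.
Proof.
case/andP: gam01 => g0 g1.
have g01 : 0 <= gam < 1 by rewrite g1 ltW.
rewrite (_ : 2 = 1 + 1) // lerD2l; apply: le_trans potential_ok.
rewrite ler_wpM2l ?mulr_ge0 ?(ltW eps_gt0) //.
exact: (potential_le N_gt2 d_gt4 A_gt0 L_gt0 AL MA LM A_large D_sparse m g01 y killing).
Qed.

Lemma kapS i (z : T) : EM (fun w => kap R L M i (z + wsum N w)) = kap R L M i.+1 z.
Proof.
rewrite /kap (mulSn i) EW_cat; apply: eq_EW => u _; apply: eq_EW => v _.
by rewrite wsum_cat addrA.
Qed.

Lemma potsumS i y : EM (fun w => potsum i (pos y w (2 * M)%N)) = potsum i.+1 y.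
Proof.
rewrite /potsum EW_sum; apply: eq_bigr => p _; rewrite -kapS; apply: eq_EW => w sw.
by rewrite -[X in pos y w X]sw pos_size addrAC.
Qed.

Lemma PhiS m y : EM (fun w => Phi m (pos y w (2 * M)%N)) = 1 + 2 * eps * \sum_(i < m) gam ^+ i * potsum i.+1 y.
Proof.
rewrite /Phi EWD EW_const // EWZ EW_sum; congr (_ + _ * _); apply: eq_bigr => i _.
by rewrite EWZ potsumS.
Qed.

(* The mean growth of [B ^+ penalty] is absorbed by the term of index 0 of [Phi m.+1]. *)
Lemma superblock_step m y H Hc :
  EM (fun w => B ^+ penalty y H Hc w * Phi m (pos y w (2 * M)%N)) <= gam^-1 * Phi m.+1 y.
Proof.
case/andP: gam01 => g0 g1.
apply: (@le_trans _ _ (EM (fun w => Phi m (pos y w (2 * M)%N) + 2 * (B ^+ penalty y H Hc w + - 1)))).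
  apply: ler_EW => w _; have h1 := Phi_ge1 m (pos y w (2 * M)%N); have h2 := Phi_le2 m (pos y w (2 * M)%N).
  have h3 : 1 <= B ^+ penalty y H Hc w by rewrite exprn_ege1.
  exact: mul_le_add.
rewrite EWD PhiS EWZ EWD EW_const //.
have pm := penalty_mean y H Hc.
have p0 : hit_rate y = eps * potsum 0 y.
  rewrite /hit_rate /potsum; congr (_ * _); apply: eq_bigr => p _.
  by rewrite /kap /= /wsum big_nil addr0.
rewrite p0 in pm.
apply: (@le_trans _ _ (1 + 2 * eps * \sum_(i < m) gam ^+ i * potsum i.+1 y + 2 * (eps * potsum 0 y))).
  by rewrite lerD2l ler_wpM2l // lerBlDl.
rewrite -(@ler_pM2l _ gam) // [leRHS]mulrA mulfV ?gt_eqF // mul1r /Phi big_ord_recl expr0 mul1r.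
have -> : \sum_(i < m) gam ^+ lift ord0 i * potsum (lift ord0 i) y = gam * \sum_(i < m) gam ^+ i * potsum i.+1 y.
  by rewrite mulr_sumr; apply: eq_bigr => i _; rewrite lift0 exprS mulrA.
have := potsum_ge0 0 y; have := ltW eps_gt0.
move: (potsum 0 y) (\sum_(i < m) _) => u S e0 u0.
rewrite !mulrDr mulr1 [gam * (2 * (eps * u))]mulrCA.
have h1 : gam * (eps * u) <= eps * u by rewrite ler_piMl ?mulr_ge0 // ltW.
have -> : gam * (2 * eps * S) = 2 * eps * (gam * S) by ring.
rewrite -!mulrA -addrA; apply: lerD; first exact: ltW.
by rewrite addrC lerD2r ler_wpM2l.
Qed.

Hypothesis skM : (2 * s * k <= M)%N.

(** Consecutive superblocks overlap, so they are split by the parity [a]; those of one parity follow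
    each other without overlap. *)
Definition total_weight a r (X : nat -> T) : nat :=
  (\sum_(i < r) \sum_(p in D) weight l s M k L W cH cC X p (2 * i + a).+1)%N.

Lemma total_weight_eq a r X X' : (forall t, (t <= (2 * r + a) * M)%N -> X t = X' t) ->
  total_weight a r X = total_weight a r X'.
Proof.
move=> e; apply: eq_bigr => i _; apply: eq_bigr => p _; apply: weight_eq => // t tb.
apply: e; apply: leq_trans tb _; rewrite -mulSnr leq_mul2r; apply/orP; right.
by move: (ltn_ord i); clear; lia.
Qed.

Lemma superblock_weight x (u v : seq dir) q : size u = (q * M)%N -> size v = (2 * M)%N ->
  (\sum_(p in D) weight l s M k L W cH cC (pos x (u ++ v)) p q.+1)%N =
  penalty (pos x u (size u)) (fun p => past L (pos x u) p (q * M)) (fun p => past_cands s M k L (pos x u) p (q * M)) v.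
Proof.
move=> su sv; apply: eq_bigr => p _; rewrite /weight /=.
have e t : (t < q * M)%N -> pos x (u ++ v) t = pos x u t by move=> h; rewrite pos_catl // su ltnW.
rewrite (past_eq _ _ e) (past_cands_eq _ _ _ _ _ e) /breaks.
rewrite (_ : fails l s M k L (superblock M (pos x (u ++ v)) q.+1) _ _ = fails l s M k L (pos (pos x u (size u)) v)
    (past L (pos x u) p (q * M)) (past_cands s M k L (pos x u) p (q * M))); last first.
  by apply: fails_eq => // t tM; rewrite /superblock /= -su pos_catr.
congr (nat_of_bool _ * _)%N; rewrite /touches /meets.
rewrite (_ : index_iota (q.+1 * M) (q.+1 * M + M).+1 = [seq (q * M + t)%N | t <- index_iota M (2 * M).+1]); last first.
  rewrite /index_iota -iotaDl; congr iota; first by rewrite mulSn addnC.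
  by rewrite mulSn; clear; lia.
by rewrite has_map; apply: eq_has => t /=; rewrite -su pos_catr.
Qed.

(** Peel off the last superblock with [superblock_step]. The horizon of [Phi] grows by one, so the
    induction needs all [m] at once. *)
Lemma total_weight_mean a r m x :
  EW ((2 * r + a) * M) (fun w : seq dir => B ^+ total_weight a r (pos x w) * Phi m (pos x w ((2 * r + a) * M)%N)) <= 2 * gam^-1 ^+ r.
Proof.
case/andP: gam01 => g0 g1; have gi : 0 <= gam^-1 by rewrite invr_ge0 ltW.
elim: r m => [|r IH] m.
  rewrite expr0 mulr1; apply: EW_le_const => // w _.
  by rewrite /total_weight big_ord0 expr0 mul1r Phi_le2.
have -> : ((2 * r.+1 + a) * M = (2 * r + a) * M + 2 * M)%N by rewrite -mulnDl; congr muln; clear; lia.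
rewrite EW_cat; apply: (@le_trans _ _ (EW ((2 * r + a) * M) (fun u : seq dir =>
    gam^-1 * (B ^+ total_weight a r (pos x u) * Phi m.+1 (pos x u ((2 * r + a) * M)%N))))); last first.
  by rewrite EWZ exprS mulrCA ler_wpM2l.
apply: ler_EW => u su.
pose y := pos x u (size u).
pose H p := past L (pos x u) p ((2 * r + a) * M).
pose Hc p := past_cands s M k L (pos x u) p ((2 * r + a) * M).
rewrite (eq_EW (G := fun v => B ^+ total_weight a r (pos x u) * (B ^+ penalty y H Hc v * Phi m (pos y v (2 * M)%N)))) => [|v sv].
  rewrite EWZ mulrCA ler_wpM2l ?exprn_ge0 //; first exact: le_trans ler01 B_ge1.
  by apply: le_trans (superblock_step m y H Hc) _; rewrite /y su.
rewrite mulrA -exprD /total_weight big_ord_recr /=; congr (B ^+ (_ + _) * Phi m _).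
- by apply: total_weight_eq => t tb; rewrite pos_catl // su.
- exact: superblock_weight.
by rewrite -su pos_catr.
Qed.

Lemma total_weight_le a r x : (a <= 1)%N ->
  EW ((2 * r + 1) * M) (fun w : seq dir => B ^+ total_weight a r (pos x w)) <= 2 * gam^-1 ^+ r.
Proof.
move=> a1; have -> : ((2 * r + 1) * M = (2 * r + a) * M + (1 - a) * M)%N by rewrite -mulnDl; congr muln; move: a1; clear; lia.
rewrite (eq_EW (G := fun w => (fun u => B ^+ total_weight a r (pos x u)) (take ((2 * r + a) * M) w))) => [|w sw].
  rewrite (EW_drop_last _ _ _ (fun u : seq dir => B ^+ total_weight a r (pos x u))) //; apply: le_trans (total_weight_mean a r 0 x); apply: ler_EW => w _.
  by rewrite /Phi big_ord0 mulr0 addr0 mulr1.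
congr (B ^+ _); apply: total_weight_eq => t tb.
by rewrite -{1}(cat_take_drop ((2 * r + a) * M) w) pos_catl // size_takel // sw leq_addr.
Qed.

Lemma weight_sum r X :
  (\sum_(p in D) \sum_(j < 2 * r) weight l s M k L W cH cC X p j.+1 = total_weight 0 r X + total_weight 1 r X)%N.
Proof.
rewrite /total_weight -big_split /= exchange_big /=.
elim: r => [|r IH]; first by rewrite muln0 !big_ord0.
rewrite [RHS]big_ord_recr -IH /= (_ : 2 * r.+1 = (2 * r).+2)%N; last by clear; lia.
by rewrite !big_ord_recr /= addnA addn0 addn1.
Qed.

(** Markov's inequality. With [B = b^2] one has [b^(x + y) <= B^x + B^y], which recombines the two
    parities without any independence. *)
Lemma all_heavy_prob b r x : 1 <= b -> B = b ^+ 2 ->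
  EW ((2 * r + 1) * M) (fun w : seq dir => [forall p in D, (W <= \sum_(j < 2 * r) weight l s M k L W cH cC (pos x w) p j.+1)%N]%:R)
    <= 4 * gam^-1 ^+ r / b ^+ (W * #|D|).
Proof.
move=> b1g Bb; have b0 : 0 < b by exact: lt_le_trans ltr01 b1g.
rewrite ler_pdivlMr ?exprn_gt0 // mulrC -EWZ.
apply: (@le_trans _ _ (EW ((2 * r + 1) * M) (fun w : seq dir => B ^+ total_weight 0 r (pos x w) + B ^+ total_weight 1 r (pos x w)))).
  apply: ler_EW => w _; have B0 i : 0 <= B ^+ i by rewrite exprn_ge0 // (le_trans ler01).
  case: forallP => [h|_]; last by rewrite mulr0 addr_ge0.
  have hW : (W * #|D| <= total_weight 0 r (pos x w) + total_weight 1 r (pos x w))%N.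
    rewrite -weight_sum mulnC -sum_nat_const; apply: leq_sum => p pD.
    by have := h p; rewrite pD.
  rewrite mulr1 Bb -!exprM; apply: le_trans (ler_weXn2l b1g hW) _.
  have [le01|le10] := leqP (total_weight 0 r (pos x w)) (total_weight 1 r (pos x w)).
    apply: (@le_trans _ _ (b ^+ (2 * total_weight 1 r (pos x w)))); last by rewrite lerDr exprn_ge0 // ltW.
    by rewrite ler_weXn2l // mul2n -addnn leq_add2r.
  apply: (@le_trans _ _ (b ^+ (2 * total_weight 0 r (pos x w)))); last by rewrite lerDl exprn_ge0 // ltW.
  by rewrite ler_weXn2l // mul2n -addnn leq_add2l ltnW.
rewrite EWD (_ : 4 * gam^-1 ^+ r = 2 * gam^-1 ^+ r + 2 * gam^-1 ^+ r); last by ring.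
by apply: lerD; exact: total_weight_le.
Qed.

End OneSuperblock.

Lemma exp_beats_poly (R : realType) (K : R) (e : nat) : exists A : nat, (0 < A)%N /\ K * A%:R ^+ e <= 2 ^+ A.
Proof.
have [n [n0 hn]] := nat_above (`|K| * (2 * e.+1)%:R ^+ e.+1).
exists (2 * e.+1 * n)%N; split; first by rewrite !muln_gt0 n0.
have p2 : n%:R <= 2 ^+ n :> R by rewrite -natrX ler_nat ltnW // ltn_expl.
have p20 : 0 <= 2 ^+ n :> R by rewrite exprn_ge0.
apply: (@le_trans _ _ (`|K| * (2 * e.+1 * n)%:R ^+ e.+1)).
  apply: (@le_trans _ _ (`|K| * (2 * e.+1 * n)%:R ^+ e)); first by rewrite ler_wpM2r ?exprn_ge0 ?ler0n // ler_norm.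
  by rewrite ler_wpM2l // ler_weXn2l // ler1n !muln_gt0 n0.
rewrite natrM exprMn mulrA; apply: (@le_trans _ _ (n%:R * (2 ^+ n) ^+ e.+1)).
  by apply: ler_pM; rewrite ?mulr_ge0 ?exprn_ge0 ?ler0n // lerXn2r ?nnegrE ?ler0n.
apply: (@le_trans _ _ (2 ^+ n * (2 ^+ n) ^+ e.+1)); first by rewrite ler_wpM2r ?exprn_ge0.
rewrite -exprS -exprM ler_weXn2l ?ler1n // mulnC leq_mul2r; apply/orP; right; clear; lia.
Qed.

Lemma compound_le4 (R : realType) (n : nat) : (0 < n)%N -> (1 + n%:R^-1) ^+ n <= 4 :> R.
Proof.
move=> n0; have n0' : 0 < n%:R :> R by rewrite ltr0n.
pose y : R := n%:R^-1 / 2.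
have y0 : 0 <= y by rewrite divr_ge0 ?invr_ge0 ?ler0n.
have ny : n%:R * y <= 1 / 2 by rewrite /y mulrA mulfV ?gt_eqF.
have h := exp_le2 y0 ny.
apply: (@le_trans _ _ (((1 + y) ^+ n) ^+ 2)).
  rewrite exprAC lerXn2r ?nnegrE ?addr_ge0 ?exprn_ge0 ?invr_ge0 ?ler0n ?addr_ge0 //.
  have -> : n%:R^-1 = y + y by rewrite -splitr.
  by rewrite expr2; nra.
rewrite (_ : 4 = 2 ^+ 2); last by rewrite expr2 -natrM.
by rewrite lerXn2r ?nnegrE ?exprn_ge0 // addr_ge0.
Qed.

Lemma compound_le (R : realType) (n m : nat) : (0 < n)%N -> (1 + m%:R / n%:R) ^+ n <= 4 ^+ m :> R.
Proof.
move=> n0; have i0 : 0 <= n%:R^-1 :> R by rewrite invr_ge0 ler0n.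
have [h1 h2] := (bernoulli m i0, @compound_le4 R n n0).
apply: (@le_trans _ _ (((1 + n%:R^-1) ^+ m) ^+ n)).
  by rewrite lerXn2r ?nnegrE ?exprn_ge0 // addr_ge0 // ?mulr_ge0 ?ler0n.
by rewrite exprAC lerXn2r ?nnegrE ?exprn_ge0 // addr_ge0.
Qed.

Definition bad (d' N l s M k L nb : nat) (X : nat -> 'rV['Z_N]_d'.+1) (p : 'rV['Z_N]_d'.+1) : bool :=
  has (fun j => touches M L X p j && fails l s M k L (superblock M X j) (past L X p (j.-1 * M))
    (past_cands s M k L X p (j.-1 * M))) (iota 1 nb).

Lemma badPn d' N l s M k L nb (X : nat -> 'rV['Z_N]_d'.+1) p : ~~ bad l s M k L nb X p ->
  forall j, (0 < j <= nb)%N -> touches M L X p j ->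
   ~~ fails l s M k L (superblock M X j) (past L X p (j.-1 * M)) (past_cands s M k L X p (j.-1 * M)).
Proof.
move=> /hasPn h j jb tj; have := h j; rewrite mem_iota add1n ltnS jb tj /=; exact.
Qed.

Lemma killing_arith (R : realType) (K r D u P n : R) : K * (r + D) <= K * (u * P + 1 + n) -> K * u * P <= P / 2 ->
  4 * K * (n + 1) <= n * n - 1 -> n * n <= P -> 0 <= n -> K * (r + D) <= P.
Proof. by move=> *; nra. Qed.

(** * Choice of all constants *)

Section ChoiceOfScales.
Variables (R : realType) (d' : nat).
Notation d := d'.+1.
Notation T N := 'rV['Z_N]_d.
Notation dir := ('I_d * bool)%type.
Hypothesis d_gt4 : (4 < d)%N.

Definition num_pairs (d : nat) (M N : nat) (u : R) : nat := (Num.truncn (u * N%:R ^+ d) %/ (2 * M)).+1.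

Lemma sparse_card L N (D : {set T N}) : (2 < N)%N -> (0 < L)%N -> sparse L D -> (#|D| <= N)%N.
Proof.
move=> N2 L0 /(_ 0 N); rewrite (eq_card (B := D)) => [|p]; first by move: N2; clear; lia.
rewrite !inE (_ : (nrm _ <= _)%N) ?andbT //; apply: (@leq_trans N); last by rewrite leq_pmulr.
by apply/bigmax_leqP => i _; rewrite /cyc geq_min; apply/orP; left; rewrite -[X in (_ <= X)%N](@Zp_cast N) // ltnW.
Qed.

(** After cancellation the inequality reads [K (r + |D|) <= N^d]. Sparseness gives [|D| <= N], and
    [r <= u N^d + 1]; this is where [u] has to be small. *)
Lemma killing_large (K u : R) (L M : nat) : (0 < M)%N -> (0 < L)%N -> 1 <= K -> 0 < u -> u * K <= 1 / 2 ->
  exists N0 : nat, forall N (D : {set T N}), (N0 <= N)%N -> sparse L D -> (0 < #|D|)%N ->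
  forall r, r = num_pairs d M N u -> #|D|%:R * (K / N%:R ^+ d) <= 1 - r%:R / (r%:R + #|D|%:R).
Proof.
move=> M0 L0 K1 u0 uK; have [N1 [N10 hN1]] := nat_above (4 * K).
exists (N1 + 3)%N => N D NN sp D0 r rE.
have N2 : (2 < N)%N by move: NN; clear; lia.
have Dr := sparse_card N2 L0 sp.
have K0 : 0 < K by exact: lt_le_trans ltr01 K1.
have Dp : 0 < #|D|%:R :> R by rewrite ltr0n.
have r0 : 0 < r%:R :> R by rewrite rE ltr0n.
have s0 : 0 < r%:R + #|D|%:R :> R by rewrite addr_gt0.
have -> : 1 - r%:R / (r%:R + #|D|%:R) = #|D|%:R / (r%:R + #|D|%:R) :> R.
  by rewrite -{1}(@mulfV _ (r%:R + #|D|%:R)) ?gt_eqF // -mulrBl addrC addKr.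
have Nd0 : 0 < N%:R ^+ d :> R by rewrite exprn_gt0 // ltr0n; move: N2; clear; lia.
rewrite ler_pM2l // ler_pdivrMr // mulrC ler_pdivlMr //.
have rb : r%:R <= u * N%:R ^+ d + 1 :> R.
  rewrite rE -natr1 lerD2r; apply: (@le_trans _ _ (Num.truncn (u * N%:R ^+ d))%:R).
    by rewrite ler_nat leq_div.
  by rewrite truncn_le // mulr_ge0 ?(ltW u0) // ltW.
have NN2 : N%:R * N%:R <= N%:R ^+ d :> R.
  by rewrite -expr2 ler_weXn2l ?ler1n //; move: N2 d_gt4; clear; lia.
have DN : #|D|%:R <= N%:R :> R by rewrite ler_nat.
have N1N : 4 * K <= N%:R - 1.
  by apply: le_trans hN1 _; rewrite lerBrDr natr1 ler_nat; move: NN; clear; lia.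
move: NN2 rb uK; set P := N%:R ^+ d; move=> NN2 rb uK.
have h1 : K * (r%:R + #|D|%:R) <= K * (u * P + 1 + N%:R) by rewrite ler_pM2l // lerD.
have h2 : K * u * P <= P / 2 by have := ler_wpM2r (ltW Nd0) uK; rewrite -/P; lra.
have h3 : 4 * K * (N%:R + 1) <= N%:R * N%:R - 1.
  apply: le_trans (ler_wpM2r _ N1N) _; first by rewrite addr_ge0 ?ler0n.
  by rewrite le_eqVlt; apply/orP; left; apply/eqP; ring.
exact: killing_arith h1 h2 h3 NN2 (ler0n _ _).
Qed.

(** Order of the choices: [t] from [eps], then [b1], [A], [e], [delta], then [k], [s] and [g]. Since
    [M] is of order [L^2 / A^2], the potential grows like [A^d] while escapes decay like [2^-A], so
    [A] only has to beat a polynomial. In the end [4 * 4^|D|] from the killing is divided by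
    [(1 + t)^|D|], and [16 <= eps (1 + t)]. *)
Theorem rare_failures (eps : R) : 0 < eps ->
  exists l s k L M : nat, [/\ (0 < l)%N && (0 < s)%N, (2 * s * k <= M)%N, (s + l <= L)%N, (0 < M)%N &
  exists2 u0 : R, 0 < u0 & forall u, 0 < u -> u < u0 -> exists N0 : nat, forall N (D : {set T N}) r (x : T N),
    (N0 <= N)%N -> sparse L D -> r = num_pairs d M N u ->
    EW ((2 * r + 1) * M) (fun w : seq dir => [forall p in D, bad l s M k L (2 * r) (pos x w) p]%:R) <= eps ^+ #|D| ].
Proof.
move=> eps0.
have [t [t0 ht]] := nat_above (16 / eps).
have t0' : 0 < t%:R :> R by rewrite ltr0n.
pose b1 : R := (1 + t%:R) ^+ 2 * 16 ^+ t.
have b1_ge1 : 1 <= b1.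
  by apply: mulr_ege1; apply: exprn_ege1; [rewrite lerDl ler0n|rewrite ler1n].
have b10 : 0 < b1 by exact: lt_le_trans ltr01 b1_ge1.
have bc0 : 0 <= ball_const R d' by rewrite /ball_const; nneg.
pose K1 : R := 157 + 12 * ball_const R d' * (4 * (hk_const d)%:R) ^+ d.
have K10 : 157 <= K1 by rewrite lerDl; nneg.
have K1p : 0 < K1 by apply: lt_le_trans K10; rewrite ltr0n.
pose K2 : R := 2 ^+ 48 * d%:R * b1 ^+ 2 * K1 + (8 * d)%:R + 4 * b1.
have K2a : 0 <= 2 ^+ 48 * d%:R * b1 ^+ 2 * K1 by apply: mulr_ge0 (ltW K1p); nneg; exact: ltW.
have [A [A0 hA]] := exp_beats_poly K2 d.
have A1 : 1 <= A%:R ^+ d :> R by rewrite exprn_ege1 // ler1n.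
have b14 : 0 <= 4 * b1 by apply: mulr_ge0 => //; exact: ltW.
have K2A : K2 <= 2 ^+ A.
  apply: le_trans hA; rewrite ler_peMr // /K2 addr_ge0 // addr_ge0 // ?ler0n.
have A_large : (8 * d)%:R <= 2 ^+ A :> R.
  by apply: le_trans K2A; rewrite /K2 addrAC lerDr addr_ge0.
have A_b1 : 4 * b1 <= 2 ^+ A by apply: le_trans K2A; rewrite /K2 lerDr addr_ge0 ?ler0n.
pose P1 : R := pot_const R d' A + 1.
have P1E : P1 = 157 + 12 * ball_const R d' * (4 * A%:R * (hk_const d)%:R) ^+ d.
  by rewrite /P1 /pot_const addrAC (_ : 157 = 156 + 1) // -(natrD _ 156%N 1%N).
have P1p : 0 < P1 by rewrite P1E ltr_wpDr ?ltr0n //; nneg.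
have P1K : P1 <= K1 * A%:R ^+ d.
  rewrite P1E /K1 [leRHS]mulrDl; apply: lerD; first by rewrite ler_peMr.
  rewrite mulrAC (_ : 4 * A%:R * _ = A%:R * (4 * (hk_const d)%:R)); last by ring.
  by rewrite exprMn; rewrite le_eqVlt; apply/orP; left; apply/eqP; ring.
pose e : R := (2 * P1)^-1.
have e0 : 0 < e by rewrite invr_gt0 mulr_gt0.
have pot_ok : 2 * e * P1 <= 1.
  by rewrite /e mulrAC mulfV // gt_eqF // mulr_gt0.
have fast_ok : 2 ^+ 47 * d%:R * b1 ^+ 2 <= e * 2 ^+ A.
  rewrite [leRHS]mulrC /e ler_pdivlMr ?mulr_gt0 //.
  apply: le_trans hA; apply: (@le_trans _ _ (2 ^+ 48 * d%:R * b1 ^+ 2 * K1 * A%:R ^+ d)); last first.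
    by rewrite ler_wpM2r ?exprn_ge0 ?ler0n // /K2 -addrA lerDl addr_ge0 ?ler0n.
  rewrite -[leRHS]mulrA (exprS 2 47) (_ : 2 ^+ 47 * d%:R * b1 ^+ 2 * (2 * P1) = 2 * 2 ^+ 47 * d%:R * b1 ^+ 2 * P1); last by ring.
  by rewrite ler_wpM2l //; nneg; exact: ltW.
pose delta : R := e / 2 ^+ 44 / b1.
have delta0 : 0 < delta by rewrite !divr_gt0 // exprn_gt0.
have [k [s [G [k0 s1 hG]]]] := fails_small d_gt4 delta0 A0.
have [g1 [g10 hg1]] := nat_above ((2 * t%:R + t%:R ^+ 2) * 2 ^+ 44 / e).
pose g := (A * (G + g1 + 1))%N.
have g0 : (0 < g)%N by rewrite muln_gt0 A0 addn1.
have Gg : (G + g1 <= g)%N by rewrite /g (leq_trans (leq_addr 1 _)) // leq_pmull.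
have [gl rare0] := hG g (leq_trans (leq_addr _ _) Gg).
have [_ skM sl LM [M1 M2L M3 slL]] := scales d_gt4 A0 k0 s1 gl.
pose L := (g ^ 4)%N; pose M := (L ^ 2 %/ (2 * A ^ 2))%N; pose l := (g ^ 3)%N.
have L0 : (0 < L)%N by rewrite expn_gt0 g0.
have M0 : (0 < M)%N by exact: ltnW M1.
exists l, s, k, L, M; split=> //; first by rewrite expn_gt0 g0 /= ltnW.
(* [b^W] lies between [1 + t] and [4^t] uniformly in [g], while [B - 1] is of order [1 / W]; so [b1]
   can be fixed before [g]. *)
pose W := (g ^ 2)%N; pose b : R := 1 + t%:R / W%:R.
have W0 : (0 < W)%N by rewrite expn_gt0 g0.
have W0' : 0 < W%:R :> R by rewrite ltr0n.
have b_ge1 : 1 <= b by rewrite lerDl divr_ge0 ?ler0n.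
have b_le : b <= 1 + t%:R by rewrite lerD2l ler_pdivrMr // ler_peMr ?ler0n // ler1n.
have bW_ge : 1 + t%:R <= b ^+ W.
  apply: le_trans (bernoulli W _); first by rewrite mulrCA mulfV ?gt_eqF // mulr1.
  by rewrite divr_ge0 ?ler0n.
have bW_le : b ^+ W <= 4 ^+ t by exact: compound_le.
have b0 : 0 <= b by exact: le_trans ler01 b_ge1.
pose B := b ^+ 2.
have B_ge1 : 1 <= B by rewrite exprn_ege1.
have Bb1 : B ^+ (1 + W) <= b1.
  rewrite exprD expr1 /B exprAC /b1 (_ : 16 ^+ t = (4 ^+ t) ^+ 2); last first.
    by rewrite exprAC; congr (_ ^+ t); rewrite expr2 -natrM.
  by apply: ler_pM; rewrite ?exprn_ge0 // lerXn2r ?nnegrE ?exprn_ge0 // addr_ge0 ?ler0n.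
have slow_ok : B - 1 + b1 * delta <= e / 2 ^+ 43.
  have hB : B - 1 <= e / 2 ^+ 44.
    have tW : B - 1 <= (2 * t%:R + t%:R ^+ 2) / W%:R.
      have -> : B - 1 = (2 * t%:R + t%:R * t%:R / W%:R) / W%:R by rewrite /B /b; field; rewrite gt_eqF.
      rewrite ler_wpM2r ?invr_ge0 ?ler0n // lerD2l ler_pdivrMr // expr2 ler_peMr ?mulr_ge0 ?ler0n //.
      by rewrite ler1n.
    apply: le_trans tW _; rewrite ler_pdivrMr // mulrAC ler_pdivlMr ?exprn_gt0 // mulrC [e * _]mulrC -ler_pdivrMr //.
    rewrite [2 ^+ 44 * _]mulrC; apply: le_trans hg1 _; rewrite ler_nat /W.
    by apply: leq_trans (leq_trans (leq_addl _ _) Gg) _; rewrite -mulnn leq_pmulr.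
  have -> : b1 * delta = e / 2 ^+ 44 by rewrite /delta mulrC divfK // gt_eqF.
  apply: (@le_trans _ _ (e / 2 ^+ 44 + e / 2 ^+ 44)); first by rewrite lerD2r.
  rewrite (exprSr 2 43) invfM mulrA; move: (e / 2 ^+ 43) => z.
  by rewrite -splitr.
pose K : R := ball_const R d' * L%:R ^+ d * (hk_const d)%:R ^+ d + 1.
have K_ge1 : 1 <= K by rewrite lerDr; nneg.
have K0 : 0 < K by exact: lt_le_trans ltr01 K_ge1.
exists (2 * K)^-1; first by rewrite invr_gt0 mulr_gt0.
move=> u u0 uK; have [|N1 hN1] := killing_large M0 L0 K_ge1 u0 (L := L) (M := M).
  by move/ltW: uK; rewrite -div1r ler_pdivlMr ?mulr_gt0 // => h; lra.
exists (N1 + 8 * L + 3)%N => N D r x NN sp rE.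
have N2 : (2 < N)%N by move: NN; clear; lia.
have N0' : 0 < N%:R :> R by rewrite ltr0n; move: N2; clear; lia.
have [D0|D0] := posnP #|D|.
  rewrite D0 expr0; apply: EW_le_const => [|w _]; first exact: dir_gt0.
  by rewrite lern1 leq_b1.
have r0 : (0 < r)%N by rewrite rE.
have r0' : 0 < r%:R :> R by rewrite ltr0n.
have D0' : 0 < #|D|%:R :> R by rewrite ltr0n.
(* Then [gam^-1 = 1 + |D| / r], and [r] superblocks of killing cost at most [4^|D|]. *)
pose gam : R := r%:R / (r%:R + #|D|%:R).
have rD : 0 < r%:R + #|D|%:R :> R by rewrite addr_gt0.
have gam01 : 0 < gam < 1 by rewrite divr_gt0 //= ltr_pdivrMr // mul1r ltrDl.
have killing : #|D|%:R * (ball_const R d' * L%:R ^+ d * ((hk_const d)%:R / N%:R) ^+ d) <= 1 - gam.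
  have NN1 : (N1 <= N)%N by move: NN; clear; lia.
  apply: le_trans (hN1 N D NN1 sp D0 r rE); rewrite ler_pM2l // expr_div_n mulrA ler_wpM2r ?invr_ge0 ?exprn_ge0 ?ler0n //.
  by rewrite lerDl.
have AL : (A %| L)%N by rewrite /L dvdn_exp // dvdn_mulr.
have MA : (2 * M * A ^ 2 <= L ^ 2)%N by rewrite mulnAC mulnC leq_divM.
have LM' : (L ^ 2 <= 16 * A ^ 2 * M)%N.
  by apply: leq_trans LM _; rewrite leq_mul2l -/M; apply/orP; right; rewrite -divn2 leq_div.
have rare : forall (y : T N) H Hc, (size H <= g ^ 10)%N -> (size Hc <= 2 * k * g ^ 2)%N ->
  EW (2 * M) (fun w : seq dir => (fails l s M k L (pos y w) H Hc && slow M L (pos y w))%:R) <= delta.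
  by move=> y H Hc hH hHc; apply: rare0 => //; move: NN; rewrite -/L; clear; lia.
have main := all_heavy_prob N2 d_gt4 A0 L0 AL MA LM' A_large B_ge1 Bb1 e0 (ltW delta0) slow_ok A_b1 fast_ok sp rare
  gam01 pot_ok killing skM r x b_ge1 (erefl B).
apply: (@le_trans _ _ (4 * gam^-1 ^+ r / b ^+ (W * #|D|))).
  apply: le_trans main; apply: ler_EW => w _; rewrite ler_nat; apply: leq_implb => /forallP h.
  apply/forallP => p; apply/implyP => pD; have := h p; rewrite pD /= => bp.
  apply: bad_weight => //.
  - rewrite /M /W; apply: (@leq_trans (g ^ 8 * g ^ 2)); last by rewrite -expnD.
    by rewrite leq_mul2r; apply/orP; right; apply: leq_trans (leq_div _ _) _; rewrite /L -expnM.
  - by rewrite -mulnA leq_pmull.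
  move=> h2; move/hasP: bp => -[j]; rewrite mem_iota add1n ltnS => jb /andP[tj].
  by apply/negP; exact: h2.
have gi : gam^-1 = 1 + #|D|%:R / r%:R by rewrite /gam invf_div mulrDl mulfV ?gt_eqF.
have bD : (1 + t%:R) ^+ #|D| <= b ^+ (W * #|D|).
  by rewrite exprM lerXn2r ?nnegrE ?exprn_ge0 // addr_ge0 ?ler0n.
have t1 : 0 < 1 + t%:R :> R by rewrite addr_gt0.
rewrite gi ler_pdivrMr ?(lt_le_trans _ bD) ?exprn_gt0 //.
apply: (@le_trans _ _ (4 * 4 ^+ #|D|)); first by rewrite ler_wpM2l // compound_le.
apply: (@le_trans _ _ (eps ^+ #|D| * (1 + t%:R) ^+ #|D|)); last by rewrite ler_wpM2l ?exprn_ge0 // ltW.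
apply: (@le_trans _ _ (16 ^+ #|D|)).
  rewrite (_ : 16 = 4 * 4); last by rewrite -natrM.
  by rewrite exprMn ler_wpM2r ?exprn_ge0 // -{1}(expr1 4) ler_weXn2l // ler1n.
rewrite -exprMn lerXn2r ?nnegrE ?mulr_ge0 ?(ltW eps0) ?(ltW t1) //.
rewrite mulrC -ler_pdivrMr //; apply: le_trans ht _; by rewrite lerDr.
Qed.

End ChoiceOfScales.

(** * Rarity of trees *)

Local Close Scope ring_scope.

Lemma expn_mono a b k : a <= b -> a ^ k <= b ^ k.
Proof. by case: k => // k; rewrite leq_exp2r. Qed.

Lemma same_quotient (s c x y a b : nat) : 0 < s -> a = x * s + c -> b = y * s + c -> b <= a + s.-1 -> a <= b + s.-1 -> x = y.
Proof. by nia. Qed.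

Section Thin.
Variables (d m l : nat).
Hypothesis l_large : 5000 <= l.
Notation box := (box d m).
Implicit Types (v q i j : box) (t f Q : seq box).
Notation reach := (reach l).
Notation trees := (@trees d m l).

(** The 600, against 100 in [sparse], absorbs the factor 4 lost in [sparse_anchors] between box and
    torus distances. *)
Definition thin t := forall i, i \in t -> forall r, 600 * count (fun j => linf i j <= r) t <= 600 + r.

Lemma reach_le k : reach k <= 2 * l ^ k.
Proof.
elim: k => [//|k IH] /=; rewrite expnS; apply: leq_trans (leq_add (leqnn _) IH) _.
move: l_large; move: (l ^ k) => z; clear; nia.
Qed.

Lemma pow_gap k : 600 * 2 ^ k.+1 + 4 * l ^ k <= 600 + l ^ k.+1.
Proof.
have h : 2 ^ k <= l ^ k by apply: expn_mono; exact: leq_trans l_large.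
have h0 : 0 < l ^ k by rewrite expn_gt0 (leq_trans _ l_large).
by rewrite !expnS; move: h h0 l_large; move: (l ^ k) (2 ^ k) => z y; clear; nia.
Qed.

(** A ball of radius below the separation meets only one of the lists; for larger radii the total
    size is already within the allowance. *)
Lemma thin_cat t1 t2 s : thin t1 -> thin t2 -> (forall a b, a \in t1 -> b \in t2 -> s <= linf a b) ->
  600 * (size t1 + size t2) <= 600 + s -> thin (t1 ++ t2).
Proof.
move=> h1 h2 sep sz i it r; rewrite count_cat.
have big : s <= r -> 600 * (count (fun j => linf i j <= r) t1 + count (fun j => linf i j <= r) t2) <= 600 + r.
  move=> sr; apply: leq_trans (leq_trans _ sz) _; last by rewrite leq_add2l.
  by rewrite leq_mul2l leq_add ?count_size.
have [|rs] := leqP s r; first exact: big.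
move: it; rewrite mem_cat => /orP[it|it].
  rewrite [X in _ + X](_ : _ = 0) ?addn0; first exact: h1.
  apply/eqP; rewrite -leqn0 leqNgt -has_count; apply/hasPn => j jt.
  by rewrite -ltnNge (leq_trans rs) // sep.
rewrite [X in X + _](_ : _ = 0) ?add0n; first exact: h2.
apply/eqP; rewrite -leqn0 leqNgt -has_count; apply/hasPn => j jt.
by rewrite -ltnNge (leq_trans rs) // linf_sym sep.
Qed.

(** The subtrees have roots [l^k.+1] apart and reach at most [2 l^k] each; by [pow_gap] the
    remaining separation allows for all [2^k.+1] leaves. *)
Lemma tree_props k i t : t \in trees k i ->
  [/\ size t = 2 ^ k, forall j, j \in t -> linf i j <= reach k, uniq t & thin t].
Proof.
elim: k i t => [|k IH] i t /=.
  rewrite inE => /eqP->; split=> // [j|j _ r]; first by rewrite inE => /eqP->; rewrite linfxx.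
  by rewrite /= addn0; case: (linf j i <= r); rewrite ?muln1 ?muln0 // leq_addr.
case/allpairsP => -[t1 t2] /= [t1i /flattenP[ts /mapP[j]]].
rewrite mem_enum inE => /eqP ij -> t2j ->.
have [s1 r1 u1 th1] := IH _ _ t1i; have [s2 r2 u2 th2] := IH _ _ t2j.
have rk := reach_le k; have gap := pow_gap k.
have sep a b : a \in t1 -> b \in t2 -> l ^ k.+1 - 4 * l ^ k <= linf a b.
  move=> /r1 h1 /r2 h2; have := linf_triangle a i j; have := linf_triangle b a j.
  by rewrite [linf b j]linf_sym ij; move: h1 h2 rk; clear; lia.
have lk : 0 < l ^ k by rewrite expn_gt0 (leq_trans _ l_large).
have p2 : 0 < 2 ^ k by rewrite expn_gt0.
split.
- by rewrite size_cat s1 s2 expnS mul2n addnn.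
- move=> b; rewrite mem_cat => /orP[/r1 h|/r2 h]; first by apply: leq_trans h _; rewrite leq_addl.
  by apply: leq_trans (linf_triangle j _ _) _; rewrite ij leq_add2l.
- rewrite cat_uniq u1 u2 andbT; apply/hasPn => b b2; apply/negP => b1.
  by have := sep b b b1 b2; rewrite linfxx; move: gap lk p2; rewrite (expnS 2); clear; lia.
apply: thin_cat sep _ => //; rewrite s1 s2; move: gap; rewrite (expnS 2); clear; lia.
Qed.

Fixpoint forests k Q : seq (seq box) :=
  if Q is q :: Q' then [seq t ++ f | t <- trees k q, f <- forests k Q'] else [:: [::]].

Lemma forests_has (Bad : pred box) k Q : all (has_tree l Bad k) Q -> has (all Bad) (forests k Q).
Proof.
elim: Q => [//|q Q IH] /= /andP[/hasP[t tq at'] /IH /hasP[f fQ af]].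
by apply/hasP; exists (t ++ f); [apply/allpairsP; exists (t, f)|rewrite all_cat at'].
Qed.

Lemma forest_size k Q f : f \in forests k Q -> size f = 2 ^ k * size Q.
Proof.
elim: Q f => [|q Q IH] f /=; first by rewrite inE => /eqP->; rewrite muln0.
by case/allpairsP => -[t g] /= [/tree_props[st _ _ _] /IH sg ->]; rewrite size_cat st sg mulnS.
Qed.

Lemma forest_root k Q f a : f \in forests k Q -> a \in f -> exists2 q, q \in Q & linf q a <= reach k.
Proof.
elim: Q f => [|q Q IH] f /=; first by rewrite inE => /eqP->.
case/allpairsP => -[t g] /= [/tree_props[_ h _ _] gQ ->]; rewrite mem_cat => /orP[/h aq|/(IH _ gQ)[q' q'Q h']].
  by exists q; rewrite ?mem_head.
by exists q'; rewrite // inE q'Q orbT.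
Qed.

Lemma forest_count k Q f i r : f \in forests k Q ->
  count (fun j => linf i j <= r) f <= 2 ^ k * count (fun q => linf i q <= r + reach k) Q.
Proof.
elim: Q f => [|q Q IH] f /=; first by rewrite inE => /eqP->; rewrite muln0.
case/allpairsP => -[t g] /= [/tree_props[st h _ _] gQ ->]; rewrite count_cat mulnDr leq_add ?IH //.
case: (boolP (linf i q <= r + reach k)) => iq; first by rewrite muln1 -st count_size.
rewrite -ltnNge in iq; rewrite muln0 leqn0 -[_ == 0]negbK -lt0n -has_count; apply/hasPn => j jt; rewrite -ltnNge.
by have := linf_triangle j i q; rewrite [linf j q]linf_sym; have := h j jt; move: iq; clear; lia.
Qed.

Definition spaced s Q := forall i r, s * count (fun q => linf i q <= r) Q <= s + 2 * r.

(** Below the spacing [s = l^k.+2] a ball around a leaf meets a single tree, which is thin. Above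
    it, each root carries [2^k <= l^k] leaves and roots have density of order [1 / s], leaving a
    density of order [l^-2]. *)
Lemma forest_props k Q f s : l ^ k.+2 = s -> uniq Q -> (forall q q', q \in Q -> q' \in Q -> q != q' -> s <= linf q q') ->
  spaced s Q -> f \in forests k Q -> uniq f /\ thin f.
Proof.
move=> sE uQ sep sp fQ; have rk := reach_le k.
have lk : 0 < l ^ k by rewrite expn_gt0 (leq_trans _ l_large).
have s_big : 5000 * (5000 * l ^ k) <= s by rewrite -sE !expnS leq_mul // leq_mul.
have rs : 4 * reach k < s by move: rk s_big lk; clear; lia.
have p2k : 2 ^ k <= l ^ k by apply: expn_mono; exact: leq_trans l_large.
have local : uniq f /\ forall i, i \in f -> forall r, r + 2 * reach k < s -> 600 * count (fun j => linf i j <= r) f <= 600 + r.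
  elim: Q f fQ uQ sep {sp} => [|q Q IH] f /=; first by rewrite inE => /eqP-> _ _; split.
  case/allpairsP => -[t g] /= [tq gQ ->] /andP[qQ uQ] sep.
  have [_ ht ut tht] := tree_props tq.
  have [|ug loc] := IH g gQ uQ; first by move=> a b aQ bQ; apply: sep; rewrite inE ?aQ ?bQ orbT.
  have far q' : q' \in Q -> s <= linf q q'.
    by move=> q'Q; apply: sep; rewrite ?inE ?eqxx ?q'Q ?orbT //; apply: contraNneq qQ => ->.
  have apart a b r : a \in t -> b \in g -> r + 2 * reach k < s -> ~~ (linf a b <= r).
    move=> /ht aq bg rs'; have [q' q'Q bq'] := forest_root gQ bg; rewrite -ltnNge.
    have := linf_triangle a q q'; have := linf_triangle b a q'; rewrite [linf b q']linf_sym.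
    by move: (far q' q'Q) aq bq' rs'; clear; lia.
  split.
    rewrite cat_uniq ut ug andbT; apply/hasPn => b bg; apply/negP => bt.
    by have := apart b b 0 bt bg; rewrite linfxx => /(_ _)/negP; apply=> //; move: rs; clear; lia.
  move=> i it r rs'; rewrite count_cat; move: it; rewrite mem_cat => /orP[it|it].
    rewrite [X in _ + X](_ : _ = 0) ?addn0; first exact: tht.
    by apply/eqP; rewrite -leqn0 leqNgt -has_count; apply/hasPn => j jt; exact: apart.
  rewrite [X in X + _](_ : _ = 0) ?add0n; first exact: loc.
  by apply/eqP; rewrite -leqn0 leqNgt -has_count; apply/hasPn => j jt; rewrite linf_sym; exact: apart.
case: local => uf loc; split=> // i it r.
have [h|h] := ltnP (r + 2 * reach k) s; first exact: loc.
have c1 := forest_count i r fQ; have c2 := sp i (r + reach k).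
move: c1 c2; move: (count _ f) (count _ Q) => x y c1 c2.
have e1 : 600 * x * s <= 600 * l ^ k * (s + 2 * (r + reach k)).
  apply: (@leq_trans (600 * (2 ^ k * y) * s)); first by rewrite leq_mul2r leq_mul2l c1 !orbT.
  rewrite -!mulnA leq_mul2l /= ; apply: leq_mul => //; by rewrite mulnC.
have e2 : 600 * l ^ k * (s + 2 * (r + reach k)) <= r * s.
  apply: (@leq_trans (600 * l ^ k * (8 * r))).
    by rewrite leq_mul2l; apply/orP; right; move: h rs; clear; lia.
  rewrite (_ : 600 * l ^ k * (8 * r) = r * (4800 * l ^ k)); last by move: (l ^ k) => z; clear; lia.
  by rewrite leq_mul2l; apply/orP; right; move: s_big; clear; lia.
have s0 : 0 < s by move: rs; clear; lia.
have : 600 * x * s <= r * s by exact: leq_trans e1 e2.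
by rewrite leq_mul2r => /orP[/eqP e|h2]; [move: s0; rewrite e|rewrite (leq_trans h2) ?leq_addl].
Qed.

Lemma residue_count (s c a r : nat) (I : seq nat) : 0 < s -> uniq I -> (forall t : nat, t \in I -> t %% s = c) ->
  s * count (fun t : nat => (t <= a + r) && (a <= t + r)) I <= s + 2 * r.
Proof.
move=> s0 uI hI; pose A := [seq t : nat <- I | (t <= a + r) && (a <= t + r)].
rewrite -size_filter -/A -(size_map (fun t : nat => (t + r - a) %/ s)).
have sz : size [seq (t + r - a) %/ s | t : nat <- A] <= (2 * r) %/ s + 1.
  rewrite -[leqRHS](size_iota 0); apply: uniq_leq_size.
    rewrite map_inj_in_uniq ?filter_uniq // => t t'; rewrite !mem_filter => /andP[/andP[b1 b2] tI] /andP[/andP[b3 b4] t'I] e.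
    have h1 := hI t tI; have h2 := hI t' t'I.
    have d1 := divn_eq t s; have d2 := divn_eq t' s; rewrite h1 in d1; rewrite h2 in d2.
    have d3 := divn_eq (t + r - a) s; have d4 := divn_eq (t' + r - a) s; rewrite e in d3.
    have l3 := ltn_pmod (t + r - a) s0; have l4 := ltn_pmod (t' + r - a) s0.
    suff e2 : t %/ s = t' %/ s by rewrite d1 d2 e2.
    move: d1 d2 d3 d4 l3 l4 b1 b2 b3 b4; move: (t %/ s) (t' %/ s) (_ %/ s) (_ %% s) (_ %% s) => x y z u v.
    by clear; nia.
  move=> y /mapP[t]; rewrite mem_filter => /andP[/andP[b1 b2] _] ->.
  by rewrite mem_iota add0n addn1 ltnS leq_div2r //; move: b1 b2; clear; lia.
apply: (@leq_trans (s * ((2 * r) %/ s + 1))); first by rewrite leq_mul2l sz orbT.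
by rewrite mulnDr muln1 addnC leq_add2l mulnC leq_divM.
Qed.

Definition vol1 : nat := (3 * l) ^ d.

(** The counts satisfy [T_(k+1) <= T_k^2 vol1^(k+1)]; the extra factor [vol1^(k+2)] is what makes
    the induction close. *)
Lemma trees_count k i : size (trees k i) * vol1 ^ (k + 2) <= vol1 ^ (2 * 2 ^ k).
Proof.
have l0 : 0 < l by rewrite (leq_trans _ l_large).
have V0 : 0 < vol1 by rewrite expn_gt0 muln_gt0 l0.
elim: k i => [|k IH] i /=; first by rewrite mul1n.
pose Z := vol1 ^ (2 * 2 ^ k).
set js := enum _.
have cj : size js <= vol1 ^ k.+1.
  rewrite -cardE; apply: leq_trans (leq_trans (card_linf_ball i (l ^ k.+1)) _).
    by apply: subset_leq_card; apply/subsetP => j; rewrite !inE => /eqP->.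
  rewrite /vol1 -expnM [(d * _)%N]mulnC expnM; apply: expn_mono; rewrite expnMn.
  have : 0 < l ^ k.+1 by rewrite expn_gt0 l0.
  have : 3 <= 3 ^ k.+1 by rewrite -{1}(expn1 3) leq_exp2l.
  by move: (l ^ k.+1) (3 ^ k.+1) => x y; clear; nia.
have szf : size (flatten [seq trees k j | j <- js]) * vol1 ^ (k + 2) <= size js * Z.
  elim: js {cj} => [|j js IHj] /=; first by rewrite mul0n.
  by rewrite size_cat mulnDl mulSn leq_add ?IH.
rewrite size_allpairs; move: szf (IH i); rewrite -/Z.
set a := size (trees k i); set b := size _ => hb ha.
have h : a * b * vol1 ^ (k + 2) * vol1 ^ (k + 2) <= Z * (vol1 ^ k.+1 * Z).
  rewrite (_ : a * b * _ * _ = (a * vol1 ^ (k + 2)) * (b * vol1 ^ (k + 2))); last by rewrite -!mulnA; congr muln; rewrite !mulnA; congr muln; rewrite mulnC.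
  by apply: leq_mul => //; apply: leq_trans hb _; rewrite leq_mul2r cj orbT.
have Vk : 0 < vol1 ^ k.+1 by rewrite expn_gt0 V0.
rewrite -(leq_pmul2r Vk) (_ : vol1 ^ (2 * 2 ^ k.+1) = Z * Z); last first.
  by rewrite /Z -expnD; congr (_ ^ _); rewrite expnS; clear; lia.
rewrite -mulnA -expnD (_ : k.+1 + 2 + k.+1 = (k + 2) + (k + 2)); last by clear; lia.
by rewrite expnD mulnA; apply: leq_trans h _; rewrite mulnA mulnAC.
Qed.

End Thin.

Local Open Scope ring_scope.

(** * Probability of trees at one root and along a line *)

Section Probability.
Variables (R : realType) (D : finType) (d m l n lo hi : nat).
Hypotheses (D0 : (0 < #|D|)%N) (l_large : (5000 <= l)%N).
Notation box := (box d m).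
Variables (badw : seq D -> pred box) (W : pred box) (eps eta : R).
Hypothesis eps_ge0 : 0 <= eps.
Hypothesis rare : forall t : seq box, uniq t -> all W t -> thin t -> EW n (fun w => (all (badw w) t)%:R) <= eps ^+ size t.
Hypothesis etaE : eta = eps * (vol1 d l)%:R ^+ 2.
Notation central := (@central d m lo hi).
Notation tree w := (has_tree l (badw w)).

Let l0 : (0 < l)%N. Proof. by rewrite (leq_trans _ l_large). Qed.
Let eta0 : 0 <= eta. Proof. by rewrite etaE mulr_ge0 ?exprn_ge0. Qed.

Definition inside k := forall q j, central q -> (linf q j <= reach l k)%N -> W j.

Lemma forest_prob k (Q : seq box) : inside k -> all central Q -> uniq Q ->
  (forall q q', q \in Q -> q' \in Q -> q != q' -> (l ^ k.+2 <= linf q q')%N) -> spaced (l ^ k.+2) Q ->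
  EW n (fun w => (all (tree w k) Q)%:R) <= (eta ^+ (2 ^ k)) ^+ size Q.
Proof.
move=> ins cQ uQ sep sp.
apply: (@le_trans _ _ (EW n (fun w => (has (fun f => all (badw w) f) (forests l k Q))%:R))).
  by apply: ler_EW => w _; rewrite ler_nat; apply: leq_implb; exact: forests_has.
apply: le_trans (EW_has (B := eps ^+ (2 ^ k * size Q)) _) _.
  move=> f fQ; rewrite -(forest_size l_large fQ).
  have [uf tf] := forest_props l_large (erefl _) uQ sep sp fQ.
  apply: rare => //; apply/allP => a af; have [q qQ qa] := forest_root l_large fQ af.
  by apply: ins qa; move/allP: cQ; exact.
have cnt : (size (forests l k Q) <= (vol1 d l ^ (2 * 2 ^ k)) ^ size Q)%N.
  elim: (Q) => [//|q Q' IH] /=; rewrite size_allpairs expnS leq_mul //.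
  apply: leq_trans (trees_count l_large k q); rewrite leq_pmulr // expn_gt0 /vol1 expn_gt0 muln_gt0 l0 //.
apply: (@le_trans _ _ (((vol1 d l ^ (2 * 2 ^ k)) ^ size Q)%:R * eps ^+ (2 ^ k * size Q))).
  by rewrite ler_wpM2r ?exprn_ge0 // ler_nat.
by rewrite natrX natrX [eps ^+ (_ * _)]exprM -exprMn etaE [(eps * _) ^+ _]exprMn -exprM [eps ^+ _ * _]mulrC.
Qed.

Lemma tree_prob K q : inside K -> central q -> EW n (fun w => (tree w K q)%:R) <= eta ^+ (2 ^ K).
Proof.
move=> ins cq; have := @forest_prob K [:: q] ins; rewrite /= cq expr1 => /(_ isT isT).
under eq_EW do rewrite andbT; apply.
  by move=> a b; rewrite !inE => /eqP-> /eqP->; rewrite eqxx.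
by move=> i r /=; rewrite addn0; case: (linf i q <= r)%N; rewrite ?muln1 ?muln0 // leq_addr.
Qed.

Definition slots k c : {set 'I_m.+1} := [set t : 'I_m.+1 | (lo <= t <= hi)%N && (t %% l ^ k.+2 == c)%N].

(** [2^X] for a sum [X] of indicators counts the sets of events that all occur; joint bounds thus
    give an exponential moment. *)
Lemma prod_indic (I : finType) (A : {set I}) (P : pred I) :
  (2 : R) ^+ (\sum_(t in A) P t)%N <= \sum_(Q : {set I} | Q \subset A) (all P (enum Q))%:R.
Proof.
pose B := [set t in A | P t].
have -> : (\sum_(t in A) P t = #|B|)%N.
  by rewrite -sum1_card big_mkcond [RHS]big_mkcond; apply: eq_bigr => t _; rewrite inE; case: (t \in A); case: (P t).
rewrite -natrX -card_powerset -sum1_card natr_sum big_mkcond [leRHS]big_mkcond; apply: ler_sum => Q _.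
rewrite powersetE; case: (boolP (Q \subset B)) => QB; last by case: ifP.
rewrite (subset_trans QB) ?ler1n; last by apply/subsetP => t; rewrite inE => /andP[].
rewrite lt0b; apply/allP => t; rewrite mem_enum => tQ.
by have := subsetP QB t tQ; rewrite inE => /andP[].
Qed.

Lemma sum_subsets (I : finType) (A : {set I}) (x : R) : \sum_(Q : {set I} | Q \subset A) x ^+ #|Q| = (1 + x) ^+ #|A|.
Proof.
rewrite [1 + x]addrC exprD1n (partition_big (fun Q : {set I} => inord #|Q| : 'I_#|A|.+1) predT) //=.
apply: eq_bigr => k _; rewrite (eq_bigr (fun=> x ^+ k)) => [|Q /andP[QA /eqP<-]]; last first.
  by rewrite inordK // ltnS subset_leq_card.
rewrite sumr_const; congr (_ *+ _); rewrite -cards_draws -cardsE; congr (#|pred_of_set _|); apply/setP => Q; rewrite !inE unfold_in /=.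
case QA : (Q \subset A) => //=; apply/eqP/eqP => [<-|e]; first by rewrite inordK // ltnS subset_leq_card.
by apply: val_inj; rewrite /= inordK // ltnS subset_leq_card.
Qed.

Lemma slots_moment v i k c : inside k -> central v ->
  EW n (fun w => 2 ^+ (\sum_(t in slots k c) tree w k (setc v i t))%N) <= (1 + eta ^+ (2 ^ k)) ^+ m.+1.
Proof.
move=> ins cv; have e0 : 0 <= eta ^+ (2 ^ k) := exprn_ge0 _ eta0.
apply: le_trans (ler_EW (fun w _ => prod_indic (slots k c) (fun t => tree w k (setc v i t)))) _.
rewrite EW_sum; apply: (@le_trans _ _ (\sum_(Q : {set 'I_m.+1} | Q \subset slots k c) (eta ^+ (2 ^ k)) ^+ #|Q|)); last first.
  rewrite sum_subsets ler_weXn2l ?lerDl //; apply: leq_trans (max_card _) _; by rewrite card_ord.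
apply: ler_sum => Q /subsetP QS.
have inj : injective (setc v i) by move=> t t' /ffunP/(_ i); rewrite !ffunE eqxx.
have s0 : (0 < l ^ k.+2)%N by rewrite expn_gt0 l0.
have slot t : t \in Q -> (lo <= t <= hi)%N /\ (t %% l ^ k.+2 = c)%N.
  by move=> /QS; rewrite inE => /andP[h /eqP].
have lin q t : (linf q (setc v i t) <= (linf q (setc v i t)))%N by [].
have near (q : box) (t : 'I_m.+1) r : (linf q (setc v i t) <= r)%N -> ((t <= q i + r) && (q i <= t + r))%N.
  by move=> /linfP/(_ i)[]; rewrite ffunE eqxx => -> ->.
have := @forest_prob k [seq setc v i t | t <- enum Q] ins.
rewrite size_map -cardE; under eq_EW do rewrite all_map; apply.
- apply/allP => q /mapP[t]; rewrite mem_enum => /slot[h _] ->; apply/forallP => j; rewrite ffunE.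
  by case: ifP => // _; move/forallP: cv; exact.
- by rewrite map_inj_uniq ?enum_uniq.
- move=> q q' /mapP[t tQ ->] /mapP[t' t'Q ->] ne.
  rewrite !mem_enum in tQ t'Q; have [[_ e1] [_ e2]] := (slot t tQ, slot t' t'Q).
  rewrite leqNgt; apply/negP => h; case/negP: ne; apply/eqP; congr setc; apply: val_inj => /=.
  have h' : (linf (setc v i t) (setc v i t') <= (l ^ k.+2).-1)%N by rewrite -ltnS prednK.
  have := near _ _ _ h'; rewrite ffunE eqxx => /andP[b1 b2].
  have d1 := divn_eq t (l ^ k.+2); have d2 := divn_eq t' (l ^ k.+2); rewrite e1 in d1; rewrite e2 in d2.
  suff e : (t %/ l ^ k.+2 = t' %/ l ^ k.+2)%N by rewrite d1 d2 e.
  exact: (same_quotient s0) d1 d2 b1 b2.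
move=> q r; rewrite count_map.
have := @residue_count (l ^ k.+2) c (q i) r [seq val t | t <- enum Q] s0.
rewrite map_inj_uniq ?enum_uniq => [/(_ isT)|]; last exact: val_inj.
move=> h; apply: leq_trans (h _); last by move=> t /mapP[t' t'Q ->]; rewrite mem_enum in t'Q; have [] := slot _ t'Q.
by rewrite leq_mul2l count_map; apply/orP; right; apply: sub_count => t /= /near.
Qed.

(** Pigeonhole over the residues modulo [l^k.+2], because joint rarity is available only for spaced
    roots; then Markov's inequality with [slots_moment]. *)
Lemma line_prob v i k J : inside k -> central v ->
  EW n (fun w => (l ^ k.+2 * J < \sum_(t : 'I_m.+1 | (lo <= t <= hi)%N) tree w k (setc v i t))%N%:R) <=
  (l ^ k.+2)%:R * ((1 + eta ^+ (2 ^ k)) ^+ m.+1 / 2 ^+ J).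
Proof.
move=> ins cv; set s := (l ^ k.+2)%N; have s0 : (0 < s)%N by rewrite expn_gt0 l0.
apply: (@le_trans _ _ (EW n (fun w => (has (fun c => (J <= \sum_(t in slots k c) tree w k (setc v i t))%N) (iota 0 s))%:R))).
  apply: ler_EW => w _; rewrite ler_nat; apply: leq_implb; apply: contraLR => /hasPn h; rewrite -leqNgt.
  rewrite (partition_big (fun t : 'I_m.+1 => inord (t %% s) : 'I_s.-1.+1) predT) //=.
  apply: (@leq_trans (\sum_(c < s.-1.+1) J)); last by rewrite sum_nat_const card_ord prednK.
  apply: leq_sum => c _; have cs : (c < s)%N by rewrite -{2}(prednK s0).
  have := h c; rewrite mem_iota add0n cs -ltnNge => /(_ isT)/ltnW; apply: leq_trans.
  rewrite leq_eqVlt; apply/orP; left; apply/eqP; apply: eq_bigl => t; rewrite inE; congr andb.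
  have ts : (t %% s < s.-1.+1)%N by rewrite prednK // ltn_pmod.
  by rewrite -val_eqE /= inordK.
apply: le_trans (EW_has (B := (1 + eta ^+ (2 ^ k)) ^+ m.+1 / 2 ^+ J) _) _; last by rewrite size_iota.
move=> c _; rewrite ler_pdivlMr ?exprn_gt0 // mulrC -EWZ; apply: le_trans (slots_moment i c ins cv).
apply: ler_EW => w _; case: leqP => h; last by rewrite mulr0 exprn_ge0.
by rewrite mulr1 ler_weXn2l // ler1n.
Qed.

End Probability.

(** * Short connections between far vertices *)

Local Close Scope ring_scope.

Section Anchors.
Variables (d' N L m : nat).
Notation d := d'.+1.
Notation T := 'rV['Z_N]_d.
Notation box := (box d m).
Hypotheses (N_gt2 : 2 < N) (L_gt0 : 0 < L) (mLN : m.+1 * L <= N) (NmL : N <= m.+2 * L).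
Implicit Types (b z : T) (u v : box).

Definition anchor b v : T := \row_i (b 0 i + (L * v i)%:R)%R.

Lemma anchorB b u v i : ((anchor b u - anchor b v) 0 i)%R = ((L * u i)%:R - (L * v i)%:R)%R.
Proof. by rewrite !mxE opprD addrACA subrr add0r. Qed.

Lemma cyc_natB (a c : nat) : cyc (a%:R - c%:R : 'Z_N)%R = cyc ((maxn (a - c) (c - a))%:R : 'Z_N)%R.
Proof.
have [h|h] := leqP a c.
  by rewrite (_ : maxn _ _ = c - a)%N ?natrB //; first (by rewrite -cycN opprB); move: h; clear; lia.
by rewrite (_ : maxn _ _ = a - c)%N ?natrB // ?(ltnW h) //; move: h; clear; lia.
Qed.

Lemma nrm_anchor_le b u v : nrm (anchor b u - anchor b v) <= L * linf u v.
Proof.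
apply/nrmP => i; rewrite anchorB cyc_natB; apply: leq_trans (cyc_nat N_gt2 _) _.
rewrite -!mulnBr -maxnMr leq_mul2l; apply/orP; right.
exact: (@leq_bigmax _ (fun i : 'I_d => maxn (u i - v i) (v i - u i))).
Qed.

Lemma cyc_half (n : nat) : n < N -> 3 * n <= 2 * N -> n <= 2 * cyc (n%:R : 'Z_N)%R.
Proof.
move=> nN n3; have [->|n0] := posnP n; first by [].
by rewrite /cyc val_oppZ // ?val_natZ //; move: nN n3 n0; clear; lia.
Qed.

(** In the window a coordinate difference is at most two thirds of [m + 1], so going around the
    torus the other way is at least half as long. [7 < q] absorbs the rounding in [q]. *)
Lemma nrm_anchor_ge b u v (q : nat) : 7 < q -> 32 * q <= m.+1 -> m.+1 < 32 * q.+1 ->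
  (forall i, 6 * q <= u i <= m.+1 - 6 * q) -> (forall i, 6 * q <= v i <= m.+1 - 6 * q) ->
  L * linf u v <= 2 * nrm (anchor b u - anchor b v).
Proof.
move=> q7 qm mq hu hv; have [i ei] : exists i : 'I_d, linf u v = maxn (u i - v i) (v i - u i).
  have [|i e] := @bigop.eq_bigmax _ (fun i : 'I_d => maxn (u i - v i) (v i - u i)); first by rewrite card_ord.
  by exists i.
apply: leq_trans (_ : _ <= 2 * cyc ((anchor b u - anchor b v) 0 i)%R) _; last by rewrite leq_mul2l cyc_nrm.
rewrite anchorB cyc_natB -!mulnBr -maxnMr -ei.
have h : 3 * linf u v <= 2 * m.+1 by rewrite ei; move: (hu i) (hv i) q7 qm mq; clear; lia.
have h2 : linf u v < m.+1 by move: h; clear; lia.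
apply: cyc_half; first by apply: leq_trans mLN; rewrite mulnC ltn_pmul2r.
apply: (@leq_trans (2 * (m.+1 * L))); last by rewrite leq_mul2l.
by rewrite mulnCA [2 * (_ * L)]mulnA [_ * L]mulnC leq_mul2l h orbT.
Qed.

(** [minn m] lets the last cell absorb the remainder of [N] modulo [L]; hence the bound [2 * L] in
    [coarse_near]. *)
Definition coarse b z : box := [ffun i => inord (minn m ((z 0 i - b 0 i)%R %/ L))].

Lemma coarseE b z i : coarse b z i = minn m ((z 0 i - b 0 i)%R %/ L) :> nat.
Proof. by rewrite ffunE inordK // ltnS geq_minl. Qed.

Lemma coarse_near b z : nrm (z - anchor b (coarse b z)) <= 2 * L.
Proof.
apply/nrmP => i; rewrite !mxE coarseE opprD addrA.
set t := (z 0 i - b 0 i)%R; have tN := val_ltZ N_gt2 t; have de := divn_eq t L; have ml := ltn_pmod t L_gt0.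
have le : L * minn m (t %/ L) <= t by rewrite {2}de (leq_trans _ (leq_addr _ _)) // mulnC leq_mul2r geq_minr orbT.
have -> : (t - (L * minn m (t %/ L))%:R = (t - L * minn m (t %/ L))%:R)%R by rewrite natrB // natr_Zp.
apply: leq_trans (cyc_nat N_gt2 _) _.
have [h|h] := leqP m (t %/ L); last by rewrite [L * _]mulnC; move: de ml; move: (t %/ L * L) => x; clear; lia.
by move: tN NmL; rewrite !mulSn [L * m]mulnC; clear; lia.
Qed.

Lemma val_near (a a' : 'Z_N) r : cyc (a - a')%R <= r -> r <= a' -> a' + r < N -> a <= a' + r /\ a' <= a + r.
Proof.
move=> h ra aN; have [e|e] := cycP (a - a')%R; move: h; set k := cyc _ in e *; move=> kr.
  have -> : a = ((a' + k)%:R)%R by rewrite natrD natr_Zp -e addrC subrK.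
  by rewrite val_natZ //; move: kr aN; clear; lia.
have ka : k <= a' by exact: leq_trans kr ra.
have -> : a = ((a' - k)%:R)%R by rewrite natrB // natr_Zp -e addrC subrK.
by rewrite val_natZ //; move: kr aN ka; clear; lia.
Qed.

Lemma coarse_step b z z' : lstep z z' -> (forall i, 0 < ((z 0 i - b 0 i)%R : 'Z_N) /\ ((z 0 i - b 0 i)%R : 'Z_N).+1 < N) ->
  coarse b z = coarse b z' \/ nn (coarse b z) (coarse b z').
Proof.
move=> /existsP[[k a] /eqP->] hz; set z1 := (z + _)%R.
have same i : i != k -> coarse b z i = coarse b z1 i.
  by move=> ik; rewrite !ffunE !mxE (negPf ik) andbF mulr0 addr0.
have [h1 h2] : ((z1 0 k - b 0 k)%R : 'Z_N) <= ((z 0 k - b 0 k)%R : 'Z_N) + 1 /\ ((z 0 k - b 0 k)%R : 'Z_N) <= ((z1 0 k - b 0 k)%R : 'Z_N) + 1.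
  have [p1 p2] := hz k; apply: val_near => //; last by rewrite addn1.
  rewrite opprB addrA subrK /z1 mxE addrAC subrr add0r.
  exact: leq_trans (cyc_nrm _ _) (nrm_vec N_gt2 _).
have d1 x y : x <= y + 1 -> x %/ L <= y %/ L + 1.
  by move=> xy; rewrite -(divnDMl 1 _ L_gt0) mul1n leq_div2r // (leq_trans xy) // leq_add2l.
have e1 := d1 _ _ h1; have e2 := d1 _ _ h2.
have [e|ne] := eqVneq (coarse b z k) (coarse b z1 k).
  by left; apply/ffunP => i; have [->//|ik] := eqVneq i k; exact: same.
right; apply/nnP; exists k; split; first exact: same.
have ne' : coarse b z k != coarse b z1 k :> nat by rewrite (inj_eq val_inj).
by move: ne' e1 e2; rewrite !coarseE; clear; lia.
Qed.

Lemma sparse_anchors b (t : seq box) q : 7 < q -> 32 * q <= m.+1 -> m.+1 < 32 * q.+1 ->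
  uniq t -> all (fun v => [forall i, 6 * q <= v i <= m.+1 - 6 * q]) t -> thin t ->
  #|[set p | p \in [seq anchor b v | v <- t]]| = size t /\ sparse L [set p | p \in [seq anchor b v | v <- t]].
Proof.
move=> q7 qm mq ut wt th; set D := [set p | _].
have w v : v \in t -> forall i, 6 * q <= v i <= m.+1 - 6 * q by move=> vt; move/allP: wt => /(_ v vt)/forallP.
have lin u v : u \in t -> v \in t -> L * linf u v <= 2 * nrm (anchor b u - anchor b v).
  by move=> /w hu /w hv; exact: nrm_anchor_ge hu hv.
have inj : {in t &, injective (anchor b)}.
  move=> u v ut' vt e; have := lin u v ut' vt; rewrite e subrr nrm0 // muln0 leqn0 muln_eq0 => /orP[|/eqP l0].
    by move=> /eqP L0; move: L_gt0; rewrite L0.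
  by apply/ffunP => i; apply: val_inj; have [h1 h2] := linf_coord u v i; move: h1 h2; rewrite l0 /=; clear; lia.
have um : uniq [seq anchor b v | v <- t] by rewrite map_inj_in_uniq.
split; first by rewrite cardsE (card_uniqP um) size_map.
move=> y r; set A := [pred p in D | _].
have -> : #|A| = count (fun v => nrm (y - anchor b v) <= r * L) t.
  rewrite -(count_map (anchor b) (fun p => nrm (y - p) <= r * L)) -size_filter.
  rewrite -(card_uniqP (filter_uniq _ um)); apply: eq_card => p; rewrite !inE mem_filter andbC //.
case: (boolP (has (fun v => nrm (y - anchor b v) <= r * L) t)) => [/hasP[v0 v0t n0]|h]; last first.
  by rewrite has_count -leqNgt leqn0 in h; rewrite (eqP h) muln0.
have h6 := th v0 v0t (4 * r).
have cc : count (fun v => nrm (y - anchor b v) <= r * L) t <= count (fun v => linf v0 v <= 4 * r) t.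
  rewrite -!size_filter; apply: uniq_leq_size; first exact: filter_uniq.
  move=> v; rewrite !mem_filter => /andP[nv vt]; rewrite vt andbT.
  rewrite -(leq_pmul2l L_gt0); apply: leq_trans (lin _ _ v0t vt) _.
  have := nrm_triangle N_gt2 (anchor b v0) y (anchor b v); rewrite [nrm (_ - y)]nrmB.
  by move: nv n0; rewrite mulnCA [L * r]mulnC; move: (r * L) => x; clear; lia.
by move: h6 cc; clear; lia.
Qed.

(** The coarse box is not periodic, so its base depends on [x] and [y]: in each coordinate the
    midpoint of a shortest arc between them is placed opposite to the cut, about [N / 2] from the
    base. *)
Lemma middle_base (x y : T) : exists b : T, forall i,
  (N <= 4 * ((x 0 i - b 0 i)%R : 'Z_N) + 8 /\ 4 * ((x 0 i - b 0 i)%R : 'Z_N) <= 3 * N + 8) /\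
  (N <= 4 * ((y 0 i - b 0 i)%R : 'Z_N) + 8 /\ 4 * ((y 0 i - b 0 i)%R : 'Z_N) <= 3 * N + 8).
Proof.
have one (x1 y1 : 'Z_N) : exists b1 : 'Z_N,
  (N <= 4 * ((x1 - b1)%R : 'Z_N) + 8 /\ 4 * ((x1 - b1)%R : 'Z_N) <= 3 * N + 8) /\
  (N <= 4 * ((y1 - b1)%R : 'Z_N) + 8 /\ 4 * ((y1 - b1)%R : 'Z_N) <= 3 * N + 8).
  have two (u v : 'Z_N) k : 2 * k <= N -> v = (u + k%:R)%R ->
      (N <= 4 * ((u - (u - (N./2 - k./2)%:R))%R : 'Z_N) + 8 /\ 4 * ((u - (u - (N./2 - k./2)%:R))%R : 'Z_N) <= 3 * N + 8) /\
      (N <= 4 * ((v - (u - (N./2 - k./2)%:R))%R : 'Z_N) + 8 /\ 4 * ((v - (u - (N./2 - k./2)%:R))%R : 'Z_N) <= 3 * N + 8).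
    move=> kN ->; have -> : (u - (u - (N./2 - k./2)%:R) = (N./2 - k./2)%:R)%R by rewrite opprB addrCA subrr addr0.
    have -> : (u + k%:R - (u - (N./2 - k./2)%:R) = (N./2 - k./2 + k)%:R)%R.
      by rewrite natrD opprB addrC addrA subrK.
    by rewrite !val_natZ //; move: kN N_gt2; clear; lia.
  have ck : 2 * cyc (y1 - x1)%R <= N.
    have [->|n0] := eqVneq (y1 - x1)%R 0%R; first by rewrite cyc0.
    by rewrite /cyc val_oppZ ?lt0n // 1?(inj_eq val_inj) //; have := val_ltZ N_gt2 (y1 - x1)%R; clear; lia.
  have [e|e] := cycP (y1 - x1)%R.
    exists (x1 - (N./2 - (cyc (y1 - x1)%R)./2)%:R)%R; apply: two => //.
    by rewrite -e addrC subrK.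
  exists (y1 - (N./2 - (cyc (y1 - x1)%R)./2)%:R)%R; apply/and_comm; apply: two => //.
  by rewrite -[X in (_ + X)%R]opprK -e opprB addrC subrK.
have [f hf] := choice (fun i => one (x 0 i)%R (y 0 i)%R).
by exists (\row_i f i)%R => i; rewrite mxE; exact: hf.
Qed.

End Anchors.

Lemma block_connect d m (al be : nat) (u v : box d m) :
  (forall i, al <= u i <= be) -> (forall i, al <= v i <= be) ->
  connect (gr (fun w : box d m => [forall i, al <= w i <= be])) u v.
Proof.
move=> hu hv; have -> : v = [ffun i => if i \in enum 'I_d then v i else u i].
  by apply/ffunP => i; rewrite ffunE mem_enum.
apply: connect_move; first exact: enum_uniq.
move=> v' k t _ hm _ tb; apply/forallP => i; rewrite ffunE; case: eqVneq => [_|_].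
  by move: (hu k) (hv k) tb => /=; move: (nat_of_ord (u k)) (nat_of_ord (v k)) (nat_of_ord t); clear; lia.
by case: (hm i) => ->.
Qed.

Section Lattice.
Variables (d' N : nat).
Notation d := d'.+1.
Notation T := 'rV['Z_N]_d.
Hypothesis N_gt2 : 2 < N.
Implicit Types (x y z : T) (P S : pred T).

Lemma lgr_end P x y : P x -> connect (lgr P) x y -> P y.
Proof. by move=> Px /connectP[p]; elim: p x Px => [|z p IH] x Px /=; [move=> _ ->|case/andP=> /and3P[_ Pz _] pz; exact: IH pz]. Qed.

Lemma sub_lgr P S x y : subpred P S -> connect (lgr P) x y -> connect (lgr S) x y.
Proof.
by move=> PS; apply: connect_sub => u v /and3P[/PS Su /PS Sv uv]; apply: connect1; rewrite /lgr Su Sv.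
Qed.

Lemma lgr_exit P x z r : P x -> connect (lgr P) x z -> r <= nrm (z - x) ->
  exists2 y, nrm (y - x) = r & connect (lgr (fun w => P w && (nrm (w - x)%R <= r))) x y.
Proof.
move=> Px /connectP[p pp ez] far; subst z.
suff gen w : connect (lgr (fun w => P w && (nrm (w - x)%R <= r))) x w -> nrm (w - x) <= r -> P w ->
    path (lgr P) w p -> r <= nrm (last w p - x) ->
    exists2 y, nrm (y - x) = r & connect (lgr (fun w => P w && (nrm (w - x)%R <= r))) x y.
  by apply: (gen x) => //; rewrite subrr nrm0.
elim: p w {pp far} => [|w1 p IH] w cw wr Pw /=; first by move=> _ h; exists w => //; apply/eqP; rewrite eqn_leq wr.
case/andP=> /and3P[_ Pw1 st] pp far.
have [e|ne] := eqVneq (nrm (w - x)) r; first by exists w.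
have w1r : nrm (w1 - x) <= r.
  apply: leq_trans (nrm_triangle N_gt2 w1 w x) _; apply: leq_trans (leq_add (lstep_nrm N_gt2 st) (leqnn _)) _.
  by rewrite add1n ltn_neqAle ne wr.
apply: (IH w1) => //; apply: connect_trans cw (connect1 _).
by rewrite /lgr Pw wr Pw1 w1r st.
Qed.

Lemma frame_ball l r (c f f' : T) : 0 < l -> 3 < d -> 4 * r < N -> l <= r ->
  frame l f -> nrm (f - c) <= r -> frame l f' -> nrm (f' - c) <= r ->
  connect (lgr (fun z => frame l z && (nrm (z - c)%R <= r))) f f'.
Proof.
move=> l0 d3 rN lr ff fr ff' f'r.
have [g hg] := grid_vertex N_gt2 c l0 lr.
have to_g x : frame l x -> nrm (x - c) <= r -> connect (lgr (fun z => frame l z && (nrm (z - c)%R <= r))) x (emb c g).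
  move=> fx xr; have [v ev] := emb_surj xr; subst x.
  apply: (@connect_emb _ _ c r (fun w => frame l (emb c w))) => //; last exact: frame_connect.
  by move=> w -> /=; exact: emb_ball.
by apply: connect_trans (to_g _ ff fr) _; rewrite lgr_csym //; exact: to_g.
Qed.

Lemma frame_point l (c : T) : 0 < l -> 3 < d -> 4 * l < N -> exists2 f, frame l f & nrm (f - c) <= l.
Proof.
move=> l0 d3 lN; have [g hg] := grid_vertex N_gt2 c l0 (leqnn l).
exists (emb c g); last exact: emb_ball.
rewrite frameE (eq_card (B := predT)) => [|i]; last by rewrite !inE hg.
by rewrite card_ord; exact: leq_trans d3.
Qed.

End Lattice.

(** * Linking two far-reaching vacant sites *)

Section Route.
Variables (d' N l s M k L nb Tl m hs K q : nat).
Notation d := d'.+1.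
Notation T := 'rV['Z_N]_d.
Notation box := (box d m).
Hypotheses (N_gt2 : 2 < N) (l_gt0 : 0 < l) (s_gt0 : 0 < s) (d_gt3 : 3 < d).
Hypotheses (skM : 2 * s * k <= M) (slL : s + l <= L) (LN : 4 * (40 * L) < N).
Variables (X : nat -> T) (b : T) (Xk : nat -> nat).
Hypothesis total : M + Tl < nb.+1 * M.
Hypotheses (mLN : m.+1 * L <= N) (NmL : N <= m.+2 * L) (qm : 32 * q <= m.+1) (mq : m.+1 < 32 * q.+1).
Notation vac := (unvisited M X Tl).
Notation anc := (anchor (m := m) L b).
Notation coarse := (@coarse d' N L m b).
Definition Bad (v : box) : bool := bad l s M k L nb X (anc v).
Notation lo := (7 * q).
Notation hi := (m.+1 - 7 * q).
Hypothesis no_tree : forall v : box, central lo hi v -> ~~ has_tree hs Bad K v.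
Hypothesis few_trees : forall (v : box) i k, central lo hi v -> k < K ->
  \sum_(t : 'I_m.+1 | lo <= t <= hi) has_tree hs Bad k (setc v i t) <= Xk k.
Notation c1 := (4 * reach hs K + 20).
Notation r1 := (c1 * L).
Hypothesis q_large : c1 + 100 <= q.
Notation vol r := ((2 * r + 1) ^ d).

Let L_gt0 : 0 < L. Proof. by move: slL s_gt0; clear; lia. Qed.
Let lL : l <= 40 * L. Proof. by move: slL s_gt0; clear; lia. Qed.
Let q7 : 7 < q. Proof. by move: q_large; clear; lia. Qed.
Let reach_lo : reach hs K < lo. Proof. by move: q_large; clear; lia. Qed.
Let d_gt1 : 1 < d. Proof. by apply: leq_trans d_gt3. Qed.

Lemma good_frame v z : ~~ Bad v -> frame l z -> nrm (z - anc v) <= 40 * L -> vac z.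
Proof. by move=> /badPn ok; exact: (frame_unvisited N_gt2 l_gt0 s_gt0 d_gt3 skM slL LN total ok). Qed.

Definition region (Y : pred box) : pred T := fun z => vac z && [exists v, Y v && (nrm (z - anc v)%R <= 40 * L)].

(** The cubes of radius [40 * L] around adjacent anchors share a frame site, and the frame is
    connected and vacant within each. *)
Lemma region_connect (Y : pred box) a a' f f' : (forall v, Y v -> ~~ Bad v) -> Y a -> connect (gr Y) a a' ->
  frame l f -> nrm (f - anc a) <= 40 * L -> frame l f' -> nrm (f' - anc a') <= 40 * L -> connect (lgr (region Y)) f f'.
Proof.
move=> good Ya /connectP[p pp ->]; elim: p a Ya pp f => [|a1 p IH] a Ya /= pp f ff fa ff' fa'.
  apply: sub_lgr (frame_ball N_gt2 l_gt0 d_gt3 LN lL ff fa ff' fa') => z /andP[fz za].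
  by rewrite /region (good_frame (good _ Ya) fz za); apply/existsP; exists a; rewrite Ya.
case/andP: pp => /and3P[_ Ya1 aa1] pp.
have [|g fg ga] := frame_point N_gt2 (anc a) l_gt0 d_gt3; first by move: LN lL; clear; lia.
have ga40 : nrm (g - anc a) <= 40 * L by apply: leq_trans ga lL.
have ga1 : nrm (g - anc a1) <= 40 * L.
  have t1 := nrm_triangle N_gt2 g (anc a) (anc a1); have t2 := nrm_anchor_le L N_gt2 b a a1.
  have t3 := nn_star aa1; rewrite /star in t3.
  have t4 : L * linf a a1 <= L by rewrite -[leqRHS]muln1 leq_mul2l t3 orbT.
  by move: t1 t2 t4 ga slL; clear; lia.
apply: connect_trans (IH a1 Ya1 pp g fg ga1 ff' fa').
apply: sub_lgr (frame_ball N_gt2 l_gt0 d_gt3 LN lL ff fa fg ga40) => z /andP[fz za].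
by rewrite /region (good_frame (good _ Ya) fz za); apply/existsP; exists a; rewrite Ya.
Qed.

Definition middle (x : T) : Prop := forall i, N <= 4 * ((x 0 i - b 0 i)%R : 'Z_N) + 8 /\ 4 * ((x 0 i - b 0 i)%R : 'Z_N) <= 3 * N + 8.

Definition far (x : T) : Prop := exists2 z, connect (lgr vac) x z & r1 <= nrm (z - x).

Definition near_comp x : pred T := connect (lgr (fun z => vac z && (nrm (z - x)%R <= r1))) x.

(** A connected set of cells, wide enough for [escape] when [x] is [far]; any good cell in it yields
    a local vacant path from [x] to the frame. *)
Definition shadow x : pred box := fun v => [exists z, near_comp x z && (coarse z == v)].

Lemma middle_val x z i : middle x -> nrm (z - x) <= r1 ->
  [/\ 8 * q * L <= ((z 0 i - b 0 i)%R : 'Z_N) + r1 + 2, ((z 0 i - b 0 i)%R : 'Z_N) < (m.+1 - 8 * q + 1 + c1) * L + 4,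
   ((z 0 i - b 0 i)%R : 'Z_N) <= ((x 0 i - b 0 i)%R : 'Z_N) + r1 & ((x 0 i - b 0 i)%R : 'Z_N) <= ((z 0 i - b 0 i)%R : 'Z_N) + r1].
Proof.
move=> /(_ i)[h1 h2] zr; set t := ((x 0 i - b 0 i)%R : 'Z_N) in h1 h2 *; set t' := ((z 0 i - b 0 i)%R : 'Z_N).
have ct : cyc (t' - t)%R <= r1.
  rewrite /t' /t opprB addrA subrK; apply: leq_trans zr.
  by apply: leq_trans (cyc_nrm (z - x)%R i); rewrite !mxE.
have mL : 32 * q * L <= m.+1 * L by rewrite leq_mul2r qm orbT.
have cq : r1 + 100 * L <= q * L by rewrite -mulnDl leq_mul2r q_large orbT.
have NL : N <= m.+1 * L + L by move: NmL; rewrite (mulSn m.+1) addnC.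
have [v1 v2] : t' <= t + r1 /\ t <= t' + r1.
  apply: val_near => //; first by move: h1 mL cq mLN L_gt0; rewrite -mulnA; clear; lia.
  by move: h2 mL cq mLN L_gt0; rewrite -mulnA; clear; lia.
split=> //; first by move: h1 v2 mL mLN; rewrite -!mulnA; clear; lia.
rewrite !mulnDl mulnBl mul1n; move: v1 h2 NL mL; clear; lia.
Qed.

Lemma near_comp_ball x z : vac x -> near_comp x z -> vac z && (nrm (z - x)%R <= r1).
Proof. by move=> vx; apply: lgr_end; rewrite vx subrr nrm0. Qed.

Lemma shadow_central x : vac x -> middle x -> {subset shadow x <= central lo hi}.
Proof.
move=> vx mx v /existsP[z /andP[/(near_comp_ball vx)/andP[_ zr] /eqP<-]].
apply/forallP => i; rewrite coarseE; have [h1 h2 _ _] := middle_val i mx zr.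
move: h1 h2; set t := nat_of_ord _ => h1 h2.
have cq : r1 + 100 * L <= q * L by rewrite -mulnDl leq_mul2r q_large orbT.
rewrite leq_min; apply/andP; split; first (apply/andP; split).
- by move: qm q7; clear; lia.
- rewrite leq_divRL //; move: h1 cq L_gt0; rewrite -!mulnA; move: (q * L) (c1 * L); clear; lia.
apply: leq_trans (geq_minr _ _) _; rewrite -ltnS ltn_divLR //; apply: leq_trans h2 _.
rewrite (_ : (m.+1 - 7 * q).+1 = (m.+1 - 8 * q + 1) + q); last by move: qm; clear; lia.
by rewrite !mulnDl; move: cq L_gt0; rewrite !mulnDl; move: (4 * reach hs K * L) (q * L) ((m.+1 - 8 * q) * L); clear; lia.
Qed.

Lemma shadow_connect x : vac x -> middle x -> forall u v, shadow x u -> shadow x v -> connect (gr (shadow x)) u v.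
Proof.
move=> vx mx; have step z : near_comp x z -> connect (gr (shadow x)) (coarse x) (coarse z).
  move=> /connectP[p pp ->].
  suff gen z0 : near_comp x z0 -> connect (gr (shadow x)) (coarse x) (coarse z0) ->
      path (lgr (fun z => vac z && (nrm (z - x)%R <= r1))) z0 p -> connect (gr (shadow x)) (coarse x) (coarse (last z0 p)).
    by apply: gen pp; exact: connect0.
  elim: p z0 {pp} => [|z1 p IH] z0 nz0 cz //= /andP[st pp].
  have nz1 : near_comp x z1 by rewrite /near_comp; apply: connect_trans nz0 (connect1 st).
  apply: (IH z1) => //; apply: connect_trans cz _.
  have /andP[_ zr] := near_comp_ball vx nz0.
  have sh z2 : near_comp x z2 -> shadow x (coarse z2) by move=> nz2; apply/existsP; exists z2; rewrite nz2 eqxx.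
  case/and3P: st => _ _ st; have [i|->|nnz] := @coarse_step _ _ L m N_gt2 L_gt0 b z0 z1 st.
  - have [h1 h2 _ _] := middle_val i mx zr.
    have cq : r1 + 100 * L <= q * L by rewrite -mulnDl leq_mul2r q_large orbT.
    have mL : 32 * q * L <= m.+1 * L by rewrite leq_mul2r qm orbT.
    move: h1 h2; set t := nat_of_ord _ => h1 h2; split.
      by move: h1 cq mL L_gt0; rewrite -!mulnA; move: (q * L) (c1 * L); clear; lia.
    move: h2 cq mL mLN L_gt0; rewrite !mulnDl mulnBl mul1n -!mulnA; move: (q * L) (reach hs K * L) (m.+1 * L); clear; lia.
  - exact: connect0.
  by apply: connect1; rewrite /gr !sh.
move=> u v /existsP[z /andP[cz /eqP<-]] /existsP[z' /andP[cz' /eqP<-]].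
by apply: connect_trans (step _ cz'); rewrite gr_csym; exact: step.
Qed.

Lemma card_shadow x : vac x -> middle x -> #|shadow x| <= vol c1.+1.
Proof.
move=> vx mx; apply: leq_trans (card_linf_ball (coarse x) c1.+1); apply: subset_leq_card; apply/subsetP => v.
move=> /existsP[z /andP[/(near_comp_ball vx)/andP[_ zr] /eqP<-]]; rewrite inE; apply/linfP => i.
rewrite !coarseE; have [_ _ h1 h2] := middle_val i mx zr.
have d1 (u v1 : nat) : u <= v1 + r1 -> u %/ L <= v1 %/ L + c1.
  by move=> xy; rewrite -(divnDMl _ _ L_gt0) leq_div2r.
by move: (d1 _ _ h1) (d1 _ _ h2); clear; lia.
Qed.

Lemma shadow_far x : vac x -> far x -> exists2 v, shadow x v & (2 * reach hs K + 1).*2 <= linf (coarse x) v.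
Proof.
move=> vx [z cz fz]; have [y yr cy] := lgr_exit N_gt2 vx cz fz.
exists (coarse y); first by apply/existsP; exists y; rewrite eqxx andbT.
have n1 := coarse_near N_gt2 L_gt0 NmL b x; have n2 := coarse_near N_gt2 L_gt0 NmL b y.
have n3 := nrm_anchor_le L N_gt2 b (coarse y) (coarse x).
have t1 := nrm_triangle N_gt2 y (anc (coarse y)) x; have t2 := nrm_triangle N_gt2 (anc (coarse y)) (anc (coarse x)) x.
rewrite [nrm (anc (coarse x) - x)]nrmB in t2; rewrite linf_sym in n3.
have : r1 <= (linf (coarse x) (coarse y) + 4) * L.
  rewrite -{1}yr; apply: leq_trans t1 _; apply: leq_trans (leq_add n2 (leq_trans t2 (leq_add n3 n1))) _.
  by move: (linf _ _) => x1; clear; lia.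
by rewrite leq_pmul2r // -mul2n; clear; lia.
Qed.

(** The cell contains a site [z] joined to [x]. From [z] a vacant path goes [10 * L] away, either to
    [x] or through [x] to the site [y] at distance [r1]; [frame_near] then applies at [z]. *)
Lemma shadow_frame x a : vac x -> far x -> shadow x a -> ~~ Bad a ->
  exists f, [/\ frame l f, nrm (f - anc a) <= 40 * L &
    connect (lgr (fun z => vac z && ((nrm (z - x)%R <= r1) || (nrm (z - anc a)%R <= 40 * L)))) x f].
Proof.
move=> vx [z0 cz0 fz0] /existsP[z /andP[cz /eqP ea]] good; subst a.
have [y yr cy] := lgr_exit N_gt2 vx cz0 fz0.
have /andP[vz zr] := near_comp_ball vx cz.
have vsub : subpred (fun z => vac z && (nrm (z - x)%R <= r1)) vac by move=> w /andP[].
have zx : connect (lgr vac) z x by rewrite lgr_csym //; exact: sub_lgr vsub cz.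
have [e ce fe] : exists2 e, connect (lgr vac) z e & 10 * L <= nrm (e - z).
  have [h10|h10] := leqP (10 * L) (nrm (x - z)); first by exists x.
  exists y; first exact: connect_trans zx (sub_lgr vsub cy).
  rewrite nrmB in h10; rewrite leqNgt; apply/negP => h11.
  have tri := leq_ltn_trans (nrm_triangle N_gt2 y z x) (leq_add h11 (ltnW h10)).
  by rewrite yr -mulnDl ltn_pmul2r // in tri; move: tri; clear; lia.
have [f ff cf] := frame_near N_gt2 l_gt0 s_gt0 d_gt3 skM slL LN total (badPn good) (coarse_near N_gt2 L_gt0 NmL b z) vz ce fe.
have vz40 : vac z && (nrm (z - anc (coarse z))%R <= 40 * L).
  by rewrite vz; apply: leq_trans (coarse_near N_gt2 L_gt0 NmL b z) _; rewrite leq_mul2r orbT.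
have /andP[_ f40] := lgr_end vz40 cf.
exists f; split=> //; apply: (@connect_trans _ _ z); [apply: sub_lgr cz|apply: sub_lgr cf] => w /andP[-> ->] //.
by rewrite orbT.
Qed.

Definition coarse_bound := (2 * vol c1.+1 * (1 + 3 ^ d * vol (reach hs K)) +
  2 ^ d * d * (m.+1 + 3 ^ d * \sum_(k < K) Xk k * vol (reach hs k.+1))).

(** From [x] to the frame in a good cell of its shadow, along the frames of a coarse route, and from
    the frame to [y]. A bound on the number of sites is all that is needed, since it bounds the
    length of a path without loops. *)
Theorem route x y : vac x -> vac y -> middle x -> middle y -> far x -> far y ->
  exists S : pred T, [/\ subpred S vac, S x, connect (lgr S) x y &
    #|S| <= 2 * vol r1 + (coarse_bound + 2) * vol (40 * L)].
Proof.
move=> vx vy mx my fx fy.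
have [v1 s1 far1] := shadow_far vx fx; have [v2 s2 far2] := shadow_far vy fy.
have sx z : shadow z (coarse z) by apply/existsP; exists z; rewrite /near_comp connect0 eqxx.
have [a [a' [Y [Sa Sa' /andP[Ya Ya'] cY [good cardY]]]]] := coarse_route d_gt1 no_tree few_trees reach_lo
  (shadow_central vx mx) (shadow_central vy my) (shadow_connect vx mx) (shadow_connect vy my)
  (sx x) s1 far1 (sx y) s2 far2.
have [f [ff fa cf]] := shadow_frame vx fx Sa (good _ Ya).
have [f' [ff' fa' cf']] := shadow_frame vy fy Sa' (good _ Ya').
pose S : pred T := fun z => vac z && [|| nrm (z - x)%R <= r1, nrm (z - y)%R <= r1 | [exists v, Y v && (nrm (z - anc v)%R <= 40 * L)]].
exists S; split.
- by move=> z /andP[].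
- by rewrite /S vx subrr nrm0.
- apply: connect_trans (sub_lgr _ cf) _.
    move=> z /andP[vz h]; rewrite /S vz /=; case/orP: h => [->//|h].
    by rewrite !orbA; apply/orP; right; apply/existsP; exists a; rewrite Ya.
  apply: connect_trans (sub_lgr _ (region_connect good Ya cY ff fa ff' fa')) _.
    by move=> z /andP[vz h]; rewrite /S vz h !orbT.
  rewrite lgr_csym //; apply: sub_lgr cf' => z /andP[vz h]; rewrite /S vz /=; case/orP: h => [->|h].
    by rewrite orbT.
  by rewrite !orbA; apply/orP; right; apply/existsP; exists a'; rewrite Ya'.
have hY : #|Y| <= coarse_bound.
  apply: leq_trans cardY _; rewrite leq_add2r leq_mul2r; apply/orP; right.
  by rewrite mul2n -addnn leq_add // card_shadow.
pose B1 : pred T := [pred z | nrm (z - x)%R <= r1]; pose B2 : pred T := [pred z | nrm (z - y)%R <= r1].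
pose B3 : pred T := [pred z | [exists v, Y v && (nrm (z - anc v)%R <= 40 * L)]].
apply: (@leq_trans (#|B1| + (#|B2| + #|B3|))).
  apply: (@leq_trans #|predU B1 (predU B2 B3)|).
    by apply: subset_leq_card; apply/subsetP => z /andP[_].
  rewrite -[leqRHS]addn0; apply: leq_trans (_ : #|predU B1 (predU B2 B3)| + #|predI B1 (predU B2 B3)| <= _); first exact: leq_addr.
  rewrite cardUI addn0 leq_add2l; apply: leq_trans (_ : #|predU B2 B3| + #|predI B2 B3| <= _); first exact: leq_addr.
  by rewrite cardUI.
rewrite mul2n -addnn -addnA leq_add ?card_ball // leq_add ?card_ball //.
apply: leq_trans (card_exists Y (fun v => [pred z : T | nrm (z - anc v)%R <= 40 * L])) _.
apply: (@leq_trans (#|Y| * vol (40 * L))).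
  by rewrite -sum_nat_const; apply: leq_sum => v _; exact: card_ball.
by rewrite leq_mul2r (leq_trans hY) ?leq_addr ?orbT.
Qed.

(** A coarse route between two cubes of cells that are at least [10 q] apart; halving by
    [nrm_anchor_ge] and the two cube radii leave [4 q L]. *)
Theorem backbone : exists f f', [/\ vac f, connect (lgr vac) f f' & 4 * q * L <= nrm (f - f')].
Proof.
pose S al : pred box := fun w => [forall i, al <= w i <= al + 2 * q].
pose pt al : box := [ffun=> inord al].
have ptE al i : al < m.+1 -> pt al i = al :> nat by move=> h; rewrite ffunE inordK.
have Sc al : 7 * q <= al -> al + 9 * q <= m.+1 -> {subset S al <= central lo hi}.
  move=> h1 h2 v /forallP hv; apply/forallP => i; move: (hv i) h1 h2; clear; lia.
have Scon al : forall u v, S al u -> S al v -> connect (gr (S al)) u v.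
  by move=> u v /forallP hu /forallP hv; exact: block_connect.
have Spt al t : al + t < m.+1 -> t <= 2 * q -> S al (pt (al + t)).
  by move=> h1 h2; apply/forallP => i; rewrite ptE // leq_addr leq_add2l.
have Sfar al : al + 2 * q < m.+1 -> (2 * reach hs K + 1).*2 <= linf (pt (al + 0)) (pt (al + 2 * q)).
  move=> h1; have [_ h2] := linf_coord (pt (al + 0)) (pt (al + 2 * q)) ord0.
  by move: h2; rewrite !ptE //; move: q_large h1; clear; lia.
have b1 : 8 * q + 2 * q < m.+1 by move: qm q7; clear; lia.
have b2 : 20 * q + 2 * q < m.+1 by move: qm q7; clear; lia.
have [||||||a [a' [Y [Sa Sa' /andP[Ya Ya'] cY [good _]]]]] := @coarse_route _ _ _ _ _ _ _ _ d_gt1 no_tree few_trees reach_lo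
  (S (8 * q)) (S (20 * q)) (pt (8 * q + 0)) (pt (8 * q + 2 * q)) (pt (20 * q + 0)) (pt (20 * q + 2 * q)) _ _
  (@Scon _) (@Scon _) _ _ (Sfar _ b1) _ _ (Sfar _ b2).
- by apply: Sc; move: qm; clear; lia.
- by apply: Sc; move: qm; clear; lia.
- by apply: Spt; move: qm q7; clear; lia.
- by apply: Spt; move: qm q7; clear; lia.
- by apply: Spt; move: qm q7; clear; lia.
- by apply: Spt; move: qm q7; clear; lia.
have lN : 4 * l < N by move: LN lL; clear; lia.
have [f ff fa] := frame_point N_gt2 (anc a) l_gt0 d_gt3 lN.
have [f' ff' fa'] := frame_point N_gt2 (anc a') l_gt0 d_gt3 lN.
have fa40 := leq_trans fa lL; have fa40' := leq_trans fa' lL.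
exists f, f'; split; first exact: good_frame (good _ Ya) ff fa40.
  apply: sub_lgr (region_connect good Ya cY ff fa40 ff' fa40'); by move=> z /andP[].
have wide al v : S al v -> 7 * q <= al -> al + 9 * q <= m.+1 -> forall i, 6 * q <= v i <= m.+1 - 6 * q.
  move=> /forallP hv h1 h2 i; move: (hv i) h1 h2; clear; lia.
have wa := wide _ _ Sa; have wa' := wide _ _ Sa'.
have far : 10 * q <= linf a a'.
  have [_ e] := linf_coord a a' ord0; move/forallP/(_ ord0): Sa; move/forallP/(_ ord0): Sa'; move: e; clear; lia.
have ge : L * linf a a' <= 2 * nrm (anc a - anc a').
  by apply: (nrm_anchor_ge N_gt2 L_gt0 mLN b q7 qm mq); [apply: wa|apply: wa']; move: qm; clear; lia.
have e2 : L * (10 * q) <= L * linf a a' by rewrite leq_mul2l far orbT.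
have t1 := nrm_triangle N_gt2 (anc a) f (anc a'); have t2 := nrm_triangle N_gt2 f f' (anc a').
rewrite [nrm (anc a - f)]nrmB in t1.
have t3 := leq_trans t1 (leq_add fa40 (leq_trans t2 (leq_add (leqnn _) fa40'))).
have qL : 100 * L <= q * L by rewrite leq_mul2r; apply/orP; right; move: q_large; clear; lia.
have t4 := leq_trans e2 (leq_trans ge (leq_mul (leqnn 2) t3)).
by move: t4 qL; move: (nrm _) => x1; clear; lia.
Qed.

End Route.

From mathcomp Require Import all_classical all_reals all_analysis.
From mathcomp Require Import ring lra zify.
Import numFieldNormedType.Exports.
Local Open Scope classical_set_scope.
Local Open Scope ring_scope.

(** * The diameter of the largest component *)

Section Adjacency.
Variables (d' N : nat).
Notation d := d'.+1.
Notation T := 'rV['Z_N]_d.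
Hypothesis N_gt2 : (2 < N)%N.
Implicit Types (x y : T).

Lemma l1distE x y : l1dist x y = (\sum_(i < d) cyc ((y - x) 0 i)%R)%N.
Proof. by apply: eq_bigr => i _; rewrite /cyc !mxE opprB minnC. Qed.

Lemma adj_lstep x y : @adj d N x y = lstep x y.
Proof.
rewrite /adj l1distE; apply/eqP/existsP => [e|[e /eqP->]]; last first.
  rewrite (eq_bigr (fun i => nat_of_bool (i == e.1))) => [|i _]; last by rewrite addrAC subrr add0r cyc_vec.
  by rewrite -big_mkcond big_pred1_eq.
have [k hk] : exists k : 'I_d, cyc ((y - x) 0 k) != 0%N.
  apply/existsP; rewrite -negb_forall; apply/negP => /forallP h; move: e; rewrite big1 // => i _.
  exact: (eqP (h i)).
move: e; rewrite (bigD1 k) //= => e.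
have ck : cyc ((y - x) 0 k) = 1%N by move: hk e; case: (cyc _) => [|[|c]].
have c0 i : i != k -> (y - x) 0 i = 0.
  move=> ik; apply/eqP; rewrite -cyc_eq0 //; move: e; rewrite ck => /eqP.
  rewrite -[X in _ == X]addn0 eqn_add2l sum_nat_eq0 => /forallP/(_ i).
  by rewrite ik.
have yx : y = x + (y - x) by rewrite addrC subrK.
exists (k, (y - x) 0 k == 1); rewrite {1}yx; apply/eqP; congr (_ + _); apply/rowP => i.
rewrite vecE [RHS]mxE unit_vecE; case: (eqVneq i k) => [->|ik]; last by rewrite mulr0 c0.
rewrite mulr1; have := cycP ((y - x) 0 k); rewrite ck; case: eqVneq => [->//|ne] [] // e1.
by rewrite e1 eqxx in ne.
Qed.

End Adjacency.

(** * From connections to the diameter of the largest component *)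

Section Event.
Variables (R : realType) (d' N : nat) (vac : pred 'rV['Z_N]_d'.+1) (r1 low top : nat).
Notation d := d'.+1.
Notation T := 'rV['Z_N]_d.
Hypothesis N_gt2 : (2 < N)%N.
Definition reaches (x : T) : Prop := exists2 z, connect (lgr vac) x z & (r1 <= nrm (z - x))%N.
Hypothesis spine : exists f f', [/\ vac f, connect (lgr vac) f f' & (low <= nrm (f - f'))%N].
Hypothesis link : forall x y, vac x -> vac y -> reaches x -> reaches y ->
  exists S : pred T, [/\ subpred S vac, S x, connect (lgr S) x y & (#|S| <= top)%N].
Hypothesis ball_low : ((2 * r1 + 1) ^ d <= low)%N.

Definition vac_set : {set torus d N} := finset vac.

Lemma edge_lgr x y : edge vac_set x y = lgr vac x y.
Proof. by rewrite /edge /lgr !inE adj_lstep. Qed.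

Lemma path_nrm (S : pred T) x p : path (lgr S) x p -> (nrm (last x p - x) <= size p)%N.
Proof.
elim: p x => [|y p IH] x /=; first by rewrite subrr nrm0.
case/andP=> /and3P[_ _ st] pp; apply: leq_trans (nrm_triangle N_gt2 _ y _) _.
by rewrite -(addn1 (size p)) leq_add ?IH ?lstep_nrm.
Qed.

Lemma comp_large x y (K : {set torus d N}) : vac x -> connect (lgr vac) x y -> K = finset (connect (edge vac_set) x) ->
  (nrm (y - x) < #|K|)%N.
Proof.
move=> vx /connectP[p pp ->] ->; case/shortenP: pp => p' pp' up' _.
apply: leq_ltn_trans (path_nrm pp') _; have -> : (size p').+1 = size (x :: p') by [].
rewrite -(card_uniqP up'); apply: subset_leq_card; apply/fintype.subsetP => z.
rewrite in_cons inE => /orP[/eqP->|zp]; first exact: connect0.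
rewrite (eq_connect edge_lgr); case/splitPr: zp pp' {up'} => p1 p2; rewrite cat_path /= => /and3P[h1 h2 _].
by apply: connect_trans (connect1 h2); apply/connectP; exists p1.
Qed.

Lemma comp_reaches x (K : {set torus d N}) : K = finset (connect (edge vac_set) x) -> (low < #|K|)%N -> reaches x.
Proof.
move=> KE Klow; have [] := boolP [exists z, connect (lgr vac) x z && (r1 <= nrm (z - x)%R)%N].
  by move=> /existsP[z /andP[h1 h2]]; exists z.
rewrite negb_exists => /forallP h; exfalso; move: Klow; rewrite ltnNge => /negP; apply.
apply: leq_trans ball_low; apply: leq_trans (card_ball N_gt2 x r1); apply: subset_leq_card.
apply/fintype.subsetP => z; rewrite KE !inE (eq_connect edge_lgr) => cz; have := h z; rewrite cz /= -ltnNge; exact: ltnW.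
Qed.

Lemma graph_dist_le x y : vac x -> vac y -> reaches x -> reaches y ->
  (graph_dist R vac_set x y <= top%:R%:E)%E.
Proof.
move=> vx vy rx ry; have [S [Sv Sx cxy St]] := link vx vy rx ry.
have [p [pp ep sp]] : exists p, [/\ path (lgr S) x p, last x p = y & (size p < #|S|)%N].
  by apply: short_path => // u v /and3P[].
apply: (@le_trans _ _ (size p)%:R%:E).
  apply: ereal_inf_lbound; exists p; split=> //; apply: sub_path pp => u v /and3P[/Sv vu /Sv vv uv].
  by rewrite edge_lgr /lgr vu vv.
by rewrite lee_fin ler_nat; apply: leq_trans (ltnW sp) St.
Qed.

Lemma graph_dist_ge x y : ((nrm (y - x))%:R%:E <= graph_dist R vac_set x y)%E.
Proof.
apply: le_ereal_inf_tmp => _ [p [pp <- ->]]; rewrite lee_fin ler_nat.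
by apply: (@path_nrm vac); apply: sub_path pp => u v; rewrite edge_lgr.
Qed.

(** A component with more than [low] sites cannot fit in a ball of radius [r1], so all its sites
    [reach] and are linked pairwise. The component of the spine is that large, hence so is the
    largest one; [link] then identifies the two, and the spine gives the lower bound. *)
Theorem diameter_bounds (K : {set torus d N}) : (vac_set != finset.set0 -> is_largest_component vac_set K) ->
  (low%:R%:E <= max_dist R vac_set K <= top%:R%:E)%E.
Proof.
move=> hK; have [f [f' [vf cf far]]] := spine.
have [|[x0 x0A KE] Kmax] := hK _.
  by apply/set0Pn; exists f; rewrite inE.
have symE : connect_sym (edge vac_set).
  by move=> u v; rewrite !(eq_connect edge_lgr) lgr_csym.
have Klow : (low < #|K|)%N.
  apply: leq_trans (Kmax _ _); last by exists f => //; rewrite inE.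
  by apply: leq_ltn_trans far _; rewrite nrmB; apply: (comp_large vf cf (erefl _)).
have inK x : x \in K -> vac x /\ reaches x.
  rewrite KE inE => cx; have vx : vac x.
    by apply: (@lgr_end _ _ vac x0); [by move: x0A; rewrite inE|rewrite -(eq_connect edge_lgr)].
  split=> //; apply: (comp_reaches (K := K)) => //; rewrite KE; apply/setP => z; rewrite !inE.
  exact: same_connect.
have vf' : vac f' by exact: lgr_end vf cf.
have rf : reaches f.
  apply: (comp_reaches (erefl _)); apply: leq_ltn_trans far _; rewrite nrmB.
  exact: (comp_large vf cf (erefl _)).
have x0K : x0 \in K by rewrite KE inE connect0.
have fK : f \in K.
  have [v0 r0] := inK _ x0K; have [S [Sv _ c0 _]] := link v0 vf r0 rf.
  by rewrite KE inE (eq_connect edge_lgr); exact: sub_lgr Sv c0.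
have f'K : f' \in K.
  by move: fK; rewrite KE !inE => h; apply: connect_trans h _; rewrite (eq_connect edge_lgr).
apply/andP; split.
  apply: (@le_trans _ _ (graph_dist R vac_set f f')).
    by apply: le_trans (graph_dist_ge _ _); rewrite lee_fin ler_nat nrmB.
  apply: le_trans (le_bigmax_cond _ (fun x => \big[Order.max/-oo%E]_(y in K) graph_dist R vac_set x y) fK).
  exact: (le_bigmax_cond _ (fun y => graph_dist R vac_set f y) f'K).
apply: bigmax_le => [|x xK]; first exact: leNye.
apply: bigmax_le => [|y yK]; first exact: leNye.
by have [vx rx] := inK _ xK; have [vy ry] := inK _ yK; exact: graph_dist_le.
Qed.

End Event.

(** * The walk as a uniformly random word of directions *)

Section WalkLaw.
Variables (R : realType) (d' N : nat).
Notation d := d'.+1.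
Notation T := 'rV['Z_N]_d.
Notation dir := ('I_d * bool)%type.
Hypothesis N_gt2 : (2 < N)%N.

Lemma EW_tuple (D : finType) n (F : seq D -> R) : EW n F = #|D|%:R^-1 ^+ n * \sum_(t : n.-tuple D) F t.
Proof.
elim: n F => [|n IH] F.
  rewrite expr0 mul1r (bigD1 [tuple]) //= big1 ?addr0 // => t /eqP[]; exact: tuple0.
rewrite /= exprS -mulrA; congr (_ * _); under eq_bigr => e _ do rewrite IH.
rewrite -mulr_sumr; congr (_ * _); rewrite pair_bigA /=.
rewrite [RHS](reindex (fun p : D * n.-tuple D => [tuple of p.1 :: p.2])) //=.
exists (fun t => (thead t, [tuple of behead t])) => [[e t] _|t _] /=.
  by rewrite theadE; congr pair; apply: val_inj.
by rewrite -tuple_eta.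
Qed.

Lemma step_probE (x y : T) : @step_prob R d N x y = #|{: dir}|%:R^-1 * \sum_(e : dir) (y == x + vec N e)%:R.
Proof.
have inj : injective (fun e : dir => x + vec N e) by move=> e e' /addrI; exact: vec_inj.
rewrite /step_prob mulrC; congr (_^-1 * _).
  rewrite -(fintype.card_codom inj); congr (_%:R); apply: eq_card => z; rewrite [LHS]inE adj_lstep //.
  by apply/existsP/codomP => [[e /eqP->]|[e ->]]; exists e.
rewrite adj_lstep //; case: (boolP (lstep x y)) => [/existsP[e /eqP->]|].
  rewrite (bigD1 e) //= eqxx big1 ?addr0 // => e' ne; rewrite (inj_eq inj) eq_sym (negPf ne) //.
by rewrite negb_exists => /forallP h; rewrite big1 // => e _; rewrite (negPf (h e)).
Qed.

Definition trajectory n (x : T) (w : seq dir) : {ffun 'I_n.+1 -> torus d N} := [ffun i : 'I_n.+1 => pos x w i].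

(** For [N > 2] the [2 d] steps lead to distinct neighbours. The product of step probabilities then
    expands into a sum over words, and a word together with a starting point determines the path. *)
Lemma walk_law n (F : {ffun 'I_n.+1 -> torus d N} -> R) :
  \sum_(w : {ffun 'I_n.+1 -> torus d N}) path_prob R w * F w = #|torus d N|%:R^-1 * \sum_(x : T) EW n (fun u => F (trajectory n x u)).
Proof.
under eq_bigr => w _ do rewrite /path_prob -mulrA; rewrite -mulr_sumr; congr (_ * _).
under [RHS]eq_bigr => x _ do rewrite EW_tuple; rewrite -mulr_sumr exchange_big /=.
have prodE (w : {ffun 'I_n.+1 -> torus d N}) :
    \prod_(i < n) step_prob R (w (inord i)) (w (inord i.+1)) =
    #|{: dir}|%:R^-1 ^+ n * \sum_(e : n.-tuple dir) (w == trajectory n (w ord0) e)%:R.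
  under eq_bigr => i _ do rewrite step_probE.
  rewrite big_split /= prodr_const card_ord; congr (_ * _).
  rewrite bigA_distr_bigA /= (reindex (fun t : n.-tuple dir => [ffun i => tnth t i])) /=; last first.
    exists (fun f : {ffun 'I_n -> dir} => [tuple f i | i < n]) => [t _|f _].
      by apply: eq_from_tnth => i; rewrite tnth_mktuple ffunE.
    by apply/ffunP => i; rewrite ffunE tnth_mktuple.
  apply: eq_bigr => t _; under eq_bigr => i _ do rewrite ffunE.
  rewrite -natr_prod; congr (_%:R).
  have posS (i : nat) x (lt : (i < n)%N) : pos x t i.+1 = pos x t i + vec N (tnth t (Ordinal lt)).
    have it : (i < size t)%N by rewrite size_tuple.
    by rewrite /pos (take_nth (ord0, true)) // -cats1 wsum_cat addrA (tnth_nth (ord0, true)) /wsum big_cons big_nil addr0.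
  have ordE (i : 'I_n) (lt : (i < n)%N) : Ordinal lt = i by apply: val_inj.
  case: eqP => [wE|ne].
    rewrite big1 // => i _; have wv j : w j = pos (w ord0) t j by rewrite {1}wE ffunE.
    rewrite (wv (inord i.+1)) (wv (inord i)) !inordK ?ltnS ?(ltnW (ltn_ord i)) ?ltn_ord //.
    by rewrite (posS i _ (ltn_ord i)) ordE eqxx.
  case: (boolP [forall i : 'I_n, w (inord i.+1) == w (inord i) + vec N (tnth t i)]) => [/forallP h|].
    case: ne; apply/ffunP => i; rewrite ffunE -[in LHS](inord_val i).
    have : (i <= n)%N by rewrite -ltnS.
    elim: (nat_of_ord i) => [_|j IH jn].
      by rewrite pos0; congr (w _); apply: val_inj; rewrite /= inordK.
    rewrite (posS j _ jn) -(IH (ltnW jn)); exact: (eqP (h (Ordinal jn))).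
  by rewrite negb_forall => /existsP[i ni]; rewrite (bigD1 i) //= (negPf ni).
under eq_bigr => w _ do rewrite prodE -mulrA; rewrite -mulr_sumr; congr (_ * _).
rewrite (eq_bigr (fun w : {ffun 'I_n.+1 -> torus d N} => \sum_(e : n.-tuple dir) (w == trajectory n (w ord0) e)%:R * F w)) => [|w _]; last exact: big_distrl.
rewrite exchange_big /=; apply: eq_bigr => t _.
rewrite (partition_big (fun w : {ffun 'I_n.+1 -> torus d N} => w ord0) predT) //=; apply: eq_bigr => x _.
have tr0 : trajectory n x t ord0 = x by rewrite ffunE pos0.
rewrite (bigD1 (trajectory n x t)) /= ?tr0 ?eqxx // mul1r big1 ?addr0 // => w /andP[/eqP-> ne].
by rewrite (negPf ne) mul0r.
Qed.

End WalkLaw.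

Section Stationarity.
Variables (R : realType) (d' N : nat).
Notation d := d'.+1.
Notation T := 'rV['Z_N]_d.
Notation dir := ('I_d * bool)%type.
Hypothesis N_gt2 : (2 < N)%N.

Let dir0 : (0 < #|{: dir}|)%N. Proof. exact: dir_gt0. Qed.

Lemma vacant_trajectory M n x (v u r : seq dir) : size v = M -> size u = n ->
  vac_set (unvisited M (pos x (v ++ u ++ r)) n) = vacant (trajectory n (x + wsum N v) u).
Proof.
move=> sv su; apply/setP => z; rewrite !inE /unvisited negb_exists -all_predC.
apply/allP/forallP => [h i|h t].
  have := h (M + i)%N; rewrite mem_index_iota leq_addr ltnS leq_add2l -ltnS ltn_ord => /(_ isT) /=.
  by rewrite -sv pos_catr pos_size ffunE pos_catl // su -ltnS ltn_ord.
rewrite mem_index_iota => /andP[Mt tn] /=.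
have ti : (t - M < n.+1)%N by move: Mt tn; clear; lia.
have e : pos x (v ++ u ++ r) t = pos (x + wsum N v) u (t - M)%N.
  by rewrite -{1}(subnKC Mt) -sv pos_catr pos_size pos_catl // sv su -ltnS.
by have := h (Ordinal ti); rewrite ffunE /= e.
Qed.

(** The uniform law is invariant under the translation by the first [M] steps, and the last [e]
    steps are averaged out. *)
Lemma walk_shift (F : {set torus d N} -> R) M n e :
  \sum_(x : T) EW n (fun u => F (vacant (trajectory n x u))) =
  \sum_(x : T) EW (M + (n + e)) (fun w : seq dir => F (vac_set (unvisited M (pos x w) n))).
Proof.
pose g x := EW n (fun u : seq dir => F (vacant (trajectory n x u))).
have -> : \sum_(x : T) EW (M + (n + e)) (fun w : seq dir => F (vac_set (unvisited M (pos x w) n))) =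
    \sum_(x : T) EW M (fun v : seq dir => g (x + wsum N v)).
  apply: eq_bigr => x _; rewrite EW_cat; apply: eq_EW => v sv; rewrite EW_cat; apply: eq_EW => u su.
  rewrite -[RHS](@EW_const R _ dir0 e); apply: eq_EW => r _.
  by rewrite (vacant_trajectory x r sv su).
rewrite -[RHS]EW_sum -[LHS](@EW_const R _ dir0 M); apply: eq_EW => v _.
by rewrite [LHS](reindex_inj (addIr (wsum N v))).
Qed.

Lemma vacant_probE (u : R) (E : pred {set torus d N}) :
  vacant_prob u E = #|torus d N|%:R^-1 * \sum_(x : T) EW (nsteps d N u) (fun w => (E (vacant (trajectory (nsteps d N u) x w)))%:R).
Proof.
rewrite -(walk_law N_gt2 (fun w => (E (vacant w))%:R)) /vacant_prob /vacant_law.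
rewrite (exchange_big_dep predT) //= ; apply: eq_bigr => w _.
rewrite big_mkcond (bigD1 (vacant w)) //= eqxx big1 ?addr0 => [|A ne].
  by case: (E _); rewrite ?mulr1 ?mulr0.
by rewrite [vacant w == A]eq_sym (negPf ne) andbF.
Qed.

Lemma vacant_prob_fail (u B : R) (E : pred {set torus d N}) M e n0 :
  n0 = (M + (nsteps d N u + e))%N ->
  (forall x, EW n0 (fun w : seq dir => (~~ E (vac_set (unvisited M (pos x w) (nsteps d N u))))%:R) <= B) ->
  0 <= 1 - vacant_prob u E <= B.
Proof.
move=> -> hB; have T0 : (0 < #|torus d N|)%N by apply/card_gt0P; exists 0.
have T0' : 0 < #|torus d N|%:R :> R by rewrite ltr0n.
have -> : 1 - vacant_prob u E = #|torus d N|%:R^-1 * \sum_(x : T)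
    EW (M + (nsteps d N u + e)) (fun w : seq dir => (~~ E (vac_set (unvisited M (pos x w) (nsteps d N u))))%:R).
  rewrite vacant_probE (walk_shift (fun A => (E A)%:R) M (nsteps d N u) e).
  rewrite -{1}(@mulVf _ (#|torus d N|%:R)) ?gt_eqF // -mulrBr; congr (_ * _).
  rewrite -[#|torus d N|%:R](sumr_const (torus d N) (1 : R)) -sumrB; apply: eq_bigr => x _.
  have e1 : 1 = EW (M + (nsteps d N u + e)) (fun _ : seq dir => 1 : R) by rewrite EW_const.
  rewrite {1}e1 -[- EW _ _]mulN1r -EWZ -EWD; apply: eq_EW => w _.
  by case: (E _); rewrite /= ?mulr1 ?mulr0 ?subrr ?addr0.
apply/andP; split.
  by rewrite mulr_ge0 ?invr_ge0 ?ler0n // sumr_ge0 // => x _; apply: EW_ge0.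
rewrite mulrC ler_pdivrMr // mulr_natr -sumr_const; apply: ler_sum => x _; exact: hB.
Qed.

End Stationarity.

Lemma inside_arith (a c x rj rK q M : nat) : (7 * q <= a <= M - 7 * q -> a <= c + x -> c <= a + x -> x <= rj ->
  rj <= rK -> rK <= q -> 32 * q <= M -> 6 * q <= c <= M - 6 * q)%N.
Proof. by lia. Qed.

(** * Few trees for every base point at once *)

Section AllBases.
Variables (R : realType) (d' N l s k M L r m q h K : nat) (J : nat -> nat).
Notation d := d'.+1.
Notation T := 'rV['Z_N]_d.
Notation dir := ('I_d * bool)%type.
Notation box := (box d m).
Hypotheses (N_gt2 : (2 < N)%N) (L_gt0 : (0 < L)%N) (h_large : (5000 <= h)%N).
Hypotheses (mLN : (m.+1 * L <= N)%N) (q7 : (7 < q)%N) (qm : (32 * q <= m.+1)%N) (mq : (m.+1 < 32 * q.+1)%N).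
Variables (eps eta beta : R).
Hypotheses (eps_ge0 : 0 <= eps) (beta_ge0 : 0 <= beta).
Hypothesis etaE : eta = eps * (vol1 d h)%:R ^+ 2.
Hypothesis reachq : (reach h K <= q)%N.
Hypothesis rare : forall (D : {set T}) (x : T), sparse L D ->
  EW ((2 * r + 1) * M) (fun w : seq dir => [forall p in D, bad l s M k L (2 * r) (pos x w) p]%:R) <= eps ^+ #|D|.
Hypothesis tail_tree : eta ^+ (2 ^ K) <= beta.
Hypothesis tail_line : forall j, (j < K)%N -> (h ^ j.+2)%:R * ((1 + eta ^+ (2 ^ j)) ^+ m.+1 / 2 ^+ J j) <= beta.
Notation lo := (7 * q)%N.
Notation hi := (m.+1 - 7 * q)%N.
Notation badb X b := (@Bad d' N l s M k L (2 * r) m X b).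
Notation n0 := ((2 * r + 1) * M)%N.

(** The two assumptions [no_tree] and [few_trees] of the route, for the base [b]. *)
Definition tame (X : nat -> T) (b : T) : bool :=
  [forall v : box, central lo hi v ==> ~~ has_tree h (badb X b) K v] &&
  [forall a : box * ('I_d * 'I_K), central lo hi a.1 ==>
     (\sum_(t : 'I_m.+1 | (lo <= t <= hi)%N) has_tree h (badb X b) a.2.2 (setc a.1 a.2.1 t) <= h ^ a.2.2.+2 * J a.2.2)%N].

Let dir0 : (0 < #|{: dir}|)%N. Proof. exact: dir_gt0. Qed.
Let W : pred box := fun v => [forall i, (6 * q <= v i <= m.+1 - 6 * q)%N].

Lemma rare_boxes b x (t : seq box) : uniq t -> all W t -> thin t ->
  EW n0 (fun w : seq dir => (all (badb (pos x w) b) t)%:R) <= eps ^+ size t.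
Proof.
move=> ut wt th; have [cD sD] := sparse_anchors N_gt2 L_gt0 mLN b q7 qm mq ut wt th.
rewrite -{1}cD; apply: le_trans (rare x sD); apply: ler_EW => w _; rewrite ler_nat; apply: leq_implb => /allP h1.
apply/forallP => p; apply/implyP; rewrite inE => /mapP[v vt ->]; exact: h1.
Qed.

Lemma insideK j : (j <= K)%N -> inside h lo hi W j.
Proof.
move=> jK v w /forallP cv vw; apply/forallP => i; have [h1 h2] := linf_coord v w i.
exact: inside_arith (cv i) h1 h2 vw (reach_mono h jK) reachq qm.
Qed.

Lemma base_prob b x : EW n0 (fun w : seq dir => (~~ tame (pos x w) b)%:R) <= (m.+1 ^ d * (1 + d * K))%:R * beta.
Proof.
have rb := rare_boxes b x.
have cbox : #|{: box}| = (m.+1 ^ d)%N by rewrite card_ffun !card_ord.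
apply: (@le_trans _ _ (EW n0 (fun w : seq dir =>
   (has (fun v => has_tree h (badb (pos x w) b) K v) (enum [pred v : box | central lo hi v]) ||
    has (fun a : box * ('I_d * 'I_K) => (h ^ a.2.2.+2 * J a.2.2 <
      \sum_(t : 'I_m.+1 | (lo <= t <= hi)%N) has_tree h (badb (pos x w) b) a.2.2 (setc a.1 a.2.1 t))%N)
      (enum [pred a : box * ('I_d * 'I_K) | central lo hi a.1]))%:R))).
  apply: ler_EW => w _; rewrite ler_nat; apply: leq_implb; rewrite negb_and !negb_forall => /orP[]/existsP[v].
    rewrite negb_imply negbK => /andP[cv tv]; apply/orP; left; apply/hasP; exists v => //.
    by rewrite mem_enum inE.
  rewrite negb_imply -ltnNge => /andP[cv tv]; apply/orP; right; apply/hasP; exists v => //.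
  by rewrite mem_enum inE.
rewrite mulnDr muln1 natrD mulrDl; apply: EW_or.
  apply: le_trans (EW_has (B := beta) _) _.
    move=> v; rewrite mem_enum inE => cv; apply: le_trans tail_tree.
    exact: (tree_prob (badw := fun w => badb (pos x w) b) (lo := lo) (hi := hi) h_large eps_ge0 rb etaE (insideK (leqnn K)) cv).
  by rewrite ler_wpM2r // ler_nat -cardE -cbox max_card.
apply: le_trans (EW_has (B := beta) _) _.
  move=> [v [i j]]; rewrite mem_enum inE /= => cv; apply: le_trans (tail_line (ltn_ord j)).
  exact: (line_prob (badw := fun w => badb (pos x w) b) (lo := lo) (hi := hi) h_large eps_ge0 rb etaE i (J j) (insideK (ltnW (ltn_ord j))) cv).
rewrite ler_wpM2r // ler_nat -cardE; apply: leq_trans (max_card _) _.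
by rewrite !card_prod cbox !card_ord.
Qed.

Lemma card_torus : #|torus d N| = (N ^ d)%N.
Proof. by rewrite card_mx mul1n card_ord Zp_cast // ltnW. Qed.

Theorem all_bases_prob x :
  EW n0 (fun w : seq dir => (~~ [forall b : T, tame (pos x w) b])%:R) <= (N ^ d * (m.+1 ^ d * (1 + d * K)))%:R * beta.
Proof.
apply: (@le_trans _ _ (EW n0 (fun w : seq dir => (has (fun b => ~~ tame (pos x w) b) (enum [set: T]%SET))%:R))).
  apply: ler_EW => w _; rewrite ler_nat; apply: leq_implb; rewrite negb_forall => /existsP[b tb].
  by apply/hasP; exists b; rewrite ?mem_enum ?inE.
apply: le_trans (EW_has (B := (m.+1 ^ d * (1 + d * K))%:R * beta) _) _; first by move=> b _; exact: base_prob.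
rewrite -cardE cardsT mulrA -natrM ler_wpM2r // ler_nat leq_mul2r; apply/orP; right.
by rewrite -card_torus.
Qed.

End AllBases.

Lemma halving_sum (a : nat -> nat) B K : (forall k, (k < K)%N -> (2 ^ k * a k <= B)%N) ->
  (\sum_(k < K) a k <= 2 * B)%N.
Proof.
move=> h; suff : (2 ^ K * \sum_(k < K) a k + 2 * B <= 2 * B * 2 ^ K)%N.
  have : (0 < 2 ^ K)%N by rewrite expn_gt0.
  move: (2 ^ K)%N (\sum_(k < K) a k)%N => x y; clear; nia.
elim: K h => [|K IH] h; first by rewrite big_ord0 muln0 muln1.
have h1 := IH (fun k kK => h k (ltnW kK)); have h2 := h K (ltnSn K).
by rewrite big_ord_recr /= expnS; move: h1 h2; move: (2 ^ K)%N (\sum_(k < K) a k)%N (a K) => x y z; clear; nia.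
Qed.

Lemma linear_exp c : exists K0, forall K, (K0 <= K)%N -> (c * (K + 2) <= 2 ^ K)%N.
Proof.
exists (2 * c + 4)%N => K /subnK <-; elim: (K - _)%N => [|i IH].
  have h := ltn_expl c (isT : (1 < 2)%N); rewrite add0n expnD mul2n -addnn expnD.
  by rewrite (_ : 2 ^ 4 = 16)%N //; move: h; move: (2 ^ c)%N => x; clear; nia.
by rewrite addSn expnS; move: IH; move: (2 ^ _)%N => x; clear; lia.
Qed.

(** * The tree depth as a function of the size of the torus *)

Section Scales.
Variables (d h L : nat).
Hypotheses (d_gt4 : (4 < d)%N) (h_large : (5000 <= h)%N) (L_gt0 : (0 < L)%N).

Let h0 : (0 < h)%N. Proof. by rewrite (leq_trans _ h_large). Qed.
Let h1 : (1 < h)%N. Proof. by rewrite (leq_trans _ h_large). Qed.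

(** The exponent ensures that the square of the cluster volume [h^(d K)], which occurs in the bound
    of [route], stays below [n], and that [2^K * H j <= n]. *)
Definition scale_ratio : nat := (h ^ (2 * (d + 2)))%N.

Lemma scale_ratio_gt1 : (1 < scale_ratio)%N.
Proof. by rewrite /scale_ratio -[X in (X < _)%N](exp1n (2 * (d + 2))) ltn_exp2r // muln_gt0 addn_gt0 orbT. Qed.

Lemma level_choice n : (scale_ratio <= n)%N -> exists K, (scale_ratio ^ K.+1 <= n < scale_ratio ^ K.+2)%N.
Proof.
move=> Ln; have n0 : (0 < n)%N by apply: leq_trans Ln; exact: ltnW scale_ratio_gt1.
have /andP[b1 b2] := trunc_log_bounds scale_ratio_gt1 n0.
case e : (trunc_log scale_ratio n) b1 b2 => [|t] b1 b2; last by exists t; rewrite b1.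
by move: b2; rewrite expn1 ltnNge Ln.
Qed.

Variables (n K : nat).
Hypothesis Ln : (scale_ratio ^ K.+1 <= n)%N.

Lemma pow_le_n e : (e <= 2 * (d + 2) * K.+1)%N -> (h ^ e <= n)%N.
Proof. by move=> he; apply: leq_trans Ln; rewrite /scale_ratio -expnM leq_exp2l. Qed.

Notation H j := (h ^ ((d + 2) * j.+2))%N.
Definition slot_quota j : nat := (2 * (n %/ H j).+1)%N.
Definition tree_quota j : nat := (h ^ j.+2 * slot_quota j)%N.

Lemma H_le j : (j < K)%N -> (2 ^ K * H j <= n)%N.
Proof.
move=> jK; apply: (@leq_trans (h ^ K * H j)); first by rewrite leq_mul2r expn_mono ?orbT.
rewrite -expnD; apply: pow_le_n.
have : ((d + 2) * j.+2 <= (d + 2) * K.+1)%N by rewrite leq_mul2l; apply/orP; right.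
by move: ((d + 2) * j.+2)%N => x; clear; nia.
Qed.

Lemma scale_lt : (K < n)%N.
Proof.
apply: leq_trans (ltn_expl K (isT : (1 < 2)%N)) _; apply: (@leq_trans (h ^ K)); first exact: expn_mono.
by apply: pow_le_n; clear; nia.
Qed.

Lemma vol_le x c : (x <= c * h ^ K)%N -> ((2 * x + 1) ^ d <= (2 * c + 1) ^ d * h ^ (d * K))%N.
Proof.
move=> xc; rewrite mulnC [(d * K)%N]mulnC expnM -expnMn; apply: expn_mono.
have : (0 < h ^ K)%N by rewrite expn_gt0 h0.
by move: xc; move: (h ^ K)%N => y; clear; nia.
Qed.

(** [H k] dominates [2^k] times the spacing [h^k.+2] times the cluster volume [h^(d k.+1)], so level
    [k] contributes order [n / 2^k]. *)
Lemma lines_le : (\sum_(k < K) tree_quota k * (2 * reach h k.+1 + 1) ^ d <= 2 * (4 * 5 ^ d * n))%N.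
Proof.
apply: (@halving_sum (fun k => (tree_quota k * (2 * reach h k.+1 + 1) ^ d)%N)) => k kK.
have Hn : (H k <= n)%N by apply: leq_trans (H_le kK); rewrite leq_pmull // expn_gt0.
have Hp : (0 < H k)%N by rewrite expn_gt0 h0.
have v1 : ((2 * reach h k.+1 + 1) ^ d <= 5 ^ d * h ^ (d * k.+1))%N.
  rewrite [(d * _)%N]mulnC expnM -expnMn; apply: expn_mono; have := reach_le h_large k.+1.
  have : (0 < h ^ k.+1)%N by rewrite expn_gt0 h0.
  by move: (h ^ k.+1)%N => y; clear; lia.
have v2 : (H k * slot_quota k <= 4 * n)%N.
  rewrite /slot_quota; have := leq_divM n (H k); move: Hn; move: (H k) (n %/ H k)%N => x y; clear; nia.
have v3 : (2 ^ k * h ^ k.+2 * h ^ (d * k.+1) <= H k)%N.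
  apply: (@leq_trans (h ^ k * h ^ k.+2 * h ^ (d * k.+1))); first by rewrite !leq_mul2r expn_mono ?orbT.
  by rewrite -!expnD leq_exp2l //; clear; nia.
rewrite -(leq_pmul2l Hp); apply: (@leq_trans (H k * (2 ^ k * (h ^ k.+2 * slot_quota k * (5 ^ d * h ^ (d * k.+1)))))).
  by rewrite !leq_mul2l v1 !orbT.
rewrite (_ : (H k * (2 ^ k * (h ^ k.+2 * slot_quota k * (5 ^ d * h ^ (d * k.+1)))) =
  (H k * slot_quota k) * (5 ^ d) * (2 ^ k * h ^ k.+2 * h ^ (d * k.+1)))%N); last first.
  by move: (H k) (2 ^ k)%N (h ^ k.+2)%N (slot_quota k) (5 ^ d)%N (h ^ (d * k.+1))%N => a b c e f g; clear; lia.
rewrite [leqRHS]mulnC; apply: leq_mul => //.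
by rewrite [leqRHS]mulnAC leq_mul2r v2 orbT.
Qed.

Notation vol r := ((2 * r + 1) ^ d)%N.
Notation c1 := (4 * reach h K + 20)%N.

Definition ball_factor : nat := ((100 * L) ^ d)%N.

Lemma volumes_le : [/\ (vol (c1 * L) <= ball_factor * h ^ (d * K))%N, (vol c1.+1 <= ball_factor * h ^ (d * K))%N &
  (vol (reach h K) <= ball_factor * h ^ (d * K))%N].
Proof.
have rk := reach_le h_large K; have hk : (0 < h ^ K)%N by rewrite expn_gt0 h0.
have gen x : (x <= 40 * L * h ^ K)%N -> (vol x <= ball_factor * h ^ (d * K))%N.
  move=> hx; apply: leq_trans (vol_le hx) _; rewrite leq_mul2r; apply/orP; right; apply: expn_mono.
  by move: L_gt0; clear; lia.
by split; apply: gen; move: rk hk L_gt0; move: (h ^ K)%N => y; clear; nia.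
Qed.

Definition route_factor : nat := (2 * ball_factor * (1 + 3 ^ d * ball_factor) + 2 ^ d * d * (1 + 3 ^ d * (8 * 5 ^ d)))%N.
Definition diameter_factor : nat := (2 * ball_factor + (route_factor + 2) * (2 * (40 * L) + 1) ^ d)%N.

Lemma top_le m : m.+1 = n ->
  (2 * vol (c1 * L) + ((2 * vol c1.+1 * (1 + 3 ^ d * vol (reach h K)) +
    2 ^ d * d * (m.+1 + 3 ^ d * \sum_(k < K) tree_quota k * vol (reach h k.+1))) + 2) * (2 * (40 * L) + 1) ^ d <= diameter_factor * n)%N.
Proof.
move=> ->; have [v1 v2 v3] := volumes_le; have ls := lines_le.
have an : (h ^ (d * K) <= n)%N by apply: pow_le_n; clear; nia.
have aan : (h ^ (d * K) * h ^ (d * K) <= n)%N by rewrite -expnD; apply: pow_le_n; clear; nia.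
have a0 : (0 < h ^ (d * K))%N by rewrite expn_gt0 h0.
have w1 : (2 * vol (c1 * L) <= 2 * ball_factor * n)%N.
  by rewrite -mulnA leq_mul2l /=; apply: leq_trans v1 _; rewrite leq_mul2l an orbT.
have w2 : (2 * vol c1.+1 * (1 + 3 ^ d * vol (reach h K)) <= 2 * ball_factor * (1 + 3 ^ d * ball_factor) * n)%N.
  apply: (@leq_trans (2 * (ball_factor * h ^ (d * K)) * (1 + 3 ^ d * (ball_factor * h ^ (d * K))))).
    by apply: leq_mul; [rewrite leq_mul2l v2 orbT|rewrite leq_add2l leq_mul2l v3 orbT].
  move: an aan a0; move: (h ^ (d * K))%N ball_factor (3 ^ d)%N => a p t an aan a0.
  have e1 : (p * a <= p * n)%N by rewrite leq_mul2l an orbT.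
  have e2 : (p * (t * p) * (a * a) <= p * (t * p) * n)%N by rewrite leq_mul2l aan orbT.
  by move: e1 e2; clear; nia.
have w3 : (2 ^ d * d * (n + 3 ^ d * \sum_(k < K) tree_quota k * vol (reach h k.+1)) <= 2 ^ d * d * (1 + 3 ^ d * (8 * 5 ^ d)) * n)%N.
  rewrite -[leqRHS]mulnA leq_mul2l; apply/orP; right; rewrite mulnDl mul1n leq_add2l -mulnA leq_mul2l; apply/orP; right.
  by apply: leq_trans ls _; rewrite !mulnA.
rewrite /diameter_factor [leqRHS]mulnDl; apply: leq_add => //; rewrite [leqRHS]mulnAC leq_mul2r; apply/orP; right.
rewrite [leqRHS]mulnDl /route_factor [X in (_ <= X + _)%N]mulnDl; apply: leq_add; first exact: leq_add.
by rewrite leq_pmulr // (leq_ltn_trans _ scale_lt).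
Qed.

Variable R : realType.
Definition eta : R := ((vol1 d h)%:R ^+ 4)^-1.
(** When [K] is chosen by [level_choice], [n] is exponential in [K], so [2^K] is at least a power of
    [n] and [beta] beats every power of [N]. *)
Definition beta : R := n%:R / 2 ^+ (2 ^ K).

Lemma eta_pow j : (2 * H j)%:R * eta ^+ (2 ^ j) <= 1 :> R.
Proof.
rewrite /eta exprVn -exprM ler_pdivrMr ?exprn_gt0 ?ltr0n ?expn_gt0 ?muln_gt0 ?h0 // mul1r -natrX ler_nat.
rewrite /vol1 -expnM expnMn; apply: leq_mul.
  apply: (@leq_trans (3 ^ 1)) => //; rewrite leq_exp2l // !muln_gt0 expn_gt0 /= andbT; exact: ltnW (ltnW (ltnW (ltnW d_gt4))).
rewrite leq_exp2l //; have := ltn_expl j (isT : (1 < 2)%N); move: (2 ^ j)%N => x; move: d_gt4; clear; nia.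
Qed.

Lemma eta_ge0 : 0 <= eta. Proof. by rewrite invr_ge0 exprn_ge0. Qed.

Lemma tail_tree_le : eta ^+ (2 ^ K) <= beta.
Proof.
have e2 : eta <= 1 / 2.
  have := eta_pow 0; rewrite expn0 expr1; have e0 := eta_ge0; have hH : 1 <= (H 0)%:R :> R by rewrite ler1n expn_gt0 h0.
  by rewrite natrM; move: hH e0; nra.
apply: (@le_trans _ _ ((1 / 2) ^+ (2 ^ K))); first by rewrite lerXn2r ?nnegrE ?eta_ge0 // divr_ge0.
rewrite expr_div_n expr1n /beta ler_wpM2r ?invr_ge0 ?exprn_ge0 // ler1n.
by apply: leq_ltn_trans scale_lt.
Qed.

Lemma tail_line_le j : (j < K)%N -> (h ^ j.+2)%:R * ((1 + eta ^+ (2 ^ j)) ^+ n / 2 ^+ slot_quota j) <= beta.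
Proof.
move=> jK; set y := eta ^+ (2 ^ j); have y0 : 0 <= y by rewrite exprn_ge0 // eta_ge0.
have Hp : (0 < H j)%N by rewrite expn_gt0 h0.
have hy : (H j)%:R * y <= 1 / 2.
  by have := eta_pow j; rewrite -/y natrM; move: ((H j)%:R) => z; lra.
have e1 := exp_le2 y0 hy; pose qj := (n %/ H j).+1.
have e2 : (1 + y) ^+ n <= 2 ^+ qj.
  apply: (@le_trans _ _ ((1 + y) ^+ (H j * qj))).
    rewrite ler_weXn2l ?lerDl // mulnC; apply: ltnW; rewrite /qj; exact: ltn_ceil.
  by rewrite exprM lerXn2r ?nnegrE ?exprn_ge0 ?addr_ge0.
have q2 : (2 ^ K <= qj)%N.
  by apply: leqW; rewrite leq_divRL // H_le.
apply: (@le_trans _ _ (n%:R * (2 ^+ qj / 2 ^+ slot_quota j))).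
  apply: ler_pM; rewrite ?ler0n ?divr_ge0 ?exprn_ge0 ?addr_ge0 //.
    by rewrite ler_nat; apply: pow_le_n; move: jK; clear; nia.
  by rewrite ler_wpM2r ?invr_ge0 ?exprn_ge0.
rewrite /beta ler_wpM2l ?ler0n // /slot_quota mul2n -addnn exprD invfM mulrA mulfV ?mul1r ?expf_neq0 //.
by rewrite lef_pV2 ?posrE ?exprn_gt0 // ler_weXn2l // ler1n.
Qed.

End Scales.

(** [N] is at most [2^(c (K + 2))], and [2^K] outgrows any linear function of [K]. *)
Lemma size_le_tower N n L Lm c p K : (0 < L)%N -> (N < n.+1 * L)%N -> (0 < n)%N -> (n < Lm ^ K.+2)%N -> (0 < Lm)%N ->
  (2 * L * Lm <= 2 ^ c)%N -> (c * p * (K + 2) <= 2 ^ K)%N -> (N ^ p <= 2 ^ (2 ^ K))%N.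
Proof.
move=> L0 Nn n0 nK Lm0 cL cK; apply: (@leq_trans ((2 ^ (c * (K + 2))) ^ p)); last first.
  by rewrite -expnM leq_exp2l // mulnAC.
apply: expn_mono; apply: leq_trans (ltnW Nn) _; rewrite expnM; apply: (@leq_trans ((2 * L * Lm) ^ (K + 2))); last exact: expn_mono.
rewrite expnMn; apply: (@leq_trans (2 * L * Lm ^ K.+2)).
  by apply: (@leq_trans (2 * n * L)); [rewrite leq_mul2r; apply/orP; right; move: n0; clear; lia|rewrite mulnAC leq_mul2l ltnW ?orbT].
rewrite addn2; apply: leq_mul => //; rewrite -{1}(expn1 (2 * L)) leq_pexp2l // muln_gt0 //.
Qed.

Lemma decay_bound (R : realType) (N n d K k0 : nat) : (0 < N)%N -> (n <= N)%N -> (K < n)%N ->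
  (N ^ (k0 + 2 * d + 3) <= 2 ^ (2 ^ K))%N ->
  N%:R ^+ k0 * ((N ^ d * (n ^ d * (1 + d * K)))%:R * beta n K R) <= d.+1%:R / N%:R.
Proof.
move=> N0 nN Kn hp; have N0' : 0 < N%:R :> R by rewrite ltr0n.
have P0 : 0 < 2 ^+ (2 ^ K) :> R by rewrite exprn_gt0.
rewrite /beta !mulrA ler_pdivrMr // [leRHS]mulrAC ler_pdivlMr // -!natrX -!natrM ler_nat.
apply: (@leq_trans (d.+1 * N ^ (k0 + 2 * d + 3))); last by rewrite leq_mul2l hp orbT.
have e1 : (1 + d * K <= d.+1 * N)%N by move: Kn nN; clear; nia.
have e2 : (n ^ d <= N ^ d)%N by exact: expn_mono.
rewrite (_ : (N ^ (k0 + 2 * d + 3) = N ^ k0 * N ^ d * N ^ d * N * N * N)%N); last first.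
  by rewrite mul2n -addnn !expnD (_ : N ^ 3 = N * N * N)%N ?mulnA // !expnS expn0 muln1 mulnA.
rewrite (_ : (d.+1 * (N ^ k0 * N ^ d * N ^ d * N * N * N) = N ^ k0 * (N ^ d * (N ^ d * (d.+1 * N))) * N * N)%N); last first.
  by move: (N ^ k0)%N (N ^ d)%N => x y; clear; lia.
rewrite leq_mul2r; apply/orP; right; apply: leq_mul => //.
by rewrite leq_mul2l leq_mul2l leq_mul ?orbT.
Qed.

(* Cmax is an arbitrary rule selecting a largest component (ties may occur);
   its value on the empty vacant set is irrelevant, the event then fails. *)
Theorem theorem2p10 (R : realType) (d : nat) (hd : (5 <= d)%N) :
  exists2 ut : R, 0 < ut &
  forall u : R, 0 < u -> u < ut ->
  exists2 C : R, 0 < C &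
  forall Cmax : (forall N : nat, {set torus d N} -> {set torus d N}),
  (forall (N : nat) (A : {set torus d N}),
     A != finset.set0 -> is_largest_component A (Cmax N A)) ->
  forall kappa : R, 0 < kappa ->
  (fun N : nat => N%:R `^ kappa *
     (1 - vacant_prob u (fun A : {set torus d N} =>
            ((N%:R / C)%:E <= max_dist R A (Cmax N A) <= (C * N%:R)%:E)%E)))
    @ \oo --> (0 : R).
Proof.
case: d hd => [//|d'] hd.
have [h h_large] : exists h, (5000 <= h)%N by exists 5000%N.
have V0 : 0 < (vol1 d'.+1 h)%:R :> R by rewrite ltr0n expn_gt0 muln_gt0 (leq_trans _ h_large).
(* Six powers of [vol1]: two are spent on counting trees and four remain in [eta]. *)
pose eps : R := ((vol1 d'.+1 h)%:R ^+ 6)^-1.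
have eps0 : 0 < eps by rewrite invr_gt0 exprn_gt0.
have etaE : eta d'.+1 h R = eps * (vol1 d'.+1 h)%:R ^+ 2.
  by rewrite /eta /eps; field; rewrite gt_eqF.
have [l [s [k [L [M [/andP[l0 s0] skM slL M0 [u0 u00 hu]]]]]]] := rare_failures hd eps0.
have L0 : (0 < L)%N by move: slL s0; clear; lia.
exists u0 => // u uu uu0; have [N1 hN1] := hu u uu uu0.
(* The summand 64 serves the lower bound, through [N <= 64 * (4 * q * L)]. *)
have C0 : 0 < (diameter_factor d'.+1 L + 64)%:R :> R by rewrite ltr0n addn_gt0 orbT.
exists (diameter_factor d'.+1 L + 64)%:R => // Cmax hC kappa kappa0.
(* The power to beat: [N^kappa], the pairs of a base and a cell, the depth, and the factor [n] of
   [beta]; one more power is kept so that the bound tends to 0. *)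
pose k0 := (Num.truncn kappa).+1; pose p := (k0 + 2 * d'.+1 + 3)%N.
pose c := (2 * L * scale_ratio d'.+1 h)%N.
have [K0 hK0] := linear_exp (c * p).
pose K1 := (K0 + ball_factor d'.+1 L)%N.
apply/cvgrPdist_le => e e0; have [N2 [N20 hN2]] := nat_above (d'.+2%:R / e).
exists (N1 + N2 + 160 * L + 3 + L * scale_ratio d'.+1 h ^ K1.+2)%N => // N /= NN.
have N_gt2 : (2 < N)%N by move: NN; clear; lia.
have N0' : 0 < N%:R :> R by rewrite ltr0n; move: N_gt2; clear; lia.
pose n := (N %/ L)%N; pose m := n.-1; pose q := (n %/ 32)%N.
have nK1 : (scale_ratio d'.+1 h ^ K1.+2 <= n)%N by rewrite leq_divRL // mulnC; move: NN; clear; lia.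
have Lm1 := scale_ratio_gt1 d'.+1 h_large.
have [K /andP[Kn nK]] : exists K, (scale_ratio d'.+1 h ^ K.+1 <= n < scale_ratio d'.+1 h ^ K.+2)%N.
  apply: (level_choice h_large); apply: leq_trans nK1; rewrite -{1}(expn1 (scale_ratio _ _)) leq_exp2l //.
have K1K : (K1 < K)%N.
  by have := leq_ltn_trans nK1 nK; rewrite ltn_exp2l // ltnS.
have n0 : (0 < n)%N by exact: leq_ltn_trans (scale_lt h_large Kn).
have mn : m.+1 = n by rewrite /m prednK.
have nLN : (n * L <= N)%N by exact: leq_divM.
have NnL : (N < n.+1 * L)%N by exact: ltn_ceil.
have qm : (32 * q <= m.+1)%N by rewrite mn mulnC leq_divM.
have mq : (m.+1 < 32 * q.+1)%N by rewrite mn mulnC ltn_ceil.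
have rk := reach_le h_large K.
have hK : (0 < h ^ K)%N by rewrite expn_gt0 (leq_trans _ h_large).
have big2 : (h * h * h ^ K <= n)%N.
  by rewrite -mulnA -!expnS; apply: (pow_le_n h_large Kn); clear; nia.
have q_large : (4 * reach h K + 20 + 100 <= q)%N.
  have : (5000 * 5000 * h ^ K <= n)%N by apply: leq_trans big2; rewrite leq_mul2r leq_mul ?orbT.
  by rewrite mn in mq; move: mq rk hK; move: (h ^ K)%N => x; clear; lia.
have q7 : (7 < q)%N by move: q_large; clear; lia.
have reachq : (reach h K <= q)%N by move: q_large; clear; lia.
have ball_low : ((2 * ((4 * reach h K + 20) * L) + 1) ^ d'.+1 <= 4 * q * L)%N.
  have [v1 _ _] := volumes_le d'.+1 h_large L0 K; apply: leq_trans v1 _.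
  have pk : (ball_factor d'.+1 L <= h ^ K)%N.
    apply: (@leq_trans (2 ^ K)); last by apply: expn_mono; exact: leq_trans h_large.
    apply: (@leq_trans K); last by apply: ltnW; exact: ltn_expl.
    by move: K1K; rewrite /K1; clear; lia.
  have big3 : (5000 * (h ^ K * h ^ (d'.+1 * K)) <= n)%N.
    apply: (@leq_trans (h * (h ^ K * h ^ (d'.+1 * K)))); first by rewrite leq_mul2r h_large orbT.
    by rewrite -expnD -expnS; apply: (pow_le_n h_large Kn); clear; nia.
  apply: (@leq_trans (h ^ K * h ^ (d'.+1 * K))); first by rewrite leq_mul2r pk orbT.
  have hKK : (0 < h ^ K * h ^ (d'.+1 * K))%N by rewrite muln_gt0 hK expn_gt0 (leq_trans _ h_large).
  apply: (@leq_trans (4 * q)); last by rewrite leq_pmulr.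
  by rewrite mn in mq; move: mq big3 hKK q7; move: (h ^ K * h ^ (d'.+1 * K))%N => x; clear; lia.
pose r := num_pairs d'.+1 M N u.
have mLN : (m.+1 * L <= N)%N by rewrite mn.
have NmL : (N <= m.+2 * L)%N by rewrite mn ltnW.
have beta_ge0 : 0 <= beta n K R by rewrite /beta divr_ge0 ?ler0n ?exprn_ge0.
have rare : forall (D : {set 'rV['Z_N]_d'.+1}) x, sparse L D ->
  EW ((2 * r + 1) * M) (fun w : seq ('I_d'.+1 * bool) => [forall p in D, bad l s M k L (2 * r) (pos x w) p]%:R) <= eps ^+ #|D|.
  by move=> D x sD; apply: hN1 => //; move: NN; clear; lia.
have tl j : (j < K)%N -> (h ^ j.+2)%:R * ((1 + eta d'.+1 h R ^+ (2 ^ j)) ^+ m.+1 / 2 ^+ slot_quota d'.+1 h n j) <= beta n K R.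
  by rewrite mn; exact: tail_line_le.
have prob x := all_bases_prob N_gt2 L0 h_large mLN q7 qm mq (ltW eps0) beta_ge0 etaE reachq rare
  (tail_tree_le hd h_large Kn R) tl x.
have Tr : (M + nsteps d'.+1 N u < (2 * r).+1 * M)%N.
  rewrite mulSn ltn_add2l /r /num_pairs -/(nsteps d'.+1 N u) mulnC mulnA [(M * 2)%N]mulnC mulnC.
  by apply: ltn_ceil; rewrite muln_gt0.
set E := (fun A : {set torus d'.+1 N} => _).
have LN : (4 * (40 * L) < N)%N by move: NN; clear; lia.
have good (X : nat -> 'rV['Z_N]_d'.+1) : [forall b, tame l s k M L r m q h K (slot_quota d'.+1 h n) X b] ->
    E (vac_set (unvisited M X (nsteps d'.+1 N u))).
  move=> /forallP tm; set vac := unvisited M X _.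
  have nt b (v : box d'.+1 m) : central (7 * q) (m.+1 - 7 * q) v -> ~~ has_tree h (Bad l s M k L (2 * r) X b) K v.
    by case/andP: (tm b) => /forallP/(_ v)/implyP.
  have ft b (v : box d'.+1 m) i j : central (7 * q) (m.+1 - 7 * q) v -> (j < K)%N ->
      (\sum_(t : 'I_m.+1 | 7 * q <= t <= m.+1 - 7 * q) has_tree h (Bad l s M k L (2 * r) X b) j (setc v i t) <= tree_quota d'.+1 h n j)%N.
    move=> cv jK; case/andP: (tm b) => _ /forallP/(_ (v, (i, Ordinal jK))) /=; rewrite cv; exact.
  have d3 : (3 < d'.+1)%N by exact: leq_trans hd.
  (* Any base point serves for the backbone; [link] chooses one adapted to [x] and [y]. *)
  have spine := backbone N_gt2 l0 s0 d3 skM slL LN Tr mLN qm mq (nt 0) (ft 0) q_large.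
  have link x y : vac x -> vac y -> reaches vac ((4 * reach h K + 20) * L) x -> reaches vac ((4 * reach h K + 20) * L) y ->
      exists S : pred 'rV['Z_N]_d'.+1, [/\ subpred S vac, S x, connect (lgr S) x y & (#|S| <= diameter_factor d'.+1 L * n)%N].
    move=> vx vy fx fy; have [b hb] := middle_base N_gt2 x y.
    have mx : middle b x by move=> i; case: (hb i).
    have my : middle b y by move=> i; case: (hb i).
    have [S [S1 S2 S3 S4]] := route N_gt2 l0 s0 d3 skM slL LN Tr mLN NmL qm (nt b) (ft b) q_large vx vy mx my fx fy.
    exists S; split=> //; apply: leq_trans S4 _; exact: (top_le h_large L0 Kn mn).
  have K_ok : vac_set vac != finset.set0 -> is_largest_component (vac_set vac) (Cmax N (vac_set vac)) by exact: hC.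
  have /andP[lb ub] := diameter_bounds R N_gt2 spine link ball_low K_ok.
  apply/andP; split.
    apply: le_trans lb; rewrite lee_fin ler_pdivrMr // -natrM ler_nat.
    apply: (@leq_trans (4 * q * L * 64)); last by rewrite leq_mul2l leq_addl orbT.
    apply: leq_trans (ltnW NnL) _; rewrite -!mulnA [(q * _)%N]mulnCA [(4 * _)%N]mulnCA mulnC leq_mul2l; apply/orP; right.
    by rewrite mn in mq; move: mq q7; clear; lia.
  apply: le_trans ub _; rewrite lee_fin -natrM ler_nat; apply: leq_mul; first exact: leq_addr.
  by apply: leq_trans nLN; rewrite leq_pmulr.
have n0E : ((2 * r + 1) * M = M + (nsteps d'.+1 N u + (2 * r * M - nsteps d'.+1 N u)))%N.
  by move: Tr; rewrite mulSn mulnDl mul1n; clear; lia.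
have fail x : EW ((2 * r + 1) * M) (fun w : seq ('I_d'.+1 * bool) => (~~ E (vac_set (unvisited M (pos x w) (nsteps d'.+1 N u))))%:R) <=
    (N ^ d'.+1 * (m.+1 ^ d'.+1 * (1 + d'.+1 * K)))%:R * beta n K R.
  apply: le_trans (prob x); apply: ler_EW => w _; rewrite ler_nat; apply: leq_implb; apply: contra; exact: good.
have /andP[p0 pB] := vacant_prob_fail N_gt2 n0E fail.
rewrite sub0r normrN ger0_norm ?mulr_ge0 ?powR_ge0 //.
apply: (@le_trans _ _ (N%:R ^+ k0 * ((N ^ d'.+1 * (n ^ d'.+1 * (1 + d'.+1 * K)))%:R * beta n K R))).
  apply: ler_pM; rewrite ?powR_ge0 //; last by rewrite -{1}mn.
  rewrite -powR_mulrn ?ler0n // ler_powR ?ler1n ?(ltnW (ltnW N_gt2)) //.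
  by apply: ltW; exact: truncnS_gt.
have Np : (N ^ p <= 2 ^ (2 ^ K))%N.
  apply: (size_le_tower L0 NnL n0 nK (ltnW Lm1) (c := c)).
    by apply: ltnW; exact: ltn_expl.
  by apply: hK0; move: K1K; rewrite /K1; clear; lia.
apply: le_trans (decay_bound R _ _ _ Np) _.
- by move: N_gt2; clear; lia.
- exact: leq_div.
- exact: (scale_lt h_large Kn).
rewrite ler_pdivrMr // mulrC -ler_pdivrMr //; apply: le_trans hN2 _.
by rewrite ler_nat; move: NN; clear; lia.
Qed.
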